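(* Let $\Omega\subset\mathbb{R}^d$ ($d\ge 2$) be an open, bounded, connected set with sufficiently regular boundary, $Y=(0,1)^d$, and $0<\sigma^-<\sigma^+$. Let $(t,y)\mapsto A(t,y)=\{a_{ij}(t,y)\}_{1\le i,j\le d}$, $t\in[\sigma^-,\sigma^+]$, be symmetric real $d\times d$ matrix functions with each $a_{ij}$ $Y$-periodic in $y$, and assume that there exist $E_1,\alpha,\beta>0$ such that (i) $A\in W^{1,\infty}([\sigma^-,\sigma^+]\times Y,\mathrm{Sym}_d)$ and $\|A\|_{W^{1,\infty}([\sigma^-,\sigma^+];W^{1,\infty}(Y))}\le E_1$; (ii) $\partial_tA\in W^{1,\infty}([\sigma^-,\sigma^+]\times Y,\mathrm{Sym}_d)$ and $\|\partial_tA\|_{W^{1,\infty}([\sigma^-,\sigma^+];W^{1,\infty}(Y))}\le E_1$; (iii) $\alpha|\xi|^2\le A(t,y)\xi\cdot\xi$ and $|A(t,y)\xi|\le\beta|\xi|$ for a.e. $y\in Y$, all $t\in[\sigma^-,\sigma^+]$, all $\xi\in\mathbb{R}^d$; (iv) $\partial_tA(t,y)\xi\cdot\xi\ge E_1^{-1}|\xi|^2$ for a.e. $y\in Y$, all $t\in[\sigma^-,\sigma^+]$, all $\xi\in\mathbb{R}^d$. Let $U=\{\sigma\in L^\infty(\Omega):\sigma^-\le\sigma(x)\le\sigma^+\}$, let $X=C^0(\overline\Omega)$ with the sup norm, and let $\mu_{pr}$ be a Gaussian probability measure on $X$. Let $P:\theta\in X\mapsto\sigma\in U$ be defined as one of the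 following two maps: (a) $P=P_1$, with $P_1(\theta)=\exp(\theta)$; (b) $P=P_2$, with $P_2(\theta)=\sum_{i=1}^nf_i\mathbb 1_{\Omega_i}$, where $n\in\mathbb{N}$, $-\infty=c_0<\dots<c_n=\infty$ are fixed constants, $\Omega_i=\{x\in\Omega:c_{i-1}\le\theta(x)<c_i\}$ for $i=1,\dots,n$, and $f_1,\dots,f_n\in C^0(\overline\Omega)$ are given strictly positive functions. Let $z\in\mathbb{R}^{JL}$ and let $C_e$ be a given (invertible) $JL\times JL$ covariance matrix. For $\varepsilon>0$ let $\mu^\varepsilon(\theta|z)$ and $\mu^0(\theta|z)$ be the fine-scale and the effective (homogenized) posterior probability measures on $X$, given by $$\frac{d\mu^\varepsilon(\theta|z)}{d\mu_{pr}(\theta)}=\frac1{C^\varepsilon}\exp(-\Phi^\varepsilon(\theta,z)),\qquad\frac{d\mu^0(\theta|z)}{d\mu_{pr}(\theta)}=\frac1{C^0}\exp(-\Phi^0(\theta,z)),$$ where $C^\varepsilon,C^0$ are the normalization constants and $$\Phi^\varepsilon(\theta,z)=\tfrac12\|z-F^\varepsilon(P(\theta))\|^2_{C_e},\qquad\Phi^0(\theta,z)=\tfrac12\|z-F^0(P(\theta))\|^2_{C_e},\qquad\|v\|_{C_e}^2=v^\top C_e^{-1}v,$$ with $F^\varepsilon,F^0:U\to\mathbb{R}^{JL}$ the fine-scale and homogenized observation operators defined in the context. Then $$d_{Hell}(\mu^0(\theta|z),\mu^\varepsilon(\theta|z))\to0\quad\text{as }\varepsilon\to0.$$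
   Context: $\mathrm{Sym}_d$ is the space of symmetric real $d\times d$ matrices. Fine-scale and homogenized tensors: for $\sigma\in U$ and $\varepsilon>0$, $A^\varepsilon_\sigma(x)=A(\sigma(x),x/\varepsilon)$, and $A^0_\sigma(x)=A^0(\sigma(x))$, where $A^0(t)=\{a^0_{ij}(t)\}$ is given by $$a^0_{ij}(t)=\frac1{|Y|}\int_Y a_{ij}(t,y)\,dy-\frac1{|Y|}\sum_{k=1}^d\int_Y a_{ik}(t,y)\frac{\partial\chi_j}{\partial y_k}\,dy,$$ and $\chi_j=\chi_j(t,\cdot)\in W^1_{per}(Y)$ is the unique solution of $\int_YA(t,y)\nabla_y\chi_j\cdot\nabla_yv\,dy=\int_YA(t,y)\mathbf e_j\cdot\nabla_yv\,dy$ for all $v\in W^1_{per}(Y)$. Here $\mathbf e_1,\dots,\mathbf e_d$ is the canonical basis of $\mathbb{R}^d$, $W^1_{per}(Y)=\{v\in H^1_{per}(Y):\int_Yv\,dy=0\}$, and $H^1_{per}(Y)$ is the $H^1$-closure of the smooth $Y$-periodic functions. Dirichlet-to-Neumann map: for a bounded, uniformly elliptic symmetric tensor $B$ on $\Omega$, $\Lambda_B:H^{1/2}(\partial\Omega)\to H^{-1/2}(\partial\Omega)$ sends $g$ to $B\nabla u\cdot\nu|_{\partial\Omega}$, where $\nu$ is the exterior unit normal and $u\in H^1(\Omega)$ is the weak solution of $-\nabla\cdot(B\nabla u)=0$ in $\Omega$, $u=g$ on $\partial\Omega$. Observation operators: fix $J,L\in\mathbb{N}$, pairwise disjoint boundary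 portions $\Gamma_1,\dots,\Gamma_J\subset\partial\Omega$, functions $\phi_j\in H^{1/2}(\partial\Omega)$ with $\mathrm{supp}(\phi_j)\subseteq\Gamma_j$ ($j=1,\dots,J$), and Dirichlet data $g_l\in H^{1/2}(\partial\Omega)$ ($l=1,\dots,L$). Then $F^\varepsilon(\sigma)$ and $F^0(\sigma)$ are the vectors in $\mathbb{R}^{JL}$ with entries $f^\varepsilon_{jl}(\sigma)=\int_{\Gamma_j}\Lambda_{A^\varepsilon_\sigma}g_l\cdot\phi_j\,ds$ and $f^0_{jl}(\sigma)=\int_{\Gamma_j}\Lambda_{A^0_\sigma}g_l\cdot\phi_j\,ds$, understood as duality pairings between $H^{-1/2}(\partial\Omega)$ and $H^{1/2}(\partial\Omega)$. Hellinger distance: for probability measures $\mu^1,\mu^2$ on $X$ absolutely continuous with respect to a common reference measure $\mu$, $d^2_{Hell}(\mu^1,\mu^2)=\frac12\int_X\left(\sqrt{\frac{d\mu^1}{d\mu}}-\sqrt{\frac{d\mu^2}{d\mu}}\right)^2d\mu$.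
   Formalization: Since exp(θ) is unbounded over X, P_1 does not map X into U and F^ε(P_1(θ)) is then undefined; ''P: X → U'' is read as the assumption that P(θ) ∈ U for μ_pr-almost every θ, which in case (a) leaves only degenerate Gaussian priors. *)

(* Defs.v *)
From HB Require Import structures.
From mathcomp Require Import all_boot all_order all_algebra.
From mathcomp Require Import all_classical all_reals all_analysis.

Set Implicit Arguments.
Unset Strict Implicit.
Unset Printing Implicit Defensive.

Import Order.TTheory GRing.Theory Num.Theory.
Import numFieldNormedType.Exports.

Local Open Scope classical_set_scope.
Local Open Scope ring_scope.

(* The Borel sigma-algebra of R^n, generated by the coordinates. *)
Section borel_rV.
Context {R : realType} (n : nat).

Let coord (i : 'I_n) (x : 'rV[R]_n) : measurableTypeR R := x ord0 i.

Let rV_set0 : g_sigma_preimage coord set0.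
Proof. exact: sigma_algebra0. Qed.

Let rV_setC A : g_sigma_preimage coord A -> g_sigma_preimage coord (~` A).
Proof. exact: sigma_algebraC. Qed.

Let rV_bigcup (F : (set 'rV[R]_n)^nat) :
  (forall i, g_sigma_preimage coord (F i)) ->
  g_sigma_preimage coord (\bigcup_i F i).
Proof. exact: sigma_algebra_bigcup. Qed.

HB.instance Definition _ := @isMeasurable.Build default_measure_display
  'rV[R]_n (g_sigma_preimage coord) rV_set0 rV_setC rV_bigcup.

Lemma measurable_coord (i : 'I_n) :
  measurable_fun [set: 'rV[R]_n] (coord i).
Proof.
move=> _ Y mY; rewrite setTI; apply: sub_sigma_algebra => /=.
rewrite -bigcup_seq/=; exists i => /=; first by rewrite mem_index_enum.
by exists Y => //; rewrite setTI.
Qed.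

Lemma measurable_fun_rV d (T : measurableType d) (f : T -> 'rV[R]_n) :
  (forall i, measurable_fun setT (fun x => f x ord0 i : measurableTypeR R)) ->
  measurable_fun setT f.
Proof.
move=> mf.
have H : preimage_set_system setT f (@measurable _ 'rV[R]_n) `<=` measurable.
  rewrite /measurable/= -g_sigma_preimage_comp.
  apply: smallest_sub; first exact: sigma_algebra_measurable.
  move=> A; rewrite -bigcup_seq => -[i _ [B mB <-]].
  exact: (mf i).
move=> _ A mA; apply: H; exists A => //.
Qed.

End borel_rV.

Section lebesgue_rV.
Context {R : realType} (n : nat).

Definition rV_cons (p : measurableTypeR R * 'rV[R]_n) : 'rV[R]_n.+1 :=
  row_mx (p.1 : R)%:M p.2.

Definition rV_uncons (x : 'rV[R]_n.+1) : measurableTypeR R * 'rV[R]_n :=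
  (x ord0 ord0, @rsubmx R 1 1 n x).

Lemma rV_consK : cancel rV_cons rV_uncons.
Proof.
move=> [a x]; rewrite /rV_uncons /rV_cons/= row_mxKr; congr pair.
rewrite (_ : ord0 = lshift n (ord0 : 'I_1)); last exact/val_inj.
by rewrite [LHS](row_mxEl (a : R)%:M x) mxE eqxx mulr1n.
Qed.

Lemma rV_unconsK : cancel rV_uncons rV_cons.
Proof.
move=> x; rewrite /rV_uncons /rV_cons/=; apply/rowP => i.
case: (split_ordP (i : 'I_(1 + n))) => j ->.
  rewrite [LHS](row_mxEl (x ord0 ord0)%:M (@rsubmx R 1 1 n x)).
  by rewrite mxE (ord1 j) eqxx mulr1n; congr (x _ _); exact/val_inj.
rewrite [LHS](row_mxEr (x ord0 ord0)%:M (@rsubmx R 1 1 n x)).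
by rewrite mxE.
Qed.

Lemma measurable_rV_cons : measurable_fun setT rV_cons.
Proof.
apply: measurable_fun_rV => i; rewrite /rV_cons.
case: (split_ordP (i : 'I_(1 + n))) => j ->.
  apply: (eq_measurable_fun fst) => [p _|]; last exact: measurable_fst.
  by rewrite (row_mxEl (p.1 : R)%:M p.2) mxE (ord1 j) eqxx mulr1n.
apply: (eq_measurable_fun (fun p : measurableTypeR R * 'rV[R]_n => p.2 ord0 j)).
  by move=> p _; rewrite (row_mxEr (p.1 : R)%:M p.2).
exact: (measurableT_comp (measurable_coord j) measurable_snd).
Qed.

Lemma measurable_rV_uncons : measurable_fun setT rV_uncons.
Proof.
apply/measurable_fun_pairP; split; first exact: measurable_coord.
apply: measurable_fun_rV => i; rewrite /rV_uncons/=.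
under eq_fun do rewrite mxE.
exact: measurable_coord.
Qed.

Variable mu : {sigma_finite_measure set 'rV[R]_n -> \bar R}.

(* The product of Lebesgue measure on R and mu, on R^(n+1). *)
Definition lebesgue_cons : set 'rV[R]_n.+1 -> \bar R :=
  pushforward (product_measure1 (@lebesgue_measure R) mu) rV_cons.


Let prod := product_measure1 (@lebesgue_measure R) mu.

Let lebesgue_cons0 : lebesgue_cons set0 = 0%E.
Proof. by rewrite /lebesgue_cons /pushforward preimage_set0 measure0. Qed.

Let lebesgue_cons_ge0 A : (0 <= lebesgue_cons A)%E.
Proof. exact: (measure_ge0 prod). Qed.

Let mcons A : measurable A -> measurable (rV_cons @^-1` A).
Proof.
by move=> mA; rewrite -[X in measurable X]setTI; exact: measurable_rV_cons.
Qed.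

Let lebesgue_cons_sigma_additive : semi_sigma_additive lebesgue_cons.
Proof.
move=> F mF tF mUF; rewrite /lebesgue_cons /pushforward preimage_bigcup.
apply: (@measure_semi_sigma_additive _ _ _ prod).
- by move=> n0; exact: mcons.
- apply/trivIsetP => /= i j _ _ ij; rewrite -preimage_setI.
  by move/trivIsetP : tF => /(_ _ _ _ _ ij) ->//; rewrite preimage_set0.
- by rewrite -preimage_bigcup; exact: mcons.
Qed.

HB.instance Definition _ := isMeasure.Build _ _ _ lebesgue_cons
  lebesgue_cons0 lebesgue_cons_ge0 lebesgue_cons_sigma_additive.

Let lebesgue_cons_sigma_finite : sigma_finite setT lebesgue_cons.
Proof.
have /sigma_finiteP[F [TF ndF Foo]] := sigma_finiteT (@lebesgue_measure R).
have /sigma_finiteP[G [TG ndG Goo]] := sigma_finiteT mu.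
exists (fun k => rV_uncons @^-1` (F k `*` G k)).
  rewrite -preimage_bigcup -[LHS](preimage_setT rV_uncons); congr (_ @^-1` _).
  rewrite -setXTT TF TG predeqE => -[x y]; split.
    move=> [/= [i _ Fnx] [k _ Gky]]; exists (maxn i k) => //; split.
    - by move: x Fnx; exact/subsetPset/ndF/leq_maxl.
    - by move: y Gky; exact/subsetPset/ndG/leq_maxr.
  by move=> [i _ []/= ? ?]; split; exists i.
move=> k; have [mF Fk] := Foo k; have [mG Gk] := Goo k; split.
  rewrite -[X in measurable X]setTI; apply: measurable_rV_uncons => //.
  exact: measurableX.
rewrite /lebesgue_cons /pushforward -comp_preimage.
rewrite (_ : rV_uncons \o rV_cons = id); last by apply/funext; exact: rV_consK.
by rewrite preimage_id product_measure1E// lte_mul_pinfty// ge0_fin_numE.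
Qed.

HB.instance Definition _ := Measure_isSigmaFinite.Build _ _ _ lebesgue_cons
  lebesgue_cons_sigma_finite.

End lebesgue_rV.

(* Lebesgue measure on R^n, as an iterated product measure. *)
Fixpoint lebesgue_rV {R : realType} (n : nat) :
    {sigma_finite_measure set 'rV[R]_n -> \bar R} :=
  match n with
  | 0 => \d_(0 : 'rV[R]_0)
  | m.+1 => lebesgue_cons (lebesgue_rV m)
  end.

Section euclidean.
Context {R : realType} {d : nat}.
Implicit Types x y : 'rV[R]_d.

Definition dotv x y : R := \sum_(k < d) x ord0 k * y ord0 k.

(* The library's norm on 'rV[R]_d is the sup norm. *)
Definition enorm x : R := Num.sqrt (dotv x x).

(* The vector B xi, for a row vector xi. *)
Definition mxv (B : 'M[R]_d) x : 'rV[R]_d := x *m B^T.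

End euclidean.

(* T with the sigma-algebra of all its subsets: covers by arbitrary sets. *)
Definition discrete_sets (T : pointedType) : Type := T.

HB.instance Definition _ (T : pointedType) := Pointed.on (discrete_sets T).
HB.instance Definition _ (T : pointedType) :=
  @isMeasurable.Build default_measure_display (discrete_sets T) setT
    I (fun _ _ => I) (fun _ _ => I).

Section hausdorff.
Local Open Scope ereal_scope.
Context {R : realType} {d : nat} (m : nat).
Implicit Types (E : set 'rV[R]_d) (delta : R).

Definition ediam E : \bar R :=
  ereal_sup [set (enorm (p.1 - p.2))%:E | p in E `*` E].

Definition unit_ball_volume : R :=
  fine (lebesgue_rV m [set x : 'rV[R]_m | (enorm x < 1)%R]).

Definition hausdorff_weight delta E : \bar R :=
  if E == set0 then 0
  else if ediam E <= delta%:E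
  then (unit_ball_volume * (fine (ediam E) / 2) ^+ m)%:E
  else +oo.

Definition hausdorff_delta delta : set 'rV[R]_d -> \bar R :=
  @mu_ext _ (discrete_sets 'rV[R]_d) R (hausdorff_weight delta).

(* The m-dimensional Hausdorff outer measure, with the normalisation that
   makes it the surface measure of m-dimensional Lipschitz surfaces. *)
Definition hausdorff E : \bar R :=
  ereal_sup
    [set hausdorff_delta delta E | delta in [set delta | (0 < delta)%R]].

Let weight0 delta : hausdorff_weight delta set0 = 0.
Proof. by rewrite /hausdorff_weight eqxx. Qed.

Let weight_ge0 delta E : 0 <= hausdorff_weight delta E.
Proof.
rewrite /hausdorff_weight; case: ifPn => // /set0P[x Ex]; case: ifP => // _.
rewrite lee_fin mulr_ge0 ?fine_ge0// exprn_ge0// divr_ge0// fine_ge0//.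
apply: (@le_trans _ _ (enorm (x - x))%:E); first by rewrite lee_fin sqrtr_ge0.
by apply: ereal_sup_ubound; exists (x, x).
Qed.

Let delta_ge0 delta E : 0 <= hausdorff_delta delta E.
Proof.
apply: (@mu_ext_ge0 _ (discrete_sets 'rV[R]_d) R _ _ E) => X.
exact: weight_ge0.
Qed.

Let hausdorff0 : hausdorff set0 = 0.
Proof.
apply/eqP; rewrite eq_le; apply/andP; split.
  apply: ge_ereal_sup => _ [delta _ <-].
  by rewrite [leLHS](@mu_ext0 _ (discrete_sets 'rV[R]_d) R _
    (weight0 delta) (weight_ge0 delta)).
apply: (@le_trans _ _ (hausdorff_delta 1 set0)).
  exact: delta_ge0.
by apply: ereal_sup_ubound; exists 1%R; first exact: ltr01.
Qed.

Let hausdorff_ge0 E : 0 <= hausdorff E.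
Proof.
apply: (@le_trans _ _ (hausdorff_delta 1 E)).
  exact: delta_ge0.
by apply: ereal_sup_ubound; exists 1%R; first exact: ltr01.
Qed.

Let le_hausdorff : {homo hausdorff : A B / A `<=` B >-> A <= B}.
Proof.
move=> A B AB; apply: ge_ereal_sup => _ [delta delta0 <-].
apply: (@le_trans _ _ (hausdorff_delta delta B)).
  exact: (@le_mu_ext _ (discrete_sets 'rV[R]_d)).
by apply: ereal_sup_ubound; exists delta.
Qed.

Let hausdorff_sigma_subadditive : sigma_subadditive hausdorff.
Proof.
move=> F; apply: ge_ereal_sup => _ [delta delta0 <-].
have := @mu_ext_sigma_subadditive _ (discrete_sets 'rV[R]_d) R _
  (weight_ge0 delta) F.
move=> /le_trans; apply; apply: lee_nneseries => [i _ _|i _].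
  exact: delta_ge0.
by apply: ereal_sup_ubound; exists delta.
Qed.

HB.instance Definition _ := isOuterMeasure.Build R 'rV[R]_d hausdorff
  hausdorff0 hausdorff_ge0 le_hausdorff hausdorff_sigma_subadditive.

End hausdorff.

Definition L2 d (T : measurableType d) (R : realType)
    (mu : {measure set T -> \bar R}) (D : set T) (f : T -> R) : Prop :=
  measurable_fun D f /\ mu.-integrable D (fun x => (f x ^+ 2)%:E).

Section sobolev.
Context {R : realType} {n : nat}.
Implicit Types (D : set 'rV[R]_n) (u v f g : 'rV[R]_n -> R)
  (Du Dv : 'rV[R]_n -> 'rV[R]_n).

Local Notation leb := (@lebesgue_rV R n).

Definition pderiv (i : 'I_n) f (x : 'rV[R]_n) : R :=
  'D_(delta_mx ord0 i) f x.

Definition grad f (x : 'rV[R]_n) : 'rV[R]_n := \row_i pderiv i f x.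

Definition smooth f : Prop :=
  forall (s : seq 'I_n) (x : 'rV[R]_n), differentiable (foldr pderiv f s) x.

Definition test_function D f : Prop :=
  smooth f /\
  exists2 K, compact K & K `<=` D /\ forall x, ~ K x -> f x = 0.

Definition weak_pderiv D (i : 'I_n) u g : Prop :=
  forall phi, test_function D phi ->
    \int[leb]_(x in D) (u x * pderiv i phi x) =
    - \int[leb]_(x in D) (g x * phi x).

(* Elements of H^1(D) are handled together with their weak gradient Du. *)
Definition H1 D u Du : Prop :=
  [/\ L2 leb D u,
      forall k, L2 leb D (fun x => Du x ord0 k) &
      forall k, weak_pderiv D k u (fun x => Du x ord0 k)].

Definition H1_cvg D (phi : nat -> 'rV[R]_n -> R) u Du : Prop :=
  (\int[leb]_(x in D)
     ((phi m x - u x) ^+ 2 + enorm (grad (phi m) x - Du x) ^+ 2)%:E)%E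
    @[m --> \oo] --> 0%E.

Definition H1_0 D u Du : Prop :=
  H1 D u Du /\
  exists2 phi : nat -> 'rV[R]_n -> R,
    forall m, test_function D (phi m) & H1_cvg D phi u Du.

Definition ess_le D f (E : R) : Prop :=
  measurable_fun D f /\ {ae leb, forall x, D x -> `|f x| <= E}.

Definition W1infty D f : Prop :=
  exists E, ess_le D f E /\
    forall k, exists2 g, weak_pderiv D k f g & ess_le D g E.

End sobolev.

Section parametrized.
Context {R : realType} {d : nat}.
Implicit Types f : R -> 'rV[R]_d -> R.

(* The point (t, y) of R x R^d is the row vector whose coordinate of index
   ord0 is t, and those of index lift ord0 k are the coordinates of y. *)
Definition joint f (z : 'rV[R]_d.+1) : R := f (z ord0 ord0) (@rsubmx R 1 1 d z).

Definition cylinder (I : set R) (Y : set 'rV[R]_d) : set 'rV[R]_d.+1 :=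
  [set z : 'rV[R]_d.+1 | I (z ord0 ord0) /\ Y (@rsubmx R 1 1 d z)].

(* The norm of f in W^{1,oo}(]a, b[; W^{1,oo}(Y)), taken to be the maximum of
   the essential suprema of f, grad_y f, d_t f and d_t grad_y f, is at most E;
   another choice of equivalent norm only changes the value of E. *)
Definition W1infty_W1infty_le (a b : R) (Y : set 'rV[R]_d) f (E : R) : Prop :=
  let Q := cylinder `]a, b[ Y in
  [/\ ess_le Q (joint f) E,
      exists2 ft, weak_pderiv Q ord0 (joint f) ft & ess_le Q ft E &
      forall k : 'I_d, exists fy fty,
        [/\ weak_pderiv Q (lift ord0 k) (joint f) fy, ess_le Q fy E,
            weak_pderiv Q ord0 fy fty & ess_le Q fty E]].

End parametrized.

Section homogenization.
Context {R : realType} {d : nat}.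
Implicit Types (B : 'rV[R]_d -> 'M[R]_d) (v : 'rV[R]_d -> R)
  (Dv : 'rV[R]_d -> 'rV[R]_d).

Local Notation leb := (@lebesgue_rV R d).

Definition unit_cube : set 'rV[R]_d := [set y | forall k, 0 < y ord0 k < 1].

Definition cell_periodic (T : Type) (f : 'rV[R]_d -> T) : Prop :=
  forall y k, f (y + delta_mx ord0 k) = f y.

Definition H1_per v Dv : Prop :=
  H1 unit_cube v Dv /\
  exists2 phi : nat -> 'rV[R]_d -> R,
    forall m, smooth (phi m) /\ cell_periodic (phi m) & H1_cvg unit_cube phi v Dv.

Definition W1_per v Dv : Prop :=
  H1_per v Dv /\ \int[leb]_(y in unit_cube) v y = 0.

Definition cell_solution B (j : 'I_d)
    (chi : ('rV[R]_d -> R) * ('rV[R]_d -> 'rV[R]_d)) : Prop :=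
  W1_per chi.1 chi.2 /\
  forall v Dv, W1_per v Dv ->
    \int[leb]_(y in unit_cube) dotv (mxv (B y) (chi.2 y)) (Dv y) =
    \int[leb]_(y in unit_cube) dotv (mxv (B y) (delta_mx ord0 j)) (Dv y).

Definition corrector B j := get (cell_solution B j).

Definition homogenized B : 'M[R]_d :=
  let vol := fine (leb unit_cube) in
  \matrix_(i, j)
    (vol^-1 * \int[leb]_(y in unit_cube) B y i j
     - vol^-1 * \sum_(k < d)
         \int[leb]_(y in unit_cube) (B y i k * (corrector B j).2 y ord0 k)).

Definition fine_tensor (A : R -> 'rV[R]_d -> 'M[R]_d) (eps : R)
    (sigma : 'rV[R]_d -> R) (x : 'rV[R]_d) : 'M[R]_d :=
  A (sigma x) (eps^-1 *: x).

Definition effective_tensor (A : R -> 'rV[R]_d -> 'M[R]_d)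
    (sigma : 'rV[R]_d -> R) (x : 'rV[R]_d) : 'M[R]_d :=
  homogenized (A (sigma x)).

End homogenization.

Section dirichlet_to_neumann.
Context {R : realType} {d : nat} (Omega : set 'rV[R]_d).
Implicit Types (B : 'rV[R]_d -> 'M[R]_d) (u v g phi : 'rV[R]_d -> R)
  (Du Dv : 'rV[R]_d -> 'rV[R]_d).

Local Notation leb := (@lebesgue_rV R d).

Definition surface_outer : {outer_measure set 'rV[R]_d -> \bar R} :=
  @hausdorff R d d.-1.

Local Notation surface := (caratheodory_type surface_outer).

Definition surface_measure : {measure set surface -> \bar R} := surface_outer.

Definition bdry : set 'rV[R]_d := closure Omega `\` interior Omega.

(* Near each of its boundary points, Omega is the strict epigraph of a
   Lipschitz function gamma of the hyperplane orthogonal to e. *)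
Definition lipschitz_boundary : Prop :=
  forall x0, bdry x0 ->
    exists (r K : R) (e : 'rV[R]_d) (gamma : 'rV[R]_d -> R),
      [/\ 0 < r, dotv e e = 1,
          forall x y, `|gamma x - gamma y| <= K * enorm (x - y) &
          forall x, enorm (x - x0) < r ->
            (Omega x <-> gamma (x - dotv x e *: e) < dotv x e)].

(* Functions on the boundary are functions on R^d of which only the values on
   the boundary matter; g is the trace of u when it is the limit in L^2 of the
   boundary values of smooth functions converging to u in H^1. *)
Definition is_trace u Du g : Prop :=
  L2 surface_measure (bdry : set surface) (g : surface -> R) /\
  exists phi : nat -> 'rV[R]_d -> R,
    [/\ forall m, smooth (phi m),
        H1_cvg Omega phi u Du &
        (\int[surface_measure]_(x in (bdry : set surface))
           ((phi m x - g x) ^+ 2)%:E)%E @[m --> \oo] --> 0%E].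

Definition is_lift g (w : ('rV[R]_d -> R) * ('rV[R]_d -> 'rV[R]_d)) : Prop :=
  H1 Omega w.1 w.2 /\ is_trace w.1 w.2 g.

Definition H12 g : Prop := exists w, is_lift g w.

Definition lift_bdry g := get (is_lift g).

(* The boundary condition u = g is imposed as u - G \in H^1_0(Omega), with
   G \in H^1(Omega) of trace g. *)
Definition dirichlet_solution B g
    (w : ('rV[R]_d -> R) * ('rV[R]_d -> 'rV[R]_d)) : Prop :=
  [/\ H1 Omega w.1 w.2,
      H1_0 Omega (w.1 \- (lift_bdry g).1) (w.2 \- (lift_bdry g).2) &
      forall v Dv, H1_0 Omega v Dv ->
        \int[leb]_(x in Omega) dotv (mxv (B x) (w.2 x)) (Dv x) = 0].

Definition dirichlet B g := get (dirichlet_solution B g).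

(* The element F . nu of H^{-1/2}, for a divergence-free F in L^2: by Green's
   formula, its value at phi is the integral of F . grad Phi for any Phi in
   H^1 of trace phi. *)
Definition normal_component (F : 'rV[R]_d -> 'rV[R]_d) phi : R :=
  \int[leb]_(x in Omega) dotv (F x) ((lift_bdry phi).2 x).

(* DtN B g phi is the duality pairing of Lambda_B g with phi. *)
Definition DtN B g : ('rV[R]_d -> R) -> R :=
  normal_component (fun x => mxv (B x) ((dirichlet B g).2 x)).

Definition bdry_support phi : set 'rV[R]_d :=
  [set x | bdry x /\ forall r : R, 0 < r ->
    (0 < surface_measure
           [set y | [/\ bdry y, (enorm (y - x) < r)%R & phi y != 0%R]])%E].

(* The entries of this vector are indexed by the pairs (j, l) through mxvec. *)
Definition observation (J L : nat) (phi : 'I_J -> 'rV[R]_d -> R)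
    (g : 'I_L -> 'rV[R]_d -> R) B : 'cV[R]_(J * L) :=
  (mxvec (\matrix_(j, l) DtN B (g l) (phi j)))^T.

Definition admissible (smin smax : R) : set ('rV[R]_d -> R) :=
  [set sigma | measurable_fun Omega sigma /\
    {ae leb, forall x, Omega x -> smin <= sigma x <= smax}].

End dirichlet_to_neumann.

Section continuous_functions.
Context {R : realType} {d : nat} (Omega : set 'rV[R]_d).

(* C^0(closure Omega), each function being extended by zero. *)
Record C0 := MkC0 {
  C0_fun :> 'rV[R]_d -> R ;
  C0_continuous : {within closure Omega, continuous C0_fun} ;
  C0_outside : forall x, ~ closure Omega x -> C0_fun x = 0 }.

Let C0_zero : C0.
Proof.
by exists (cst 0) => // x; exact: cst_continuous.
Defined.

HB.instance Definition _ := gen_eqMixin C0.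
HB.instance Definition _ := gen_choiceMixin C0.
HB.instance Definition _ := isPointed.Build C0 C0_zero.

Definition C0_dist (th1 th2 : C0) : R :=
  sup [set `|th1 x - th2 x| | x in closure Omega].

Definition C0_norm (th : C0) : R := sup [set `|th x| | x in closure Omega].

Definition C0_open : set (set C0) :=
  [set B | forall th, B th ->
    exists2 r : R, 0 < r & forall th', C0_dist th th' < r -> B th'].

HB.instance Definition _ := @isMeasurable.Build default_measure_display C0
  <<s C0_open >> (@sigma_algebra0 _ setT C0_open)
  (@sigma_algebraC _ C0_open) (@sigma_algebra_bigcup _ setT C0_open).

Definition bounded_linear_form (l : C0 -> R) : Prop :=
  (forall (a : R) (th1 th2 th3 : C0),
     (forall x, th3 x = a * th1 x + th2 x) -> l th3 = a * l th1 + l th2) /\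
  exists C : R, forall th, `|l th| <= C * C0_norm th.

(* normal_prob is not a Dirac mass when the standard deviation is 0. *)
Definition gaussian (mu : probability C0 R) : Prop :=
  forall l, bounded_linear_form l ->
    exists m s : R, forall B : set R, measurable B ->
      mu (l @^-1` B) = if s == 0 then \d_m B else normal_prob m s B.

Definition P1 (th : C0) (x : 'rV[R]_d) : R := expR (th x).

Definition level_region (c : nat -> \bar R) (th : C0) (i : nat) :
    set 'rV[R]_d :=
  [set x | Omega x /\ (c i <= (th x)%:E < c i.+1)%E].

Definition P2 (n : nat) (c : nat -> \bar R) (f : 'I_n -> C0)
    (th : C0) (x : 'rV[R]_d) : R :=
  \sum_(i < n) f i x * \1_(level_region c th i) x.

Definition level_set_map (P : C0 -> 'rV[R]_d -> R) : Prop :=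
  exists (n : nat) (c : nat -> \bar R) (f : 'I_n -> C0),
    [/\ c 0%N = -oo%E, c n = +oo%E,
        forall i, (i < n)%N -> (c i < c i.+1)%E,
        forall i x, closure Omega x -> 0 < f i x &
        P = P2 c f].

End continuous_functions.

Section bayes.
Context d {X : measurableType d} {R : realType}.

Definition RN_density (nu mu : probability X R) : X -> \bar R :=
  Radon_Nikodym (charge_of_finite_measure nu) mu.

Definition posterior (prior : probability X R) (Phi : X -> R)
    (nu : probability X R) : Prop :=
  let C := \int[prior]_th expR (- Phi th) in
  nu `<< prior /\
  ae_eq prior setT (RN_density nu prior)
    (fun th => (C^-1 * expR (- Phi th))%:E).

Definition hellinger (mu mu1 mu2 : probability X R) : R :=
  Num.sqrt (2^-1 * \int[mu]_th
    (Num.sqrt (fine (RN_density mu1 mu th)) -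
     Num.sqrt (fine (RN_density mu2 mu th))) ^+ 2).

End bayes.

Definition covariance_matrix (R : realType) n (C : 'M[R]_n) : Prop :=
  C^T = C /\ forall v : 'cV[R]_n, 0 <= (v^T *m C *m v) ord0 ord0.

Definition misfit (R : realType) n (C : 'M[R]_n) (z w : 'cV[R]_n) : R :=
  2^-1 * ((z - w)^T *m invmx C *m (z - w)) ord0 ord0.

(* Main.v *)
(* The Dirichlet-to-Neumann pairing is \int_Omega B grad u . grad Phi, where Phi
   is any fixed lift of phi, so it suffices that the fluxes A_eps grad u_eps tend
   to A_0 grad u_0 when tested against one fixed field.

   If sigma = t on a set A, approximate 1_A by a test function eta and the
   corrector gradient by that of a smooth periodic psi: with g = c - grad psi, the
   fields eta(x) g(x/eps) are, up to the gradient of a test function, close to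
   1_A c, and their fluxes converge weakly to the homogenized flux.
   Fields with this property form a closed subspace of L^2, which for a simple
   sigma is everything; the energy estimate then compares u_eps with such an
   approximation of grad u_0.  A general sigma is a uniform limit of simple ones,
   and both A and the homogenized tensor are Lipschitz in t.

   So F_eps(sigma) tends to F_0(sigma) for every admissible sigma.  The potentials
   converge pointwise, and since the densities exp(- Phi) are bounded by 1,
   dominated convergence gives the convergence in the Hellinger distance. *)
Require Import Defs.
From HB Require Import structures.
From mathcomp Require Import all_boot all_order all_algebra.
From mathcomp Require Import all_classical all_reals all_analysis.
From mathcomp Require Import measurable_realfun zify ring lra.

Set Implicit Arguments.
Unset Strict Implicit.
Unset Printing Implicit Defensive.

Import Order.TTheory GRing.Theory Num.Theory.
Import numFieldNormedType.Exports.

Local Open Scope classical_set_scope.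
Local Open Scope ring_scope.

(** * Semi-inner products and square-integrable functions *)

(** [P2] produces discontinuous conductivities, so sigma is no better than measurable in x and a
    two-scale expansion with a smooth slow variable is out of reach; this forces the passage through
    indicators and simple functions. Correctors and Dirichlet solutions are picked by [get], which
    returns an arbitrary value when no solution exists, so existence is part of the proof. It comes
    from minimizing the energy over gradients of smooth functions, the strong convergence of a
    minimizing sequence taking the place of weak compactness. Oscillating terms are also handled by
    estimates: Poincare-Wirtinger on the cell bounds the pairing of q (x / eps), for q periodic of
    mean zero, with f by O (eps) times the norm of grad f, and a divergence-free q can be tested
    against eta grad psi after one integration by parts. This replaces flux potentials and the
    div-curl lemma. Most estimates are kept in squared form, X ^ 2 <= C kap, to stay polynomial. The
    bounds on A hold almost everywhere in y; A is exchanged for a tensor that is elliptic at every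
    point and agrees with it almost everywhere. *)

Section semi_inner_product.
Context {R : realType} {V : lmodType R} (W : set V) (b : V -> V -> R).
Hypothesis W0 : W 0.
Hypothesis WP : forall a u v, W u -> W v -> W (a *: u + v).
Hypothesis bC : forall u v, W u -> W v -> b u v = b v u.
Hypothesis bP : forall a u v w, W u -> W v -> W w ->
  b (a *: u + v) w = a * b u w + b v w.
Hypothesis b_ge0 : forall u, W u -> 0 <= b u u.

Lemma sipZ a u : W u -> W (a *: u).
Proof. by move=> Wu; rewrite -[_ *: _]addr0; exact: WP. Qed.

Lemma sipD u v : W u -> W v -> W (u + v).
Proof. by move=> Wu Wv; rewrite -[u]scale1r; exact: WP. Qed.

Lemma sip0l w : W w -> b 0 w = 0.
Proof. by move=> Ww; have := bP 1 W0 W0 Ww; rewrite scale1r addr0 mul1r; lra. Qed.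

Lemma sip_expand a u v : W u -> W v ->
  b (a *: u + v) (a *: u + v) = a ^+ 2 * b u u + 2 * a * b u v + b v v.
Proof.
move=> Wu Wv; have Ws := WP a Wu Wv.
by rewrite bP // (bC Wu) // (bC Wv) // !bP // (bC Wv Wu); ring.
Qed.

Lemma sipZl a u w : W u -> W w -> b (a *: u) w = a * b u w.
Proof. by move=> Wu Ww; rewrite -[a *: u]addr0 bP // sip0l // addr0. Qed.

Lemma sip_expand2 a c u v : W u -> W v -> b (a *: u + c *: v) (a *: u + c *: v) =
  a ^+ 2 * b u u + 2 * a * c * b u v + c ^+ 2 * b v v.
Proof.
move=> Wu Wv.
have Wc : W (c *: v) := sipZ c Wv; have Wa : W (a *: u) := sipZ a Wu.
by rewrite sip_expand // (bC Wu Wc) !sipZl // (bC Wv Wc) sipZl // (bC Wv Wu); ring.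
Qed.

(** The polynomial is taken at its minimum a = - y / x, where it equals c - y ^ 2 / x; if x = 0 it
    is affine in a, and the a chosen makes it equal to - 1 unless y = 0. *)
Lemma sip_quad (c x y : R) : 0 <= c -> (forall a, 0 <= a ^+ 2 * x + 2 * a * y + c) ->
  0 <= x -> y ^+ 2 <= c * x.
Proof.
move=> c0 H x0; have [x00|xn0] := eqVneq x 0.
  subst x; rewrite mulr0; have [->|yn0] := eqVneq y 0; first by rewrite expr0n.
  have := H (- (c + 1) / (2 * y)); rewrite mulr0 add0r.
  rewrite (_ : 2 * (- (c + 1) / (2 * y)) * y = - (c + 1)); last by field.
  lra.
have xp : 0 < x by rewrite lt_neqAle eq_sym xn0.
have := H (- y / x).
rewrite (_ : _ + c = (c * x - y ^+ 2) / x); last by field.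
by rewrite pmulr_lge0 ?invr_gt0 // subr_ge0.
Qed.

Lemma sip_CS u v : W u -> W v -> b u v ^+ 2 <= b u u * b v v.
Proof.
move=> Wu Wv; rewrite mulrC; apply: sip_quad; rewrite ?b_ge0 // => a.
by rewrite -sip_expand // b_ge0 //; exact: WP.
Qed.

(* The s n almost minimize b (f + v) (f + v) over S: the parallelogram law gives
   the Cauchy estimate, perturbation along v the approximate orthogonality. *)
Lemma minimizing_sequence (S : set V) (f : V) : S `<=` W -> W f -> S 0 ->
  (forall a u v, S u -> S v -> S (a *: u + v)) ->
  exists s : nat -> V, [/\ forall n, S (s n),
    forall n m, b (s n - s m) (s n - s m) <= 2 * (n.+1%:R^-1 + m.+1%:R^-1) &
    forall n v, S v -> b (f + s n) v ^+ 2 <= n.+1%:R^-1 * b v v].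
Proof.
move=> SW Wf S0 SP.
pose E := [set b (f + v) (f + v) | v in S].
have SZ a u : S u -> S (a *: u) by move=> Su; rewrite -[_ *: _]addr0; exact: SP.
have SD u v : S u -> S v -> S (u + v) by move=> Su Sv; rewrite -[u]scale1r; exact: SP.
have WfS v : S v -> W (f + v) by move=> /SW; exact: sipD.
have E0 : lbound E 0 by move=> _ [v Sv <-]; apply: b_ge0; exact: WfS.
have En : E !=set0 by exists (b (f + 0) (f + 0)), 0.
have hE : has_inf E by split => //; exists 0.
have Einf v : S v -> inf E <= b (f + v) (f + v).
  by move=> Sv; apply: ge_inf; [exists 0|exists v].
have /choice[s sP] : forall n, exists s, S s /\ b (f + s) (f + s) < inf E + n.+1%:R^-1.
  move=> n; have [_ [v Sv <-] H] := @inf_adherent R E n.+1%:R^-1 ltac:(by rewrite invr_gt0) hE.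
  by exists v.
have Ss n : S (s n) by have [] := sP n.
exists s; split => //.
- move=> n m; have Sh : S (2^-1 *: s n + 2^-1 *: s m) by apply: SD; exact: SZ.
  have W1 := WfS _ (Ss n); have W2 := WfS _ (Ss m).
  have := Einf _ Sh.
  rewrite (_ : f + _ = 2^-1 *: (f + s n) + 2^-1 *: (f + s m)); last first.
    rewrite !scalerDr addrACA -scalerDl.
    by rewrite (_ : 2^-1 + 2^-1 = 1 :> R) ?scale1r //; lra.
  rewrite sip_expand2 //; rewrite (_ : s n - s m = -1 *: (f + s m) + (f + s n)); last first.
    by rewrite scaleN1r opprD addrAC addrA addNr add0r addrC.
  rewrite sip_expand // (bC W1 W2) sqrrN expr1n.
  have := (sP n).2; have := (sP m).2.
  move: (b (f + s n) _) (b (f + s m) (f + s n)) (b _ _) (inf E) => B C A I.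
  rewrite !expr2; move: (n.+1%:R^-1) (m.+1%:R^-1) => x y *; lra.
- move=> n v Sv.
  have Wv := SW _ Sv; have W1 := WfS _ (Ss n).
  rewrite (bC W1 Wv); apply: sip_quad; rewrite ?b_ge0 ?invr_ge0 // => a.
  have := Einf (s n + a *: v) ltac:(by apply: SD => //; exact: SZ).
  rewrite addrA (addrC _ (a *: v)) sip_expand //; have := (sP n).2.
  move: (b (f + s n) _) (n.+1%:R^-1) => x y; lra.
Qed.

End semi_inner_product.

Section L2_theory.
Context d (T : measurableType d) (R : realType) (mu : {measure set T -> \bar R}).
Implicit Types (D N : set T) (f g : T -> R).

Import HBNNSimple.

(** The integral of a nonnegative function, measurable or not, is a supremum over the simple
    functions below it; cutting such a function to the complement of [N] puts it below [g] without
    changing its integral. Almost everywhere rewriting is thus available for integrands not known to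
    be measurable, such as exp (- Phi) for the posteriors. *)
Lemma ge0_integralT_le_off (N : set T) (f g : T -> \bar R) : measurable N -> mu N = 0%E ->
  (forall x, 0 <= f x)%E -> (forall x, 0 <= g x)%E -> (forall x, ~ N x -> f x <= g x)%E ->
  (\int[mu]_x f x <= \int[mu]_x g x)%E.
Proof.
move=> mN N0 f0 g0 fg; rewrite !ge0_integralTE //.
apply: ge_ereal_sup => _ [h hf <-].
have mCN : measurable (~` N) by exact: measurableC.
pose h' : {nnsfun T >-> R} := [the {nnsfun T >-> R} of h \* mindic R mCN].
apply: ereal_sup_ubound => /=; exists h'.
  move=> x /=; rewrite mindicE; case: (boolP (x \in ~` N)) => [|_].
    by rewrite inE => Nx; rewrite mulr1; apply: le_trans (fg _ Nx); exact: hf.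
  by rewrite mulr0.
rewrite -!integralT_nnsfun.
apply: ae_eq_integral => //; [exact/measurable_EFinP|exact/measurable_EFinP|].
exists N; split => // x /= /existsNP[]; rewrite /= mindicE => _.
by case: (boolP (x \in ~` N)) => [_|]; rewrite ?mulr1 // notin_setE => /contrapT.
Qed.

Lemma ge0_integral_le D (f g : T -> \bar R) : (forall x, D x -> 0 <= f x)%E ->
  (forall x, D x -> f x <= g x)%E -> (\int[mu]_(x in D) f x <= \int[mu]_(x in D) g x)%E.
Proof.
move=> f0 fg; rewrite integral_mkcond [leRHS]integral_mkcond.
apply: (@ge0_integralT_le_off set0) => //= x.
- by rewrite /patch; case: ifPn => //; rewrite inE => /f0.
- by rewrite /patch; case: ifPn => //; rewrite inE => Dx; apply: le_trans (f0 x Dx) (fg x Dx).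
- by move=> _; rewrite /patch; case: ifPn => //; rewrite inE => /fg.
Qed.

Lemma integral_eq_off D N (f g : T -> \bar R) : measurable N -> mu N = 0%E ->
  (forall x, D x -> ~ N x -> f x = g x) ->
  (\int[mu]_(x in D) f x = \int[mu]_(x in D) g x)%E.
Proof.
move=> mN N0 fg.
have E x : ~ N x -> (f \_ D) x = (g \_ D) x.
  by move=> Nx; rewrite /patch; case: ifPn => //; rewrite inE => Dx; exact: fg.
have H (u v : T -> \bar R) : (forall x, 0 <= u x)%E -> (forall x, 0 <= v x)%E ->
    (forall x, ~ N x -> u x = v x) -> (\int[mu]_x u x = \int[mu]_x v x)%E.
  move=> u0 v0 uv; apply/eqP; rewrite eq_le; apply/andP; split.
    by apply: ge0_integralT_le_off mN N0 u0 v0 _ => x Nx; rewrite uv.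
  by apply: ge0_integralT_le_off mN N0 v0 u0 _ => x Nx; rewrite uv.
rewrite integral_mkcond [RHS]integral_mkcond [LHS]integralE [RHS]integralE.
congr (_ - _)%E; apply: H => x //.
  by move=> Nx; rewrite !funeposE E.
by move=> Nx; rewrite !funenegE E.
Qed.

Lemma Rintegral_eq_off D N f g : measurable N -> mu N = 0%E ->
  (forall x, D x -> ~ N x -> f x = g x) ->
  \int[mu]_(x in D) f x = \int[mu]_(x in D) g x.
Proof.
by move=> mN N0 fg; congr fine; apply: (integral_eq_off mN N0) => x Dx Nx; rewrite fg.
Qed.

Lemma Rintegral_eq_ae D f g : {ae mu, forall x, D x -> f x = g x} ->
  \int[mu]_(x in D) f x = \int[mu]_(x in D) g x.
Proof.
move=> [N [mN N0 H]]; apply: (Rintegral_eq_off mN N0) => x Dx Nx.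
by apply: contrapT => fg; apply: Nx; apply: H => /(_ Dx).
Qed.

Variable D : set T.
Hypothesis mD : measurable D.

Local Notation L2 := (L2 mu D).
Local Notation "\intD f" := (Rintegral mu D f) (at level 10).

Lemma L2_measurable f : L2 f -> measurable_fun D f. Proof. by case. Qed.

Lemma L2_cst0 : L2 (cst 0).
Proof.
split => //; apply: eq_integrable (integrable0 mu D) => //= x _.
by rewrite expr0n.
Qed.

Lemma L2P a f g : L2 f -> L2 g -> L2 (fun x => a * f x + g x).
Proof.
move=> [mf if2] [mg ig2]; split; first by apply: measurable_funD => //; exact: measurable_funM.
have H : mu.-integrable D (fun x => (2 * a ^+ 2)%:E * (f x ^+ 2)%:E + 2%:E * (g x ^+ 2)%:E)%E.
  by apply: integrableD => //; exact: integrableZl.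
apply: le_integrable H => //.
  apply/measurable_EFinP/measurable_funX/measurable_funD => //.
  exact: measurable_funM.
move=> x _; rewrite /= lee_fin ger0_norm ?sqr_ge0 //.
apply: le_trans (ler_norm _).
rewrite -subr_ge0 (_ : _ - _ = (a * f x - g x) ^+ 2) ?sqr_ge0 //; ring.
Qed.

Lemma L2Z a f : L2 f -> L2 (fun x => a * f x).
Proof.
move=> Lf; rewrite (_ : (fun _ => _) = fun x => a * f x + cst 0 x).
  exact: (L2P a Lf L2_cst0).
by apply/funext => x /=; rewrite addr0.
Qed.

Lemma L2D f g : L2 f -> L2 g -> L2 (fun x => f x + g x).
Proof.
move=> Lf Lg; rewrite (_ : (fun _ => _) = fun x => 1 * f x + g x); first exact: L2P.
by apply/funext => x /=; rewrite mul1r.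
Qed.

Lemma L2B f g : L2 f -> L2 g -> L2 (fun x => f x - g x).
Proof.
move=> Lf Lg; rewrite (_ : (fun _ => _) = fun x => -1 * g x + f x); first exact: L2P.
by apply/funext => x /=; rewrite mulN1r addrC.
Qed.

Lemma L2_sum (I : Type) (r : seq I) (P : pred I) (F : I -> T -> R) :
  (forall i, P i -> L2 (F i)) -> L2 (fun x => \sum_(i <- r | P i) F i x).
Proof.
move=> H; elim: r => [|i r IH].
  rewrite (_ : (fun _ => _) = cst 0); first exact: L2_cst0.
  by apply/funext => x; rewrite big_nil.
case: (boolP (P i)) => Pi.
  rewrite (_ : (fun _ => _) = fun x => F i x + \sum_(j <- r | P j) F j x).
    exact: L2D (H _ Pi) IH.
  by apply/funext => x; rewrite big_cons Pi.
rewrite (_ : (fun _ => _) = fun x => \sum_(j <- r | P j) F j x) //.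
by apply/funext => x; rewrite big_cons (negbTE Pi).
Qed.

Lemma L2M_integrable f g : L2 f -> L2 g -> mu.-integrable D (EFin \o (fun x => f x * g x)).
Proof.
move=> [mf if2] [mg ig2].
apply: le_integrable (integrableD mD if2 ig2) => //.
  exact/measurable_EFinP/measurable_funM.
move=> x _ /=; rewrite lee_fin normrM [leRHS]ger0_norm ?addr_ge0 ?sqr_ge0 //.
by rewrite -(real_normK (num_real (f x))) -(real_normK (num_real (g x))); nra.
Qed.

Lemma L2_le f g : measurable_fun D f -> (forall x, D x -> `|f x| <= `|g x|) -> L2 g -> L2 f.
Proof.
move=> mf fg [mg ig]; split => //; apply: le_integrable ig => //.
  exact/measurable_EFinP/measurable_funX.
by move=> x Dx /=; rewrite lee_fin !normrX ler_pXn2r ?nnegrE ?fg.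
Qed.

Lemma L2M_bounded f g (M : R) : L2 f -> measurable_fun D g -> (forall x, D x -> `|g x| <= M) ->
  L2 (fun x => g x * f x).
Proof.
move=> Lf mg gM; apply: (L2_le (g := fun x => M * f x)) (L2Z M Lf).
  by apply: measurable_funM => //; exact: L2_measurable.
move=> x Dx; rewrite !normrM ler_wpM2r //.
exact: le_trans (gM x Dx) (ler_norm _).
Qed.

Lemma L2_integrable_sqr f : L2 f -> mu.-integrable D (EFin \o (fun x => f x ^+ 2)).
Proof. by case. Qed.

Hypothesis muD : (mu D < +oo)%E.

Lemma L2_cst c : L2 (cst c).
Proof.
split; first exact: measurable_cst.
apply/integrableP; split; first exact: (measurable_cst (c ^+ 2)%:E).
rewrite (eq_integral (fun=> (c ^+ 2)%:E)); last first.
  by move=> x _ /=; rewrite ger0_norm ?sqr_ge0.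
by rewrite integral_cst // lte_mul_pinfty // lee_fin sqr_ge0.
Qed.

Lemma L2_bounded f (M : R) : measurable_fun D f -> (forall x, D x -> `|f x| <= M) -> L2 f.
Proof.
move=> mf fM; apply: L2_le (L2_cst M) => // x Dx /=.
exact: le_trans (fM x Dx) (ler_norm _).
Qed.

Lemma L2_integrable f : L2 f -> mu.-integrable D (EFin \o f).
Proof.
move=> Lf; apply: eq_integrable (L2M_integrable Lf (L2_cst 1)) => // x _ /=.
by rewrite mulr1.
Qed.

Lemma cvgn_sqr (u : nat -> R) (l : R) : u n @[n --> \oo] --> l -> u n ^+ 2 @[n --> \oo] --> l ^+ 2.
Proof. by move=> ul; under eq_fun do rewrite expr2; rewrite expr2; exact: cvgM. Qed.

Lemma limn_einf_le_cst (u : (\bar R)^nat) c : (forall n, u n <= c)%E -> (limn_einf u <= c)%E.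
Proof.
move=> uc; rewrite limn_einf_lim; apply: lime_le; first exact: is_cvg_einfs.
by apply: nearW => n; apply: le_trans (uc n); apply: ereal_inf_lbound; exists n => /=.
Qed.

(** Riesz-Fischer: along a subsequence whose increments have squared norm at most 4 ^ - k the
    increments are summable in L^1, hence almost everywhere, and Fatou bounds the distance to the
    pointwise limit. The finite measure of [D] lets L^2 bounds control L^1 norms. *)
Lemma L2_complete (f : nat -> T -> R) : (forall n, L2 (f n)) ->
  (forall e : R, 0 < e -> exists K : nat, forall n m, (K <= n)%N -> (K <= m)%N ->
     \int[mu]_(x in D) ((f n x - f m x) ^+ 2) <= e) ->
  exists2 g, L2 g & forall e : R, 0 < e -> exists K : nat, forall n, (K <= n)%N ->
     \int[mu]_(x in D) ((f n x - g x) ^+ 2) <= e.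
Proof.
move=> Lf Cf.
have e_gt0 k : 0 < (4^-1 : R) ^+ k by rewrite exprn_gt0 // invr_gt0.
have /choice[p0 p0P] k := Cf _ (e_gt0 k).
(* Partial sums of the thresholds [p0] give a nondecreasing index sequence with [p0 k <= p k]. *)
pose p k := (\sum_(i < k.+1) p0 i)%N.
have pS k : (p k <= p k.+1)%N by rewrite /p [X in (_ <= X)%N]big_ord_recr leq_addr.
have p_homo : {homo p : m n / (m <= n)%N} by apply: homo_leq => //; exact: leq_trans.
have p0p k : (p0 k <= p k)%N by rewrite /p big_ord_recr leq_addl.
pose h k := f (p k).
have Lh k : L2 (h k) := Lf _.
have mh k : measurable_fun D (h k) by exact: L2_measurable.
pose u k x := h k.+1 x - h k x.
have Lu k : L2 (u k) by exact: L2B.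
pose M := 1 + fine (mu D).
have M_ge0 : 0 <= M by rewrite addr_ge0 // fine_ge0.
(* From |u| <= 2 ^ k u ^ 2 + 2 ^ - k and the bound 4 ^ - k on the integral of u ^ 2, the total is (1
   + mu D) 2 ^ - k. *)
have int_u k : (\int[mu]_(x in D) `|u k x|%:E <= (M / 2 ^+ k)%:E)%E.
  have /fineK <- : (\int[mu]_(x in D) `|u k x|%:E)%E \is a fin_num.
    apply: integrable_fin_num => //; apply: (integrable_norm (f := u k)).
    exact: L2_integrable.
  rewrite lee_fin.
  have H1 : mu.-integrable D (EFin \o (fun x => 2 ^+ k * u k x ^+ 2)).
    by have := integrableZl mD (2 ^+ k) (L2_integrable_sqr (Lu k)).
  have H2 : mu.-integrable D (EFin \o (cst (2^-1 ^+ k))).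
    by apply: L2_integrable; exact: L2_cst.
  apply: (@le_trans _ _ (\int[mu]_(x in D) (2 ^+ k * u k x ^+ 2 + cst (2^-1 ^+ k) x))).
    apply: le_Rintegral => //.
    - exact: (integrable_norm (L2_integrable (Lu k))).
    - exact: (integrableD mD H1 H2).
    move=> x Dx /=; rewrite exprVn.
    have a0 : 0 < (2 : R) ^+ k by rewrite exprn_gt0.
    rewrite -(real_normK (num_real (u k x))).
    set a := 2 ^+ k in a0 *; set y := `|u k x|.
    have y0 : 0 <= y by exact: normr_ge0.
    have : 0 <= (a * y - 1) ^+ 2 / a by rewrite divr_ge0 ?sqr_ge0 // ltW.
    rewrite (_ : _ / a = a * y ^+ 2 + a^-1 - 2 * y); last by field; rewrite gt_eqF.
    by lra.
  rewrite RintegralD // RintegralZl //; last exact: L2_integrable_sqr.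
  rewrite Rintegral_cst //.
  have := p0P k (p k.+1) (p k) (leq_trans (p0p k) (pS k)) (p0p k).
  move=> /(ler_wpM2l (exprn_ge0 k (ler0n R 2))) H.
  have E : 2 ^+ k * 4^-1 ^+ k = 2^-1 ^+ k :> R.
    by rewrite -exprMn; congr (_ ^+ _); field.
  rewrite E in H; apply: le_trans (lerD H (lexx _)) _.
  by rewrite /M mulrDl mul1r exprVn mulrC.
have sum_u : (\int[mu]_(x in D) \sum_(0 <= k <oo) `|u k x|%:E < +oo)%E.
  rewrite integral_nneseries //; last first.
    move=> n; apply/measurable_EFinP/measurableT_comp => //; exact: L2_measurable.
  apply: (@le_lt_trans _ _ (\sum_(0 <= k <oo) (M / 2 ^+ k)%:E)%E).
    by apply: lee_nneseries => // n _ _; rewrite ?int_u // integral_ge0.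
  have := @cvg_geometric_eseries_half R (2 * M) 0.
  move=> /cvg_lim H; have {}H := H (@ereal_hausdorff R).
  rewrite (_ : (fun _ => _) = eseries (fun k : nat => (2 * M / (2 ^ (k + 1))%:R)%:E)).
    by rewrite H ltry.
  apply/funext => n; apply: eq_bigr => k _; congr EFin.
  rewrite addn1 expnS natrM natrX; field.
  by rewrite expf_neq0.
pose G x := (\sum_(0 <= k <oo) `|u k x|%:E)%E.
have G0 x : (0 <= G x)%E by apply: nneseries_ge0.
have mG : measurable_fun D G.
  apply: ge0_emeasurable_sum => // k _.
  by apply/measurable_EFinP/measurableT_comp => //; exact: L2_measurable.
have iG : mu.-integrable D G.
  apply/integrableP; split => //.
  by under eq_integral do rewrite gee0_abs //.
have [N [mN N0 GN]] := integrable_ae mD iG.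
have h_cvg x : D x -> ~ N x -> cvgn (h ^~ x).
  move=> Dx Nx; have Gx : G x \is a fin_num.
    by apply: contrapT => ?; apply: Nx; apply: GN => /= /(_ Dx).
  suff : cvgn (series (u ^~ x)).
    move=> H; rewrite (_ : h ^~ x = fun n => h 0%N x + series (u ^~ x) n).
      by apply: is_cvgD => //; exact: is_cvg_cst.
    apply/funext; elim => [|n IH]; first by rewrite /series /= big_geq // addr0.
    by rewrite /series /= big_nat_recr //= addrA -[X in _ = X + _]IH /u addrC subrK.
  apply: normed_cvg; apply: nondecreasing_is_cvgn.
    apply: (@homo_leq _ _ (fun a b => a <= b)) => [//|? ? ?|n]; first exact: le_trans.
    have : \sum_(0 <= k < n) `|u k x| <= \sum_(0 <= k < n.+1) `|u k x|.
      by rewrite big_nat_recr //= lerDl.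
    exact.
  exists (fine (G x)) => _ [n _ <-]; rewrite -lee_fin fineK // /series /= -sumEFin.
  exact: nneseries_lim_ge.
(* Setting the sequence to 0 on the null set [N] makes it converge at every point of [D], so that
   the limit is measurable. *)
pose h' k x := \1_(~` N) x * h k x.
pose g x := limn (h' ^~ x).
have h'_cvg x : D x -> h' ^~ x @ \oo --> g x.
  move=> Dx; rewrite /g /h' indicE; case: (boolP (x \in ~` N)) => [|_].
    rewrite inE => Nx; under eq_fun do rewrite mul1r.
    exact: h_cvg.
  by under eq_fun do rewrite mul0r; rewrite lim_cst //; exact: cvg_cst.
have mh' k : measurable_fun D (h' k).
  apply: measurable_funM => //; apply: measurable_indic; exact: measurableC.
have mg : measurable_fun D g by exact: measurable_fun_cvg h'_cvg.
have int_h' n k : (\int[mu]_(x in D) ((h' k x - f n x) ^+ 2)%:E =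
    \int[mu]_(x in D) ((h k x - f n x) ^+ 2)%:E)%E.
  by apply: (integral_eq_off mN N0) => x Dx Nx; rewrite /h' indicE mem_set // mul1r.
have key k0 n : (p0 k0 <= n)%N ->
    (\int[mu]_(x in D) ((g x - f n x) ^+ 2)%:E <= (4^-1 ^+ k0)%:E)%E.
  move=> k0n.
  have mhn k : measurable_fun D (fun x => ((h' (k + k0)%N x - f n x) ^+ 2)%:E).
    apply/measurable_EFinP/measurable_funX/measurable_funB => //; exact: L2_measurable.
  have h0 k x : D x -> (0 <= ((h' (k + k0)%N x - f n x) ^+ 2)%:E)%E.
    by move=> _; rewrite lee_fin sqr_ge0.
  have := fatou mu mD mhn h0.
  rewrite (eq_integral (fun x => ((g x - f n x) ^+ 2)%:E)); last first.
    move=> x; rewrite inE => Dx; apply: (cvg_limn_einf_sup _).1.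
    apply: cvg_EFin; first by near=> k.
    apply: (@cvgn_sqr (fun k => h' (k + k0)%N x - f n x)).
    apply: cvgB; last exact: cvg_cst.
    by have := h'_cvg x Dx; rewrite -(cvg_shiftn k0).
  move=> /le_trans; apply; apply: limn_einf_le_cst => k.
  rewrite int_h'; have pk : (p0 k0 <= p (k + k0))%N.
    by apply: leq_trans (p0p k0) _; rewrite p_homo ?leq_addl.
  have := p0P k0 (p (k + k0)%N) n pk k0n.
  rewrite -lee_fin; apply: le_trans; rewrite fineK //; apply: integrable_fin_num => //.
  exact: L2_integrable_sqr (L2B _ _).
have Lgn k0 n : (p0 k0 <= n)%N -> L2 (fun x => g x - f n x).
  move=> k0n; have mgn : measurable_fun D (fun x => g x - f n x).
    by apply: measurable_funB => //; exact: L2_measurable.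
  split => //; apply/integrableP; split; first exact/measurable_EFinP/measurable_funX.
  under eq_integral do rewrite gee0_abs ?lee_fin ?sqr_ge0 //.
  exact: le_lt_trans (key _ _ k0n) (ltry _).
have Lg : L2 g.
  have := L2D (Lgn 0%N _ (leqnn _)) (Lf (p0 0%N)); congr L2.
  by apply/funext => x; rewrite subrK.
exists g => // e e0.
have [k0 k0e] : exists k0, 4^-1 ^+ k0 <= e.
  have := @cvg_geometric R 1 4^-1 ltac:(by rewrite ger0_norm ?invr_ge0 // invf_lt1 // ltr1n).
  move=> /cvgr0_norm_le /(_ e e0) [k0 _ H]; exists k0.
  by have := H k0 (leqnn _); rewrite /geometric /= mul1r ger0_norm // ltW.
exists (p0 k0) => n k0n; apply: le_trans k0e.
under eq_Rintegral do rewrite -sqrrN opprB.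
rewrite -lee_fin fineK; first exact: key.
by apply: integrable_fin_num => //; exact: (L2_integrable_sqr (Lgn _ _ k0n)).
Unshelve. all: by end_near. Qed.

Lemma Rintegral_dct (f : nat -> T -> R) (g h : T -> R) :
  (forall n, measurable_fun D (f n)) -> mu.-integrable D (EFin \o h) ->
  (forall n x, D x -> `|f n x| <= h x) ->
  (forall x, D x -> f n x @[n --> \oo] --> g x) ->
  \int[mu]_(x in D) f n x @[n --> \oo] --> \int[mu]_(x in D) g x.
Proof.
move=> mf ih fh fg; have mg : measurable_fun D g by exact: measurable_fun_cvg fg.
have [] := @dominated_convergence _ _ _ mu D mD (fun n => EFin \o f n) (EFin \o g) (EFin \o h).
- by move=> n; exact/measurable_EFinP.
- exact/measurable_EFinP.
- by apply: aeW => x Dx; apply: cvg_EFin; [near=> n|exact: fg].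
- exact: ih.
- by apply: aeW => x n Dx; rewrite lee_fin fh.
by move=> ig _; rewrite -(fineK (integrable_fin_num mD ig)) => /fine_cvg.
Unshelve. all: by end_near. Qed.

(** Closure under limits already makes [Q] insensitive to values outside [D]. The usual ladder then
    applies: indicators, simple functions, nonnegative functions by dominated convergence, and
    positive minus negative part. *)
Lemma L2_ind (Q : (T -> R) -> Prop) :
  (forall A, measurable A -> A `<=` D -> Q \1_A) ->
  (forall a f g, L2 f -> L2 g -> Q f -> Q g -> Q (fun x => a * f x + g x)) ->
  (forall f, L2 f -> (forall e : R, 0 < e ->
      exists g, [/\ L2 g, Q g & \int[mu]_(x in D) ((f x - g x) ^+ 2) <= e]) -> Q f) ->
  forall f, L2 f -> Q f.
Proof.
Import HBSimple.
move=> Q1 Qlin Qlim f Lf.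
have Lind (A : set T) : measurable A -> L2 \1_A.
  move=> mA; apply: (@L2_bounded _ 1) => [|x _]; first exact: measurable_indic.
  by rewrite indicE; case: (_ \in _); rewrite ?normr1 ?normr0.
have Q0 : Q (cst 0).
  have := Q1 set0 measurable0 (@sub0set _ _); congr Q.
  by apply/funext => x; rewrite indic0.
have Qext (u v : T -> R) : L2 u -> L2 v -> (forall x, D x -> u x = v x) -> Q u -> Q v.
  move=> Lu Lv uv Qu; apply: Qlim => // e e0; exists u; split => //.
  rewrite (@eq_Rintegral _ _ _ mu D (cst 0)) ?Rintegral_cst ?mul0r ?ltW //.
  by move=> x /set_mem Dx; rewrite uv // subrr expr0n.
have Qs (h : {sfun T >-> R}) : Q h.
  have Lh : L2 h.
    have [M hM] : exists M : R, forall x, `|h x| <= M.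
      exists (\sum_(y \in range h) `|y|) => x.
      have hx : range h (h x) by exists x.
      rewrite (@fsbigD1 _ _ _ _ (h x) (range h) (fun y => `|y|) (@fimfunP _ _ h) hx) /=.
      by rewrite lerDl; apply: fsumr_ge0.
    apply: (@L2_bounded (h : T -> R) M) => [|x _]; last exact: hM.
    apply: measurable_funTS; exact: measurable_funPT.
  have E x : h x = \sum_(y <- finmap.enum_fset (fset_set (range h))) y * \1_(h @^-1` [set y]) x.
    by rewrite fimfunE fsbig_finite.
  pose r := finmap.enum_fset (fset_set (range h)).
  suff H : L2 (fun x => \sum_(y <- r) y * \1_(h @^-1` [set y] `&` D) x) /\
      Q (fun x => \sum_(y <- r) y * \1_(h @^-1` [set y] `&` D) x).
    apply: Qext H.2 => //; first exact: H.1.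
    move=> x Dx; rewrite [RHS]E; apply: eq_bigr => y _; rewrite !indicE in_setI.
    by rewrite (mem_set Dx) andbT.
  elim: r => [|y r [LH QH]].
    by rewrite (_ : (fun _ => _) = cst 0) // ?funeqE => [|x]; [split => //; exact: L2_cst0|rewrite big_nil].
  rewrite (_ : (fun _ => _) = fun x => y * \1_(h @^-1` [set y] `&` D) x +
      \sum_(y <- r) y * \1_(h @^-1` [set y] `&` D) x); last first.
    by apply/funext => x; rewrite big_cons.
  have mI : measurable (h @^-1` [set y] `&` D) by exact: measurableI.
  split; first by apply: L2P => //; exact: Lind.
  by apply: Qlin => //; [exact: Lind|apply: Q1 => // x []].
have Qnn u : L2 u -> (forall x, D x -> 0 <= u x) -> Q u.
  move=> Lu u0; apply: Qlim => // e e0.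
  have [|g [g_nd g_cvg]] := @approximation _ _ _ D mD (EFin \o u) _ u0.
    exact/measurable_EFinP/L2_measurable.
  have g_cvg' x : D x -> g n x @[n --> \oo] --> u x.
    by move=> Dx; have /fine_cvg := g_cvg x Dx.
  have gu n x : D x -> 0 <= g n x <= u x.
    move=> Dx; apply/andP; split; first exact: fun_ge0.
    rewrite -(cvg_lim _ (g_cvg' x Dx)) //; apply: (@nondecreasing_cvgn_le _ (fun n => g n x)).
      by move=> a b ab; move/lefP : (g_nd _ _ ab); exact.
    by apply/cvg_ex; exists (u x); exact: g_cvg'.
  have Lg n : L2 (g n).
    apply: L2_le (Lu) => [|x Dx]; first by apply: measurable_funTS; exact: measurable_funPT.
    have /andP[? ?] := gu n x Dx.
    by rewrite !ger0_norm // u0.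
  have : \int[mu]_(x in D) ((u x - g n x) ^+ 2) @[n --> \oo] --> \int[mu]_(x in D) cst 0 x.
    apply: (@Rintegral_dct _ _ (fun x => u x ^+ 2)).
    - by move=> n; apply/measurable_funX/measurable_funB => //; exact: L2_measurable.
    - exact: L2_integrable_sqr.
    - move=> n x Dx; have /andP[? ?] := gu n x Dx.
      by rewrite normrX ler_pXn2r ?nnegrE ?u0 // ger0_norm ?subr_ge0 // gerBl.
    - move=> x Dx; have -> : cst 0 x = (u x - u x) ^+ 2 by rewrite subrr expr0n.
      apply: cvgn_sqr.
      by apply: cvgB; [exact: cvg_cst|exact: g_cvg'].
  rewrite Rintegral_cst // mul0r => /cvgr0_norm_le /(_ e e0) [n _ /(_ n (leqnn n)) /= H].
  by exists (g n); split => //; apply: le_trans H; exact: ler_norm.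
have Lpos : L2 (fun x => Num.max (f x) 0).
  apply: L2_le (Lf) => [|x Dx]; first by apply: measurable_maxr => //; exact: L2_measurable.
  by case: (ltrP (f x) 0) => fx; rewrite ?normr0.
have Lneg : L2 (fun x => Num.max (- f x) 0).
  apply: L2_le (Lf) => [|x Dx].
    by apply: measurable_maxr => //; apply: measurable_funN; exact: L2_measurable.
  by case: (ltrP (- f x) 0) => fx; rewrite ?normr0 ?normrN.
rewrite (_ : f = fun x => -1 * Num.max (- f x) 0 + Num.max (f x) 0); last first.
  apply/funext => x; case: (ltrP (f x) 0) => fx.
    by rewrite max_l ?oppr_ge0 ?ltW // mulN1r opprK addr0.
  by rewrite max_r ?oppr_le0 // mulr0 add0r.
by apply: Qlin => //; apply: Qnn => // x _; rewrite le_max lexx orbT.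
Qed.

End L2_theory.

(** * Lebesgue measure on row vectors *)

Section lebesgue_rV_theory.
Context {R : realType}.
Local Notation leb := (@lebesgue_rV R).
Local Notation lam := (@lebesgue_measure R).

Lemma ge0_integral_rV_cons n (f : 'rV[R]_n.+1 -> \bar R) :
  measurable_fun setT f -> (forall x, 0 <= f x)%E ->
  (\int[leb n.+1]_x f x = \int[lam]_a \int[leb n]_x f (rV_cons (a, x)))%E.
Proof.
move=> mf f0.
have E := @ge0_integral_pushforward _ _ _ _ _ _ (@measurable_rV_cons R n)
   (product_measure1 lam (leb n)) setT f measurableT mf (fun x _ => f0 x).
rewrite [LHS]E preimage_setT fubini_tonelli1 // => [|p]; last exact: f0.
exact: measurableT_comp mf (@measurable_rV_cons R _).
Qed.

Lemma ge0_integral_rV_consC n (f : 'rV[R]_n.+1 -> \bar R) :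
  measurable_fun setT f -> (forall x, 0 <= f x)%E ->
  (\int[leb n.+1]_x f x = \int[leb n]_x \int[lam]_a f (rV_cons (a, x)))%E.
Proof.
move=> mf f0.
have E := @ge0_integral_pushforward _ _ _ _ _ _ (@measurable_rV_cons R n)
   (product_measure1 lam (leb n)) setT f measurableT mf (fun x _ => f0 x).
rewrite [LHS]E preimage_setT fubini_tonelli2 // => [|p]; last exact: f0.
exact: measurableT_comp mf (@measurable_rV_cons R _).
Qed.

Lemma rV_cons0 n (p : measurableTypeR R * 'rV[R]_n) : rV_cons p ord0 ord0 = p.1.
Proof. by have := congr1 fst (rV_consK p). Qed.

Lemma rV_consS n (p : measurableTypeR R * 'rV[R]_n) k : rV_cons p ord0 (lift ord0 k) = p.2 ord0 k.
Proof.
rewrite /rV_cons (_ : lift ord0 k = rshift 1 k :> 'I_(1 + n)); last exact/val_inj.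
exact: row_mxEr.
Qed.

Lemma rV_consP n (x y : 'rV[R]_n.+1) : x ord0 ord0 = y ord0 ord0 ->
  (forall k : 'I_n, x ord0 (lift ord0 k) = y ord0 (lift ord0 k)) -> x = y.
Proof.
by move=> xy0 xyS; apply/rowP => k; case: (unliftP ord0 k) => [j|] ->; [exact: xyS|exact: xy0].
Qed.

Lemma rVZDE n (c : R) (x v : 'rV[R]_n) i j : (c *: x + v) i j = c * x i j + v i j.
Proof. by rewrite !mxE. Qed.

Lemma rsubmxE n (z : 'rV[R]_n.+1) (k : 'I_n) : (@rsubmx R 1 1 n z) ord0 k = z ord0 (lift ord0 k).
Proof. by rewrite mxE; congr (z _ _); exact/val_inj. Qed.

Lemma measurable_rV_consr n (a : R) :
  measurable_fun setT (fun x : 'rV[R]_n => rV_cons ((a : measurableTypeR R), x)).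
Proof. exact: (measurableT_comp (@measurable_rV_cons R n) (pair1_measurable (a : measurableTypeR R))). Qed.

Definition pbox n (I : set R) : set 'rV[R]_n := [set x | forall k, I (x ord0 k)].

Arguments pbox : clear implicits.

Lemma measurable_pbox n (I : set (measurableTypeR R)) : measurable I -> measurable (pbox n I).
Proof.
move=> mI; rewrite (_ : pbox n I = \bigcap_(k in [set: 'I_n]) ((fun x : 'rV[R]_n => x ord0 k : measurableTypeR R) @^-1` I)).
  apply: fin_bigcap_measurable => // k _; rewrite -[X in measurable X]setTI.
  exact: (measurable_coord k).
by apply/seteqP; split => x /= H k; [move=> _|]; apply: H.
Qed.

Lemma pbox_cons n (I : set R) (p : measurableTypeR R * 'rV[R]_n) :
  pbox n.+1 I (rV_cons p) <-> I p.1 /\ pbox n I p.2.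
Proof.
split => [H|[H1 H2] k].
  by split => [|k]; [have := H ord0; rewrite rV_cons0|have := H (lift ord0 k); rewrite rV_consS].
by case: (unliftP ord0 k) => [j|] ->; rewrite ?rV_cons0 ?rV_consS.
Qed.

Lemma leb_pbox n (I : set (measurableTypeR R)) (r : R) : measurable I -> lam I = r%:E ->
  leb n (pbox n I) = (r ^+ n)%:E.
Proof.
move=> mI Ir; elim: n => [|n IH].
  rewrite (_ : pbox 0 I = setT); last by apply/seteqP; split => // x _ [].
  by rewrite /= diracT.
rewrite -(setIT (pbox n.+1 I)) -integral_indic //; last exact: measurable_pbox.
have mB : measurable_fun setT (fun x : 'rV[R]_n.+1 => (\1_(pbox n.+1 I) x : R)%:E).
  apply: measurableT_comp => //; apply: measurable_indic; exact: measurable_pbox.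
rewrite ge0_integral_rV_cons //.
rewrite (eq_integral (fun a => (r ^+ n)%:E * (\1_I a)%:E)%E); last first.
    move=> a _; rewrite -IH -[X in (leb n X * _)%E](setIT (pbox n I)).
    rewrite -integral_indic //; last exact: measurable_pbox.
    rewrite muleC -ge0_integralZl //.
    + apply: eq_integral => x _; rewrite -EFinM !indicE; congr EFin.
      rewrite -[LHS]/((_ \in _)%:R : R) -natrM mulnb; congr (nat_of_bool _)%:R.
      apply/idP/idP => [/set_mem/pbox_cons[/= ? ?]|/andP[/set_mem ? /set_mem ?]].
        by apply/andP; split; apply/mem_set.
      by apply/mem_set/pbox_cons.
    + by apply/measurable_EFinP; apply: measurable_indic; exact: measurable_pbox.
have rn0 : (0 <= r ^+ n)%R by rewrite -lee_fin -IH measure_ge0.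
have mI1 : measurable_fun setT (fun x : measurableTypeR R => (\1_I x : R)%:E).
  by apply/measurable_EFinP; exact: measurable_indic.
have I1_ge0 x : [set: measurableTypeR R] x -> (0 <= (\1_I x : R)%:E)%E by rewrite lee_fin.
rewrite ge0_integralZl //.
rewrite integral_indic // setIT; transitivity ((r ^+ n)%:E * r%:E)%E.
  by congr (_ * _)%E; exact: Ir.
by rewrite -EFinM exprSr.
Qed.

(** Cubes with rational centre and radius 1 / (m + 1): a countable base of the topology. It links
    open sets to the sigma-algebra, which is generated by the coordinates. *)
Definition qbox n (p : 'rV[rat]_n * nat) : set 'rV[R]_n :=
  [set x | forall k, `|x ord0 k - ratr (p.1 ord0 k)| < p.2.+1%:R^-1].

Lemma measurable_qbox n (p : 'rV[rat]_n * nat) : measurable (qbox p).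
Proof.
rewrite (_ : qbox p = \bigcap_(k in [set: 'I_n]) ((fun x : 'rV[R]_n => x ord0 k : measurableTypeR R) @^-1`
     `]ratr (p.1 ord0 k) - p.2.+1%:R^-1, ratr (p.1 ord0 k) + p.2.+1%:R^-1[)).
  apply: fin_bigcap_measurable => // k _; rewrite -[X in measurable X]setTI.
  exact: (measurable_coord k).
apply/seteqP; split => x /= H k => [_|]; have := H k; rewrite ?in_itv /= ltr_distl //.
by move=> /(_ I); rewrite in_itv.
Qed.

Lemma qbox_nbhs n (U : set 'rV[R]_n) x : open U -> U x -> exists2 p : 'rV[rat]_n * nat, qbox p x &
  forall y : 'rV[R]_n, (forall k, `|y ord0 k - ratr (p.1 ord0 k)| <= p.2.+1%:R^-1) -> U y.
Proof.
rewrite openE => oU Ux; have /nbhs_ballP[e /= e0 eU] := oU x Ux.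
have [m me] : exists m : nat, m.+1%:R^-1 < e / 2.
  have /cvgr0_norm_lt /(_ (e / 2)) := @cvg_harmonic R.
  move=> /(_ ltac:(by rewrite divr_gt0)) [m _ /(_ m (leqnn _))] H; exists m.
  by move: H; rewrite /harmonic /= ger0_norm // invr_ge0.
have /choice[q qP] : forall k, exists q : rat, `|x ord0 k - ratr q| < m.+1%:R^-1.
  move=> k; have [q H] := @rat_in_itvoo R (x ord0 k - m.+1%:R^-1) (x ord0 k + m.+1%:R^-1)
    ltac:(by rewrite ltrD2l gtrN // invr_gt0).
  by exists q; rewrite distrC ltr_distl; move: H; rewrite in_itv.
exists (\row_k q k, m) => [k|y By]; first by rewrite /= mxE.
apply: eU; split=> // i k; rewrite (ord1 i) -ball_normE /=.
apply: (@le_lt_trans _ _ (m.+1%:R^-1 *+ 2)); last by rewrite mulr2n [ltRHS]splitr ltrD.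
rewrite (_ : _ - _ = (x ord0 k - ratr (q k)) - (y ord0 k - ratr (q k))); last by ring.
rewrite mulr2n; apply: le_trans (ler_normB _ _) _; apply: lerD; first exact: ltW.
by have := By k; rewrite /= mxE.
Qed.

Lemma open_measurable_rV n (U : set 'rV[R]_n) : open U -> measurable U.
Proof.
move=> oU; rewrite [X in measurable X](_ : _ = \bigcup_p (if pselect (qbox p `<=` U) then qbox p else set0)).
  apply: countable_bigcupT_measurable => [|p]; first exact: countableP.
  by case: (pselect (qbox p `<=` U)) => h /=; [exact: measurable_qbox|exact: measurable0].
apply/seteqP; split => [x Ux|x [p _]]; last by case: pselect => // pU /pU.
have [p px pU] := qbox_nbhs oU Ux; exists p => //; case: pselect => // -[] y py.
by apply: pU => k; exact: ltW.
Qed.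

Lemma continuous_at_measurable n (U : set 'rV[R]_n) (f : 'rV[R]_n -> R) : open U ->
  (forall x, U x -> {for x, continuous f}) -> measurable_fun U f.
Proof.
move=> oU cf.
apply: (measurability _ (RGenOInfty.measurableE R)) => _ [_ [a ->] <-].
apply: open_measurable_rV; rewrite openE => x [Ux fx].
have : nbhs (f x) `]a, +oo[%classic by exact: open_nbhs_nbhs.
move=> /(cf x Ux) H; apply: filterI => //.
by move: oU; rewrite openE => /(_ x Ux).
Qed.

Lemma continuous_rV_measurable n (D : set 'rV[R]_n) (f : 'rV[R]_n -> R) : continuous f ->
  measurable_fun D f.
Proof.
move=> cf; apply: measurable_funTS; apply: continuous_at_measurable; first exact: openT.
by move=> x _; exact: cf.
Qed.

(** Lebesgue measure is determined by its values on half-open intervals, and the preimage of such an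
    interval is again one, its length divided by [c]. *)
Lemma lebesgue_measure_affine (c v : R) (A : set (measurableTypeR R)) : 0 < c -> measurable A ->
  lam A = (c%:E * lam ((fun x : R => (c * x + v)%R) @^-1` A))%E.
Proof.
move=> c0 mA.
pose phi : measurableTypeR R -> measurableTypeR R := fun x => c * x + v.
have mphi : measurable_fun setT phi by apply: measurable_funD => //; exact: measurable_funM.
apply: (@lebesgue_measure_unique R (mscale (NngNum (ltW c0)) (pushforward lam phi))) => //= _ [[a b] _ <-].
rewrite /mscale /= /pushforward /=.
rewrite (_ : phi @^-1` `]a, b]%classic = `](a - v) / c, (b - v) / c]%classic); last first.
  apply/seteqP; split => x; rewrite /= !in_itv /= /phi ltr_pdivrMr // ler_pdivlMr //;
  by rewrite ltrBlDr lerBrDr (mulrC x).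
rewrite !lebesgue_measure_itv /= !lte_fin ltr_pM2r ?invr_gt0 // ltrBlDr subrK.
case: ifP => _; last by rewrite mule0.
by rewrite -!EFinB -EFinM; congr EFin; field; rewrite gt_eqF.
Qed.

Lemma ge0_integral_affine1 (c v : R) (f : R -> \bar R) : 0 < c ->
  measurable_fun setT (f : measurableTypeR R -> \bar R) -> (forall x, 0 <= f x)%E ->
  (\int[lam]_x f x = c%:E * \int[lam]_x f (c * x + v)%R)%E.
Proof.
move=> c0 mf f0.
pose phi : measurableTypeR R -> measurableTypeR R := fun x => c * x + v.
have mphi : measurable_fun setT phi by apply: measurable_funD => //; exact: measurable_funM.
have E A : measurable A -> A `<=` setT ->
    lam A = mscale (NngNum (ltW c0)) (pushforward lam phi) A.
  by move=> mA _; exact: (lebesgue_measure_affine v).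
rewrite (eq_measure_integral _ (E mphi)).
rewrite ge0_integral_mscale //=; congr (_ * _)%E.
by rewrite (ge0_integral_pushforward mphi) //; exact: in1W.
Qed.

Lemma ge0_integral_affine n (c : R) (v : 'rV[R]_n) (f : 'rV[R]_n -> \bar R) : 0 < c ->
  measurable_fun setT f -> (forall x, 0 <= f x)%E ->
  (\int[leb n]_x f x = (c ^+ n)%:E * \int[leb n]_x f (c *: x + v)%R)%E.
Proof.
move=> c0; have affE m (w : 'rV[R]_m.+1) p : c *: rV_cons p + w =
    rV_cons ((c * p.1 + w ord0 ord0)%R : measurableTypeR R, c *: p.2 + @rsubmx R 1 1 m w).
  by apply: rV_consP => [|k]; rewrite ?rV_cons0 ?rV_consS /= !rVZDE ?rV_cons0 ?rV_consS ?rsubmxE.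
elim: n v f => [|n IH] v f mf f0.
  rewrite expr0 mul1e; congr (integral _ _ _); apply/funext => x; congr f.
  by apply/rowP => -[].
have maff : measurable_fun setT (fun x : 'rV[R]_n.+1 => c *: x + v).
  apply: measurable_fun_rV => k; under eq_fun do rewrite rVZDE.
  by apply: measurable_funD => //; apply: measurable_funM => //; exact: measurable_coord.
rewrite ge0_integral_rV_cons // [in RHS]ge0_integral_rV_cons //; last first.
  exact: measurableT_comp mf maff.
transitivity (\int[lam]_a ((c ^+ n)%:E * \int[leb n]_x f (rV_cons (a : measurableTypeR R, (c *: x + @rsubmx R 1 1 n v)%R))))%E.
  apply: eq_integral => a _; apply: IH => //.
  exact: (measurableT_comp mf (@measurable_rV_consr n a)).
have mF : measurable_fun setT (fun a : measurableTypeR R => \int[leb n]_x f (rV_cons (a, (c *: x + @rsubmx R 1 1 n v)%R)))%E.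
  apply: (measurable_fun_fubini_tonelli_F (fun p : measurableTypeR R * 'rV[R]_n => f (rV_cons (p.1, c *: p.2 + @rsubmx R 1 1 n v)))) => //.
  apply: measurableT_comp mf _; apply: measurableT_comp (@measurable_rV_cons R _) _.
  apply/measurable_fun_pairP; split => //=; first exact: measurable_fst.
  apply: measurable_fun_rV => k.
  under eq_fun do rewrite /= rVZDE.
  apply: measurable_funD => //; apply: measurable_funM => //.
  exact: (measurableT_comp (measurable_coord k) measurable_snd).
have F0 a : (0 <= \int[leb n]_x f (rV_cons (a : measurableTypeR R, (c *: x + @rsubmx R 1 1 n v)%R)))%E.
  by apply: integral_ge0.
have cn0 : 0 <= c ^+ n by rewrite exprn_ge0 // ltW.
rewrite (ge0_integralZl_EFin lam measurableT (fun a _ => F0 a) mF cn0).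
rewrite (ge0_integral_affine1 (v ord0 ord0) c0 mF F0) exprSr muleA -EFinM; congr (_ * _)%E.
by apply: eq_integral => a _; apply: eq_integral => x _; rewrite affE.
Qed.

Definition box n (M : R) : set (matrix R 1 n) := pbox n `]- M, M[%classic.

Arguments box : clear implicits.

Lemma bounded_leb_fin n (D : set 'rV[R]_n) : bounded_set D ->
  exists2 M : R, 0 < M & D `<=` box n M.
Proof.
move=> [M [Mr DM]]; exists (`|M| + 2); first by rewrite ltr_wpDl.
move=> x Dx k; rewrite /= in_itv /= -ltr_norml.
apply: (@le_lt_trans _ _ `|x|).
  by rewrite [leRHS]mx_normrE; apply: (le_bigmax _ (fun i => `|x i.1 i.2|) (ord0, k)).
apply: (@le_lt_trans _ _ (`|M| + 1)); last by rewrite ltrD2l ltrDl.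
apply: DM => //; apply: le_lt_trans (ler_norm _) _; by rewrite ltrDl.
Qed.

Lemma lebesgue_measure_ooN (M : R) : 0 < M -> lam `]- M, M[%classic = (2 * M)%:E.
Proof.
move=> M0; rewrite lebesgue_measure_itv /= lte_fin gt0_cp // -EFinB; congr EFin; ring.
Qed.

Lemma measurable_box n M : measurable (box n M).
Proof. exact: measurable_pbox. Qed.

Lemma leb_box_lty n M : 0 < M -> (leb n (box n M) < +oo)%E.
Proof.
by move=> M0; rewrite (@leb_pbox _ _ (2 * M)) ?ltry //; exact: lebesgue_measure_ooN.
Qed.

Lemma leb_bounded_lty n (D : set 'rV[R]_n) : measurable D -> bounded_set D -> (leb n D < +oo)%E.
Proof.
move=> mD /bounded_leb_fin[M M0 DM]; apply: le_lt_trans (leb_box_lty n M0).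
by apply: le_measure; rewrite ?inE //; exact: measurable_box.
Qed.

(** Support in a cube, said coordinate by coordinate so that slices inherit it. The condition is
    closed: [g] already vanishes where a coordinate has absolute value exactly [K]. *)
Definition coord_bounded n (K : R) (g : 'rV[R]_n -> R) :=
  forall x : 'rV[R]_n, (exists i, K <= `|x ord0 i|) -> g x = 0.

Lemma coord_bounded_integrable n (g : 'rV[R]_n -> R) (M K : R) :
  measurable_fun setT g -> (forall x, `|g x| <= M) -> coord_bounded K g ->
  (leb n).-integrable setT (EFin \o g).
Proof.
move=> mg gM gK; pose K' : R := `|K| + 1; have K'0 : 0 < K' by rewrite ltr_wpDl.
have mB : measurable (box n K') by exact: measurable_box.
have -> : g = g \_ (box n K').
  apply/funext => x; rewrite /patch; case: ifPn => //; rewrite notin_setE => /existsNP[i].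
  rewrite /= in_itv /= -ltr_norml => /negP; rewrite -leNgt => K'x.
  rewrite gK //; exists i; apply: le_trans K'x; rewrite /K'.
  by apply: le_trans (ler_norm _) _; rewrite lerDl.
have fB := leb_box_lty n K'0.
rewrite -restrict_EFin -integrable_mkcond //.
apply: L2_integrable => //; apply: (@L2_bounded _ _ _ _ _ mB fB g M) => //.
exact: measurable_funTS.
Qed.

Lemma integrable_rV_cons n (g : 'rV[R]_n.+1 -> R) : (leb n.+1).-integrable setT (EFin \o g) ->
  (product_measure1 lam (leb n)).-integrable setT ((EFin \o g) \o @rV_cons R n).
Proof.
move=> /integrableP[mg ig]; apply/integrableP; split.
  exact: (measurableT_comp mg (@measurable_rV_cons R n)).
have mag : measurable_fun setT (fun x => `|(EFin \o g) x|)%E by exact: measurableT_comp.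
have E := @ge0_integral_pushforward _ _ _ _ _ _ (@measurable_rV_cons R n)
   (product_measure1 lam (leb n)) setT _ measurableT mag (fun x _ => abse_ge0 _).
by move: ig; rewrite [X in (X < _)%E]E preimage_setT.
Qed.

Lemma integral_rV_cons0 n (g : 'rV[R]_n.+1 -> R) : (leb n.+1).-integrable setT (EFin \o g) ->
  (forall a, \int[leb n]_x (g (rV_cons (a : measurableTypeR R, x)))%:E = 0)%E ->
  (\int[leb n.+1]_x (g x)%:E = 0)%E.
Proof.
move=> ig g0; have mg := measurable_int _ ig.
have ig' := integrable_rV_cons ig.
have E := @integral_pushforward _ _ _ _ _ _ (@measurable_rV_cons R n)
   (product_measure1 lam (leb n)) setT _ mg ig' measurableT.
rewrite [LHS]E preimage_setT -integral12_prod_meas1 //.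
by apply: integral0_eq => a _; exact: g0.
Qed.

Lemma integral_rV_consC0 n (g : 'rV[R]_n.+1 -> R) : (leb n.+1).-integrable setT (EFin \o g) ->
  (forall x, \int[lam]_a (g (rV_cons (a, x)))%:E = 0)%E ->
  (\int[leb n.+1]_x (g x)%:E = 0)%E.
Proof.
move=> ig g0; have mg := measurable_int _ ig.
have ig' := integrable_rV_cons ig.
have E := @integral_pushforward _ _ _ _ _ _ (@measurable_rV_cons R n)
   (product_measure1 lam (leb n)) setT _ mg ig' measurableT.
rewrite [LHS]E preimage_setT -integral21_prod_meas1 //.
by apply: integral0_eq => a _; exact: g0.
Qed.

Definition upd n (x : 'rV[R]_n) (k : 'I_n) (s : R) : 'rV[R]_n :=
  \row_i (if i == k then s else x ord0 i).

(** Induction on the dimension by Fubini. If [k] is the first coordinate it is integrated innermost;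
    otherwise the first coordinate is fixed and the claim is applied to the slice. *)
Lemma integral_slice0 n (k : 'I_n) (g : 'rV[R]_n -> R) (M K : R) :
  measurable_fun setT g -> (forall x, `|g x| <= M) -> coord_bounded K g ->
  (forall x, \int[lam]_s (g (upd x k s))%:E = 0)%E ->
  (\int[leb n]_x (g x)%:E = 0)%E.
Proof.
elim: n k g => [[]//|n IH] k g mg gM gK g0.
have ig := coord_bounded_integrable mg gM gK.
case: (unliftP ord0 k) => [j|] kE; subst k.
  apply: integral_rV_cons0 => // a; apply: (IH j).
  - exact: (measurableT_comp mg (@measurable_rV_consr n a)).
  - by move=> x; exact: gM.
  - by move=> x [i Kx]; apply: gK; exists (lift ord0 i); rewrite rV_consS.
  move=> x; rewrite -[RHS](g0 (rV_cons (a : measurableTypeR R, x))).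
  apply: eq_integral => s _; congr (EFin (g _)); apply: rV_consP => [|i].
    by rewrite rV_cons0 [RHS]mxE /= rV_cons0.
  by rewrite rV_consS [LHS]mxE [RHS]mxE (inj_eq lift_inj) rV_consS.
apply: integral_rV_consC0 => // x.
rewrite -[RHS](g0 (rV_cons ((0 : R) : measurableTypeR R, x))).
apply: eq_integral => s _; congr (EFin (g _)); apply: rV_consP => [|i].
  by rewrite rV_cons0 [RHS]mxE eqxx.
by rewrite rV_consS [RHS]mxE /= rV_consS.
Qed.

End lebesgue_rV_theory.

(** * Smooth functions and integration by parts *)

Section smooth_calculus.
Context {R : realType} {n : nat}.
Local Notation T := 'rV[R]_n.
Implicit Types (f g : T -> R) (i k : 'I_n) (x : T).

Local Notation e_ i := (delta_mx ord0 i : T).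

Lemma diff_pderivable f i x : differentiable f x -> derivable f x (e_ i).
Proof. exact: diff_derivable. Qed.

Lemma pderivD f g i : (forall x, differentiable f x) -> (forall x, differentiable g x) ->
  pderiv i (fun x => f x + g x) = fun x => pderiv i f x + pderiv i g x.
Proof.
move=> df dg; apply/funext => x; rewrite /pderiv.
exact: (deriveD (diff_pderivable (df x)) (diff_pderivable (dg x))).
Qed.

Lemma pderivM f g i : (forall x, differentiable f x) -> (forall x, differentiable g x) ->
  pderiv i (fun x => f x * g x) = fun x => pderiv i f x * g x + f x * pderiv i g x.
Proof.
move=> df dg; apply/funext => x; rewrite /pderiv.
rewrite [LHS](deriveM (diff_pderivable (df x)) (diff_pderivable (dg x))).
by rewrite addrC [X in X + _]mulrC.
Qed.

Lemma pderiv_cst (c : R) i : pderiv i (fun _ : T => c) = fun=> 0.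
Proof. by apply/funext => x; rewrite /pderiv derive_cst. Qed.

Lemma pderivZ c f i : (forall x, differentiable f x) ->
  pderiv i (fun x => c * f x) = fun x => c * pderiv i f x.
Proof.
move=> df; rewrite pderivM //; apply/funext => x.
by rewrite pderiv_cst mul0r add0r.
Qed.

Lemma pderiv_near f g i x : (\near x, f x = g x) -> pderiv i f x = pderiv i g x.
Proof. exact: near_eq_derive. Qed.

(** The partial derivatives of order at most [m] are differentiable. [smooth] is defined through
    words in the coordinates; its closure properties are proved by recursion on [m] in this form. *)
Fixpoint Ck (m : nat) f : Prop := (forall x, differentiable f x) /\
  if m is m'.+1 then forall i, Ck m' (pderiv i f) else True.

Lemma Ck_diff m f : Ck m f -> forall x, differentiable f x.
Proof. by case: m => [|m] []. Qed.

Lemma smooth_pderiv f i : smooth f -> smooth (pderiv i f).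
Proof. by move=> sf s x; have := sf (rcons s i) x; rewrite foldr_rcons. Qed.

Lemma smooth_diff f x : smooth f -> differentiable f x.
Proof. by move=> /(_ [::] x). Qed.

Lemma smoothE f : smooth f <-> forall m, Ck m f.
Proof.
split => [sf m|H s].
  elim: m f sf => [|m IH] f sf; split => //; try by move=> x; exact: smooth_diff.
  by move=> i; apply: IH; exact: smooth_pderiv.
have {H} := H (size s); elim/last_ind: s f => [|s i IH] f; first by case.
by rewrite size_rcons foldr_rcons => -[_] /(_ i) /IH.
Qed.

Lemma Ck_weak m f : Ck m.+1 f -> Ck m f.
Proof.
elim: m f => [|m IH] f [df Hf]; split => // i.
by apply: IH; exact: Hf.
Qed.

Lemma CkD m f g : Ck m f -> Ck m g -> Ck m (fun x => f x + g x).
Proof.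
elim: m f g => [|m IH] f g [df Hf] [dg Hg]; split => //; try by move=> x; exact: differentiableD.
by move=> i; rewrite pderivD //; apply: IH; [exact: Hf|exact: Hg].
Qed.

Lemma CkM m f g : Ck m f -> Ck m g -> Ck m (fun x => f x * g x).
Proof.
elim: m f g => [|m IH] f g Cf Cg.
  by split => // x; apply: differentiableM; [exact: (Ck_diff Cf)|exact: (Ck_diff Cg)].
split; first by move=> x; apply: differentiableM; [exact: (Ck_diff Cf)|exact: (Ck_diff Cg)].
case: (Cf) => df Hf; case: (Cg) => dg Hg i; rewrite pderivM //.
by apply: CkD; apply: IH; [exact: Hf|exact: Ck_weak|exact: Ck_weak|exact: Hg].
Qed.

Lemma Ck_cst m c : Ck m (fun=> c).
Proof.
elim: m c => [|m IH] c; split => //; try by move=> x; exact: differentiable_cst.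
by move=> i; rewrite pderiv_cst; exact: IH.
Qed.

Lemma CkZ m c f : Ck m f -> Ck m (fun x => c * f x).
Proof. by move=> Cf; apply: CkM => //; exact: Ck_cst. Qed.

Lemma smooth_cst c : smooth (fun _ : T => c).
Proof. by apply/smoothE => m; exact: Ck_cst. Qed.

Lemma smoothD f g : smooth f -> smooth g -> smooth (fun x => f x + g x).
Proof. by move=> /smoothE Cf /smoothE Cg; apply/smoothE => m; exact: CkD. Qed.

Lemma smoothM f g : smooth f -> smooth g -> smooth (fun x => f x * g x).
Proof. by move=> /smoothE Cf /smoothE Cg; apply/smoothE => m; exact: CkM. Qed.

Lemma smoothZ c f : smooth f -> smooth (fun x => c * f x).
Proof. by move=> sf; apply: smoothM => //; exact: smooth_cst. Qed.

Lemma smooth_sum (I : Type) (r : seq I) (P : pred I) (F : I -> T -> R) :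
  (forall j, P j -> smooth (F j)) -> smooth (fun x => \sum_(j <- r | P j) F j x).
Proof.
move=> sF; elim: r => [|i r IH].
  by under eq_fun do rewrite big_nil; exact: smooth_cst.
case: (boolP (P i)) => Pi.
  under eq_fun do rewrite big_cons Pi.
  by apply: smoothD => //; exact: sF.
by under eq_fun do rewrite big_cons (negbTE Pi); exact: IH.
Qed.

Lemma pderiv_sum (I : Type) (r : seq I) (P : pred I) (F : I -> T -> R) k :
  (forall j x, P j -> differentiable (F j) x) ->
  pderiv k (fun x => \sum_(j <- r | P j) F j x) = fun x => \sum_(j <- r | P j) pderiv k (F j) x.
Proof.
move=> dF; suff [] : (forall x, differentiable (fun x => \sum_(j <- r | P j) F j x) x) /\
  pderiv k (fun x => \sum_(j <- r | P j) F j x) = fun x => \sum_(j <- r | P j) pderiv k (F j) x by [].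
elim: r => [|i r [IH1 IH2]].
  split => [x|]; under eq_fun do rewrite big_nil; first exact: differentiable_cst.
  by rewrite pderiv_cst; under [RHS]eq_fun do rewrite big_nil.
case: (boolP (P i)) => Pi.
  have E : (fun x => \sum_(j <- i :: r | P j) F j x) = fun x => F i x + \sum_(j <- r | P j) F j x.
    by apply/funext => x; rewrite big_cons Pi.
  rewrite E; split => [x|]; first by apply: differentiableD => //; exact: dF.
  rewrite pderivD //; last by move=> x; exact: dF.
  by rewrite IH2; apply/funext => x; rewrite big_cons Pi.
have E : (fun x => \sum_(j <- i :: r | P j) F j x) = fun x => \sum_(j <- r | P j) F j x.
  by apply/funext => x; rewrite big_cons (negbTE Pi).
by rewrite E IH2; split => //; apply/funext => x; rewrite big_cons (negbTE Pi).
Qed.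

Lemma differentiable_affine (c : R) (v x : T) : differentiable (fun y : T => c *: y + v) x.
Proof. by apply: differentiableD => //; apply: differentiableZ. Qed.

Arguments Ck : simpl never.

Lemma pderiv_affine f (c : R) (v : T) i : (forall x, differentiable f x) ->
  pderiv i (fun x => f (c *: x + v)) = fun x => c * pderiv i f (c *: x + v).
Proof.
move=> df; apply/funext => x; rewrite /pderiv.
have da := @differentiable_affine c v x.
rewrite (deriveE _ (differentiable_comp da (df _))) diff_comp //=.
have Da : is_derive x (e_ i) (fun y : T => c *: y + v) (c *: e_ i + 0).
  exact: is_deriveD.
by rewrite -(deriveE _ da) derive_val addr0 linearZ /= deriveE.
Qed.

Lemma smooth_affine f (c : R) (v : T) : smooth f -> smooth (fun x => f (c *: x + v)).
Proof.
move=> /smoothE Cf; apply/smoothE => m; have {Cf} := Cf m.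
have dc g x : differentiable g (c *: x + v) -> differentiable (fun y => g (c *: y + v)) x.
  by move=> dg; apply: differentiable_comp => //; exact: differentiable_affine.
elim: m f => [|m IH] f [df Hf]; split => //; try by move=> x; exact: dc.
by move=> i; rewrite pderiv_affine //; apply: CkZ; apply: IH; exact: Hf.
Qed.

Lemma pderiv_comp1 (h : R -> R) g i x : derivable h (g x) 1 -> differentiable g x ->
  pderiv i (h \o g) x = 'D_1 h (g x) * pderiv i g x.
Proof.
move=> /derivable1_diffP dh dg; rewrite /pderiv.
rewrite (deriveE _ (differentiable_comp dg dh)) diff_comp //= -(deriveE _ dg).
by rewrite diff1E //= derive1E mulrC.
Qed.

Lemma pderiv_coord (c v : R) k i : pderiv i (fun x : T => c * x ord0 k + v) = fun=> c * (i == k)%:R.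
Proof.
have dk x : differentiable (fun y : T => y ord0 k) x by exact: differentiable_coord.
rewrite (pderivD (g := fun=> v)) //; last by move=> x; exact: differentiableM.
rewrite pderivZ // pderiv_cst; apply/funext => x; rewrite addr0; congr (_ * _).
apply: derive_val; rewrite /pderiv; apply: DeriveDef.
  exact: diff_pderivable.
apply/cvg_lim => //; apply: cvg_near_cst; near=> h.
rewrite /= !mxE eqxx addrK /= eq_sym; rewrite [_ *: _]mulrA mulVf ?mul1r //; near: h; exact: nbhs_dnbhs_neq.
Unshelve. all: by end_near. Qed.

Lemma smooth_coord k : smooth (fun x : T => x ord0 k).
Proof.
apply/smoothE => -[|m]; split => //; try by move=> x; exact: differentiable_coord.
move=> i; have := pderiv_coord 1 0 k i.
under [X in pderiv _ X]eq_fun do rewrite mul1r addr0.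
by move=> ->; exact: Ck_cst.
Qed.

Lemma smooth_continuous f : smooth f -> continuous f.
Proof. by move=> sf x; exact/differentiable_continuous/smooth_diff. Qed.

Lemma pderiv_out (K : set T) f i : closed K -> (forall x, ~ K x -> f x = 0) ->
  forall x, ~ K x -> pderiv i f x = 0.
Proof.
move=> cK f0 x Kx; rewrite (@pderiv_near _ (fun=> 0)) ?pderiv_cst //.
have : open (~` K) by exact: closed_openC.
rewrite openE => /(_ x Kx); apply: filterS => y; exact: f0.
Qed.

Lemma test_function_pderiv (D : set T) f i : test_function D f -> test_function D (pderiv i f).
Proof.
move=> [sf [K cK [KD f0]]]; split; first exact: smooth_pderiv.
exists K => //; split => //; apply: pderiv_out => //.
by apply: compact_closed => //; exact: norm_hausdorff.
Qed.

Lemma test_functionM (D : set T) f g : test_function D f -> smooth g ->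
  test_function D (fun x => g x * f x).
Proof.
move=> [sf [K cK [KD f0]]] sg; split; first exact: smoothM.
by exists K => //; split => // x /f0 ->; rewrite mulr0.
Qed.

Lemma test_functionP (D : set T) a f g : test_function D f -> test_function D g ->
  test_function D (fun x => a * f x + g x).
Proof.
move=> [sf [K cK [KD f0]]] [sg [K' cK' [K'D g0]]]; split.
  by apply: smoothD => //; exact: smoothZ.
exists (K `|` K'); first exact: compactU.
split => [x [/KD|/K'D]//|x /not_orP[/f0 -> /g0 ->]]; by rewrite mulr0 addr0.
Qed.

Lemma test_function0 (D : set T) : test_function D (fun=> 0).
Proof. by split; [exact: smooth_cst|exists set0; [exact: compact0|split]]. Qed.

End smooth_calculus.

(** * The functions x ^ - m exp (- 1 / x), extended by zero *)

Section flat_exponential.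
Context {R : realType}.

(* The derivatives of exp (- 1/x) are combinations of such functions. *)
Definition flat (m : nat) (x : R) : R := if 0 < x then x ^- m * expR (- x^-1) else 0.

Lemma flat_ge0 m x : 0 <= flat m x.
Proof. by rewrite /flat; case: ifP => // x0; rewrite mulr_ge0 ?expR_ge0 // invr_ge0 exprn_ge0 // ltW. Qed.

(** The term of order m + 2 in the series of exp (1 / x) dominates x ^ - (m + 2) / (m + 2)!. The
    resulting quadratic decay makes the derivative at 0 vanish. *)
Lemma flat_le m x : `|flat m x| <= (m.+2)`!%:R * x ^+ 2.
Proof.
rewrite ger0_norm ?flat_ge0 // /flat; case: ifPn => [x0|_]; last by rewrite mulr_ge0 ?sqr_ge0.
have y0 : 0 <= x^-1 by rewrite invr_ge0 ltW.
have := expR_ge1Dxn m.+1 y0; rewrite expRN.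
set E := expR _; have E0 : 0 < E by exact: expR_gt0.
move=> H; have {}H : x ^- m.+2 / (m.+2)`!%:R <= E.
  by rewrite -exprVn; apply: le_trans H; rewrite lerDr.
rewrite ler_pdivrMr // mulrC.
apply: le_trans (ler_wpM2r _ H); last by rewrite mulr_ge0 ?sqr_ge0.
rewrite le_eqVlt; apply/orP; left; apply/eqP.
rewrite -[in RHS]addn2 exprD; field.
by rewrite gt_eqF // expf_neq0 ?gt_eqF // pnatr_eq0 -lt0n fact_gt0.
Qed.

Lemma is_derive_flat0 (f : R -> R) (C : R) : (forall h, `|f h| <= C * h ^+ 2) -> is_derive (0 : R) 1 f 0.
Proof.
move=> fC; have f0 : f 0 = 0.
  by apply/eqP; rewrite -normr_le0; apply: le_trans (fC 0) _; rewrite expr0n mulr0.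
have C0 : 0 <= C by have := fC 1; rewrite expr1n mulr1; apply: le_trans.
have H : h^-1 *: (f (h *: 1 + 0) - f 0) @[h --> 0^'] --> 0.
  apply/cvgr0Pnorm_le => e e0; near=> h.
  rewrite f0 subr0 addr0 scaler1 normrM normfV.
  have h0 : h != 0 by near: h; exact: nbhs_dnbhs_neq.
  rewrite ler_pdivrMl ?normr_gt0 //; apply: le_trans (fC h) _.
  have -> : h ^+ 2 = `|h| * `|h| by rewrite -normrM -expr2 ger0_norm ?sqr_ge0.
  rewrite mulrCA ler_wpM2l //.
  have : `|h| <= e / (C + 1).
    by near: h; apply: dnbhs0_le; rewrite divr_gt0 // ltr_wpDl.
  rewrite ler_pdivlMr ?ltr_wpDl //; apply: le_trans.
  by rewrite mulrC ler_wpM2l // lerDl.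
by split; [apply/cvg_ex; exists 0|exact: cvg_lim].
Unshelve. all: by end_near. Qed.

(** Differentiating the power gives - m x ^ - (m + 1), and exp (- 1 / x) brings the factor x ^ - 2.
    The span of the family is thus stable under differentiation, which gives smoothness. *)
Lemma is_derive_flat m (x : R) : is_derive x 1 (flat m) (flat m.+2 x - m%:R * flat m.+1 x).
Proof.
have [x0|x0|->] := ltgtP x 0.
- rewrite /flat !ifF ?(lt_gtF x0) // mulr0 subr0.
  apply: near_eq_is_derive (is_derive_cst (0 : R) x 1).
  near=> y; rewrite /flat ifF //; apply: lt_gtF; near: y; exact: lt_nbhsl.
- have xn0 : x != 0 by rewrite gt_eqF.
  have E : \near x, (fun y => (y^-1) ^+ m * expR (- y^-1)) x = flat m x.
    by near=> y; rewrite /flat ifT ?exprVn //; near: y; exact: lt_nbhsr.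
  apply: near_eq_is_derive E _.
  have dV : is_derive x 1 (fun y : R => y^-1) (- x ^- 2).
    have := @is_deriveV R id x 1 1 xn0 (is_derive_id x 1).
    by rewrite [X in is_derive _ _ _ X -> _]mulr1.
  have dX := @is_deriveX _ _ _ m _ _ _ dV.
  have dN := is_deriveN dV.
  have dE := @is_derive1_comp R expR (- (fun y : R => y^-1)) x _ _ (is_derive_expR _) dN.
  have := is_deriveM dX dE.
  have -> : (fun y : R => y^-1) ^+ m * (expR \o - (fun y : R => y^-1)) =
      (fun y => y^-1 ^+ m * expR (- y^-1)).
    by apply/funext => y; rewrite exprfctE.
  rewrite /flat x0 => H; apply: is_derive_eq H _.
  rewrite exprfctE /= /comp /= opprK [_ *: _]mulrA [X in _ + X]mulrA.
  have -> : (- (fun y : R => y^-1)) x = - x^-1 by [].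
  case: m {dX} => [|m].
    rewrite expr0; field; exact: xn0.
  rewrite /= !exprS !exprVn; have X := expf_neq0 m xn0; field; by rewrite xn0 X.
- rewrite /flat ltxx mulr0 subr0; exact: is_derive_flat0 (flat_le m).
Unshelve. all: by end_near. Qed.

End flat_exponential.

(** * Integration by parts against functions of bounded support *)

Section integral_pderiv.
Context {R : realType} {n : nat}.
Local Notation T := 'rV[R]_n.
Local Notation leb := (@lebesgue_rV R n).
Local Notation lam := (@lebesgue_measure R).
Implicit Types (f g : T -> R) (k i : 'I_n) (x : T).
Local Notation e_ i := (delta_mx ord0 i : T).

Lemma upd_addE x k (s t : R) : upd x k (t + s) = t *: e_ k + upd x k s.
Proof.
apply/rowP => i; rewrite !mxE eqxx /= eq_sym.
by case: eqP => _; rewrite ?mulr1 // mulr0 add0r.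
Qed.

Lemma is_derive_upd f x k s : derivable f (upd x k s) (e_ k) ->
  is_derive s 1 (fun t => f (upd x k t)) (pderiv k f (upd x k s)).
Proof.
move=> df; have E : (fun h : R => h^-1 *: (((fun t => f (upd x k t)) \o shift s) (h *: (1 : R)) - f (upd x k s))) =
  (fun h => h^-1 *: ((f \o shift (upd x k s)) (h *: e_ k) - f (upd x k s))).
  by apply/funext => h /=; rewrite [h *: (1 : R)]mulr1 upd_addE.
split; first by rewrite /derivable E; exact: df.
by rewrite /derive E.
Qed.

Lemma continuous_compact_bounded (A : set T) f : compact A -> continuous f ->
  exists2 M : R, 0 <= M & forall x, A x -> `|f x| <= M.
Proof.
move=> cA cf; have /compact_bounded[M [Mr H]] : compact (f @` A).
  by apply: continuous_compact => //; exact: continuous_subspaceT.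
exists (`|M| + 1) => [|x Ax]; first by rewrite addr_ge0.
apply: H; last by exists x.
by apply: le_lt_trans (ler_norm _) _; rewrite ltrDl.
Qed.

Lemma compact_cbox (K : R) : compact [set x : T | forall i, `|x ord0 i| <= K].
Proof.
have := @rV_compact R n (fun=> `[- K, K]%classic) (fun=> @segment_compact R _ _).
congr compact; apply/seteqP; split => x /= H i; have := H i; by rewrite /= in_itv /= ler_norml.
Qed.

Lemma coord_bounded_bounded f (K : R) : continuous f -> coord_bounded K f ->
  exists M : R, forall x, `|f x| <= M.
Proof.
move=> cf fK; have [M M0 H] := continuous_compact_bounded (@compact_cbox K) cf.
exists M => x; have [/H//|/existsNP[i /negP]] := pselect (forall i, `|x ord0 i| <= K).
by rewrite -ltNge => /ltW Kx; rewrite fK ?normr0 //; exists i.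
Qed.

(** A derivative vanishes where the function does on a whole neighbourhood. The margin 1 provides
    one: near a point with a coordinate of size at least [K + 1], that coordinate stays above
    [K]. *)
Lemma coord_bounded_pderiv f k (K : R) : coord_bounded K f -> coord_bounded (K + 1) (pderiv k f).
Proof.
move=> fK x [i Kx]; rewrite (@pderiv_near _ _ _ (fun=> 0)) ?pderiv_cst //.
have c : {for x, continuous (fun y : T => y ord0 i)} by exact: coord_continuous.
have H : (fun y : T => `|y ord0 i|) @ x --> `|x ord0 i| by exact: (cvg_norm (F := nbhs x) c).
have : nbhs x [set y : T | K < `|y ord0 i|].
  by apply: (cvgr_gt _ H); apply: lt_le_trans Kx; rewrite ltrDl.
by apply: filterS => y Ky; apply: fK; exists i; exact: ltW.
Qed.

Lemma integral_lam_pderiv0 f k (K : R) x :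
  (forall y, derivable f y (e_ k)) -> continuous (pderiv k f) -> coord_bounded K f ->
  (\int[lam]_s (pderiv k f (upd x k s))%:E = 0)%E.
Proof.
(* [K'] exceeds [K + 1], beyond which the derivative vanishes, and is positive whatever the sign of
   [K]. *)
move=> df cf fK; pose K' : R := `|K| + 2.
have KK' : K + 1 < K' by rewrite /K'; have := ler_norm K; lra.
have K'0 : 0 < K' by rewrite ltr_wpDl.
have gK := coord_bounded_pderiv k fK.
have upk s : upd x k s ord0 k = s by rewrite mxE eqxx.
pose g s := (pderiv k f (upd x k s))%:E.
have gE : g = g \_ `[- K', K']%classic.
  apply/funext => s; rewrite /patch; case: ifPn => //; rewrite notin_setE /= in_itv /=.
  rewrite -ler_norml => /negP; rewrite -ltNge => Ks; rewrite /g gK //; exists k.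
  by rewrite upk; exact/ltW/(lt_trans KK').
rewrite -[LHS]/(\int[lam]_s g s)%E gE -integral_mkcond /g.
have ds s := is_derive_upd (df (upd x k s)).
have cg : continuous (fun s => pderiv k f (upd x k s)).
  move=> s; apply: (@continuous_comp _ _ _ (fun s => upd x k s) (pderiv k f)); last exact: cf.
  have -> : (fun s => upd x k s) = (fun s => s *: e_ k + upd x k 0).
    by apply/funext => t; rewrite -[t in LHS]addr0 upd_addE.
  by apply: cvgD; [apply: cvgZl; exact: cvg_id|exact: cvg_cst].
have ch : continuous (fun s => f (upd x k s)).
  by move=> s; apply: differentiable_continuous; apply/derivable1_diffP; exact: (@ex_derive _ _ _ _ _ _ _ (ds s)).
rewrite (continuous_FTC2 (F := fun s => f (upd x k s))).
- have f0 s : `|s| = K' -> f (upd x k s) = 0.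
    move=> sK; apply: fK; exists k; rewrite upk sK; apply: ltW.
    by apply: lt_trans KK'; rewrite ltrDl.
  have E1 : `|- K'| = K' by rewrite normrN gtr0_norm.
  by rewrite (f0 K' (gtr0_norm K'0)) (f0 (- K') E1) sube0.
- by rewrite gt0_cp.
- exact: continuous_subspaceT.
- split; first by move=> s _; exact: (@ex_derive _ _ _ _ _ _ _ (ds s)).
  + by apply: cvg_at_right_filter; exact: ch.
  + by apply: cvg_at_left_filter; exact: ch.
- by move=> s _; rewrite derive1E; exact: (@derive_val _ _ _ _ _ _ _ (ds s)).
Qed.

Lemma integral_pderiv0 f k (K : R) :
  (forall y, derivable f y (e_ k)) -> continuous (pderiv k f) -> coord_bounded K f ->
  \int[leb]_x pderiv k f x = 0.
Proof.
move=> df cf fK; have gK := coord_bounded_pderiv k fK.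
have [M gM] := coord_bounded_bounded cf gK.
rewrite /Rintegral (integral_slice0 (k := k) _ gM gK) //.
  exact: continuous_rV_measurable.
by move=> x; exact: (integral_lam_pderiv0 x df cf fK).
Qed.

Lemma compact_coord_bounded (A : set T) f : compact A -> (forall x, ~ A x -> f x = 0) ->
  exists2 K : R, 0 < K & coord_bounded K f.
Proof.
move=> /compact_bounded/bounded_leb_fin[K K0 AK] f0; exists K => // x [i Kx].
apply: f0 => /AK /(_ i) /=; rewrite in_itv /= -ltr_norml => H.
by have := lt_le_trans H Kx; rewrite ltxx.
Qed.

Lemma continuous_cb_integrable f (K : R) : continuous f -> coord_bounded K f ->
  leb.-integrable setT (EFin \o f).
Proof.
move=> cf fK; have [M fM] := coord_bounded_bounded cf fK.
by apply: coord_bounded_integrable fM fK; exact: continuous_rV_measurable.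
Qed.

Lemma integral_by_parts f g k (K : R) : smooth f -> smooth g -> coord_bounded K g ->
  \int[leb]_x (f x * pderiv k g x) = - \int[leb]_x (pderiv k f x * g x).
Proof.
move=> sf sg gK.
have df x := smooth_diff x sf; have dg x := smooth_diff x sg.
have sfg : smooth (fun x => f x * g x) by exact: smoothM.
have fgK : coord_bounded K (fun x => f x * g x) by move=> x /gK ->; rewrite mulr0.
have i1 : leb.-integrable setT (EFin \o (fun x => pderiv k f x * g x)).
  apply: (@continuous_cb_integrable _ K); last by move=> x /gK ->; rewrite mulr0.
  by apply: smooth_continuous; apply: smoothM => //; exact: smooth_pderiv.
have i2 : leb.-integrable setT (EFin \o (fun x => f x * pderiv k g x)).
  apply: (@continuous_cb_integrable _ (K + 1)).
    by apply: smooth_continuous; apply: smoothM => //; exact: smooth_pderiv.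
  by move=> x /(coord_bounded_pderiv k gK) ->; rewrite mulr0.
have := integral_pderiv0 (k := k) (fun y => diff_pderivable (smooth_diff y sfg))
  (smooth_continuous (smooth_pderiv k sfg)) fgK.
rewrite pderivM // RintegralD // => /eqP; rewrite addrC addr_eq0 => /eqP.
exact.
Qed.

Lemma Rintegral_restrict (D : set T) f : (forall x, ~ D x -> f x = 0) ->
  \int[leb]_(x in D) f x = \int[leb]_x f x.
Proof.
move=> f0; rewrite Rintegral_mkcond; congr (Rintegral _ _ _); apply/funext => x.
by rewrite /patch; case: ifPn => //; rewrite notin_setE => /f0.
Qed.

Lemma test_function_out (D : set T) f x : test_function D f -> ~ D x -> f x = 0.
Proof. by move=> [_ [K _ [KD f0]]] Dx; apply: f0 => /KD. Qed.

Lemma test_function_coord_bounded (D : set T) f : test_function D f ->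
  exists2 K : R, 0 < K & coord_bounded K f.
Proof. by move=> [_ [A cA [_ f0]]]; exact: compact_coord_bounded cA f0. Qed.

Lemma smooth_weak_pderiv (D : set T) f k : smooth f -> weak_pderiv D k f (pderiv k f).
Proof.
move=> sf phi tphi; have [K _ phiK] := test_function_coord_bounded tphi.
have H1 x : ~ D x -> f x * pderiv k phi x = 0.
  by move=> Dx; rewrite (test_function_out (test_function_pderiv k tphi) Dx) mulr0.
have H2 x : ~ D x -> pderiv k f x * phi x = 0.
  by move=> Dx; rewrite (test_function_out tphi Dx) mulr0.
by rewrite (Rintegral_restrict H1) (Rintegral_restrict H2) (integral_by_parts k sf (proj1 tphi) phiK).
Qed.

End integral_pderiv.

(** * Density of the test functions in L^2 *)

Section smooth_bump.
Context {R : realType} {n : nat}.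
Local Notation T := 'rV[R]_n.
Implicit Types (f g : T -> R) (i k : 'I_n) (x : T).

Lemma smooth_prod (I : Type) (r : seq I) (F : I -> T -> R) :
  (forall j, smooth (F j)) -> smooth (fun x => \prod_(j <- r) F j x).
Proof.
move=> sF; elim: r => [|i r IH].
  by under eq_fun do rewrite big_nil; exact: smooth_cst.
under eq_fun do rewrite big_cons.
exact: smoothM.
Qed.

Lemma smooth_flat j (c v : R) k : smooth (fun x => flat j (c * x ord0 k + v)).
Proof.
apply/smoothE => m; elim: m j => [|m IH] j.
  split => // x; apply: (@differentiable_comp _ _ _ _ (fun x : T => c * x ord0 k + v)).
    apply: differentiableD => //; apply: differentiableM => //; exact: differentiable_coord.
  apply/derivable1_diffP; exact: (@ex_derive _ _ _ _ _ _ _ (is_derive_flat j _)).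
have dk x : differentiable (fun x : T => c * x ord0 k + v) x.
  by apply: differentiableD => //; apply: differentiableM => //; exact: differentiable_coord.
split => [x|i].
  apply: (@differentiable_comp _ _ _ _ (fun x : T => c * x ord0 k + v)) => //.
  apply/derivable1_diffP; exact: (@ex_derive _ _ _ _ _ _ _ (is_derive_flat j _)).
rewrite (_ : pderiv i _ = fun x => (c * (i == k)%:R) * (flat j.+2 (c * x ord0 k + v) +
  (- j%:R) * flat j.+1 (c * x ord0 k + v))).
  by apply: CkZ; apply: CkD => //; apply: CkZ.
apply/funext => x; have D := is_derive_flat j (c * x ord0 k + v).
have D1 : derivable (flat j) (c * x ord0 k + v) 1 by exact: (@ex_derive _ _ _ _ _ _ _ D).
have -> := @pderiv_comp1 _ _ (flat j) (fun x : T => c * x ord0 k + v) i x D1 (dk x).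
by rewrite (@derive_val _ _ _ _ _ _ _ D) pderiv_coord mulrC mulNr.
Qed.

Lemma flat0_le1 (s : R) : flat 0 s <= 1.
Proof.
rewrite /flat; case: ifP => // s0; rewrite expr0 invr1 mul1r.
by rewrite -expR0 ler_expR oppr_le0 invr_ge0 ltW.
Qed.

Lemma flat0_out j (s : R) : s <= 0 -> flat j s = 0.
Proof. by move=> s0; rewrite /flat ltNge s0. Qed.

Lemma flat0_cvg (s : R) : flat 0 (m.+1%:R * s) @[m --> \oo] --> ((0 < s)%R%:R : R).
Proof.
case: ltP => s0 /=; last first.
  apply: cvg_near_cst; apply: nearW => m; rewrite flat0_out //.
  by rewrite mulr_ge0_le0.
have E m : flat 0 (m.+1%:R * s) = expR (- (s^-1 * m.+1%:R^-1)).
  by rewrite /flat mulr_gt0 // expr0 invr1 mul1r invfM mulrC.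
under eq_fun do rewrite E.
have H : expR (- (s^-1 * m.+1%:R^-1)) @[m --> \oo] --> expR (- (s^-1 * 0)).
  apply: (@continuous_cvg _ _ _ _ _ _ (@expR R)); first exact: continuous_expR.
  by apply: cvgN; apply: cvgM; [exact: cvg_cst|exact: cvg_harmonic].
by rewrite mulr0 oppr0 expR0 in H.
Qed.

(** A product of the factors exp (- 1 / ((m + 1) s)) over the distances s to the faces of a box;
    each factor tends to 1 inside the box as m grows and is 0 outside. *)
Definition bump (a c : 'I_n -> R) (m : nat) x : R :=
  \prod_(k < n) (flat 0 (m.+1%:R * x ord0 k + - (m.+1%:R * a k)) *
    flat 0 ((- m.+1%:R) * x ord0 k + m.+1%:R * c k)).

Lemma smooth_bump a c m : smooth (bump a c m).
Proof. by apply: smooth_prod => k; apply: smoothM; exact: smooth_flat. Qed.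

Lemma bump_ge0 a c m x : 0 <= bump a c m x.
Proof. by apply: prodr_ge0 => k _; rewrite mulr_ge0 ?flat_ge0. Qed.

Lemma bump_le1 a c m x : bump a c m x <= 1.
Proof.
have H : 0 <= bump a c m x <= \prod_(k < n) 1.
  apply/andP; split; first exact: bump_ge0.
  apply: ler_prod => k _; rewrite mulr_ge0 ?flat_ge0 //=.
  by apply: mulr_ile1; rewrite ?flat_ge0 ?flat0_le1.
by case/andP: H => _; rewrite big1.
Qed.

Lemma bump_out a c m x k : ~ (a k < x ord0 k < c k) -> bump a c m x = 0.
Proof.
move=> H; rewrite /bump (bigD1 k) //=.
suff -> : flat 0 (m.+1%:R * x ord0 k + - (m.+1%:R * a k)) *
    flat 0 (- m.+1%:R * x ord0 k + m.+1%:R * c k) = 0 by rewrite mul0r.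
case: (ltP (a k) (x ord0 k)) => ax.
  case: (ltP (x ord0 k) (c k)) => xc; first by case: H; rewrite ax xc.
  by rewrite [X in _ * X]flat0_out ?mulr0 // mulNr addrC subr_le0 ler_pM2l.
by rewrite flat0_out ?mul0r // subr_le0 ler_pM2l.
Qed.

Lemma cvg_prod_seq (I : Type) (r : seq I) (F : I -> nat -> R) (l : I -> R) :
  (forall j, F j m @[m --> \oo] --> l j) ->
  \prod_(j <- r) F j m @[m --> \oo] --> \prod_(j <- r) l j.
Proof.
move=> H; elim: r => [|i r IH].
  by under eq_fun do rewrite big_nil; rewrite big_nil; exact: cvg_cst.
by under eq_fun do rewrite big_cons; rewrite big_cons; apply: cvgM.
Qed.

Lemma bump_cvg a c x : bump a c m x @[m --> \oo] --> (\1_[set x : T | forall k, a k < x ord0 k < c k] x : R).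
Proof.
rewrite indicE.
have -> : (x \in [set x : T | forall k, a k < x ord0 k < c k])%:R =
    \prod_(k < n) ((0 < x ord0 k - a k)%R%:R * (0 < c k - x ord0 k)%R%:R) :> R.
  case: (boolP (x \in _)) => [|/negP].
    rewrite inE /= => H; rewrite big1 // => k _; have /andP[h1 h2] := H k.
    by rewrite !subr_gt0 h1 h2 mulr1.
  rewrite inE => /existsNP[k /negP]; rewrite negb_and => H.
  rewrite (bigD1 k) //= !subr_gt0; case/orP: H => /negbTE ->; by rewrite ?mulr0 ?mul0r // mul0r.
apply: cvg_prod_seq => k; apply: cvgM.
  by under eq_fun do rewrite -mulrBr; exact: flat0_cvg.
by under eq_fun do rewrite mulNr addrC -mulrBr; exact: flat0_cvg.
Qed.

End smooth_bump.

Section orthants.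
Context {R : realType} {n : nat}.
Local Notation T := 'rV[R]_n.

(** Infinite bounds are allowed so that a condition on a single coordinate is an orthant. These sets
    form a pi-system generating the sigma-algebra, as Dynkin's theorem requires. *)
Definition orthant (b : 'I_n -> \bar R) : set T := [set x | forall k, ((x ord0 k)%:E < b k)%E].

Definition orthants : set (set T) := range orthant.

Lemma orthantsI : setI_closed orthants.
Proof.
move=> _ _ [b _ <-] [b' _ <-]; exists (fun k => mine (b k) (b' k)) => //.
apply/seteqP; split => [x H|x [H1 H2] k].
  by split => k; have := H k; rewrite lt_min => /andP[].
by rewrite lt_min H1 H2.
Qed.

Lemma orthantsE : @measurable _ T = <<s orthants >>.
Proof.
apply/seteqP; split; last first.
  apply: smallest_sub; first exact: sigma_algebra_measurable.
  move=> _ [b _ <-].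
  rewrite (_ : orthant b = \bigcap_(k in [set: 'I_n]) ((fun x : T => x ord0 k : measurableTypeR R) @^-1`
     [set s | (s%:E < b k)%E])).
    apply: fin_bigcap_measurable => // k _; rewrite -[X in measurable X]setTI.
    apply: (measurable_coord k) => //.
    case: (b k) => [r||].
    + rewrite [X in measurable X](_ : _ = `]-oo, r[%classic); first exact: measurable_itv.
      by apply/seteqP; split => s /=; rewrite in_itv /= lte_fin.
    + rewrite [X in measurable X](_ : _ = setT); first exact: measurableT.
      by apply/seteqP; split => s //= _; exact: ltry.
    + by rewrite [X in measurable X](_ : _ = set0); [exact: measurable0|apply/seteqP; split].
  by apply/seteqP; split => x H k => [_|]; exact: H.
apply: smallest_sub; first exact: smallest_sigma_algebra.
move=> A; rewrite -bigcup_seq => -[i _ [B mB <-]].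
have {}mB : (@RGenInftyO.G R).-sigma.-measurable B by rewrite -RGenInftyO.measurableE.
suff : (@RGenInftyO.G R).-sigma.-measurable `<=`
    [set B : set R | <<s orthants >> (setT `&` (fun x : T => x ord0 i) @^-1` B)] by move=> /(_ B mB).
apply: smallest_sub.
  have [s0 sC sU] := @smallest_sigma_algebra _ setT orthants.
  split => /=; first by rewrite preimage_set0 setI0.
    move=> C /sC; rewrite setTD setTI => H; rewrite setTI setTD preimage_setC.
    exact: H.
  move=> F HF; rewrite preimage_bigcup setI_bigcupr; exact: sU.
move=> _ [s ->] /=; apply: sub_sigma_algebra.
exists (fun k => if k == i then s%:E else +oo%E) => //.
rewrite setTI; apply/seteqP; split => x /=; rewrite in_itv /=.
  by move=> /(_ i); rewrite eqxx lte_fin.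
by move=> xs k /=; case: eqP => [->|_]; rewrite ?lte_fin // ltry.
Qed.

End orthants.

Section test_function_density.
Context {R : realType} {n : nat}.
Local Notation T := 'rV[R]_n.
Local Notation leb := (@lebesgue_rV R n).
Variable O : set T.
Hypothesis oO : open O.
Hypothesis leO : (leb O < +oo)%E.

Let mO : measurable O := open_measurable_rV oO.

Lemma test_function_measurable (D : set T) (psi : T -> R) : test_function O psi -> measurable_fun D psi.
Proof. by move=> [spsi _]; apply: continuous_rV_measurable; exact: smooth_continuous. Qed.

Lemma test_function_bounded (psi : T -> R) : test_function O psi ->
  exists2 M : R, 0 <= M & forall x, `|psi x| <= M.
Proof.
move=> tpsi; have [K _ pK] := test_function_coord_bounded tpsi.
have [M HM] := coord_bounded_bounded (smooth_continuous (proj1 tpsi)) pK.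
by exists `|M| => // x; exact: le_trans (HM x) (ler_norm _).
Qed.

Lemma test_function_L2 (psi : T -> R) : test_function O psi -> L2 leb O psi.
Proof.
move=> tpsi; have [M _ HM] := test_function_bounded tpsi.
by apply: (@L2_bounded _ _ _ _ _ mO leO _ M) => //; exact: test_function_measurable.
Qed.

Lemma sqrD_le (x y : R) : (x + y) ^+ 2 <= 2 * x ^+ 2 + 2 * y ^+ 2.
Proof. by have := sqr_ge0 (x - y); lra. Qed.

Lemma sqrD_Rintegral_le d' (S : measurableType d') (mu : {measure set S -> \bar R}) (D : set S)
    (f g : S -> R) : measurable D -> L2 mu D f -> L2 mu D g ->
  \int[mu]_(x in D) ((f x + g x) ^+ 2) <= 2 * \int[mu]_(x in D) (f x ^+ 2) + 2 * \int[mu]_(x in D) (g x ^+ 2).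
Proof.
move=> mD Lf Lg.
have if2 := L2_integrable_sqr Lf; have ig2 := L2_integrable_sqr Lg.
have if2' : mu.-integrable D (EFin \o (fun x => 2 * f x ^+ 2)).
  by apply: eq_integrable (integrableZl mD 2 if2).
have ig2' : mu.-integrable D (EFin \o (fun x => 2 * g x ^+ 2)).
  by apply: eq_integrable (integrableZl mD 2 ig2).
rewrite -!RintegralZl // -RintegralD //; apply: le_Rintegral => //.
- exact: (L2_integrable_sqr (L2D mD Lf Lg)).
- by apply: eq_integrable (integrableD mD if2' ig2').
- by move=> x _; exact: sqrD_le.
Qed.

Definition test_approx (f : T -> R) := forall e : R, 0 < e ->
  exists2 psi, test_function O psi & \int[leb]_(x in O) ((f x - psi x) ^+ 2) <= e.

Lemma test_approxP a f g : L2 leb O f -> L2 leb O g -> test_approx f -> test_approx g ->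
  test_approx (fun x => a * f x + g x).
Proof.
move=> Lf Lg af ag e e0.
have c0 : 0 < 4 * (a ^+ 2 + 1) by rewrite mulr_gt0 // ltr_wpDl // sqr_ge0.
have [p tp Hp] := af (e / (4 * (a ^+ 2 + 1))) ltac:(by rewrite divr_gt0).
have [q tq Hq] := ag (e / 4) ltac:(by rewrite divr_gt0).
exists (fun x => a * p x + q x); first exact: test_functionP.
have Lp := L2B mO Lf (test_function_L2 tp); have Lq := L2B mO Lg (test_function_L2 tq).
have E : (fun x => (a * f x + g x - (a * p x + q x)) ^+ 2) =
    (fun x => (a * (f x - p x) + (g x - q x)) ^+ 2) by apply/funext => x; congr (_ ^+ 2); ring.
rewrite E; apply: le_trans (sqrD_Rintegral_le mO (L2Z mO a Lp) Lq) _.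
under eq_Rintegral do rewrite exprMn.
rewrite RintegralZl //; last exact: L2_integrable_sqr.
rewrite ler_pdivlMr // in Hp.
have : 0 <= a ^+ 2 := sqr_ge0 a.
set I := Rintegral _ _ _ in Hp *.
have I0 : 0 <= I by apply: Rintegral_ge0 => x _; exact: sqr_ge0.
nra.
Qed.

Lemma test_approx_lim f : L2 leb O f -> (forall e : R, 0 < e ->
    exists g, [/\ L2 leb O g, test_approx g & \int[leb]_(x in O) ((f x - g x) ^+ 2) <= e]) -> test_approx f.
Proof.
move=> Lf H e e0; have [g [Lg ag Hg]] := H (e / 4) ltac:(by rewrite divr_gt0).
have [p tp Hp] := ag (e / 4) ltac:(by rewrite divr_gt0).
exists p => //.
have E : (fun x => (f x - p x) ^+ 2) = (fun x => ((f x - g x) + (g x - p x)) ^+ 2).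
  by apply/funext => x; congr (_ ^+ 2); ring.
rewrite E; apply: le_trans (sqrD_Rintegral_le mO (L2B mO Lf Lg) (L2B mO Lg (test_function_L2 tp))) _.
by move: Hg Hp; lra.
Qed.

Lemma test_approx_dct (f : nat -> T -> R) (g : T -> R) : (forall m, measurable_fun O (f m)) -> measurable_fun O g ->
  (forall m x, `|f m x| <= 1) -> (forall x, `|g x| <= 1) -> (forall x, O x -> f m x @[m --> \oo] --> g x) ->
  forall e : R, 0 < e -> exists m, \int[leb]_(x in O) ((g x - f m x) ^+ 2) <= e.
Proof.
move=> mf mg f1 g1 fg e e0.
have H : \int[leb]_(x in O) ((g x - f m x) ^+ 2) @[m --> \oo] --> \int[leb]_(x in O) (cst 0 x : R).
  apply: (@Rintegral_dct _ _ _ _ _ mO _ _ (cst 4)).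
  - by move=> m; apply: measurable_funX; apply: measurable_funB.
  - by apply: (@L2_integrable _ _ _ _ _ mO leO); exact: L2_cst.
  - move=> m x _ /=; have := f1 m x; have := g1 x; rewrite !ler_norml => /andP[? ?] /andP[? ?].
    by apply/andP; split; nra.
  - move=> x Ox /=; have : (g x - f m x) ^+ 2 @[m --> \oo] --> (g x - g x) ^+ 2.
      by apply: cvgn_sqr; apply: cvgB; [exact: cvg_cst|exact: fg].
    by rewrite subrr expr0n.
rewrite Rintegral_cst // mul0r in H.
have /cvgr0_norm_le /(_ e e0) [m _ /(_ m (leqnn m))] := H.
by move=> Hm; exists m; exact: le_trans (ler_norm _) Hm.
Qed.

Lemma L2_indic (A : set T) : measurable A -> L2 leb O (\1_A : T -> R).
Proof.
move=> mA; apply: (@L2_bounded _ _ _ _ _ mO leO _ 1) => [|x _]; first exact: measurable_indic.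
by rewrite ger0_norm indicE ?ler0n // lern1 leq_b1.
Qed.

Lemma indic_norm_le1 (A : set T) x : `|\1_A x : R| <= 1.
Proof. by rewrite ger0_norm indicE ?ler0n // lern1 leq_b1. Qed.

Lemma test_approx_bigcup (F : nat -> set T) : (forall m, measurable (F m)) ->
  (forall m, test_approx (\1_(\big[setU/set0]_(k < m) F k) : T -> R)) -> test_approx (\1_(\bigcup_k F k) : T -> R).
Proof.
move=> mF aF; have mU : measurable (\bigcup_k F k) by exact: bigcup_measurable.
have mUm m : measurable (\big[setU/set0]_(k < m) F k) by exact: bigsetU_measurable.
apply: test_approx_lim => [|e e0]; first exact: L2_indic.
have [|||||m Hm] := @test_approx_dct (fun m => \1_(\big[setU/set0]_(k < m) F k)) (\1_(\bigcup_k F k)) _ _ _ _ _ e e0.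
- by move=> m; exact: measurable_indic.
- exact: measurable_indic.
- by move=> m x; exact: indic_norm_le1.
- by move=> x; exact: indic_norm_le1.
- move=> x _; apply: cvg_near_cst; have [[k _ Fkx]|Fx] := pselect ((\bigcup_k F k) x).
    exists k.+1 => // m /= km; rewrite !indicE !mem_set //; first by exists k.
    by rewrite -bigcup_mkord; exists k.
  apply: nearW => m; rewrite !indicE !memNset // => H; apply: Fx; move: H.
  by rewrite -bigcup_mkord => -[k _ Fkx]; exists k.
by exists (\1_(\big[setU/set0]_(k < m) F k)); split => //; exact: L2_indic.
Qed.

Lemma test_approx_disjU (A B : set T) : measurable A -> measurable B -> (forall x, A x -> ~ B x) ->
  test_approx (\1_A : T -> R) -> test_approx (\1_B : T -> R) -> test_approx (\1_(A `|` B) : T -> R).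
Proof.
move=> mA mB AB aA aB.
rewrite (_ : \1_(A `|` B) = fun x : T => 1 * \1_A x + \1_B x).
  by apply: test_approxP => //; exact: L2_indic.
apply/funext => x; rewrite mul1r !indicE.
have [Ax|Ax] := pselect (A x).
  by rewrite (mem_set Ax) (memNset (AB _ Ax)) mem_set ?addr0 //; left.
rewrite (memNset Ax) add0r; have [Bx|Bx] := pselect (B x).
  by rewrite !mem_set //; right.
by rewrite !memNset // => -[].
Qed.

(** The bumps of the open box are supported in the closed one, which is compact and lies in [O];
    they converge boundedly to the indicator. *)
Lemma test_approx_box (a c : 'I_n -> R) :
  (forall x : T, (forall k, a k <= x ord0 k <= c k) -> O x) ->
  test_approx (\1_[set x : T | forall k, a k < x ord0 k < c k] : T -> R).
Proof.
move=> acO.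
have mB : measurable [set x : T | forall k, a k < x ord0 k < c k].
  rewrite (_ : [set x : T | forall k, a k < x ord0 k < c k] =
     \bigcap_(k in [set: 'I_n]) ((fun x : T => x ord0 k : measurableTypeR R) @^-1` `]a k, c k[)).
    apply: fin_bigcap_measurable => // k _; rewrite -[X in measurable X]setTI.
    exact: (measurable_coord k).
  by apply/seteqP; split => x /= H k => [_|]; have := H k; rewrite ?in_itv //= => /(_ I); rewrite in_itv.
have tb m : test_function O (bump a c m).
  split; first exact: smooth_bump.
  exists [set x : T | forall k, `[a k, c k]%classic (x ord0 k)].
    exact: (@rV_compact R n (fun k => `[a k, c k]%classic) (fun=> @segment_compact R _ _)).
  split => [x H|x H]; first by apply: acO => k; have := H k; rewrite /= in_itv.
  have /existsNP[k Hk] := H; apply: (@bump_out _ _ _ _ _ _ k) => /andP[h1 h2]; apply: Hk.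
  by rewrite /= in_itv /= !ltW.
move=> e e0; have [||||m Hm] := @test_approx_dct (bump a c) _ _ _ _ _ (fun x _ => @bump_cvg _ _ a c x) e e0.
- by move=> m; exact: test_function_measurable.
- exact: measurable_indic.
- by move=> m x; rewrite ger0_norm ?bump_ge0 ?bump_le1.
- by move=> x; exact: indic_norm_le1.
by exists (bump a c m).
Qed.

(** Dynkin's theorem on the sets [S]: localized to a cube whose closure is in [O], an orthant
    becomes an open box of the same kind, and complements are taken within the cube. *)
Lemma test_approx_qbox (p : 'rV[rat]_n * nat) :
  (forall x : T, (forall k, `|x ord0 k - ratr (p.1 ord0 k)| <= p.2.+1%:R^-1) -> O x) ->
  forall S, measurable S -> test_approx (\1_(S `&` qbox p) : T -> R).
Proof.
move=> pO S mS; have mp := @measurable_qbox R n p.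
have : <<s @orthants R n >> S by rewrite -orthantsE.
have aB (b : 'I_n -> \bar R) : (forall k, b k != -oo%E) -> test_approx (\1_(orthant b `&` qbox p) : T -> R).
  move=> bN.
  pose lo k : R := ratr (p.1 ord0 k) - p.2.+1%:R^-1.
  pose up k : R := ratr (p.1 ord0 k) + p.2.+1%:R^-1.
  (* Upper faces of the box: the orthant bound cut at the cube. The minimum is finite because [b k]
     is not -oo; an orthant with such a bound is empty and is treated separately. *)
  pose c k := fine (mine (b k) (up k)%:E).
  have cE k : (c k)%:E = mine (b k) (up k)%:E.
    rewrite /c fineK // fin_numElt; apply/andP; split.
      by rewrite lt_min ltNyr andbT ltNye.
    by rewrite gt_min ltry orbT.
  have -> : orthant b `&` qbox p = [set x : T | forall k, lo k < x ord0 k < c k].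
    apply/seteqP; split => [x [H1 H2] k|x H].
      have := H2 k; rewrite ltr_distl => /andP[h1 h2]; rewrite h1 /= -lte_fin cE lt_min (H1 k).
      by rewrite lte_fin.
    split => k; have /andP[h1] := H k; rewrite -lte_fin cE lt_min => /andP[] // h2 h3.
    by rewrite ltr_distl; apply/andP; split => //; rewrite -lte_fin.
  apply: test_approx_box => x H; apply: pO => k; have /andP[h1 h2] := H k.
  rewrite ler_distl h1 /=; rewrite -lee_fin cE le_min in h2; case/andP: h2 => _.
  by rewrite lee_fin.
have aT : test_approx (\1_(setT `&` qbox p) : T -> R).
  have := aB (fun=> +oo%E) (fun=> isT); rewrite (_ : orthant _ = setT) //.
  by apply/seteqP; split => // x _ k; exact: ltry.
apply: (dynkin_induction (P := fun S => test_approx (\1_(S `&` qbox p) : T -> R))).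
- exact: orthantsE.
- exact: orthantsI.
- exact: aT.
- move=> _ [b _ <-]; have [bN|/existsNP[k /negP]] := pselect (forall k, b k != -oo%E); first exact: aB.
  rewrite negbK => /eqP bk.
  have -> : orthant b `&` qbox p = set0.
    by apply/seteqP; split => // x [/(_ k)]; rewrite bk.
  move=> e e0; exists (fun=> 0); first exact: test_function0.
  under eq_Rintegral do rewrite indic0 subr0 expr0n.
  by rewrite Rintegral_cst // mul0r ltW.
- move=> A mA aA.
  rewrite (_ : \1_(~` A `&` qbox p) = fun x : T => -1 * \1_(A `&` qbox p) x + \1_(setT `&` qbox p) x).
    by apply: test_approxP => //; apply: L2_indic => //; apply: measurableI.
  apply/funext => x; rewrite setTI !indicE mulN1r addrC.
  have [Ax|Ax] := pselect (A x); have [qx|qx] := pselect (qbox p x).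
  + by rewrite memNset ?(mem_set qx) ?mem_set ?subrr // => -[].
  + by rewrite memNset ?(memNset qx) ?memNset ?subrr // => -[].
  + by rewrite mem_set ?(mem_set qx) ?memNset ?subr0 // => -[].
  + by rewrite memNset ?(memNset qx) ?memNset ?subrr // => -[].
- move=> F mF tF aF; rewrite setI_bigcupl; apply: test_approx_bigcup => [m|m].
    exact: measurableI.
  elim: m => [|m IH].
    rewrite big_ord0; have := test_approxP (-1) (L2_indic (measurableI _ _ (measurableT) mp)) (L2_indic (measurableI _ _ (measurableT) mp)) aT aT.
    rewrite (_ : (fun x : T => -1 * _ + _) = \1_set0) //.
    by apply/funext => x; rewrite indic0 mulN1r addNr.
  rewrite big_ord_recr /=; apply: test_approx_disjU => //.
  + by apply: bigsetU_measurable => k _; exact: measurableI.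
  + exact: measurableI.
  + move=> x; rewrite -(bigcup_mkord m (fun k => F k `&` qbox p)) => -[k km [Fkx _]] [Fmx _].
    have /trivIsetP /(_ k m I I) := tF.
    rewrite (ltn_eqF km) => /(_ isT) /seteqP[] /(_ x) H _; exact: H.
Qed.

(** By [L2_ind] only indicators matter. A measurable subset of [O] is a countable union of pieces,
    each in a rational cube whose closure is in [O]; the pieces are made disjoint one after the
    other. *)
Lemma test_dense f : L2 leb O f -> test_approx f.
Proof.
apply: (@L2_ind _ _ _ _ _ mO leO); last exact: test_approx_lim; last exact: test_approxP.
move=> A mA AO.
pose good (p : 'rV[rat]_n * nat) := forall x : T, (forall k, `|x ord0 k - ratr (p.1 ord0 k)| <= p.2.+1%:R^-1) -> O x.
pose B k : set T := if unpickle k is Some p then (if pselect (good p) then qbox p else set0) else set0.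
have mB k : measurable (B k).
  by rewrite /B; case: unpickle => [p|]; rewrite ?measurable0 //; case: pselect => ? //=; exact: measurable_qbox.
have mABk k : measurable (A `&` B k) by exact: measurableI.
have -> : A = \bigcup_k (A `&` B k).
  apply/seteqP; split => [x Ax|x [k _ []//]].
  have [p px pO] := qbox_nbhs oO (AO _ Ax); exists (pickle p) => //; split => //.
  by rewrite /B pickleK; case: pselect.
have aS S k : measurable S -> test_approx (\1_(S `&` B k) : T -> R).
  have z : test_approx (\1_(S `&` set0) : T -> R).
    move=> e e0; exists (fun=> 0); first exact: test_function0.
    under eq_Rintegral do rewrite setI0 indic0 subr0 expr0n.
    by rewrite Rintegral_cst // mul0r ltW.
  rewrite /B => mS; case: unpickle => [p|//]; case: pselect => [gp|//] /=.
  exact: test_approx_qbox.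
apply: test_approx_bigcup => // m; elim: m => [|m IH].
  by have := aS set0 0%N measurable0; rewrite set0I big_ord0.
have mU : measurable (\big[setU/set0]_(k < m) (A `&` B k)) by exact: bigsetU_measurable.
rewrite big_ord_recr /=.
have -> : \big[setU/set0]_(i < m) (A `&` B i) `|` A `&` B m =
   \big[setU/set0]_(i < m) (A `&` B i) `|` (A `\` \big[setU/set0]_(i < m) (A `&` B i)) `&` B m.
  apply/seteqP; split => x [Ux|[Ax Bx]]; try by left.
    by have [Ux|Ux] := pselect ((\big[setU/set0]_(i < m) (A `&` B i)) x); [left|right].
  by case: Ax => Ax _; right.
apply: test_approx_disjU => //.
- by apply: measurableI => //; exact: measurableD.
- by move=> x Ux [[]].
- by apply: aS; exact: measurableD.
Qed.

End test_function_density.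

(** * Poincare inequalities *)

Arguments pbox {R} n I.
Arguments box {R} n M.

Section poincare.
Context {R : realType}.
Local Notation leb := (@lebesgue_rV R).
Local Notation lam := (@lebesgue_measure R).
Local Notation I01 := (`]0, 1[%classic : set (measurableTypeR R)).


Lemma measurable_patch0 d (T : measurableType d) (D : set T) (f : T -> \bar R) : measurable D ->
  measurable_fun setT f -> measurable_fun setT (f \_ D).
Proof.
move=> mD mf; rewrite (_ : f \_ D = fun x => (f x * (\1_D x : R)%:E)%E).
  apply: emeasurable_funM => //; apply/measurable_EFinP; exact: measurable_indic.
by apply/funext => x; rewrite /patch indicE; case: ifP => _; rewrite ?mule1 ?mule0.
Qed.

Lemma unit_cubeE n : @unit_cube R n = @pbox R n I01.
Proof. by apply/seteqP; split => x H k; have := H k; rewrite /= in_itv. Qed.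

Lemma measurable_unit_cube n : measurable (@unit_cube R n).
Proof. by rewrite unit_cubeE; apply: measurable_pbox; exact: measurable_itv. Qed.

Lemma lam01 : lam `]0, 1[%classic = 1%E.
Proof. by rewrite lebesgue_measure_itv /= lte_fin ltr01 oppr0 adde0. Qed.

Lemma leb_unit_cube n : leb n (@unit_cube R n) = 1%E.
Proof. by rewrite unit_cubeE (@leb_pbox R n I01 1) ?expr1n // ?lam01 //; exact: measurable_itv. Qed.

Lemma unit_cube_lty n : (leb n (@unit_cube R n) < +oo)%E.
Proof. by rewrite leb_unit_cube ltry. Qed.

Lemma unit_cube_cons n (a : measurableTypeR R) (x : 'rV[R]_n) :
  unit_cube (rV_cons (a, x)) <-> `]0, 1[%classic (a : R) /\ unit_cube x.
Proof. by rewrite !unit_cubeE; exact: pbox_cons. Qed.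

Lemma ge0_integral_cube_cons n (f : 'rV[R]_n.+1 -> \bar R) :
  measurable_fun setT f -> (forall x, 0 <= f x)%E ->
  (\int[leb n.+1]_(x in unit_cube) f x =
   \int[lam]_(a in `]0%R, 1%R[%classic) \int[leb n]_(x in unit_cube) f (rV_cons (a : measurableTypeR R, x)))%E.
Proof.
move=> mf f0; rewrite integral_mkcond ge0_integral_rV_cons.
- rewrite [RHS]integral_mkcond; apply: eq_integral => a _ /=.
  rewrite {2}/patch; case: ifPn => [|/negP]; rewrite inE => Ia.
    rewrite [RHS]integral_mkcond; apply: eq_integral => x _ /=.
    rewrite /patch; case: ifPn => [|/negP]; rewrite inE unit_cube_cons.
      by move=> [_ Cx]; rewrite mem_set.
    by move=> H; rewrite memNset // => Cx; apply: H.
  rewrite integral0_eq // => x _; rewrite /patch ifF //; apply/negP; rewrite inE unit_cube_cons.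
  by case.
- exact: measurable_patch0 (@measurable_unit_cube n.+1) mf.
- by move=> x; rewrite /patch; case: ifP.
Qed.

Lemma ge0_integral_cube_consC n (f : 'rV[R]_n.+1 -> \bar R) :
  measurable_fun setT f -> (forall x, 0 <= f x)%E ->
  (\int[leb n.+1]_(x in unit_cube) f x =
   \int[leb n]_(x in unit_cube) \int[lam]_(a in `]0%R, 1%R[%classic) f (rV_cons (a : measurableTypeR R, x)))%E.
Proof.
move=> mf f0; rewrite integral_mkcond ge0_integral_rV_consC.
- rewrite [RHS]integral_mkcond; apply: eq_integral => x _ /=.
  rewrite {2}/patch; case: ifPn => [|/negP]; rewrite inE => Cx.
    rewrite [RHS]integral_mkcond; apply: eq_integral => a _ /=.
    rewrite /patch; case: ifPn => [|/negP]; rewrite inE unit_cube_cons.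
      by move=> [Ia _]; rewrite mem_set.
    by move=> H; rewrite memNset // => Ia; apply: H.
  rewrite integral0_eq // => a _; rewrite /patch ifF //; apply/negP; rewrite inE unit_cube_cons.
  by case.
- exact: measurable_patch0 (@measurable_unit_cube n.+1) mf.
- by move=> x; rewrite /patch; case: ifP.
Qed.

(** Cauchy-Schwarz on an interval of length at most 1. With m = g b - g a, expanding the nonnegative
    integral of (g' - m) ^ 2 over [a, b] shows that the integral of g' ^ 2 is at least 2 m ^ 2 - m ^
    2 (b - a). *)
Lemma sqr_increment_le (g g' : R -> R) (a b : R) : (forall s : R, is_derive s (1 : R) g (g' s)) -> continuous g' ->
  `]0, 1[%classic a -> `]0, 1[%classic b ->
  (((g a - g b) ^+ 2)%:E <= \int[lam]_(s in `]0%R, 1%R[%classic) ((g' s) ^+ 2)%:E)%E.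
Proof.
move=> dg cg'; wlog ab : a b / a <= b => [H Ia Ib|].
  by have [ab|/ltW ab] := leP a b; [exact: H|rewrite -sqrrN opprB; exact: H].
rewrite /= !in_itv /= => /andP[a0 a1] /andP[b0 b1].
have [<-|anb] := eqVneq a b.
  by rewrite subrr expr0n; apply: integral_ge0 => s _; rewrite lee_fin sqr_ge0.
have {}ab : a < b by rewrite lt_neqAle anb.
have dg' s : derivable g s 1 := @ex_derive _ _ _ _ _ _ _ (dg s).
have cg : continuous g by move=> s; apply: differentiable_continuous; exact/derivable1_diffP.
have F : (\int[lam]_(x in `[a, b]) (g' x)%:E = (g b)%:E - (g a)%:E)%E.
  apply: continuous_FTC2 => //; first exact: continuous_subspaceT.
    by split; [move=> s _|apply: cvg_at_right_filter; exact: cg|apply: cvg_at_left_filter; exact: cg].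
  by move=> s _; rewrite derive1E; exact: (@derive_val _ _ _ _ _ _ _ (dg s)).
have ci (h : R -> R) : continuous h -> lam.-integrable `[a, b] (EFin \o h).
  move=> ch; apply: continuous_compact_integrable; first exact: segment_compact.
  exact: continuous_subspaceT.
have cg2 : continuous (fun s => g' s ^+ 2) by move=> s; exact: (cvgM (cg' s) (cg' s)).
have cgm (m : R) : continuous (fun s => m * g' s).
  by move=> s; apply: continuousM; [exact: cst_continuous|exact: cg'].
have mab : measurable (`[a, b]%classic : set (measurableTypeR R)) by exact: measurable_itv.
pose m := g b - g a.
have Fm : \int[lam]_(s in `[a, b]) g' s = m by rewrite /Rintegral F.
have Lab : lam `[a, b]%classic = (b - a)%:E by rewrite lebesgue_measure_itv /= lte_fin ab EFinB.
have S : 0 <= \int[lam]_(s in `[a, b]) (g' s ^+ 2) - 2 * m * m + m ^+ 2 * (b - a).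
  have -> : \int[lam]_(s in `[a, b]) (g' s ^+ 2) - 2 * m * m + m ^+ 2 * (b - a) =
     \int[lam]_(s in `[a, b]) (g' s ^+ 2 + ((- 2 * m) * g' s + m ^+ 2)).
    rewrite RintegralD //; last 2 first.
    - exact: ci.
    - by apply: ci => s; apply: cvgD; [exact: cgm|exact: cst_continuous].
    rewrite RintegralD //; last 2 first.
    - by apply: ci; exact: cgm.
    - by apply: ci; exact: cst_continuous.
    rewrite RintegralZl //; last exact: ci.
    by rewrite Fm Rintegral_cst //= Lab /=; ring.
  apply: Rintegral_ge0 => s _; rewrite (_ : _ + _ = (g' s - m) ^+ 2) ?sqr_ge0 //; ring.
have le : \int[lam]_(s in `[a, b]) (g' s ^+ 2) >= (g a - g b) ^+ 2.
  rewrite -sqrrN opprB -/m; apply: le_trans (_ : 2 * m * m - m ^+ 2 * (b - a) <= _); last by lra.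
  have : m ^+ 2 * (b - a) <= m ^+ 2 by rewrite ler_piMr ?sqr_ge0 //; lra.
  by rewrite expr2; lra.
apply: (@le_trans _ _ (\int[lam]_(s in `[a, b]) (g' s ^+ 2)%:E)%E).
  rewrite -[leRHS]fineK ?lee_fin //; exact: integrable_fin_num (ci _ cg2).
rewrite integral_mkcond [leRHS]integral_mkcond; apply: ge0_integral_le => s _.
  by rewrite /patch; case: ifP => // _; rewrite lee_fin sqr_ge0.
rewrite /patch; case: ifPn => [|_]; last by case: ifP => // _; rewrite lee_fin sqr_ge0.
rewrite inE /= in_itv /= => /andP[h1 h2]; rewrite ifT // inE /= in_itv /=.
by apply/andP; split; lra.
Qed.

(** The regularity on which the induction on the dimension runs: it passes directly to the slices
    obtained by fixing the first coordinate. *)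
Definition C1 n (f : 'rV[R]_n -> R) := continuous f /\
  forall k : 'I_n, (forall y, derivable f y (delta_mx ord0 k)) /\ continuous (pderiv k f).

Lemma smooth_C1 n (f : 'rV[R]_n -> R) : smooth f -> C1 f.
Proof.
move=> sf; split => [|k]; first exact: smooth_continuous.
split => [y|]; first by apply: diff_pderivable; exact: smooth_diff.
by apply: smooth_continuous; exact: smooth_pderiv.
Qed.

Lemma rV_cons_shiftS n (b : measurableTypeR R) (x : 'rV[R]_n) (k : 'I_n) (h : R) :
  rV_cons (b, h *: delta_mx ord0 k + x) = h *: delta_mx ord0 (lift ord0 k) + rV_cons (b, x).
Proof.
apply: rV_consP => [|i]; first by rewrite rVZDE !rV_cons0 /= mxE mulr0 add0r.
by rewrite rVZDE !rV_consS /= rVZDE !mxE.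
Qed.

Lemma rV_cons_shift0 n (s h : R) (x : 'rV[R]_n) :
  rV_cons ((h + s : measurableTypeR R), x) = h *: delta_mx ord0 ord0 + rV_cons ((s : measurableTypeR R), x).
Proof.
apply: rV_consP => [|i]; first by rewrite rVZDE !rV_cons0 /= mxE mulr1.
by rewrite rVZDE !rV_consS /= mxE mulr0 add0r.
Qed.

Lemma pderiv_slice n (f : 'rV[R]_n.+1 -> R) (b : measurableTypeR R) (k : 'I_n) (x : 'rV[R]_n) :
  derivable f (rV_cons (b, x)) (delta_mx ord0 (lift ord0 k)) ->
  derivable (fun y => f (rV_cons (b, y))) x (delta_mx ord0 k) /\
  pderiv k (fun y => f (rV_cons (b, y))) x = pderiv (lift ord0 k) f (rV_cons (b, x)).
Proof.
move=> df; rewrite /pderiv /derive /derivable.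
have -> : (fun h : R => h^-1 *: (((fun y => f (rV_cons (b, y))) \o shift x) (h *: delta_mx ord0 k) - f (rV_cons (b, x)))) =
    (fun h : R => h^-1 *: ((f \o shift (rV_cons (b, x))) (h *: delta_mx ord0 (lift ord0 k)) - f (rV_cons (b, x)))).
  by apply/funext => h /=; rewrite rV_cons_shiftS.
by [].
Qed.

Lemma continuous_rV_consr n (b : measurableTypeR R) : continuous (fun x : 'rV[R]_n => rV_cons (b, x)).
Proof.
move=> x; apply: (@cvg_ballP _ _ _ (nbhs x) (nbhs_filter x) _ _).2 => e e0.
apply: (@filterS _ (nbhs x) _ (ball x e)); last exact: nbhsx_ballx.
move=> y [_ xy]; split => // i j; rewrite (ord1 i).
case: (unliftP ord0 j) => [k ->|->]; last by rewrite !rV_cons0; exact: ballxx.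
by rewrite !rV_consS.
Qed.

Lemma C1_slice n (f : 'rV[R]_n.+1 -> R) (b : measurableTypeR R) : C1 f -> C1 (fun y => f (rV_cons (b, y))).
Proof.
move=> [cf df]; split => [x|k].
  by apply: continuous_comp; [exact: continuous_rV_consr|exact: cf].
have [d1 c1] := df (lift ord0 k); split => [y|].
  by have [] := pderiv_slice (d1 (rV_cons (b, y))).
have -> : pderiv k (fun y => f (rV_cons (b, y))) = fun y => pderiv (lift ord0 k) f (rV_cons (b, y)).
  by apply/funext => y; have [_] := pderiv_slice (d1 (rV_cons (b, y))).
by move=> x; apply: continuous_comp; [exact: continuous_rV_consr|exact: c1].
Qed.

Lemma is_derive_slice0 n (f : 'rV[R]_n.+1 -> R) (x : 'rV[R]_n) (s : R) : C1 f ->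
  is_derive s (1 : R) (fun s : R => f (rV_cons ((s : measurableTypeR R), x))) (pderiv ord0 f (rV_cons ((s : measurableTypeR R), x))).
Proof.
move=> [_ /(_ ord0) [df _]]; have {}df := df (rV_cons ((s : measurableTypeR R), x)).
have E : (fun h : R => h^-1 *: (((fun s : R => f (rV_cons ((s : measurableTypeR R), x))) \o shift s) (h *: (1 : R)) -
    f (rV_cons ((s : measurableTypeR R), x)))) =
  (fun h : R => h^-1 *: ((f \o shift (rV_cons ((s : measurableTypeR R), x))) (h *: delta_mx ord0 ord0) - f (rV_cons ((s : measurableTypeR R), x)))).
  by apply/funext => h /=; rewrite [h *: (1 : R)]mulr1 rV_cons_shift0.
by split; rewrite /derivable /pderiv /derive E.
Qed.

Lemma continuous_rV_consl n (x : 'rV[R]_n) : continuous (fun s : R => rV_cons ((s : measurableTypeR R), x)).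
Proof.
have -> : (fun s : R => rV_cons ((s : measurableTypeR R), x)) =
  (fun s : R => s *: delta_mx ord0 ord0 + rV_cons ((0 : measurableTypeR R), x)).
  by apply/funext => s; rewrite -rV_cons_shift0 addr0.
by move=> s; apply: cvgD; [apply: cvgZl; exact: cvg_id|exact: cvg_cst].
Qed.

Lemma continuous_measurable_sqr n (f : 'rV[R]_n -> R) (m : R) : continuous f ->
  measurable_fun setT (fun x => ((f x - m) ^+ 2)%:E).
Proof.
move=> cf; apply/measurable_EFinP/measurable_funX/measurable_funB => //.
exact: continuous_rV_measurable.
Qed.

Lemma continuous_measurable_sqrZ n (f : 'rV[R]_n -> R) (c : R) : continuous f ->
  measurable_fun setT (fun x => (c * (f x) ^+ 2)%:E).
Proof.
move=> cf; apply/measurable_EFinP/measurable_funM => //; apply: measurable_funX => //.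
exact: continuous_rV_measurable.
Qed.

(** Induction on the dimension. Comparing f with its slice at first coordinate [b] costs the
    integral of 2 (d_0 f) ^ 2; what remains is twice the same problem for the slice, whose estimate
    is then integrated over [b]. With a number [E] below every integral of (f - m) ^ 2, the claim
    involves no mean of a slice, hence no dependence of such means on [b]. *)
Lemma poincare_wirtinger_inf n : exists2 c : R, 0 <= c & forall f : 'rV[R]_n -> R, C1 f ->
  forall E : R, (forall m : R, E%:E <= \int[leb n]_(x in unit_cube) ((f x - m) ^+ 2)%:E)%E ->
  (E%:E <= \int[leb n]_(x in unit_cube) (c * \sum_k (pderiv k f x) ^+ 2)%:E)%E.
Proof.
elim: n => [|n [c c0 IH]].
  exists 0 => // f _ E /(_ (f 0)) H; apply: le_trans H _.
  rewrite [leLHS]integral0_eq; last first.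
    by move=> x _; rewrite (_ : x = 0) ?subrr ?expr0n //; apply/rowP => -[].
  by apply: integral_ge0 => x _; rewrite mul0r.
exists (2 * (1 + c)); first by rewrite mulr_ge0 // addr_ge0.
move=> f Cf E HE; have [cf df] := Cf.
pose g0 x := 2 * (pderiv ord0 f x) ^+ 2.
pose g1 x := c * \sum_k (pderiv (lift ord0 k) f x) ^+ 2.
have m0 : measurable_fun setT (fun x => (g0 x)%:E).
  by apply: continuous_measurable_sqrZ; exact: (df ord0).2.
have m1 : measurable_fun setT (fun x => (g1 x)%:E).
  apply/measurable_EFinP; apply: measurable_funM => //; apply: measurable_sum => k.
  by apply: measurable_funX; apply: continuous_rV_measurable; exact: (df _).2.
have g00 x : (0 <= (g0 x)%:E)%E by rewrite lee_fin mulr_ge0 ?sqr_ge0.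
have g10 x : (0 <= (g1 x)%:E)%E by rewrite lee_fin mulr_ge0 ?sumr_ge0 // => k _; exact: sqr_ge0.
pose A := (\int[leb n.+1]_(x in unit_cube) (g0 x)%:E)%E.
pose H := (\int[leb n.+1]_(x in unit_cube) (g1 x)%:E)%E.
have fin : (A + 2%:E * H <= \int[leb n.+1]_(x in unit_cube) (2 * (1 + c) * \sum_k (pderiv k f x) ^+ 2)%:E)%E.
  have mC := @measurable_unit_cube n.+1.
  rewrite -(ge0_integralZl_EFin _ mC (fun x _ => g10 x) (measurable_funTS m1)) //.
  have g10' x : unit_cube x -> (0 <= 2%:E * (g1 x)%:E)%E by move=> _; rewrite mule_ge0.
  rewrite -(ge0_integralD _ mC (fun x _ => g00 x) (measurable_funTS m0) g10'); last first.
    by apply: measurable_funeM; exact: measurable_funTS.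
  apply: ge0_integral_le => x _; first by rewrite adde_ge0 // mule_ge0.
  rewrite -EFinM -EFinD lee_fin /g0 /g1 big_ord_recl.
  set S := \sum_(_ < _) _; set p := _ ^+ 2.
  have S0 : 0 <= S by apply: sumr_ge0 => k _; exact: sqr_ge0.
  have p0 : 0 <= p by exact: sqr_ge0.
  by nra.
apply: le_trans fin.
have A0 : (0 <= A)%E by exact: integral_ge0.
have H0 : (0 <= H)%E by exact: integral_ge0.
have [Aoo|Afin] := eqVneq A +oo%E.
  by rewrite Aoo addye ?leey // gt_eqF // (lt_le_trans (ltNyr 0)) // mule_ge0.
have [a aE] : exists a : R, A = a%:E by exists (fine A); rewrite fineK // ge0_fin_numE // ltey.
(* The bound passed on to the slices, since E is at most a plus twice the integral of (f (b, .) - m)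
   ^ 2 for every m. If it is negative, E < a and the claim is immediate. *)
pose E' := (E - a) / 2.
have [E'0|E'0] := leP 0 E'; last first.
  apply: (@le_trans _ _ (A + 0)%E); last by rewrite leeD2l // mule_ge0.
  by rewrite adde0 aE lee_fin; move: E'0; rewrite /E'; lra.
suff HH : (E'%:E <= H)%E.
  have -> : E = a + 2 * E' by rewrite /E'; lra.
  by rewrite EFinD EFinM aE leeD2l // lee_pmul2l.
have -> : E'%:E = (\int[lam]_(b in `]0%R, 1%R[%classic) (E'%:E : \bar R))%E.
  rewrite integral_cst /=; last exact: measurable_itv.
  by rewrite lam01 mule1.
rewrite /H ge0_integral_cube_cons //; apply: ge0_integral_le => b Ib; first by rewrite lee_fin.
have := IH _ (C1_slice b Cf) E'.
have -> : (\int[leb n]_(x in unit_cube) (c * \sum_k pderiv k (fun y => f (rV_cons (b, y))) x ^+ 2)%:E =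
    \int[leb n]_(x in unit_cube) (g1 (rV_cons ((b : measurableTypeR R), x)))%:E)%E.
  apply: eq_integral => x _; rewrite /g1; congr (_ * _)%:E; apply: eq_bigr => k _.
  by have [_ ->] := pderiv_slice ((df (lift ord0 k)).1 (rV_cons ((b : measurableTypeR R), x))).
apply => m; have {HE} := HE m.
pose G x := (\int[lam]_(s in `]0%R, 1%R[%classic) (g0 (rV_cons ((s : measurableTypeR R), x)))%:E)%E.
have AG : A = (\int[leb n]_(x in unit_cube) G x)%E by rewrite /A ge0_integral_cube_consC.
have G0 x : (0 <= G x)%E by exact: integral_ge0.
have mG : measurable_fun setT G.
  pose h (p : measurableTypeR R * 'rV[R]_n) := (g0 (rV_cons p) * (\1_(I01) p.1 : R))%:E.
  have mh : measurable_fun setT h.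
    apply/measurable_EFinP; apply: measurable_funM.
      have /measurable_EFinP mg0 := m0.
      exact: measurableT_comp mg0 (@measurable_rV_cons R n).
    apply: (measurableT_comp (f := \1_I01 : measurableTypeR R -> R)); last exact: measurable_fst.
    by apply: measurable_indic; exact: measurable_itv.
  have h0 p : (0 <= h p)%E.
    by rewrite lee_fin mulr_ge0 // -lee_fin.
  have := @measurable_fun_fubini_tonelli_G _ _ _ _ _ lam h mh h0.
  congr (measurable_fun _ _); apply/funext => x; rewrite /fubini_G /G [RHS]integral_mkcond.
  apply: eq_integral => s _; rewrite /h /patch indicE /=.
  by case: ifP => _; rewrite ?mulr1 ?mulr0.
have K x : (0 <= (2 * (f (rV_cons ((b : measurableTypeR R), x)) - m) ^+ 2)%:E)%E.
  by rewrite lee_fin mulr_ge0 ?sqr_ge0.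
pose g2 y := f (rV_cons ((b : measurableTypeR R), y)) - m.
have cg2 : continuous g2.
  move=> x; have Hx : {for x, continuous (fun y => f (rV_cons ((b : measurableTypeR R), y)))}.
    by apply: continuous_comp; [exact: continuous_rV_consr|exact: cf].
  exact: (cvgB Hx (cvg_cst m)).
have le1 : (\int[leb n.+1]_(x in unit_cube) ((f x - m) ^+ 2)%:E <=
    \int[leb n]_(x in unit_cube) (G x + (2 * (g2 x) ^+ 2)%:E))%E.
  rewrite ge0_integral_cube_cons; first last.
  - by move=> x; rewrite lee_fin sqr_ge0.
  - exact: continuous_measurable_sqr.
  apply: (@le_trans _ _ (\int[lam]_(a in `]0%R, 1%R[%classic) \int[leb n]_(x in unit_cube) (G x + (2 * (g2 x) ^+ 2)%:E))%E); last first.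
    rewrite integral_cst /=; last exact: measurable_itv.
    by rewrite lam01 mule1.
  apply: ge0_integral_le => s Is; first by apply: integral_ge0 => x _; rewrite lee_fin sqr_ge0.
  apply: ge0_integral_le => x Cx; first by rewrite lee_fin sqr_ge0.
  apply: (@le_trans _ _ ((2 * (f (rV_cons ((s : measurableTypeR R), x)) - f (rV_cons ((b : measurableTypeR R), x))) ^+ 2)%:E + (2 * g2 x ^+ 2)%:E)%E).
    rewrite -EFinD lee_fin; apply: le_trans (sqrD_le _ _); rewrite /g2.
    by rewrite le_eqVlt; apply/orP; left; apply/eqP; congr (_ ^+ 2); ring.
  rewrite leeD2r //; rewrite /G /g0.
  have mp : measurable_fun (`]0, 1[%classic : set (measurableTypeR R))
      (fun s : measurableTypeR R => ((pderiv ord0 f (rV_cons (s, x))) ^+ 2)%:E).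
    apply: measurable_funTS; apply/measurable_EFinP.
    apply: measurable_funX; apply: continuous_measurable_fun => t.
    by apply: continuous_comp; [exact: continuous_rV_consl|exact: (df ord0).2].
  have p0 (s0 : measurableTypeR R) : `]0, 1[%classic s0 -> (0 <= ((pderiv ord0 f (rV_cons (s0, x))) ^+ 2)%:E)%E.
    by move=> _; rewrite lee_fin sqr_ge0.
  have EZ := @ge0_integralZl_EFin _ _ _ lam _ (measurable_itv _) _ p0 mp 2 (ler0n _ _).
  rewrite (_ : (\int[lam]_(s0 in _) _)%E = (2%:E * \int[lam]_(x0 in `]0%R, 1%R[%classic) ((pderiv ord0 f (rV_cons ((x0 : measurableTypeR R), x))) ^+ 2)%:E)%E); last first.
    by rewrite -EZ; apply: eq_integral => t _; rewrite EFinM.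
  rewrite EFinM lee_pmul2l //.
  apply: (@sqr_increment_le (fun s : R => f (rV_cons ((s : measurableTypeR R), x)))) => //.
    by move=> t; exact: is_derive_slice0.
  by move=> t; apply: continuous_comp; [exact: continuous_rV_consl|exact: (df ord0).2].
have mC := @measurable_unit_cube n.
move=> /le_trans /(_ le1).
rewrite (ge0_integralD _ mC (fun x _ => G0 x) (measurable_funTS mG)); last 2 first.
- by move=> x _; exact: K.
- by apply: measurable_funTS; exact: continuous_measurable_sqrZ.
rewrite -AG aE; under eq_integral do rewrite EFinM.
have m2 : measurable_fun (@unit_cube R n) (fun x => (g2 x ^+ 2)%:E).
  by apply/measurable_EFinP/measurable_funX; exact: continuous_rV_measurable.
rewrite (ge0_integralZl_EFin _ mC _ m2) //; last by move=> x _; rewrite lee_fin sqr_ge0.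
have -> : E = a + 2 * E' by rewrite /E'; lra.
by rewrite EFinD EFinM leeD2lE // lee_pmul2l.
Qed.

Lemma integrable_EFin_Rintegral d (T : measurableType d) (mu : {measure set T -> \bar R}) (D : set T) (f : T -> R) :
  measurable D -> mu.-integrable D (EFin \o f) -> (\int[mu]_(x in D) (f x)%:E = (\int[mu]_(x in D) f x)%:E)%E.
Proof. by move=> mD fi; rewrite /Rintegral fineK //; exact: integrable_fin_num. Qed.

Lemma Rintegral_sum d (T : measurableType d) (mu : {measure set T -> \bar R}) (D : set T)
    (I : Type) (r : seq I) (f : I -> T -> R) : measurable D ->
  (forall i, mu.-integrable D (EFin \o f i)) ->
  \int[mu]_(x in D) (\sum_(i <- r) f i x) = \sum_(i <- r) \int[mu]_(x in D) f i x.
Proof.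
move=> mD fi; elim: r => [|i r IH].
  by under eq_Rintegral do rewrite big_nil; rewrite Rintegral_cst // mul0r big_nil.
under eq_Rintegral do rewrite big_cons.
rewrite RintegralD ?IH ?big_cons //.
apply: eq_integrable (integrable_sum mD r (fun i _ => fi i)) => // x _ /=.
by rewrite sumEFin.
Qed.

Lemma L2_CS d (T : measurableType d) (mu : {measure set T -> \bar R}) (D : set T) (f g : T -> R) :
  measurable D -> L2 mu D f -> L2 mu D g ->
  (\int[mu]_(x in D) (f x * g x)) ^+ 2 <= \int[mu]_(x in D) (f x ^+ 2) * \int[mu]_(x in D) (g x ^+ 2).
Proof.
move=> mD Lf Lg; rewrite mulrC; apply: sip_quad; try by apply: Rintegral_ge0 => x _; exact: sqr_ge0.
move=> a.
have i1 : mu.-integrable D (EFin \o (fun x => a ^+ 2 * f x ^+ 2)).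
  by apply: eq_integrable (integrableZl mD (a ^+ 2) (L2_integrable_sqr Lf)).
have i2 : mu.-integrable D (EFin \o (fun x => (2 * a) * (f x * g x))).
  by apply: eq_integrable (integrableZl mD (2 * a) (L2M_integrable mD Lf Lg)).
have i3 := L2_integrable_sqr Lg.
have i23 : mu.-integrable D (EFin \o (fun x => (2 * a) * (f x * g x) + g x ^+ 2)).
  by apply: eq_integrable (integrableD mD i2 i3).
rewrite -!RintegralZl //; [|exact: L2M_integrable|exact: L2_integrable_sqr].
rewrite -addrA -RintegralD // -RintegralD //.
apply: Rintegral_ge0 => x _; rewrite (_ : _ + _ = (a * f x + g x) ^+ 2) ?sqr_ge0 //; ring.
Qed.

Lemma continuous_box_bounded n (f : 'rV[R]_n -> R) (M : R) : continuous f ->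
  exists2 K : R, 0 <= K & forall x, box n M x -> `|f x| <= K.
Proof.
move=> cf; have [K K0 H] := continuous_compact_bounded (@compact_cbox R n M) cf.
exists K => // x Mx; apply: H => i; have := Mx i; rewrite /= in_itv /= -ltr_norml; exact: ltW.
Qed.

Lemma continuous_L2 n (D : set 'rV[R]_n) (f : 'rV[R]_n -> R) (M : R) : measurable D -> D `<=` box n M ->
  (leb n D < +oo)%E -> continuous f -> L2 (leb n) D f.
Proof.
move=> mD DM Doo cf; have [K _ HK] := continuous_box_bounded M cf.
apply: (@L2_bounded _ _ _ _ _ mD Doo _ K); first exact: continuous_rV_measurable.
by move=> x /DM; exact: HK.
Qed.

Lemma unit_cube_box n : @unit_cube R n `<=` box n 1.
Proof. by move=> x Cx k; have := Cx k; rewrite /= in_itv /= => /andP[? ?]; apply/andP; split; lra. Qed.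

Lemma smooth_L2_cube n (f : 'rV[R]_n -> R) : smooth f -> L2 (leb n) unit_cube f.
Proof.
move=> sf; apply: continuous_L2 (@unit_cube_box n) (@unit_cube_lty n) _; first exact: measurable_unit_cube.
exact: smooth_continuous.
Qed.

Definition gradsq n (f : 'rV[R]_n -> R) := \sum_k \int[leb n]_(x in unit_cube) (pderiv k f x ^+ 2).

Lemma poincare_wirtinger n : exists2 c : R, 0 <= c & forall f : 'rV[R]_n -> R, smooth f ->
  \int[leb n]_(x in unit_cube) f x = 0 ->
  \int[leb n]_(x in unit_cube) (f x ^+ 2) <= c * gradsq f.
Proof.
have [c c0 H] := poincare_wirtinger_inf n; exists c => // f sf f0.
have mC := @measurable_unit_cube n; have Coo := @unit_cube_lty n.
have Lf := smooth_L2_cube sf.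
have ip k : (leb n).-integrable unit_cube (EFin \o (fun x => pderiv k f x ^+ 2)).
  by apply: L2_integrable_sqr; apply: smooth_L2_cube; exact: smooth_pderiv.
have isum : (leb n).-integrable unit_cube (EFin \o (fun x => \sum_k pderiv k f x ^+ 2)).
  apply: eq_integrable (integrable_sum mC (index_enum 'I_n) (fun k _ => ip k)) => // x _ /=.
  by rewrite sumEFin.
rewrite -lee_fin; apply: le_trans (H f (smooth_C1 sf) _ _) _.
  move=> m.
  have Lm : L2 (leb n) unit_cube (fun x => f x - m) by apply: L2B => //; exact: L2_cst.
  rewrite integrable_EFin_Rintegral //; last exact: L2_integrable_sqr Lm.
  have i2 : (leb n).-integrable unit_cube (EFin \o (fun x => (- 2 * m) * f x)).
    by apply: eq_integrable (integrableZl mC (- 2 * m) (L2_integrable mC Coo Lf)).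
  have i3 : (leb n).-integrable unit_cube (EFin \o (fun x => m ^+ 2)).
    by apply: L2_integrable => //; exact: L2_cst.
  have -> : \int[leb n]_(x in unit_cube) ((f x - m) ^+ 2) =
      \int[leb n]_(x in unit_cube) (f x ^+ 2 + ((- 2 * m) * f x + m ^+ 2)).
    by congr Rintegral; apply/funext => x; ring.
  rewrite RintegralD //; [|exact: L2_integrable_sqr|by apply: eq_integrable (integrableD mC i2 i3)].
  rewrite RintegralD // RintegralZl //; last exact: L2_integrable.
  by rewrite f0 mulr0 add0r Rintegral_cst //= leb_unit_cube mulr1 lee_fin lerDl sqr_ge0.
have ic : (leb n).-integrable unit_cube (EFin \o (fun x => c * \sum_k pderiv k f x ^+ 2)).
  by apply: eq_integrable (integrableZl mC c isum).
by rewrite integrable_EFin_Rintegral // RintegralZl // Rintegral_sum.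
Qed.

(** As q has mean zero, f may be replaced by f minus its mean before Cauchy-Schwarz. This is the
    bound of q in the dual norm that later makes oscillating factors small. *)
Lemma poincare_wirtinger_dual n : exists2 c : R, 0 <= c & forall (q f : 'rV[R]_n -> R),
  L2 (leb n) unit_cube q -> \int[leb n]_(x in unit_cube) q x = 0 -> smooth f ->
  (\int[leb n]_(x in unit_cube) (q x * f x)) ^+ 2 <=
  c * \int[leb n]_(x in unit_cube) (q x ^+ 2) * gradsq f.
Proof.
have [c c0 H] := poincare_wirtinger n; exists c => // q f Lq q0 sf.
have mC := @measurable_unit_cube n; have Coo := @unit_cube_lty n.
have Lf := smooth_L2_cube sf.
pose m := \int[leb n]_(x in unit_cube) f x.
pose g x := f x + - m.
have sg : smooth g by apply: smoothD => //; exact: smooth_cst.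
have Lg := smooth_L2_cube sg.
have im : (leb n).-integrable unit_cube (EFin \o (fun x => - m)).
  by apply: L2_integrable => //; exact: L2_cst.
have g0 : \int[leb n]_(x in unit_cube) g x = 0.
  rewrite RintegralD //; last exact: L2_integrable.
  by rewrite Rintegral_cst //= leb_unit_cube mulr1 subrr.
have gg : gradsq g = gradsq f.
  apply: eq_bigr => k _; congr Rintegral; apply/funext => x; congr (_ ^+ 2).
  rewrite pderivD ?pderiv_cst ?addr0 //; move=> y; first exact: smooth_diff.
have qg : \int[leb n]_(x in unit_cube) (q x * g x) = \int[leb n]_(x in unit_cube) (q x * f x).
  have -> : \int[leb n]_(x in unit_cube) (q x * g x) = \int[leb n]_(x in unit_cube) (q x * f x + (- m) * q x).
    by congr Rintegral; apply/funext => x; rewrite /g; ring.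
  have iq : (leb n).-integrable unit_cube (EFin \o (fun x => - m * q x)).
    by apply: eq_integrable (integrableZl mC (- m) (L2_integrable mC Coo Lq)).
  have iqf := L2M_integrable mC Lq Lf.
  rewrite (RintegralD mC iqf iq) (RintegralZl (- m) mC (L2_integrable mC Coo Lq)).
  by rewrite q0 mulr0 addr0.
rewrite -qg -gg; apply: le_trans (L2_CS mC Lq Lg) _.
have := H g sg g0.
have : 0 <= \int[leb n]_(x in unit_cube) (q x ^+ 2) by apply: Rintegral_ge0 => x _; exact: sqr_ge0.
move: (Rintegral _ _ (fun x => q x ^+ 2)) (Rintegral _ _ (fun x => g x ^+ 2)) (gradsq g) => I J G I0 h.
by rewrite (_ : c * I * G = I * (c * G)); [exact: ler_wpM2l|ring].
Qed.

(** Writing 1 as the derivative of x_k and integrating by parts turns psi ^ 2 into - 2 x_k psi d_k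
    psi, which on [O] is at most psi ^ 2 / 2 + 2 M ^ 2 (d_k psi) ^ 2. Half of the left side is
    absorbed, whence 4 M ^ 2. *)
Lemma friedrichs n (O : set 'rV[R]_n) (M : R) (k : 'I_n) (psi : 'rV[R]_n -> R) : O `<=` box n M -> 0 < M ->
  test_function O psi ->
  \int[leb n]_(x in O) (psi x ^+ 2) <= 4 * M ^+ 2 * \int[leb n]_(x in O) (pderiv k psi x ^+ 2).
Proof.
move=> OM M0 tpsi; have [spsi _] := tpsi.
have [K _ pK] := test_function_coord_bounded tpsi.
have dK := coord_bounded_pderiv k pK.
have tk := test_function_pderiv k tpsi.
have r1 x : ~ O x -> psi x ^+ 2 = 0 by move=> Ox; rewrite (test_function_out tpsi Ox) expr0n.
have r2 x : ~ O x -> pderiv k psi x ^+ 2 = 0 by move=> Ox; rewrite (test_function_out tk Ox) expr0n.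
rewrite (Rintegral_restrict r1) (Rintegral_restrict r2).
have cp := smooth_continuous spsi; have cd := smooth_continuous (smooth_pderiv k spsi).
pose p2 x := psi x * psi x.
have sp2 : smooth p2 by exact: smoothM.
have p2K : coord_bounded K p2 by move=> x Kx; rewrite /p2 pK // mul0r.
have := integral_by_parts k (smooth_coord k) sp2 p2K.
have dx : pderiv k (fun x : 'rV[R]_n => x ord0 k) = fun=> 1.
  have := @pderiv_coord R n 1 0 k k; under [X in pderiv _ X]eq_fun do rewrite mul1r addr0.
  by rewrite eqxx mulr1.
rewrite dx.
have -> : (fun x : 'rV[R]_n => 1 * p2 x) = fun x => psi x ^+ 2 by apply/funext => x; rewrite mul1r.
have dp2 : pderiv k p2 = fun x => 2 * psi x * pderiv k psi x.
  by rewrite /p2 pderivM; [apply/funext => x; ring|move=> x; exact: smooth_diff..].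
rewrite dp2 => E.
have i1 : (leb n).-integrable setT (EFin \o (fun x => psi x ^+ 2)).
  apply: (@continuous_cb_integrable R n _ K); last by move=> x Kx; rewrite pK // expr0n.
  by move=> x; exact: (cvgM (cp x) (cp x)).
have i2 : (leb n).-integrable setT (EFin \o (fun x => pderiv k psi x ^+ 2)).
  apply: (@continuous_cb_integrable R n _ (K + 1)); last by move=> x Kx; rewrite dK // expr0n.
  by move=> x; exact: (cvgM (cd x) (cd x)).
have i1' : (leb n).-integrable setT (EFin \o (fun x => 2^-1 * psi x ^+ 2)).
  by apply: eq_integrable (integrableZl measurableT 2^-1 i1).
have i2' : (leb n).-integrable setT (EFin \o (fun x => 2 * M ^+ 2 * pderiv k psi x ^+ 2)).
  by apply: eq_integrable (integrableZl measurableT (2 * M ^+ 2) i2).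
have i3 : (leb n).-integrable setT (EFin \o (fun x : 'rV[R]_n => x ord0 k * (2 * psi x * pderiv k psi x))).
  apply: (@continuous_cb_integrable R n _ K).
    apply: smooth_continuous; apply: smoothM; first exact: smooth_coord.
    by apply: smoothM; [exact: smoothZ|exact: smooth_pderiv].
  by move=> x Kx; rewrite pK // mulr0 mul0r mulr0.
have : - (\int[leb n]_x (x ord0 k * (2 * psi x * pderiv k psi x))) <=
    2^-1 * \int[leb n]_x (psi x ^+ 2) + 2 * M ^+ 2 * \int[leb n]_x (pderiv k psi x ^+ 2).
  have i4 : (leb n).-integrable setT (EFin \o (fun x : 'rV[R]_n => -1 * (x ord0 k * (2 * psi x * pderiv k psi x)))).
    by apply: eq_integrable (integrableZl measurableT (-1) i3).
  have i5 : (leb n).-integrable setT (EFin \o (fun x : 'rV[R]_n => 2^-1 * psi x ^+ 2 + 2 * M ^+ 2 * pderiv k psi x ^+ 2)).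
    by apply: eq_integrable (integrableD measurableT i1' i2').
  rewrite -mulN1r -(RintegralZl _ measurableT i3) -(RintegralZl _ measurableT i1) -(RintegralZl _ measurableT i2).
  rewrite -RintegralD //; apply: (le_Rintegral measurableT i4 i5).
  - move=> x _; have [Ox|Ox] := pselect (O x); last first.
      rewrite (test_function_out tpsi Ox); have h5 := sqr_ge0 (pderiv k psi x); have h6 := sqr_ge0 M.
      by nra.
    have : `|x ord0 k| < M by have := OM x Ox k; rewrite /= in_itv /= ltr_norml.
    rewrite ltr_norml => /andP[h1 h2].
    have h3 : x ord0 k ^+ 2 <= M ^+ 2 by nra.
    have h4 := sqr_ge0 (psi x + 2 * x ord0 k * pderiv k psi x).
    have h5 := sqr_ge0 (pderiv k psi x).
    nra.
rewrite E opprK; set I := Rintegral _ _ _; set J := Rintegral _ _ _; lra.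
Qed.

Lemma cell_periodic_upd n (f : 'rV[R]_n -> R) (x : 'rV[R]_n) k : cell_periodic f -> f (upd x k 1) = f (upd x k 0).
Proof. by move=> fp; rewrite -[1 in LHS]addr0 upd_addE scale1r addrC fp. Qed.

(** On each line across the cube the fundamental theorem of calculus gives the difference of the
    values at opposite faces. *)
Lemma periodic_pderiv0 n (f : 'rV[R]_n -> R) (k : 'I_n) : smooth f -> cell_periodic f ->
  \int[leb n]_(x in unit_cube) pderiv k f x = 0.
Proof.
move=> sf fp; have sd := smooth_pderiv k sf; have cd := smooth_continuous sd.
have mC := @measurable_unit_cube n.
pose g x := pderiv k f x * (\1_(@unit_cube R n) x : R).
have [M M0 HM] := continuous_box_bounded 1 cd.
have gM x : `|g x| <= M.
  rewrite /g indicE; case: (boolP (x \in unit_cube)) => [|_]; last by rewrite mulr0 normr0.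
  by rewrite inE mulr1 => /unit_cube_box; exact: HM.
have gK : coord_bounded 1 g.
  move=> x [i Hi]; rewrite /g indicE memNset ?mulr0 // => /(_ i) /andP[x0 x1].
  by move: Hi; rewrite gtr0_norm // leNgt x1.
have mg : measurable_fun setT g.
  by apply: measurable_funM; [exact: continuous_rV_measurable|exact: measurable_indic].
have -> : \int[leb n]_(x in unit_cube) pderiv k f x = \int[leb n]_x g x.
  rewrite Rintegral_mkcond; congr Rintegral; apply/funext => x; rewrite /patch /g indicE.
  by case: ifP => _; rewrite ?mulr1 ?mulr0.
rewrite /Rintegral (integral_slice0 (k := k) mg gM gK) // => x.
have [H|H] := pselect (forall i, i != k -> 0 < x ord0 i < 1); last first.
  rewrite integral0_eq // => s _; rewrite /g indicE memNset ?mulr0 // => Cx; apply: H => i ik.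
  by have := Cx i; rewrite mxE (negbTE ik).
have -> : (\int[lam]_s (g (upd x k s))%:E = \int[lam]_(s in `]0%R, 1%R[%classic) (pderiv k f (upd x k s))%:E)%E.
  rewrite [RHS]integral_mkcond; apply: eq_integral => s _; rewrite /g /patch indicE.
  case: (boolP (s \in _)) => [|/negP]; rewrite inE /= in_itv /= => Hs.
    rewrite mem_set ?mulr1 // => i; rewrite mxE; case: eqP => // /eqP; exact: H.
  rewrite memNset ?mulr0 // => /(_ k); by rewrite mxE eqxx.
have ds s := is_derive_upd (diff_pderivable (i := k) (smooth_diff (upd x k s) sf)).
have cg : continuous (fun s => pderiv k f (upd x k s)).
  move=> s; apply: (@continuous_comp _ _ _ (fun s => upd x k s) (pderiv k f)); last exact: cd.
  have -> : (fun s => upd x k s) = (fun s => s *: (delta_mx ord0 k : 'rV[R]_n) + upd x k 0).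
    by apply/funext => t; rewrite -[t in LHS]addr0 upd_addE.
  by apply: cvgD; [apply: cvgZl; exact: cvg_id|exact: cvg_cst].
have ch : continuous (fun s => f (upd x k s)).
  by move=> s; apply: differentiable_continuous; apply/derivable1_diffP; exact: (@ex_derive _ _ _ _ _ _ _ (ds s)).
have F : (\int[lam]_(s in `[0%R, 1%R]) (pderiv k f (upd x k s))%:E = (f (upd x k 1))%:E - (f (upd x k 0))%:E)%E.
  apply: (continuous_FTC2 (F := fun s => f (upd x k s))) => //.
  - exact: continuous_subspaceT.
  - split; first by move=> s _; exact: (@ex_derive _ _ _ _ _ _ _ (ds s)).
    + by apply: cvg_at_right_filter; exact: ch.
    + by apply: cvg_at_left_filter; exact: ch.
  - by move=> s _; rewrite derive1E; exact: (@derive_val _ _ _ _ _ _ _ (ds s)).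
rewrite cell_periodic_upd // subee // in F; rewrite -[RHS]F.
rewrite integral_itv_obnd_cbnd ?integral_itv_bndo_bndc //.
  by apply: measurable_funTS; apply/measurable_EFinP; exact: continuous_measurable_fun.
by apply: measurable_funTS; apply/measurable_EFinP; exact: continuous_measurable_fun.
Qed.

End poincare.

(** * Periodic functions on a small scale *)

(** Makes differentiability a local property: two functions equal near x differ by a function
    vanishing near x. *)
Lemma near0_differentiable (K : numFieldType) (V W : normedModType K) (h : V -> W) (x : V) :
  (\forall y \near x, h y = 0) -> differentiable h x.
Proof.
move=> h0; have hx : h x = 0 := nbhs_singleton h0.
have E : h \o shift x = cst (h x) + \0 +o_ 0 id.
  apply/eqaddoP => e e0.
  have := h0; rewrite (near_shift 0) subr0 /=; apply: filterS => y Hy.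
  by rewrite [X in `|X|](_ : _ = h (y + x)) ?Hy ?normr0 ?mulr_ge0 ?(ltW e0) // !fctE /= hx addr0 subr0.
have c0 : continuous (\0 : V -> W) by exact: cst_continuous.
by apply/diff_locallyP; rewrite (diff_unique c0 E).
Qed.

Lemma sume_const (R : realType) (I : finType) (x : \bar R) : (0 <= x)%E ->
  (\sum_(i : I) x = #|I|%:R%:E * x)%E.
Proof.
move=> x0; rewrite big_const; elim: #|_| => [|m IH] /=; first by rewrite mul0e.
by rewrite IH -nat1r EFinD ge0_muleDl ?lee_fin // mul1e.
Qed.

(** The sum of the squared deviations from the mean is nonnegative. *)
Lemma sqr_sum_le (R : realType) (I : finType) (a : I -> R) :
  (\sum_i a i) ^+ 2 <= #|I|%:R * \sum_i a i ^+ 2.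
Proof.
have [I0|I0] := posnP #|I|.
  rewrite big1 ?expr0n ?I0 ?mul0r // => i _.
  by have := fintype0 i I0.
pose m := (\sum_i a i) / #|I|%:R.
have In0 : #|I|%:R != 0 :> R by rewrite pnatr_eq0 -lt0n.
have : 0 <= \sum_i (a i - m) ^+ 2 by apply: sumr_ge0 => i _; exact: sqr_ge0.
have -> : \sum_i (a i - m) ^+ 2 = \sum_i a i ^+ 2 - (2 * m * \sum_i a i - #|I|%:R * m ^+ 2).
  have -> : #|I|%:R * m ^+ 2 = \sum_(i : I) m ^+ 2 by rewrite sumr_const mulr_natl.
  rewrite mulr_sumr -!sumrB; apply: eq_bigr => i _; ring.
have -> : 2 * m * \sum_i a i - #|I|%:R * m ^+ 2 = (\sum_i a i) ^+ 2 / #|I|%:R by rewrite /m; field.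
by rewrite subr_ge0 ler_pdivrMr ?ltr0n // mulrC.
Qed.

Section smooth_local.
Context {R : realType} {n : nat}.
Local Notation T := 'rV[R]_n.

Lemma near_eq_differentiable (f g : T -> R) (x : T) : (\forall y \near x, f y = g y) -> differentiable g x ->
  differentiable f x.
Proof.
move=> fg dg; rewrite (_ : f = (fun y => g y + (f y - g y))); last first.
  by apply/funext => y; rewrite addrC subrK.
apply: differentiableD => //; apply: near0_differentiable.
by apply: filterS fg => y ->; rewrite subrr.
Qed.

Lemma near_pderiv (f g : T -> R) k (x : T) : (\forall y \near x, f y = g y) -> \forall y \near x, pderiv k f y = pderiv k g y.
Proof.
rewrite -nbhs_nearE nbhsE => -[U [oU Ux] UH].
rewrite -nbhs_nearE nbhsE; exists U => // y Uy; apply: pderiv_near.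
rewrite -nbhs_nearE nbhsE; exists U => //.
Qed.

(** For periodizations, which near each point are finite sums of smooth functions. *)
Lemma smooth_local (f : T -> R) : (forall x : T, exists2 g, smooth g & \forall y \near x, f y = g y) -> smooth f.
Proof.
move=> H; apply/smoothE => m; elim: m f H => [|m IH] f H.
  split => // x; have [g sg fg] := H x.
  by apply: (near_eq_differentiable fg); exact: smooth_diff.
split => [x|i].
  by have [g sg fg] := H x; apply: (near_eq_differentiable fg); exact: smooth_diff.
apply: IH => x; have [g sg fg] := H x; exists (pderiv i g); first exact: smooth_pderiv.
exact: near_pderiv.
Qed.

End smooth_local.

Section affine_integral.
Context {R : realType}.
Local Notation leb := (@lebesgue_rV R).

Lemma measurable_affine n (c : R) (v : 'rV[R]_n) : measurable_fun setT (fun x : 'rV[R]_n => c *: x + v).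
Proof.
apply: measurable_fun_rV => i; under eq_fun do rewrite rVZDE.
by apply: measurable_funD => //; apply: measurable_funM => //; exact: measurable_coord.
Qed.

Lemma integrable_affine n (c : R) (v : 'rV[R]_n) (f : 'rV[R]_n -> R) : 0 < c ->
  (leb n).-integrable setT (EFin \o f) -> (leb n).-integrable setT (EFin \o (fun x => f (c *: x + v))).
Proof.
move=> c0 /integrableP[mf fi].
have mfa : measurable_fun setT (EFin \o (fun x => f (c *: x + v))).
  exact: (measurableT_comp mf (measurable_affine c v)).
apply/integrableP; split => //.
have mn : measurable_fun setT (fun x => `|(EFin \o f) x|)%E by exact: measurableT_comp.
have := ge0_integral_affine v c0 mn (fun x => abse_ge0 _); move: fi => /[swap] ->.
rewrite !ltey; apply: contra_neq => H.
by rewrite [X in (_ * X)%E](_ : _ = +oo%E) // gt0_muley // lte_fin exprn_gt0.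
Qed.

Lemma Rintegral_affine n (c : R) (v : 'rV[R]_n) (f : 'rV[R]_n -> R) : 0 < c ->
  (leb n).-integrable setT (EFin \o f) ->
  \int[leb n]_x f x = c ^+ n * \int[leb n]_x f (c *: x + v).
Proof.
move=> c0 fi; have fia := integrable_affine v c0 fi.
have mf := measurable_int _ fi.
have E : (\int[leb n]_x (f x)%:E = (c ^+ n)%:E * \int[leb n]_x (f (c *: x + v))%:E)%E.
  rewrite integralE [in RHS]integralE muleBr //; last first.
    by apply: fin_num_adde_defr; apply: integrable_pos_fin_num.
  congr (_ - _)%E.
    have := ge0_integral_affine v c0 (measurable_funepos mf) (funepos_ge0 _).
    by move=> ->; congr (_ * _)%E; apply: eq_integral => x _; rewrite !funeposE.
  have := ge0_integral_affine v c0 (measurable_funeneg mf) (funeneg_ge0 _).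
  by move=> ->; congr (_ * _)%E; apply: eq_integral => x _; rewrite !funenegE.
by rewrite /Rintegral E fineM //; exact: integrable_fin_num.
Qed.

End affine_integral.

(** * Tiling by unit cells, periodization and scaling *)

Section lattice.
Context {R : realType} {n : nat}.
Local Notation T := 'rV[R]_n.
Local Notation leb := (@lebesgue_rV R n).

Definition zv (z : 'rV[int]_n) : T := \row_k (z ord0 k)%:~R.

(** The integer vectors with entries in [-N, N), indexed by a finite type so that sums over cells
    are finite sums. *)
Definition zI N (z : 'rV['I_(N + N)]_n) : 'rV[int]_n := \row_k ((z ord0 k)%:Z - N%:Z).

(** Half-open, so that its integer translates partition the space; it exceeds the open [unit_cube]
    by a null set. *)
Definition cube0 : set T := pbox n `[0, 1[%classic.

Definition hbox (N : nat) : set T := [set x | forall k, - N%:R <= x ord0 k < N%:R].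

Lemma periodic_zv U (f : T -> U) y z : cell_periodic f -> f (y + zv z) = f y.
Proof.
move=> fp.
have pn (m : nat) k y' : f (y' + m%:R *: delta_mx ord0 k) = f y'.
  elim: m => [|m IH]; first by rewrite scale0r addr0.
  by rewrite -natr1 scalerDl scale1r addrA fp IH.
have pz (m : int) k y' : f (y' + m%:~R *: delta_mx ord0 k) = f y'.
  case: m => m; first exact: pn.
  by rewrite NegzE mulrNz scaleNr -{2}[y'](subrK (m.+1%:R *: delta_mx ord0 k)) pn.
have -> : zv z = \sum_k (z ord0 k)%:~R *: delta_mx ord0 k.
  by rewrite [LHS]row_sum_delta; apply: eq_bigr => k _; rewrite mxE.
elim: (index_enum _) y => [|k r IH] y; first by rewrite big_nil addr0.
by rewrite big_cons addrA IH pz.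
Qed.

Lemma zI_inj N : injective (@zI N).
Proof.
move=> z z' /rowP E; apply/rowP => k; have := E k; rewrite !mxE => /addIr [] H.
exact/val_inj.
Qed.

Lemma tile_unique (N : nat) x : hbox N x ->
  exists z : 'rV['I_(N + N)]_n, forall z', cube0 (x - zv (zI z')) <-> z' = z.
Proof.
move=> Nx.
have /choice[z zP] : forall k, exists j : 'I_(N + N), (j%:Z - N%:Z)%:~R <= x ord0 k < (j%:Z - N%:Z + 1)%:~R.
  move=> k; have /andP[h1 h2] := Nx k; have /andP[h3 h4] := floor_itv (x ord0 k).
  (* The index in each coordinate is the floor of x, shifted by N to become a natural number below 2
     N. *)
  pose m := Num.floor (x ord0 k) + N%:Z.
  have m0 : 0 <= m.
    have : (- N%:Z)%:~R < (Num.floor (x ord0 k) + 1)%:~R :> R.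
      by rewrite mulrNz; exact: le_lt_trans h1 h4.
    by rewrite ltr_int /m; lia.
  have mN : m < (N + N)%:Z.
    have : (Num.floor (x ord0 k))%:~R < N%:Z%:~R :> R by exact: le_lt_trans h3 h2.
    by rewrite ltr_int /m; lia.
  have [j jE] : exists j : nat, m = j%:Z by exists `|m|%N; rewrite gez0_abs.
  have jN : (j < N + N)%N by rewrite jE in mN.
  by exists (Ordinal jN); rewrite /= -jE /m addrK; apply/andP.
exists (\row_k z k) => z'; split => [H|-> k].
  apply/rowP => k; apply/val_inj; have := H k; rewrite !mxE /= in_itv /= => /andP[h1 h2].
  have /floor_def E1 : ((z' ord0 k)%:Z - N%:Z)%:~R <= x ord0 k < ((z' ord0 k)%:Z - N%:Z + 1)%:~R.
    by rewrite -subr_ge0 h1 /= [X in _ < X]intrD -ltrBlDl.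
  have := floor_def (zP k); rewrite E1 => /addIr [] //.
by have := zP k; rewrite !mxE /= in_itv /= => /andP[h1 h2]; rewrite subr_ge0 h1 /= ltrBlDl -[X in _ + X]/(1%:~R) -intrD.
Qed.

Lemma tile_sum (N : nat) x : hbox N x -> \sum_(z : 'rV['I_(N + N)]_n) (\1_cube0 (x - zv (zI z)) : R) = 1.
Proof.
move=> /tile_unique[z zP]; rewrite (bigD1 z) //= big1 ?addr0.
  by rewrite indicE mem_set //; apply/zP.
by move=> z' zz'; rewrite indicE memNset // => /zP /eqP; rewrite (negbTE zz').
Qed.

Lemma measurable_cube0 : measurable cube0.
Proof. by apply: measurable_pbox; exact: measurable_itv. Qed.

Lemma leb_cube0D : leb (cube0 `\` unit_cube) = 0%E.
Proof.
have mc := measurable_cube0; have mu := @measurable_unit_cube R n.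
have uc : unit_cube `<=` cube0.
  by move=> x H k; have /andP[h1 h2] := H k; rewrite /= in_itv /= (ltW h1).
have l01 : (@lebesgue_measure R) `[0, 1[%classic = 1%:E.
  by rewrite lebesgue_measure_itv /= lte_fin ltr01 oppr0 adde0.
have lc : leb cube0 = 1%E by rewrite /cube0 (leb_pbox n (measurable_itv _) l01) expr1n.
have oo : (leb cube0 < +oo)%E by rewrite lc ltry.
have -> := measureD mc mu oo.
have -> : cube0 `&` unit_cube = unit_cube by apply/setIidPr.
have lu := @leb_unit_cube R n.
by rewrite [X in (X - _)%E]lc [X in (_ - X)%E]lu subee.
Qed.

Lemma integral_cube0 (f : T -> \bar R) :
  (\int[leb]_(x in cube0) f x = \int[leb]_(x in unit_cube) f x)%E.
Proof.
rewrite integral_mkcond [RHS]integral_mkcond.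
apply: (@integral_eq_off _ _ _ _ _ (cube0 `\` unit_cube)); last 1 first.
- move=> x _ Hx; rewrite /patch; case: (boolP (x \in unit_cube)) => [|/negP].
    by rewrite inE => H; rewrite mem_set // => k; have /andP[h1 h2] := H k; rewrite /= in_itv /= (ltW h1).
  by rewrite inE => ux; rewrite memNset // => cx; apply: Hx.
- by apply: measurableD; [exact: measurable_cube0|exact: measurable_unit_cube].
- exact: leb_cube0D.
Qed.

Lemma Rintegral_cube0 (f : T -> R) : \int[leb]_(x in cube0) f x = \int[leb]_(x in unit_cube) f x.
Proof. by rewrite /Rintegral integral_cube0. Qed.

Lemma ge0_tile_integral (N : nat) (f : T -> R) : measurable_fun setT f -> (forall x, 0 <= f x) ->
  (forall x, ~ hbox N x -> f x = 0) ->
  (\int[leb]_x (f x)%:E = \sum_(z : 'rV['I_(N + N)]_n) \int[leb]_(x in unit_cube) (f (x + zv (zI z)))%:E)%E.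
Proof.
move=> mf f0 fN.
have E x : (f x)%:E = (\sum_(z : 'rV['I_(N + N)]_n) (f x * \1_cube0 (x - zv (zI z)))%:E)%E.
  rewrite sumEFin -mulr_sumr; have [Nx|Nx] := pselect (hbox N x).
    by rewrite tile_sum // mulr1.
  by rewrite fN // mul0r.
under eq_integral do rewrite E.
have mi (z : 'rV['I_(N + N)]_n) : measurable_fun setT (fun x => (f x * \1_cube0 (x - zv (zI z)))%:E).
  apply/measurable_EFinP; apply: measurable_funM => //.
  have := @measurable_affine R n 1 (- zv (@zI N z)).
  under eq_fun do rewrite scale1r.
  move=> H; apply: (measurableT_comp (f := \1_cube0 : T -> R)) H; apply: measurable_indic; exact: measurable_cube0.
have i0 (z : 'rV['I_(N + N)]_n) x : (0 <= (f x * \1_cube0 (x - zv (zI z)))%:E)%E.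
  by rewrite lee_fin mulr_ge0 // indicE.
rewrite ge0_integral_sum //; apply: eq_bigr => z _.
rewrite (ge0_integral_affine (zv (zI z)) ltr01) // expr1n mul1e -integral_cube0 [RHS]integral_mkcond.
apply: eq_integral => x _; rewrite scale1r addrK /patch indicE.
by case: ifP => _; rewrite ?mulr1 ?mulr0.
Qed.

Lemma tile_integral (N : nat) (f : T -> R) : leb.-integrable setT (EFin \o f) ->
  (forall x, ~ hbox N x -> f x = 0) ->
  \int[leb]_x f x = \sum_(z : 'rV['I_(N + N)]_n) \int[leb]_(x in unit_cube) f (x + zv (zI z)).
Proof.
move=> fi fN.
have E : f = fun x => \sum_(z : 'rV['I_(N + N)]_n) (f x * \1_cube0 (x - zv (zI z))).
  apply/funext => x; rewrite -mulr_sumr; have [Nx|Nx] := pselect (hbox N x).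
    by rewrite tile_sum // mulr1.
  by rewrite fN // mul0r.
have mf := measurable_int _ fi; move/measurable_EFinP in mf.
have ii (z : 'rV['I_(N + N)]_n) : leb.-integrable setT (EFin \o (fun x => f x * \1_cube0 (x - zv (zI z)))).
  apply: le_integrable fi => //.
    apply/measurable_EFinP; apply: measurable_funM => //.
    have := @measurable_affine R n 1 (- zv (@zI N z)).
    under eq_fun do rewrite scale1r.
    move=> H; apply: (measurableT_comp (f := \1_cube0 : T -> R)) H; apply: measurable_indic; exact: measurable_cube0.
  by move=> x _ /=; rewrite lee_fin normrM ler_piMr // ger0_norm indicE ?ler0n // lern1 leq_b1.
rewrite [in LHS]E Rintegral_sum //; apply: eq_bigr => z _.
rewrite (Rintegral_affine (zv (zI z)) ltr01) // expr1n mul1r -Rintegral_cube0 [RHS]Rintegral_mkcond.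
congr Rintegral; apply/funext => x; rewrite scale1r addrK /patch indicE.
by case: ifP => _; rewrite ?mulr1 ?mulr0.
Qed.

(* Periodizing f turns an integral of q f, with q periodic, into an integral over
   the unit cube, so test functions become test functions for the cell problem. *)
Definition periodize (f : T -> R) (y : T) : R := \sum_(z \in [set: 'rV[int]_n]) f (y + zv z).

(** For y in a bounded region only finitely many translates of y meet the support of f, so the sum
    over all integer vectors becomes a fixed finite one, which can be differentiated termwise. *)
Lemma periodizeE (f : T -> R) (K M : R) (N : nat) (y : T) : coord_bounded K f ->
  (forall k, `|y ord0 k| <= M) -> K + M <= N%:R ->
  periodize f y = \sum_(z : 'rV['I_(N + N)]_n) f (y + zv (zI z)).
Proof.
move=> fK yM KMN; rewrite /periodize (@fsbigE _ _ _ _ _ (map (@zI N) (index_enum _))).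
- by rewrite big_map; apply: eq_bigl => z; rewrite in_setT.
- by rewrite map_inj_uniq ?index_enum_uniq //; exact: zI_inj.
- by [].
- move=> z _ zN; apply: fK; apply: contrapT => /forallNP H.
  have {}H k : `|y ord0 k + (z ord0 k)%:~R| < K.
    by have /negP := H k; rewrite -ltNge !mxE.
  have B k : - N%:Z <= z ord0 k < N%:Z.
    have := H k; have := yM k; rewrite ltr_norml ler_norml => /andP[? ?] /andP[? ?].
    rewrite -(ler_int R) -(ltr_int R) mulrNz -[N%:Z%:~R]/(N%:R : R); apply/andP; split; lra.
  move/negP: zN; apply; apply/mapP.
  have /choice[j jP] : forall k, exists j : 'I_(N + N), j%:Z - N%:Z = z ord0 k.
    move=> k; have /andP[b1 b2] := B k.
    have [m mE] : exists m : nat, z ord0 k + N%:Z = m%:Z.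
      by exists (absz (z ord0 k + N%:Z)); lia.
    have mN : (m < N + N)%N by rewrite -ltz_nat -mE PoszD ltrD2r.
    by exists (Ordinal mN); rewrite /= -mE addrK.
  exists (\row_k j k); first by rewrite mem_index_enum.
  by apply/rowP => k; rewrite !mxE jP.
Qed.

Lemma periodize_periodic (f : T -> R) : cell_periodic (periodize f).
Proof.
move=> y k; rewrite /periodize.
pose h (z : 'rV[int]_n) := z + delta_mx ord0 k.
rewrite [RHS](@reindex_fsbigT _ _ _ _ _ h).
  apply: eq_fsbigr => z _; congr f; rewrite -addrA; congr (_ + _).
  by apply/rowP => i; rewrite !mxE intrD addrC; congr (_ + _); case: (_ && _).
exists (fun z : 'rV[int]_n => z - delta_mx ord0 k) => z; rewrite /h; first exact: addrK.
exact: subrK.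
Qed.

Lemma periodize_near (f : T -> R) (K : R) (y : T) (N : nat) : coord_bounded K f ->
  K + (\sum_i `|y ord0 i| + 1) <= N%:R ->
  \forall x \near y, periodize f x = \sum_(z : 'rV['I_(N + N)]_n) f (x + zv (zI z)).
Proof.
move=> fK KN; have : nbhs y (ball y (1 : R)) by exact: nbhsx_ballx.
apply: filterS => x [_ yx]; apply: (periodizeE fK _ KN) => k.
have yM : `|y ord0 k| <= \sum_i `|y ord0 i| by rewrite (bigD1 k) //= lerDl sumr_ge0.
have := yx ord0 k; rewrite /ball /= => Hx; rewrite -[x _ _](subrK (y ord0 k)).
apply: le_trans (ler_normD _ _) _; rewrite addrC lerD // distrC; exact: ltW.
Qed.

Lemma nat_ge (r : R) : exists N : nat, r <= N%:R.
Proof.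
exists (Num.truncn `|r|).+1; apply: le_trans (ler_norm r) _.
by apply: ltW; case/andP: (truncn_itv (normr_ge0 r)).
Qed.

Lemma smooth_shift (f : T -> R) v : smooth f -> smooth (fun x => f (x + v)).
Proof. by move=> sf; have := smooth_affine 1 v sf; under eq_fun do rewrite scale1r. Qed.

Lemma pderiv_shift (f : T -> R) v k : smooth f -> pderiv k (fun x => f (x + v)) = fun x => pderiv k f (x + v).
Proof.
move=> sf; have := @pderiv_affine R n f 1 v k (fun x => smooth_diff x sf).
under [X in pderiv _ X]eq_fun do rewrite scale1r.
by move=> ->; apply/funext => x; rewrite scale1r mul1r.
Qed.

Lemma smooth_periodize (f : T -> R) (K : R) : smooth f -> coord_bounded K f -> smooth (periodize f).
Proof.
move=> sf fK; apply: smooth_local => y.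
have [N KN] := nat_ge (K + (\sum_i `|y ord0 i| + 1)); have H := periodize_near fK KN.
exists (fun x => \sum_(z : 'rV['I_(N + N)]_n) f (x + zv (zI z))) => //.
by apply: smooth_sum => z _; exact: smooth_shift.
Qed.

Lemma pderiv_periodize (f : T -> R) (K : R) k y : smooth f -> coord_bounded K f ->
  pderiv k (periodize f) y = periodize (pderiv k f) y.
Proof.
move=> sf fK; have dK := coord_bounded_pderiv k fK.
have f'K : coord_bounded (K + 1) f.
  by move=> x [i Hi]; apply: fK; exists i; apply: le_trans Hi; rewrite lerDl.
have [N KN] := nat_ge (K + 1 + (\sum_i `|y ord0 i| + 1)); have H := periodize_near f'K KN.
have yM i : `|y ord0 i| <= \sum_i `|y ord0 i| by rewrite (bigD1 i) //= lerDl sumr_ge0.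
rewrite (pderiv_near _ H) pderiv_sum; last by move=> z x _; apply: smooth_diff; exact: smooth_shift.
rewrite (periodizeE dK yM (N := N)) //; last by apply: le_trans KN; rewrite lerD2l lerDl.
by apply: eq_bigr => z _; rewrite pderiv_shift.
Qed.

Definition Lper (q : T -> R) := [/\ measurable_fun setT q, cell_periodic q & L2 leb unit_cube q].

Lemma measurable_scale (c : R) D : measurable_fun D (fun x : T => c *: x).
Proof.
apply: measurable_funTS; have := @measurable_affine R n c 0.
by under eq_fun do rewrite addr0.
Qed.

(** O / eps is covered by (2 N) ^ n unit cells with N at most M / eps + 1, and the change of
    variables brings eps ^ n; as eps <= 1, the product (2 N eps) ^ n is at most (2 M + 2) ^ n. *)
Lemma tile_bound (h : T -> R) (O : set T) (M eps : R) : measurable_fun setT h -> (forall x, 0 <= h x) ->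
  cell_periodic h -> measurable O -> O `<=` box n M -> 0 < M -> 0 < eps <= 1 ->
  (\int[leb]_(x in O) (h (eps^-1 *: x))%:E <= ((2 * M + 2) ^+ n)%:E * \int[leb]_(x in unit_cube) (h x)%:E)%E.
Proof.
move=> mh h0 hp mO OM M0 /andP[e0 e1].
pose N := (Num.truncn (M / eps)).+1.
have /andP[N1 N2] : (Num.truncn (M / eps))%:R <= M / eps < N%:R by apply: truncn_itv; rewrite divr_ge0 // ltW.
pose f x := h x * \1_(box n M) (eps *: x).
have mb : measurable_fun setT (\1_(box n M) : T -> R).
  by apply: measurable_indic; exact: measurable_box.
have mf : measurable_fun setT f.
  by apply: measurable_funM => //; exact: (measurableT_comp (f := \1_(box n M) : T -> R) mb (@measurable_scale eps setT)).
have f0 x : 0 <= f x by rewrite mulr_ge0 // indicE.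
have ei0 : 0 < eps^-1 by rewrite invr_gt0.
apply: (@le_trans _ _ (\int[leb]_x (f (eps^-1 *: x + 0))%:E)%E).
  rewrite integral_mkcond; apply: ge0_integral_le => x _.
    by rewrite /patch; case: ifP => // _; rewrite lee_fin.
  rewrite /patch; case: ifPn => [|_]; last by rewrite lee_fin.
  rewrite inE => Ox; rewrite lee_fin addr0 /f scalerA mulfV ?gt_eqF // scale1r.
  by rewrite indicE mem_set ?mulr1 //; exact: OM.
have mfE : measurable_fun setT (EFin \o f) by exact/measurable_EFinP.
have H := ge0_integral_affine 0 ei0 mfE (fun x => f0 x).
have -> : (\int[leb]_x (f (eps^-1 *: x + 0)%R)%:E = (eps ^+ n)%:E * \int[leb]_x (f x)%:E)%E.
  rewrite [X in (_ * X)%E]H muleA -EFinM -exprMn mulfV ?gt_eqF // expr1n mul1e //.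
have fN x : ~ hbox N x -> f x = 0.
  move=> Nx; rewrite /f indicE memNset ?mulr0 // => H1; apply: Nx => k.
  have := H1 k; rewrite /= !mxE in_itv /= -ltr_norml normrM gtr0_norm // => H2.
  have : `|x ord0 k| < N%:R by apply: lt_trans N2; rewrite ltr_pdivlMr // mulrC.
  by rewrite ltr_norml => /andP[? ?]; apply/andP; split => //; exact: ltW.
rewrite (ge0_tile_integral mf f0 fN).
apply: (@le_trans _ _ ((eps ^+ n)%:E * \sum_(z : 'rV['I_(N + N)]_n) \int[leb]_(x in unit_cube) (h x)%:E)%E).
  apply: lee_pmul => //; [by rewrite lee_fin exprn_ge0 // ltW| |].
    by apply: sume_ge0 => z _; apply: integral_ge0 => x _; rewrite lee_fin.
  apply: lee_sum => z _; apply: ge0_integral_le => x _; first by rewrite lee_fin.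
  by rewrite lee_fin /f (periodic_zv _ _ hp) ler_piMr // indicE lern1 leq_b1.
have X0 : (0 <= \int[leb]_(x in unit_cube) (h x)%:E)%E by apply: integral_ge0 => x _; rewrite lee_fin.
rewrite (sume_const _ X0) muleA -EFinM; apply: (lee_wpmul2r X0).
have -> : #|{: 'rV['I_(N + N)]_n}| = ((N + N) ^ n)%N by rewrite card_mx card_ord mul1n.
have NM : eps * N%:R <= M + 1.
  by rewrite /N -natr1 mulrDr mulr1 lerD // mulrC -ler_pdivlMr.
have E0 : 0 <= eps * (N + N)%:R by rewrite mulr_ge0 // ltW.
rewrite lee_fin natrX -exprMn; apply: lerXn2r; rewrite ?nnegrE //; first by lra.
by rewrite natrD mulrDr; lra.
Qed.

(** Unfolding: substitute x = eps y, cut the integral into unit cells and bring each back by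
    periodicity of q. The finite form of the periodization is returned with the same [N], for later
    pointwise estimates. *)
Lemma cell_int (q f : T -> R) (K eps : R) (N : nat) : Lper q -> 0 < eps -> continuous f -> coord_bounded K f ->
  K / eps + 1 <= N%:R ->
  [/\ leb.-integrable setT (EFin \o (fun x => q (eps^-1 *: x) * f x)),
  \int[leb]_x (q (eps^-1 *: x) * f x) =
  eps ^+ n * \int[leb]_(y in unit_cube) (q y * periodize (fun x => f (eps *: x)) y) &
  forall y, unit_cube y -> periodize (fun x => f (eps *: x)) y =
    \sum_(z : 'rV['I_(N + N)]_n) f (eps *: (y + zv (zI z)))].
Proof.
move=> [mq qp Lq] e0 cf fK KN.
have ei0 : 0 < eps^-1 by rewrite invr_gt0.
pose fe x := f (eps *: x).
have feK : coord_bounded (K / eps) fe.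
  move=> x [k Hk]; apply: fK; exists k; rewrite mxE normrM gtr0_norm //.
  by rewrite mulrC -ler_pdivrMr.
have [M fM] := coord_bounded_bounded cf fK.
have mfe : measurable_fun setT fe.
  have mf : measurable_fun setT f by exact: continuous_rV_measurable.
  exact: (measurableT_comp mf (@measurable_scale eps setT)).
pose g x := q x * fe x.
have gN x : ~ hbox N x -> g x = 0.
  move=> Nx; rewrite /g feK ?mulr0 //; apply: contrapT => /forallNP H; apply: Nx => k.
  have /negP := H k; rewrite -ltNge => Hk.
  have : `|x ord0 k| < N%:R by apply: lt_le_trans Hk _; apply: le_trans KN; rewrite lerDl.
  by rewrite ltr_norml => /andP[? ?]; apply/andP; split => //; exact: ltW.
have mC := @measurable_unit_cube R n; have Coo := @unit_cube_lty R n.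
have mg : measurable_fun setT g by exact: measurable_funM.
have gi : leb.-integrable setT (EFin \o g).
  apply/integrableP; split; first exact/measurable_EFinP.
  have mn : measurable_fun setT (fun x => `|g x|) by exact: measurableT_comp.
  have gN' x : ~ hbox N x -> `|g x| = 0 by move=> /gN ->; rewrite normr0.
  rewrite (ge0_tile_integral mn (fun x => normr_ge0 _) gN').
  apply: lte_sum_pinfty => z _.
  apply: (@le_lt_trans _ _ (\int[leb]_(x in unit_cube) (M * `|q x|)%:E)%E).
    apply: ge0_integral_le => x _; first by rewrite lee_fin.
    by rewrite lee_fin /g (periodic_zv _ _ qp) normrM mulrC ler_wpM2r //; exact: fM.
  have iq : leb.-integrable unit_cube (EFin \o (fun x => M * `|q x|)).
    apply: eq_integrable (integrableZl mC M (integrable_norm (L2_integrable mC Coo Lq))) => // x _.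
  exact: integrable_lty.
have E : (fun x => q (eps^-1 *: x) * f x) = fun x => g (eps^-1 *: x + 0).
  by apply/funext => x; rewrite addr0 /g /fe scalerA mulfV ?gt_eqF // scale1r.
have P y : unit_cube y -> periodize fe y = \sum_(z : 'rV['I_(N + N)]_n) fe (y + zv (zI z)).
  move=> Cy; apply: (periodizeE feK _ KN) => k; have /andP[h1 h2] := Cy k.
  by rewrite ger0_norm ltW.
split => //; first by rewrite E; exact: integrable_affine.
have := Rintegral_affine 0 ei0 gi; rewrite E => H.
have -> : \int[leb]_x g (eps^-1 *: x + 0) = eps ^+ n * \int[leb]_x g x.
  by rewrite H mulrA -exprMn mulfV ?gt_eqF // expr1n mul1r.
congr (_ * _); rewrite (tile_integral gi gN).
have ii (z : 'rV['I_(N + N)]_n) : leb.-integrable unit_cube (EFin \o (fun x => q x * fe (x + zv (zI z)))).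
  have := integrable_affine (zv (zI z)) ltr01 gi.
  move=> /(integrableS measurableT mC (@subsetT _ _)); apply: eq_integrable => // x _ /=.
  by rewrite scale1r /g (periodic_zv _ _ qp).
rewrite [RHS](_ : _ = \int[leb]_(y in unit_cube) \sum_(z : 'rV['I_(N + N)]_n) (q y * fe (y + zv (zI z)))).
  rewrite Rintegral_sum //; apply: eq_bigr => z _; apply: eq_Rintegral => x _.
  by rewrite /g (periodic_zv _ _ qp).
by apply: eq_Rintegral => y; rewrite inE => Cy; rewrite P // mulr_sumr.
Qed.

Lemma smooth_scale (f : T -> R) eps : smooth f -> smooth (fun x => f (eps *: x)).
Proof. by move=> sf; have := smooth_affine eps 0 sf; under eq_fun do rewrite addr0. Qed.

Lemma pderiv_scale (f : T -> R) eps k : smooth f ->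
  pderiv k (fun x => f (eps *: x)) = fun x => eps * pderiv k f (eps *: x).
Proof.
move=> sf; have := @pderiv_affine R n f eps 0 k (fun x => smooth_diff x sf).
by under [X in pderiv _ X]eq_fun do rewrite addr0; move=> ->; apply/funext => x; rewrite addr0.
Qed.

Lemma coord_bounded_scale (f : T -> R) (K eps : R) : 0 < eps -> coord_bounded K f ->
  coord_bounded (K / eps) (fun x => f (eps *: x)).
Proof.
move=> e0 fK x [k Hk]; apply: fK; exists k; rewrite mxE normrM gtr0_norm //.
by rewrite mulrC -ler_pdivrMr.
Qed.

Lemma periodizeZ (f : T -> R) (c K : R) : coord_bounded K f ->
  periodize (fun x => c * f x) = fun y => c * periodize f y.
Proof.
move=> fK; apply/funext => y.
have yM i : `|y ord0 i| <= \sum_i `|y ord0 i| by rewrite (bigD1 i) //= lerDl sumr_ge0.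
have [N KN] := nat_ge (K + \sum_i `|y ord0 i|).
rewrite (periodizeE fK yM KN) (periodizeE _ yM KN) ?mulr_sumr // => x Hx.
by rewrite fK ?mulr0.
Qed.

Lemma pderiv_periodize_scale (f : T -> R) (K eps : R) k : 0 < eps -> smooth f -> coord_bounded K f ->
  pderiv k (periodize (fun x => f (eps *: x))) = fun y => eps * periodize (fun x => pderiv k f (eps *: x)) y.
Proof.
move=> e0 sf fK; apply/funext => y.
have feK := coord_bounded_scale e0 fK.
rewrite (pderiv_periodize _ _ (smooth_scale eps sf) feK) pderiv_scale //.
rewrite (@periodizeZ _ _ ((K + 1) / eps)) //.
by apply: coord_bounded_scale => //; exact: coord_bounded_pderiv.
Qed.

(** The periodization of x |-> f (eps x) is an admissible test function on the cell, and its
    derivatives are eps times the periodized derivatives of f. *)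
Lemma div_free_scale (q : 'I_n -> T -> R) (f : T -> R) (K eps : R) : (forall k, Lper (q k)) ->
  (forall phi, smooth phi -> cell_periodic phi ->
     \int[leb]_(y in unit_cube) (\sum_k q k y * pderiv k phi y) = 0) ->
  0 < eps -> smooth f -> coord_bounded K f ->
  \int[leb]_x (\sum_k q k (eps^-1 *: x) * pderiv k f x) = 0.
Proof.
move=> Lq q0 e0 sf fK.
have mC := @measurable_unit_cube R n.
have [N KN] := nat_ge ((K + 1) / eps + 1).
have c k := cell_int (Lq k) e0 (smooth_continuous (smooth_pderiv k sf)) (coord_bounded_pderiv k fK) KN.
have feK := coord_bounded_scale e0 fK.
have sp : smooth (periodize (fun x => f (eps *: x))) := smooth_periodize (smooth_scale eps sf) feK.
rewrite Rintegral_sum //; last by move=> k; case: (c k).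
have := q0 _ sp (periodize_periodic _).
have ii k : leb.-integrable unit_cube (EFin \o (fun y => q k y * pderiv k (periodize (fun x => f (eps *: x))) y)).
  apply: (L2M_integrable mC); first by case: (Lq k).
  by apply: smooth_L2_cube; exact: smooth_pderiv.
rewrite (Rintegral_sum (index_enum _) mC ii) => H; have : eps ^+ n * eps^-1 * (\sum_k \int[leb]_(x in unit_cube) (q k x * pderiv k (periodize (fun x => f (eps *: x))) x)) = 0.
  by rewrite H mulr0.
rewrite mulr_sumr => {2}<-; apply: eq_bigr => k _; case: (c k) => _ -> _.
rewrite -mulrA; congr (_ * _); rewrite (pderiv_periodize_scale k e0 sf fK).
rewrite -RintegralZl //; last first.
  apply: (L2M_integrable mC); first by case: (Lq k).
  rewrite -(pderiv_periodize_scale k e0 sf fK).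
  by apply: smooth_L2_cube; exact: smooth_pderiv.
by apply: eq_Rintegral => y _; rewrite mulrCA mulKf // gt_eqF.
Qed.

(* Apply Poincare-Wirtinger on the cell to the periodization of x |-> f (eps x),
   whose gradient carries the factor eps. *)
Lemma mean_zero_scale (K : R) : 0 < K -> exists2 C : R, 0 <= C & forall (q f : T -> R) (eps : R),
  Lper q -> \int[leb]_(y in unit_cube) q y = 0 -> 0 < eps <= 1 -> smooth f -> coord_bounded K f ->
  (\int[leb]_x (q (eps^-1 *: x) * f x)) ^+ 2 <=
  C * eps ^+ 2 * \int[leb]_(y in unit_cube) (q y ^+ 2) * \sum_k \int[leb]_x (pderiv k f x ^+ 2).
Proof.
move=> K0; have [c c0 PW] := @poincare_wirtinger_dual R n.
exists (c * (2 * (K + 3)) ^+ n) => [|q f eps Lq q0 /andP[e0 e1] sf fK].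
  by rewrite mulr_ge0 // exprn_ge0 // mulr_ge0 //; lra.
have mC := @measurable_unit_cube R n.
have [mq qp Lq2] := Lq.
pose N := (Num.truncn ((K + 1) / eps + 1)).+1.
have a0 : 0 <= (K + 1) / eps + 1 by rewrite addr_ge0 // divr_ge0 // ?(ltW e0) //; lra.
have /andP[N1 N2] : (Num.truncn ((K + 1) / eps + 1))%:R <= (K + 1) / eps + 1 < N%:R by exact: truncn_itv.
have KN : K / eps + 1 <= N%:R.
  by apply: le_trans (ltW N2); rewrite lerD2r ler_pM2r ?invr_gt0 //; lra.
have eN : eps * N%:R <= K + 3.
  rewrite /N -natr1 mulrDr mulr1.
  have : eps * (Num.truncn ((K + 1) / eps + 1))%:R <= eps * ((K + 1) / eps + 1) by rewrite ler_pM2l.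
  by rewrite mulrDr mulr1 mulrCA mulfV ?gt_eqF // mulr1; lra.
have [_ -> _] := cell_int Lq e0 (smooth_continuous sf) fK KN.
have feK := coord_bounded_scale e0 fK.
set P := periodize _.
have sP : smooth P := smooth_periodize (smooth_scale eps sf) feK.
have H := PW q P Lq2 q0 sP.
set S := \sum_k _; set Q := \int[leb]_(y in unit_cube) (q y ^+ 2) in H *.
have Q0 : 0 <= Q by apply: Rintegral_ge0 => x _; exact: sqr_ge0.
(* Count of powers: each derivative of [P] carries eps, and the square of a sum over (2 N) ^ n cells
   costs (2 N) ^ n. One of the two factors eps ^ n compensates this cost, since eps N <= K + 3; the
   other is the change of variables in the integrals of (d_k f) ^ 2. *)
suff G : (eps ^+ n) ^+ 2 * gradsq P <= (2 * (K + 3)) ^+ n * eps ^+ 2 * S.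
  rewrite exprMn; apply: (le_trans (ler_wpM2l (sqr_ge0 (eps ^+ n)) H)).
  rewrite (_ : _ * (c * Q * gradsq P) = c * Q * ((eps ^+ n) ^+ 2 * gradsq P)); last by ring.
  have cQ : 0 <= c * Q by exact: mulr_ge0.
  apply: (le_trans (ler_wpM2l cQ G)).
  by rewrite le_eqVlt; apply/orP; left; apply/eqP; ring.
rewrite /gradsq !mulr_sumr; apply: ler_sum => k _.
pose h x := pderiv k f x.
have sh : smooth h by exact: smooth_pderiv.
have hK : coord_bounded (K + 1) h by exact: coord_bounded_pderiv.
have L1 : Lper (fun=> 1).
  by split => //; exact: (smooth_L2_cube (smooth_cst 1)).
pose h2 x := h x ^+ 2.
have sh2 : smooth h2 by rewrite /h2; under eq_fun do rewrite expr2; exact: smoothM.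
have ch2 := smooth_continuous sh2.
have h2K : coord_bounded (K + 1) h2 by move=> x /hK; rewrite /h2 => ->; rewrite expr0n.
have [_ E1 _] := cell_int L1 e0 ch2 h2K (ltW N2).
have [_ _ Ph] := cell_int L1 e0 (smooth_continuous sh) hK (ltW N2).
have [_ _ Ph2] := cell_int L1 e0 ch2 h2K (ltW N2).
have -> : \int[leb]_x (pderiv k f x ^+ 2) = eps ^+ n * \int[leb]_(y in unit_cube) (periodize (fun x => h2 (eps *: x)) y).
  have := E1; under eq_Rintegral do rewrite mul1r.
  by move=> ->; congr (_ * _); apply: eq_Rintegral => y _; rewrite mul1r.
have -> : \int[leb]_(x in unit_cube) pderiv k P x ^+ 2 = eps ^+ 2 * \int[leb]_(y in unit_cube) (periodize (fun x => h (eps *: x)) y ^+ 2).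
  have L : L2 leb unit_cube (fun y => periodize (fun x => h (eps *: x)) y).
    apply: smooth_L2_cube; apply: smooth_periodize (smooth_scale eps sh) _.
    exact: coord_bounded_scale e0 hK.
  rewrite -RintegralZl //; last exact: L2_integrable_sqr.
  by apply: eq_Rintegral => y _; rewrite (pderiv_periodize_scale k e0 sf fK) exprMn.
set I1 := Rintegral _ _ _; set I2 := Rintegral _ _ _.
have le : I1 <= ((N + N) ^ n)%:R * I2.
  have sp2 : leb.-integrable unit_cube (EFin \o (periodize (fun x => h2 (eps *: x)))).
    apply: L2_integrable => //; first exact: unit_cube_lty.
    apply: smooth_L2_cube; apply: (@smooth_periodize _ ((K + 1) / eps)).
      exact: smooth_scale.
    exact: coord_bounded_scale.
  rewrite /I2 -RintegralZl //; apply: le_Rintegral => //.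
  - apply: L2_integrable_sqr; apply: smooth_L2_cube; apply: smooth_periodize (smooth_scale eps sh) _.
    exact: coord_bounded_scale e0 hK.
  - by apply: eq_integrable (integrableZl mC ((N + N) ^ n)%:R sp2).
  - move=> y; rewrite ?inE => Cy; rewrite Ph // Ph2 // /h2.
    have := @sqr_sum_le R 'rV['I_(N + N)]_n (fun z => h (eps *: (y + zv (zI z)))).
    by rewrite card_mx card_ord mul1n.
have I20 : 0 <= I2.
  apply: Rintegral_ge0 => y Cy; rewrite Ph2 //; apply: sumr_ge0 => z _; exact: sqr_ge0.
apply: (le_trans (ler_wpM2l (sqr_ge0 (eps ^+ n)) (ler_wpM2l (sqr_ge0 eps) le))).
rewrite [X in X <= _](_ : _ = (eps ^+ n * ((N + N) ^ n)%:R) * (eps ^+ n * eps ^+ 2 * I2)); last by ring.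
have -> : (2 * (K + 3)) ^+ n * eps ^+ 2 * (eps ^+ n * I2) = ((2 * (K + 3)) ^+ n) * (eps ^+ n * eps ^+ 2 * I2).
  by ring.
have J0 : 0 <= eps ^+ n * eps ^+ 2 * I2 by rewrite mulr_ge0 // mulr_ge0 ?exprn_ge0 // ltW.
apply: (ler_wpM2r J0).
have E0 : 0 <= eps * (N + N)%:R by rewrite mulr_ge0 // ltW.
rewrite natrX -exprMn; apply: lerXn2r; rewrite ?nnegrE //; first by lra.
by rewrite natrD mulrDr; lra.
Qed.

Lemma Lper_sqr_int (q : T -> R) (O : set T) (M eps : R) : Lper q -> measurable O -> O `<=` box n M -> 0 < M ->
  0 < eps <= 1 -> L2 leb O (fun x => q (eps^-1 *: x)) /\
  \int[leb]_(x in O) (q (eps^-1 *: x) ^+ 2) <= (2 * M + 2) ^+ n * \int[leb]_(y in unit_cube) (q y ^+ 2).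
Proof.
move=> [mq qp Lq] mO OM M0 e01; have mC := @measurable_unit_cube R n.
have mq2 : measurable_fun setT (fun x => q x ^+ 2) by exact: measurable_funX.
have qp2 : cell_periodic (fun x => q x ^+ 2) by move=> y k; rewrite qp.
have H := tile_bound mq2 (fun x => sqr_ge0 _) qp2 mO OM M0 e01.
have iq := L2_integrable_sqr Lq.
rewrite (integrable_EFin_Rintegral mC iq) -EFinM in H.
have mqe : measurable_fun O (fun x => q (eps^-1 *: x)).
  exact: (measurableT_comp mq (@measurable_scale eps^-1 O)).
have L : L2 leb O (fun x => q (eps^-1 *: x)).
  split => //; apply/integrableP; split; first exact/measurable_EFinP/measurable_funX.
  under eq_integral do rewrite gee0_abs ?lee_fin ?sqr_ge0 //.
  by apply: le_lt_trans H _; exact: ltry.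
split => //; rewrite -lee_fin; apply: le_trans H.
by rewrite (integrable_EFin_Rintegral mO (L2_integrable_sqr L)).
Qed.

(** Weak convergence of q (x / eps) to its mean. [z] is replaced by a test function: the error is
    controlled by the norm of q (x / eps), bounded uniformly in eps, and on the test function the
    mean-zero part of q acts as O (eps). *)
Lemma mean_value (O : set T) (M : R) (q z : T -> R) : open O -> O `<=` box n M -> 0 < M ->
  (leb O < +oo)%E -> Lper q -> L2 leb O z -> forall kap : R, 0 < kap -> \forall eps \near (0 : R)^'+,
  `|\int[leb]_(x in O) (q (eps^-1 *: x) * z x) -
    (\int[leb]_(y in unit_cube) q y) * \int[leb]_(x in O) z x| <= kap.
Proof.
move=> oO OM M0 leO Lq Lz kap kap0.
have mO := open_measurable_rV oO; have mC := @measurable_unit_cube R n; have Coo := @unit_cube_lty R n.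
have [mq qp Lq2] := Lq.
pose m := \int[leb]_(y in unit_cube) q y.
pose q0 y := q y - m.
have Lq0 : L2 leb unit_cube q0 by apply: L2B => //; exact: L2_cst.
have Lper0 : Lper q0.
  by split => //; [exact: measurable_funB|move=> y k; rewrite /q0 qp].
have q00 : \int[leb]_(y in unit_cube) q0 y = 0.
  have im : leb.-integrable unit_cube (EFin \o (fun=> - m)) by apply: L2_integrable => //; exact: L2_cst.
  rewrite /q0 RintegralD //; last exact: L2_integrable.
  by rewrite Rintegral_cst //= leb_unit_cube mulr1 subrr.
pose Q := \int[leb]_(y in unit_cube) (q0 y ^+ 2).
have Q0 : 0 <= Q by apply: Rintegral_ge0 => x _; exact: sqr_ge0.
pose B := (2 * M + 2) ^+ n * Q.
have B0 : 0 <= B by rewrite mulr_ge0 // exprn_ge0 //; lra.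
(* [B] bounds the squared norm of q0 (x / eps), so this accuracy keeps the square of the first error
   below kap ^ 2 / 4; eps is then taken so small that the second satisfies the same bound. *)
pose e := kap ^+ 2 / (4 * (B + 1)).
have B1 : 0 < 4 * (B + 1) by lra.
have e0 : 0 < e by rewrite divr_gt0 // exprn_gt0.
have [psi tpsi Hpsi] := test_dense oO leO Lz e0.
have [K K0 pK] := test_function_coord_bounded tpsi; have [spsi _] := tpsi.
have [C C0 HC] := @mean_zero_scale K K0.
pose S := \sum_k \int[leb]_x (pderiv k psi x ^+ 2).
have S0 : 0 <= S by apply: sumr_ge0 => k _; apply: Rintegral_ge0 => x _; exact: sqr_ge0.
have D0 : 0 < 4 * (C * Q * S + 1) by rewrite mulr_gt0 // ltr_wpDl // !mulr_ge0.
have near_e : \forall eps \near (0 : R)^'+, eps <= kap ^+ 2 / (4 * (C * Q * S + 1)).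
  by apply: nbhs_right_le; rewrite divr_gt0 // exprn_gt0.
have near_1 : \forall eps \near (0 : R)^'+, eps <= 1 by exact: nbhs_right_le.
near=> eps.
have eps0 : 0 < eps by near: eps; exact: nbhs_right_gt.
have eps1 : eps <= 1 by near: eps; exact: near_1.
have epsk : eps <= kap ^+ 2 / (4 * (C * Q * S + 1)) by near: eps; exact: near_e.
have e01 : 0 < eps <= 1 by rewrite eps0.
have [Lqe Hqe] := Lper_sqr_int Lper0 mO OM M0 e01.
have Lpsi : L2 leb O psi := test_function_L2 oO leO tpsi.
have [Lqe' _] := Lper_sqr_int Lq mO OM M0 e01.
have E : \int[leb]_(x in O) (q (eps^-1 *: x) * z x) - m * \int[leb]_(x in O) z x =
   \int[leb]_(x in O) (q0 (eps^-1 *: x) * (z x - psi x)) + \int[leb]_(x in O) (q0 (eps^-1 *: x) * psi x).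
  rewrite -RintegralD //; [|exact: (L2M_integrable mO Lqe (L2B mO Lz Lpsi))|exact: (L2M_integrable mO Lqe Lpsi)].
  have iz := L2_integrable mO leO Lz.
  have imz : leb.-integrable O (EFin \o (fun x => (- m) * z x)).
    by apply: eq_integrable (integrableZl mO (- m) iz).
  rewrite -mulNr -(RintegralZl (- m) mO iz) -RintegralD //; last exact: (L2M_integrable mO Lqe' Lz).
  by apply: eq_Rintegral => x _; rewrite /q0; ring.
rewrite E; set I1 := Rintegral _ _ _; set I2 := Rintegral _ _ _.
have H1 : I1 ^+ 2 <= B * e.
  apply: (le_trans (L2_CS mO Lqe (L2B mO Lz Lpsi))).
  by apply: ler_pM => //; apply: Rintegral_ge0 => x _; exact: sqr_ge0.
have H2 : I2 ^+ 2 <= C * eps ^+ 2 * Q * S.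
  have <- : \int[leb]_x (q0 (eps^-1 *: x) * psi x) = I2.
    have r x : ~ O x -> q0 (eps^-1 *: x) * psi x = 0 by move=> Ox; rewrite (test_function_out tpsi Ox) mulr0.
    by rewrite /I2 (Rintegral_restrict r).
  exact: HC.
have H1' : B * e <= kap ^+ 2 / 4.
  rewrite /e mulrA ler_pdivrMr //; have k2 := sqr_ge0 kap; nra.
have H2' : C * eps ^+ 2 * Q * S <= kap ^+ 2 / 4.
  have : eps * (4 * (C * Q * S + 1)) <= kap ^+ 2 by rewrite -ler_pdivlMr //.
  have CQS : 0 <= C * Q * S by rewrite !mulr_ge0.
  rewrite (_ : C * eps ^+ 2 * Q * S = eps ^+ 2 * (C * Q * S)); last by ring.
  by move: CQS; move: (C * Q * S) => X; nra.
rewrite -ler_sqr ?nnegrE ?(ltW kap0) // real_normK ?num_real //.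
apply: (le_trans (sqrD_le _ _)); lra.
Unshelve. all: by end_near. Qed.

End lattice.

(** * Vector fields and coercive tensor fields *)

Section dotv_theory.
Context {R : realType} {n : nat}.
Implicit Types (x y z : 'rV[R]_n) (B C : 'M[R]_n).

Lemma dotvC x y : dotv x y = dotv y x.
Proof. by apply: eq_bigr => k _; rewrite mulrC. Qed.

Lemma dotvP a x y z : dotv (a *: x + y) z = a * dotv x z + dotv y z.
Proof.
rewrite /dotv mulr_sumr -big_split; apply: eq_bigr => k _ /=; rewrite rVZDE; ring.
Qed.

Lemma dotvDl x y z : dotv (x + y) z = dotv x z + dotv y z.
Proof. by rewrite -[x]scale1r dotvP mul1r scale1r. Qed.

Lemma dotvDr x y z : dotv z (x + y) = dotv z x + dotv z y.
Proof. by rewrite dotvC dotvDl !(dotvC z). Qed.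

Lemma dotv0l x : dotv 0 x = 0.
Proof. by rewrite /dotv big1 // => k _; rewrite mxE mul0r. Qed.

Lemma dotvZl a x y : dotv (a *: x) y = a * dotv x y.
Proof. by have := dotvP a x 0 y; rewrite addr0 dotv0l addr0. Qed.

Lemma dotvZr a x y : dotv y (a *: x) = a * dotv y x.
Proof. by rewrite dotvC dotvZl dotvC. Qed.

Lemma dotvBl x y z : dotv (x - y) z = dotv x z - dotv y z.
Proof. by rewrite dotvDl -scaleN1r dotvZl mulN1r. Qed.

Lemma dotvBr x y z : dotv z (x - y) = dotv z x - dotv z y.
Proof. by rewrite dotvC dotvBl !(dotvC z). Qed.

Lemma dotvv_ge0 x : 0 <= dotv x x.
Proof. by apply: sumr_ge0 => k _; rewrite -expr2 sqr_ge0. Qed.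

Lemma dotv_CS x y : dotv x y ^+ 2 <= dotv x x * dotv y y.
Proof.
apply: (@sip_CS R _ setT (fun x y => dotv x y)) => //.
- by move=> u v _ _; exact: dotvC.
- by move=> a u v w _ _ _; exact: dotvP.
- by move=> u _; exact: dotvv_ge0.
Qed.

Lemma enorm_sqr x : enorm x ^+ 2 = dotv x x.
Proof. by rewrite sqr_sqrtr // dotvv_ge0. Qed.

Lemma coord_le_dotv x k : x ord0 k ^+ 2 <= dotv x x.
Proof. by rewrite /dotv (bigD1 k) //= expr2 lerDl sumr_ge0 // => i _; rewrite -expr2 sqr_ge0. Qed.

Lemma dotvD_le x y : dotv (x + y) (x + y) <= 2 * dotv x x + 2 * dotv y y.
Proof.
have := dotvv_ge0 (x - y); rewrite dotvBl !dotvBr dotvDl !dotvDr (dotvC y x); lra.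
Qed.

Lemma dotv_delta x k : dotv x (delta_mx ord0 k) = x ord0 k.
Proof.
rewrite /dotv (bigD1 k) //= mxE !eqxx mulr1 big1 ?addr0 // => i ik.
by rewrite mxE (negbTE ik) andbF mulr0.
Qed.

Lemma mxvE B x i : mxv B x ord0 i = \sum_j B i j * x ord0 j.
Proof. by rewrite /mxv mxE; apply: eq_bigr => j _; rewrite mxE mulrC. Qed.

Lemma mxvP B a x y : mxv B (a *: x + y) = a *: mxv B x + mxv B y.
Proof. by rewrite /mxv mulmxDl scalemxAl. Qed.

Lemma mxvD B x y : mxv B (x + y) = mxv B x + mxv B y.
Proof. by rewrite /mxv mulmxDl. Qed.

Lemma mxvB B x y : mxv B (x - y) = mxv B x - mxv B y.
Proof. by rewrite /mxv mulmxBl. Qed.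

Lemma mxvZ B a x : mxv B (a *: x) = a *: mxv B x.
Proof. by rewrite /mxv scalemxAl. Qed.

Lemma mxvBmx B C x : mxv (B - C) x = mxv B x - mxv C x.
Proof. by rewrite /mxv linearB /= mulmxBr. Qed.

Lemma mxv_delta B i j : mxv B (delta_mx ord0 j) ord0 i = B i j.
Proof.
rewrite mxvE (bigD1 j) //= mxE !eqxx mulr1 big1 ?addr0 // => k kj.
by rewrite mxE (negbTE kj) andbF mulr0.
Qed.

Lemma dotv_mxvC B x y : B^T = B -> dotv (mxv B x) y = dotv x (mxv B y).
Proof.
move=> sB; rewrite /dotv.
transitivity (\sum_i \sum_j B i j * x ord0 j * y ord0 i).
  by apply: eq_bigr => i _; rewrite mxvE mulr_suml.
rewrite exchange_big; apply: eq_bigr => j _; rewrite mxvE mulr_sumr; apply: eq_bigr => i _.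
by rewrite -[in RHS]sB mxE; ring.
Qed.

Definition elliptic (al be : R) B := [/\ B^T = B,
  forall xi, al * dotv xi xi <= dotv (mxv B xi) xi &
  forall xi, dotv (mxv B xi) (mxv B xi) <= be ^+ 2 * dotv xi xi].

Lemma elliptic_entry al be B i j : 0 <= be -> elliptic al be B -> `|B i j| <= be.
Proof.
move=> be0 [_ _ H]; have := le_trans (coord_le_dotv _ i) (H (delta_mx ord0 j)).
rewrite mxv_delta dotv_delta mxE !eqxx mulr1 => H2.
by rewrite -ler_sqr ?nnegrE // real_normK ?num_real.
Qed.

Lemma elliptic_form_le al be B x : 0 <= be -> elliptic al be B -> dotv (mxv B x) x <= be * dotv x x.
Proof.
move=> be0 [_ _ H]; have H1 := dotv_CS (mxv B x) x; have H2 := H x; have x0 := dotvv_ge0 x.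
have H3 : dotv (mxv B x) x ^+ 2 <= (be * dotv x x) ^+ 2.
  by apply: (le_trans H1); rewrite exprMn expr2 mulrA ler_wpM2r.
by apply: le_trans (ler_norm _) _; rewrite -ler_sqr ?nnegrE ?mulr_ge0 // real_normK ?num_real.
Qed.

Lemma mxv_entry_bound B (L : R) x : 0 <= L -> (forall i j, `|B i j| <= L) ->
  dotv (mxv B x) (mxv B x) <= (n%:R * L) ^+ 2 * dotv x x.
Proof.
move=> L0 HB.
have H i : mxv B x ord0 i * mxv B x ord0 i <= n%:R * (L ^+ 2 * dotv x x).
  rewrite -expr2 mxvE; apply: (le_trans (sqr_sum_le _)); rewrite card_ord ler_wpM2l //.
  rewrite /dotv mulr_sumr; apply: ler_sum => j _; rewrite exprMn -expr2 ler_wpM2r ?sqr_ge0 //.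
  by rewrite -(real_normK (num_real (B i j))) ler_sqr ?nnegrE.
apply: (le_trans (ler_sum _ (fun i _ => H i))); rewrite sumr_const card_ord -mulr_natl.
by rewrite le_eqVlt; apply/orP; left; apply/eqP; ring.
Qed.

End dotv_theory.

Section vector_L2.
Context {R : realType} {n : nat}.
Local Notation T := 'rV[R]_n.
Local Notation leb := (@lebesgue_rV R n).
Implicit Types (D : set T) (F G H : T -> 'rV[R]_n) (B : T -> 'M[R]_n).

Definition L2v D F := forall k, L2 leb D (fun x => F x ord0 k).
Definition ipv D F G := \int[leb]_(x in D) dotv (F x) (G x).
Definition nrm2 D F := ipv D F F.

Section fixed_domain.
Variable D : set T.
Hypothesis mD : measurable D.

Lemma L2vP a F G : L2v D F -> L2v D G -> L2v D (fun x => a *: F x + G x).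
Proof.
move=> LF LG k; have := L2P mD a (LF k) (LG k); congr (L2 _ _ _); apply/funext => x.
by rewrite rVZDE.
Qed.

Lemma L2v0 : L2v D (fun=> 0).
Proof. by move=> k; under eq_fun do rewrite mxE; exact: L2_cst0. Qed.

Lemma L2vZ a F : L2v D F -> L2v D (fun x => a *: F x).
Proof. by move=> LF; have := L2vP a LF L2v0; under eq_fun do rewrite addr0. Qed.

Lemma L2vD F G : L2v D F -> L2v D G -> L2v D (fun x => F x + G x).
Proof. by move=> LF LG; have := L2vP 1 LF LG; under eq_fun do rewrite scale1r. Qed.

Lemma L2vB F G : L2v D F -> L2v D G -> L2v D (fun x => F x - G x).
Proof. by move=> LF LG; have := L2vP (-1) LG LF; under eq_fun do rewrite scaleN1r addrC. Qed.

Lemma ipv_integrable F G : L2v D F -> L2v D G -> leb.-integrable D (EFin \o (fun x => dotv (F x) (G x))).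
Proof.
move=> LF LG; apply: eq_integrable (integrable_sum mD (index_enum 'I_n) (fun k _ => L2M_integrable mD (LF k) (LG k))) => //.
by move=> x _ /=; rewrite sumEFin.
Qed.

Lemma ipvE F G : L2v D F -> L2v D G -> ipv D F G = \sum_k \int[leb]_(x in D) (F x ord0 k * G x ord0 k).
Proof. by move=> LF LG; rewrite /ipv Rintegral_sum // => k; exact: L2M_integrable. Qed.

Lemma ipvC F G : ipv D F G = ipv D G F.
Proof. by apply: eq_Rintegral => x _; exact: dotvC. Qed.

Lemma ipvP a F G H : L2v D F -> L2v D G -> L2v D H ->
  ipv D (fun x => a *: F x + G x) H = a * ipv D F H + ipv D G H.
Proof.
move=> LF LG LH; have i1 := ipv_integrable LF LH; have i2 := ipv_integrable LG LH.
rewrite /ipv -(RintegralZl a mD i1) -RintegralD //; last by apply: eq_integrable (integrableZl mD a i1).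
by apply: eq_Rintegral => x _; rewrite dotvP.
Qed.

Lemma ipvD F G H : L2v D F -> L2v D G -> L2v D H ->
  ipv D (fun x => F x + G x) H = ipv D F H + ipv D G H.
Proof. by move=> LF LG LH; have := ipvP 1 LF LG LH; under eq_fun do rewrite scale1r; rewrite mul1r. Qed.

Lemma ipvB F G H : L2v D F -> L2v D G -> L2v D H ->
  ipv D (fun x => F x - G x) H = ipv D F H - ipv D G H.
Proof.
move=> LF LG LH; have := ipvP (-1) LG LF LH.
by under eq_fun do rewrite scaleN1r addrC; rewrite mulN1r addrC.
Qed.

Lemma ipvZ a F H : L2v D F -> L2v D H -> ipv D (fun x => a *: F x) H = a * ipv D F H.
Proof.
move=> LF LH; have i1 := ipv_integrable LF LH.
by rewrite /ipv -(RintegralZl a mD i1); apply: eq_Rintegral => x _; rewrite dotvZl.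
Qed.

Lemma nrm2_ge0 F : 0 <= nrm2 D F.
Proof. by apply: Rintegral_ge0 => x _; exact: dotvv_ge0. Qed.

Lemma ipv_CS F G : L2v D F -> L2v D G -> ipv D F G ^+ 2 <= nrm2 D F * nrm2 D G.
Proof.
move=> LF LG.
have := @sip_CS R _ (L2v D) (ipv D) L2vP (fun u v _ _ => ipvC u v) ipvP (fun u _ => nrm2_ge0 u) F G LF LG.
by [].
Qed.

Lemma nrm2D_le F G : L2v D F -> L2v D G -> nrm2 D (fun x => F x + G x) <= 2 * nrm2 D F + 2 * nrm2 D G.
Proof.
move=> LF LG; have i1 := ipv_integrable LF LF; have i2 := ipv_integrable LG LG.
have j1 : leb.-integrable D (EFin \o (fun x => 2 * dotv (F x) (F x))).
  by apply: eq_integrable (integrableZl mD 2 i1).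
have j2 : leb.-integrable D (EFin \o (fun x => 2 * dotv (G x) (G x))).
  by apply: eq_integrable (integrableZl mD 2 i2).
rewrite /nrm2 /ipv -(RintegralZl 2 mD i1) -(RintegralZl 2 mD i2) -RintegralD //.
apply: le_Rintegral => //; first exact: (ipv_integrable (L2vD LF LG) (L2vD LF LG)).
  by apply: eq_integrable (integrableD mD j1 j2).
by move=> x _; exact: dotvD_le.
Qed.

Lemma nrm2Z a F : L2v D F -> nrm2 D (fun x => a *: F x) = a ^+ 2 * nrm2 D F.
Proof.
move=> LF; have Lz := L2vZ a LF.
by rewrite /nrm2 (ipvZ a LF Lz) ipvC (ipvZ a LF LF) mulrA -expr2.
Qed.

Lemma nrm2_le F G : L2v D F -> L2v D G -> (forall x, D x -> dotv (F x) (F x) <= dotv (G x) (G x)) ->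
  nrm2 D F <= nrm2 D G.
Proof. by move=> LF LG H; apply: le_Rintegral => //; exact: ipv_integrable. Qed.

Lemma nrm2_sum F : L2v D F -> nrm2 D F = \sum_k \int[leb]_(x in D) (F x ord0 k ^+ 2).
Proof. by move=> LF; rewrite /nrm2 ipvE // ; apply: eq_bigr => k _; apply: eq_Rintegral => x _; rewrite expr2. Qed.

Definition tfield al be B := (forall i j, measurable_fun D (fun x => B x i j)) /\
  forall x, D x -> elliptic al be (B x).

Variables (al be : R).
Hypothesis al0 : 0 < al.
Hypothesis be0 : 0 <= be.

Lemma L2v_mxv B F (L : R) : (forall i j, measurable_fun D (fun x => B x i j)) ->
  (forall x i j, D x -> `|B x i j| <= L) -> L2v D F -> L2v D (fun x => mxv (B x) (F x)).
Proof.
move=> mB BL LF i; under eq_fun do rewrite mxvE.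
by apply: (L2_sum mD) => j _; apply: (L2M_bounded mD (LF j) (mB i j)) => x; exact: BL.
Qed.

Lemma L2v_tfield B F : tfield al be B -> L2v D F -> L2v D (fun x => mxv (B x) (F x)).
Proof.
move=> [mB eB]; apply: L2v_mxv => // x i j Dx; exact: elliptic_entry be0 (eB x Dx).
Qed.

Lemma nrm2_tfield B F : tfield al be B -> L2v D F -> nrm2 D (fun x => mxv (B x) (F x)) <= be ^+ 2 * nrm2 D F.
Proof.
move=> tB LF; have i1 := ipv_integrable LF LF; have LB := L2v_tfield tB LF.
rewrite /nrm2 /ipv -(RintegralZl _ mD i1); apply: le_Rintegral => //; first exact: ipv_integrable.
  by apply: eq_integrable (integrableZl mD (be ^+ 2) i1).
by move=> x Dx; case: (tB.2 x Dx).
Qed.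

Lemma coercive B F : tfield al be B -> L2v D F -> al * nrm2 D F <= ipv D (fun x => mxv (B x) (F x)) F.
Proof.
move=> tB LF; have i1 := ipv_integrable LF LF; have LB := L2v_tfield tB LF.
rewrite /nrm2 /ipv -(RintegralZl _ mD i1); apply: le_Rintegral => //; last by move=> x Dx; case: (tB.2 x Dx).
  by apply: eq_integrable (integrableZl mD al i1).
exact: ipv_integrable.
Qed.

Lemma ipv_tfieldC B F G : tfield al be B -> ipv D (fun x => mxv (B x) (F x)) G = ipv D (fun x => mxv (B x) (G x)) F.
Proof.
move=> [_ eB]; apply: eq_Rintegral => x; rewrite inE => /eB[sB _ _].
by rewrite dotv_mxvC // dotvC.
Qed.

Lemma L2v_complete (f : nat -> T -> 'rV[R]_n) : (leb D < +oo)%E -> (forall m, L2v D (f m)) ->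
  (forall e : R, 0 < e -> exists K : nat, forall m p, (K <= m)%N -> (K <= p)%N ->
     nrm2 D (fun x => f m x - f p x) <= e) ->
  exists2 w, L2v D w & forall e : R, 0 < e -> exists K : nat, forall m, (K <= m)%N ->
     nrm2 D (fun x => f m x - w x) <= e.
Proof.
move=> Doo Lf Cf.
have /choice[w wP] : forall k, exists g : T -> R, L2 leb D g /\ forall e : R, 0 < e -> exists K : nat, forall m, (K <= m)%N ->
     \int[leb]_(x in D) ((f m x ord0 k - g x) ^+ 2) <= e.
  move=> k; have [||g Lg Hg] := @L2_complete _ _ _ _ _ mD Doo (fun m x => f m x ord0 k).
  - by move=> m; exact: Lf.
  - move=> e e0; have [K HK] := Cf e e0; exists K => m p Km Kp.
    apply: le_trans (HK m p Km Kp); rewrite nrm2_sum; last exact: L2vB.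
    rewrite (bigD1 k) //= [X in X + _](_ : _ = \int[leb]_(x in D) ((f m x ord0 k - f p x ord0 k) ^+ 2)).
      by rewrite lerDl; apply: sumr_ge0 => i _; apply: Rintegral_ge0 => x _; exact: sqr_ge0.
    by apply: eq_Rintegral => x _; rewrite !mxE.
  - by exists g.
exists (fun x => \row_k w k x).
  by move=> k; under eq_fun do rewrite mxE; case: (wP k).
have Lw : L2v D (fun x => \row_k w k x) by move=> k; under eq_fun do rewrite mxE; case: (wP k).
move=> e e0.
(* n + 1 rather than n: the dimension may be 0 here. *)
have en0 : 0 < e / n.+1%:R by rewrite divr_gt0.
have /choice[K HK] : forall k, exists K : nat, forall m, (K <= m)%N ->
     \int[leb]_(x in D) ((f m x ord0 k - w k x) ^+ 2) <= e / n.+1%:R.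
  by move=> k; have [_ /(_ _ en0)] := wP k.
exists (\max_k K k)%N => m Km; rewrite nrm2_sum; last exact: L2vB.
apply: (@le_trans _ _ (\sum_(k < n) e / n.+1%:R)).
  apply: ler_sum => k _; apply: le_trans (HK k m _); last by apply: leq_trans Km; exact: leq_bigmax.
  by rewrite le_eqVlt; apply/orP; left; apply/eqP; apply: eq_Rintegral => x _; rewrite !mxE.
rewrite sumr_const card_ord -[leLHS]mulr_natl mulrCA ler_piMr ?(ltW e0) //.
by rewrite ler_pdivrMr // mul1r ler_nat.
Qed.

(** As B is symmetric, the solution minimizes the energy of f + s over s in [S]. Coercivity turns
    the Cauchy estimate of a minimizing sequence into strong convergence, and the approximate
    orthogonality passes to the limit. The sequence is returned along with its limit because [H1_0]
    and [H1_per] are defined by approximation. *)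
Lemma lax_milgram B (S : set (T -> 'rV[R]_n)) f : (leb D < +oo)%E -> tfield al be B -> S `<=` L2v D -> S 0 ->
  (forall a u v, S u -> S v -> S (a *: u + v)) -> L2v D f ->
  exists (s : nat -> T -> 'rV[R]_n) w, [/\ forall m, S (s m), L2v D w,
    forall e : R, 0 < e -> exists K : nat, forall m, (K <= m)%N -> nrm2 D (fun x => s m x - w x) <= e &
    forall v, S v -> ipv D (fun x => mxv (B x) (f x + w x)) v = 0].
Proof.
move=> Doo tB SL S0 SP Lf.
pose b F G := ipv D (fun x => mxv (B x) (F x)) G.
have bP a u v w : L2v D u -> L2v D v -> L2v D w -> b (a *: u + v) w = a * b u w + b v w.
  move=> Lu Lv Lw; rewrite /b -ipvP //; [|exact: L2v_tfield..].
  by apply: eq_Rintegral => x _; rewrite mxvP.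
have bC u v : L2v D u -> L2v D v -> b u v = b v u by move=> _ _; exact: ipv_tfieldC.
have b_ge0 u : L2v D u -> 0 <= b u u.
  by move=> Lu; apply: le_trans (coercive tB Lu); rewrite mulr_ge0 ?nrm2_ge0 ?(ltW al0).
have [s [Ss sC sO]] := @minimizing_sequence R _ (L2v D) b L2v0 L2vP bC bP b_ge0 S f SL Lf S0 SP.
have Ls m : L2v D (s m) := SL _ (Ss m).
have [|w Lw sw] := L2v_complete Doo Ls.
  move=> e e0; have /cvgr0_norm_lt /(_ (e * al / 4)) := @cvg_harmonic R.
  move=> /(_ ltac:(by rewrite divr_gt0 // mulr_gt0)) [K _ HK]; exists K => m p Km Kp.
  rewrite -(ler_pM2l al0); apply: le_trans (coercive tB (L2vB (Ls m) (Ls p))) _.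
  apply: le_trans (sC m p) _.
  have := HK m Km; have := HK p Kp; rewrite /harmonic /= !ger0_norm ?invr_ge0 // => h1 h2.
  rewrite [al * e]mulrC; move: h1 h2; move: (e * al) (p.+1%:R^-1) (m.+1%:R^-1) => c r1 r2; lra.
exists s, w; split => // v Sv; have Lv := SL _ Sv.
have bv0 := b_ge0 v Lv.
apply/eqP; rewrite -sqrf_eq0 eq_le sqr_ge0 andbT; apply/ler_addgt0Pr => e e0; rewrite add0r.
(* The two main terms are the defect of orthogonality of [s m] and the effect of its distance to
   [w]; the 1 keeps [c] positive. *)
pose c := 2 * b v v + 2 * (be * b v v) + 1.
have c0 : 0 < c by rewrite /c ltr_wpDl // addr_ge0 ?mulr_ge0.
have [K1 HK1] := sw (e / c) ltac:(by rewrite divr_gt0).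
have /cvgr0_norm_lt /(_ (e / c)) := @cvg_harmonic R.
move=> /(_ ltac:(by rewrite divr_gt0)) [K2 _ HK2].
pose m := maxn K1 K2.
have h1 := HK1 m (leq_maxl _ _); have := HK2 m (leq_maxr _ _).
rewrite /harmonic /= ger0_norm ?invr_ge0 // => h2.
have Ld : L2v D (fun x => w x - s m x) by exact: L2vB.
have E : ipv D (fun x => mxv (B x) (f x + w x)) v = b (f + s m) v + b (fun x => w x - s m x) v.
  rewrite /b -ipvD //; [|by apply: L2v_tfield => //; exact: L2vD|exact: L2v_tfield].
  apply: eq_Rintegral => x _; rewrite -mxvD; congr (dotv (mxv (B x) _) (v x)).
  by rewrite [(f + s m) x]/(f x + s m x) -addrA [s m x + _]addrC subrK.
rewrite E; apply: (le_trans (sqrD_le _ _)).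
have h3 := sO m v Sv.
have h4 : b (fun x => w x - s m x) v ^+ 2 <= be * (e / c) * b v v.
  have := @sip_CS R _ (L2v D) b L2vP bC bP b_ge0 _ _ Ld Lv.
  move=> /le_trans; apply; rewrite ler_wpM2r //.
  apply: (@le_trans _ _ (be * nrm2 D (fun x => w x - s m x))).
    have i1 := ipv_integrable Ld Ld.
    rewrite /nrm2 /b /ipv -(RintegralZl _ mD i1); apply: le_Rintegral => //.
    - by apply: ipv_integrable => //; exact: L2v_tfield.
    - by apply: eq_integrable (integrableZl mD be i1).
    - by move=> x Dx; apply: elliptic_form_le be0 (tB.2 x Dx).
  rewrite ler_wpM2l //; apply: le_trans h1.
  rewrite le_eqVlt; apply/orP; left; apply/eqP; apply: eq_Rintegral => x _.
  by rewrite -opprB -scaleN1r dotvZl dotvZr mulrA mulrNN !mul1r.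
have ec : e / c * c = e by rewrite divfK ?gt_eqF.
have ec0 : 0 < e / c by rewrite divr_gt0.
have h5 : m.+1%:R^-1 * b v v <= e / c * b v v by rewrite ler_wpM2r // ltW.
have h6 := le_trans h3 h5.
have -> : e = e / c * (2 * b v v + 2 * (be * b v v) + 1) by rewrite -[LHS]ec.
move: h6 h4 ec0; move: (b _ v ^+ 2) (b _ v ^+ 2) (b v v) (e / c) => X Y V r; lra.
Qed.

End fixed_domain.
End vector_L2.

(** * Dirichlet and cell problems *)

Section h1_limits.
Context {R : realType} {n : nat}.
Local Notation T := 'rV[R]_n.
Local Notation leb := (@lebesgue_rV R n).
Variable D : set T.
Hypothesis mD : measurable D.
Hypothesis leD : (leb D < +oo)%E.
Implicit Types (u v phi psi : T -> R) (F G H Du : T -> 'rV[R]_n).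

Lemma gradP a phi psi : smooth phi -> smooth psi ->
  grad (fun x => a * phi x + psi x) = fun x => a *: grad phi x + grad psi x.
Proof.
move=> sf sg; apply/funext => x; apply/rowP => k; rewrite rVZDE !mxE.
rewrite pderivD; [|by move=> y; apply: smooth_diff; exact: smoothZ|by move=> y; exact: smooth_diff].
by rewrite pderivZ // => y; exact: smooth_diff.
Qed.

Lemma nrm2_eq F G : (forall x, D x -> F x = G x) -> nrm2 D F = nrm2 D G.
Proof. by move=> FG; apply: eq_Rintegral => x; rewrite inE => Dx; rewrite FG. Qed.

Lemma nrm2C F G : nrm2 D (fun x => F x - G x) = nrm2 D (fun x => G x - F x).
Proof.
apply: eq_Rintegral => x _; rewrite -opprB -scaleN1r dotvZl dotvZr mulrA mulrNN !mul1r //.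
Qed.

Lemma ipv_lim0 F H : L2v D F -> L2v D H ->
  (forall e : R, 0 < e -> exists G, [/\ L2v D G, ipv D F G = 0 & nrm2 D (fun x => G x - H x) <= e]) ->
  ipv D F H = 0.
Proof.
move=> LF Lv HG; apply/eqP; rewrite -sqrf_eq0 eq_le sqr_ge0 andbT; apply/ler_addgt0Pr => e e0; rewrite add0r.
have c0 : 0 < nrm2 D F + 1 by rewrite ltr_wpDl // nrm2_ge0.
have [G [LG FG0 Ge]]   := HG (e / (nrm2 D F + 1)) ltac:(by rewrite divr_gt0).
have -> : ipv D F H = ipv D (fun x => H x - G x) F by rewrite ipvB // ipvC [ipv D G F]ipvC FG0 subr0.
apply: (le_trans (ipv_CS mD (L2vB mD Lv LG) LF)).
rewrite nrm2C; apply: (@le_trans _ _ (e / (nrm2 D F + 1) * nrm2 D F)); first by rewrite ler_wpM2r ?nrm2_ge0.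
by rewrite mulrAC ler_pdivrMr // ler_pM2l // lerDl.
Qed.

(** Passes from the limit of one extended-real integral to separate bounds on two real ones, the
    form in which approximations are built and used. *)
Lemma H1_cvgP (phi : nat -> T -> R) u Du : (forall m, L2 leb D (phi m)) -> (forall m, L2v D (grad (phi m))) ->
  L2 leb D u -> L2v D Du ->
  H1_cvg D phi u Du <-> forall e : R, 0 < e -> exists K : nat, forall m, (K <= m)%N ->
    \int[leb]_(x in D) ((phi m x - u x) ^+ 2) <= e /\ nrm2 D (fun x => grad (phi m) x - Du x) <= e.
Proof.
move=> Lp Lg Lu LDu.
pose a m := \int[leb]_(x in D) ((phi m x - u x) ^+ 2).
pose b m := nrm2 D (fun x => grad (phi m) x - Du x).
have a0 m : 0 <= a m by apply: Rintegral_ge0 => x _; exact: sqr_ge0.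
have b0 m : 0 <= b m := nrm2_ge0 _ _.
have E m : (\int[leb]_(x in D) ((phi m x - u x) ^+ 2 + enorm (grad (phi m) x - Du x) ^+ 2)%:E = (a m + b m)%:E)%E.
  have Ld := L2vB mD (Lg m) LDu.
  have i1 := L2_integrable_sqr (L2B mD (Lp m) Lu); have i2 := ipv_integrable mD Ld Ld.
  rewrite /a /b /nrm2 /ipv -RintegralD // -integrable_EFin_Rintegral //.
    by apply: eq_integral => x _; rewrite enorm_sqr.
  by apply: eq_integrable (integrableD mD i1 i2).
rewrite /H1_cvg; under eq_fun do rewrite E.
split => [H e e0|H].
  have /fine_cvgP[_ /cvgr0_norm_le /(_ e e0) [K _ HK]] := H.
  exists K => m Km; have := HK m Km; rewrite /= ger0_norm ?addr_ge0 // => h.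
  by split; apply: le_trans h; rewrite -/(a m) -/(b m) ?lerDl ?lerDr.
apply/fine_cvgP; split; first exact: nearW.
apply/cvgr0Pnorm_le => e e0; have [K HK] := H (e / 2) ltac:(by rewrite divr_gt0).
exists K => // m /= Km; have [h1 h2] := HK m Km.
by rewrite ger0_norm ?addr_ge0 // -/(a m) -/(b m) in h1 h2 *; rewrite [leRHS]splitr lerD.
Qed.

Lemma test_function_L2' psi : test_function D psi -> L2 leb D psi.
Proof.
move=> tpsi; have [K _ pK] := test_function_coord_bounded tpsi.
have [M HM] := coord_bounded_bounded (smooth_continuous (proj1 tpsi)) pK.
apply: (@L2_bounded _ _ _ _ _ mD leD _ M) => //.
exact: continuous_rV_measurable (smooth_continuous (proj1 tpsi)).
Qed.

Lemma test_function_gradL2 psi : test_function D psi -> L2v D (grad psi).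
Proof.
move=> tpsi k; under eq_fun do rewrite mxE.
by apply: test_function_L2'; exact: test_function_pderiv.
Qed.

(** Both sides of the weak identity are continuous in L^2. The identity holds for the smooth
    [phi m], and Cauchy-Schwarz bounds the two errors. *)
Lemma weak_limit (phi : nat -> T -> R) u Du k : (forall m, smooth (phi m)) ->
  (forall m, L2 leb D (phi m)) -> (forall m, L2v D (grad (phi m))) -> L2 leb D u -> L2v D Du ->
  (forall e : R, 0 < e -> exists m, \int[leb]_(x in D) ((phi m x - u x) ^+ 2) <= e /\
     nrm2 D (fun x => grad (phi m) x - Du x) <= e) ->
  weak_pderiv D k u (fun x => Du x ord0 k).
Proof.
move=> sp Lp Lg Lu LDu H psi tpsi.
have tk := test_function_pderiv k tpsi.
have L1 := test_function_L2' tpsi; have L2k := test_function_L2' tk.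
pose A := \int[leb]_(x in D) (pderiv k psi x ^+ 2); pose B := \int[leb]_(x in D) (psi x ^+ 2).
have A0 : 0 <= A by apply: Rintegral_ge0 => x _; exact: sqr_ge0.
have B0 : 0 <= B by apply: Rintegral_ge0 => x _; exact: sqr_ge0.
apply/eqP; rewrite -addr_eq0 -sqrf_eq0 eq_le sqr_ge0 andbT; apply/ler_addgt0Pr => e e0; rewrite add0r.
have c0 : 0 < 2 * A + 2 * B + 1 by lra.
have [m [h1 h2]] := H (e / (2 * A + 2 * B + 1)) ltac:(by rewrite divr_gt0).
have Lgk : L2 leb D (pderiv k (phi m)) by have := Lg m k; under eq_fun do rewrite mxE.
have w := smooth_weak_pderiv (D := D) k (sp m) tpsi.
have Ld := L2B mD Lu (Lp m); have Ldk := L2B mD (LDu k) Lgk.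
pose X := \int[leb]_(x in D) ((u x - phi m x) * pderiv k psi x).
pose Y := \int[leb]_(x in D) ((Du x ord0 k - pderiv k (phi m) x) * psi x).
have E : \int[leb]_(x in D) (u x * pderiv k psi x) + \int[leb]_(x in D) (Du x ord0 k * psi x) = X + Y.
  have -> : \int[leb]_(x in D) (u x * pderiv k psi x) = X + \int[leb]_(x in D) (phi m x * pderiv k psi x).
    rewrite -RintegralD //; [|exact: L2M_integrable|exact: L2M_integrable].
    by apply: eq_Rintegral => x _; ring.
  have -> : \int[leb]_(x in D) (Du x ord0 k * psi x) = Y + \int[leb]_(x in D) (pderiv k (phi m) x * psi x).
    rewrite -RintegralD //; [|exact: L2M_integrable|exact: L2M_integrable].
    by apply: eq_Rintegral => x _; ring.
  by rewrite w; ring.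
rewrite E; apply: (le_trans (sqrD_le _ _)).
have hX : X ^+ 2 <= e / (2 * A + 2 * B + 1) * A.
  apply: (le_trans (L2_CS mD Ld L2k)); rewrite ler_wpM2r //; apply: le_trans h1.
  by rewrite le_eqVlt; apply/orP; left; apply/eqP; apply: eq_Rintegral => x _; ring.
have hY : Y ^+ 2 <= e / (2 * A + 2 * B + 1) * B.
  apply: (le_trans (L2_CS mD Ldk L1)); rewrite ler_wpM2r //; apply: le_trans h2.
  rewrite nrm2_sum //; last exact: L2vB.
  rewrite (bigD1 k) //= [X in _ <= X + _](_ : _ = \int[leb]_(x in D) ((Du x ord0 k - pderiv k (phi m) x) ^+ 2)).
    by rewrite lerDl; apply: sumr_ge0 => i _; apply: Rintegral_ge0 => x _; exact: sqr_ge0.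
  by apply: eq_Rintegral => x _; rewrite !mxE; ring.
have ec : e / (2 * A + 2 * B + 1) * (2 * A + 2 * B + 1) = e by rewrite divfK ?gt_eqF.
have r0 : 0 < e / (2 * A + 2 * B + 1) by rewrite divr_gt0.
rewrite -[leRHS]ec; move: hX hY r0; move: (e / _) (X ^+ 2) (Y ^+ 2) => r X2 Y2; lra.
Qed.

End h1_limits.

(** * Existence for the Dirichlet problem *)

Section dirichlet_existence.
Context {R : realType} {n : nat}.
Local Notation T := 'rV[R]_n.
Local Notation leb := (@lebesgue_rV R n).
Variables (O : set T) (M : R) (k0 : 'I_n).
Hypothesis oO : open O.
Hypothesis OM : O `<=` box n M.
Hypothesis M0 : 0 < M.
Hypothesis leO : (leb O < +oo)%E.

Let mO : measurable O := open_measurable_rV oO.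

(* The L^2-closure of the gradients of test functions, i.e. grad H^1_0. *)
Definition Vcl (w : T -> 'rV[R]_n) := L2v O w /\ forall e : R, 0 < e ->
  exists2 psi, test_function O psi & nrm2 O (fun x => grad psi x - w x) <= e.

Lemma H1_0_test psi : test_function O psi -> H1_0 O psi (grad psi).
Proof.
move=> tpsi; have L1 := test_function_L2' mO leO tpsi; have Lg := test_function_gradL2 mO leO tpsi.
split.
  split => // k; have := smooth_weak_pderiv (D := O) k (proj1 tpsi).
  by congr weak_pderiv; apply/funext => x; rewrite mxE.
exists (fun=> psi) => //; apply/(H1_cvgP mO) => // e e0; exists 0%N => m _.
split; first by under eq_Rintegral do rewrite subrr expr0n; rewrite Rintegral_cst // mul0r ltW.
by rewrite /nrm2 /ipv; under eq_Rintegral do rewrite subrr dotv0l; rewrite Rintegral_cst // mul0r ltW.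
Qed.

Lemma H1_0_Vcl u Du : H1_0 O u Du -> Vcl Du.
Proof.
move=> [[Lu LDu _] [phi tphi cphi]]; split => // e e0.
have Lp m := test_function_L2' mO leO (tphi m); have Lg m := test_function_gradL2 mO leO (tphi m).
have /(H1_cvgP mO Lp Lg Lu LDu) /(_ e e0) [K /(_ K (leqnn K)) [_ h]] := cphi.
by exists (phi K).
Qed.

Lemma Vcl_ipv0 F w : L2v O F -> Vcl w -> (forall psi, test_function O psi -> ipv O F (grad psi) = 0) ->
  ipv O F w = 0.
Proof.
move=> LF [Lw Hw] F0; apply: (ipv_lim0 mO LF Lw) => e e0.
have [psi tpsi He] := Hw e e0; exists (grad psi); split => //; last exact: F0.
exact: test_function_gradL2.
Qed.

Lemma dirichlet_solution_facts B g w : dirichlet_solution O B g w ->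
  [/\ L2v O w.2, Vcl (fun x => w.2 x - (lift_bdry O g).2 x) &
  forall psi, test_function O psi -> ipv O (fun x => mxv (B x) (w.2 x)) (grad psi) = 0].
Proof.
move=> [[_ Lw _] Hw H]; split => //; first exact: H1_0_Vcl Hw.
by move=> psi tpsi; apply: H (H1_0_test tpsi).
Qed.

(** Lax-Milgram over the gradients of test functions, started from the gradient of the lift,
    produces only a limit of gradients. Friedrichs' inequality makes the potentials converge too,
    which gives the function itself. *)
Lemma dirichlet_existence (al be : R) B g : 0 < al -> 0 <= be -> tfield O al be B ->
  H1 O (lift_bdry O g).1 (lift_bdry O g).2 -> exists w, dirichlet_solution O B g w.
Proof.
move=> al0 be0 tB; pose g0 := (lift_bdry O g).1; pose g1 := (lift_bdry O g).2.
rewrite -/g0 -/g1 => -[Lg0 Lg1 wg].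
pose S : set (T -> 'rV[R]_n) := [set F | exists2 psi, test_function O psi & F = grad psi].
have SL : S `<=` L2v O by move=> _ [psi tpsi ->]; exact: test_function_gradL2.
have S0 : S 0.
  exists (fun=> 0); first exact: test_function0.
  by apply/funext => x; apply/rowP => k; rewrite !mxE pderiv_cst.
have SP a u v : S u -> S v -> S (a *: u + v).
  move=> [p tp ->] [q tq ->]; exists (fun x => a * p x + q x); first exact: test_functionP.
  by rewrite gradP //; [exact: (proj1 tp)|exact: (proj1 tq)].
have [s [w [Ss Lw sw Hw]]] := lax_milgram mO al0 be0 leO tB SL S0 SP Lg1.
have /choice[psi psiP] : forall m, exists psi, test_function O psi /\ s m = grad psi.
  by move=> m; have [psi ? ?] := Ss m; exists psi.
have tpsi m := (psiP m).1; have spsi m : s m = grad (psi m) := (psiP m).2.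
have Lp m := test_function_L2' mO leO (tpsi m); have Lg m := test_function_gradL2 mO leO (tpsi m).
have c0 : 0 < 4 * M ^+ 2 by rewrite mulr_gt0 // exprn_gt0.
have [|v Lv sv] := L2_complete mO leO Lp.
  move=> e e0; have [K HK] := sw (e / (4 * M ^+ 2) / 4) ltac:(by rewrite !divr_gt0).
  exists K => m p Km Kp.
  have td : test_function O (fun x => -1 * psi p x + psi m x) by exact: test_functionP.
  have := friedrichs k0 OM M0 td.
  under eq_Rintegral do rewrite mulN1r addrC; move=> /le_trans; apply.
  rewrite -ler_pdivlMl // mulrC.
  apply: (@le_trans _ _ (nrm2 O (fun x => s m x - s p x))).
    rewrite nrm2_sum //; last by rewrite !spsi; exact: L2vB.
    rewrite (bigD1 k0) //= [X in _ <= X + _](_ : _ = \int[leb]_(x in O) (pderiv k0 (fun x => -1 * psi p x + psi m x) x ^+ 2)).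
      by rewrite lerDl; apply: sumr_ge0 => i _; apply: Rintegral_ge0 => x _; exact: sqr_ge0.
    apply: eq_Rintegral => x _; congr (_ ^+ 2).
    have := congr1 (fun F : T -> 'rV[R]_n => F x ord0 k0) (gradP (-1) (proj1 (tpsi p)) (proj1 (tpsi m))).
    by rewrite !spsi rVZDE !mxE mulN1r addrC => ->.
  have -> : (fun x => s m x - s p x) = (fun x => (s m x - w x) + (w x - s p x)).
    by apply/funext => x; rewrite addrA subrK.
  have Lmw : L2v O (fun x => s m x - w x) by rewrite spsi; exact: L2vB.
  have Lwp : L2v O (fun x => w x - s p x) by rewrite spsi; exact: L2vB.
  apply: (le_trans (nrm2D_le mO Lmw Lwp)); rewrite [X in _ + 2 * X]nrm2C.
  by have := HK m Km; have := HK p Kp; move: (e / (4 * M ^+ 2)) => c; lra.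
have cv : forall e : R, 0 < e -> exists K : nat, forall m, (K <= m)%N ->
    \int[leb]_(x in O) ((psi m x - v x) ^+ 2) <= e /\ nrm2 O (fun x => grad (psi m) x - w x) <= e.
  move=> e e0; have [K1 H1] := sv e e0; have [K2 H2] := sw e e0; exists (maxn K1 K2) => m.
  rewrite geq_max => /andP[h1 h2]; split; first exact: H1.
  by rewrite -spsi; exact: H2.
have H1v : H1 O v w.
  split; [exact: Lv|exact: Lw|move=> k]; apply: (weak_limit mO leO k (fun m => proj1 (tpsi m)) Lp Lg Lv Lw) => e e0.
  by have [K /(_ K (leqnn K)) H] := cv e e0; exists K.
exists (fun x => g0 x + v x, fun x => g1 x + w x); rewrite /dirichlet_solution /= -/g0 -/g1.
have e1 : ((fun x => g0 x + v x) \- g0) = v by apply/funext => x /=; rewrite addrC addKr.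
have e2 : ((fun x => g1 x + w x) \- g1) = w by apply/funext => x /=; rewrite addrC addKr.
have Lgw : L2v O (fun x => g1 x + w x) by exact: L2vD.
split.
- split; first exact: L2D; first exact: Lgw.
  move=> k phi tphi; have [_ _ wv] := H1v.
  have Lphi := test_function_L2' mO leO tphi; have Lk := test_function_L2' mO leO (test_function_pderiv k tphi).
  transitivity (\int[leb]_(x in O) (g0 x * pderiv k phi x) + \int[leb]_(x in O) (v x * pderiv k phi x)).
    rewrite -RintegralD //; [|exact: L2M_integrable|exact: L2M_integrable].
    by apply: eq_Rintegral => x _; rewrite mulrDl.
  rewrite (wg k phi tphi) (wv k phi tphi) -opprD; congr (- _).
  rewrite -RintegralD //; [|exact: (L2M_integrable mO (Lg1 k) Lphi)|exact: (L2M_integrable mO (Lw k) Lphi)].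
  by apply: eq_Rintegral => x _; rewrite mxE mulrDl.
- rewrite e1 e2; split => //; exists psi => //.
  by apply/(H1_cvgP mO Lp Lg Lv Lw).
- move=> u Du Hu; apply: Vcl_ipv0 (H1_0_Vcl Hu) _; first exact: (L2v_tfield mO be0 tB Lgw).
  by move=> p tp; apply: Hw; exists p.
Qed.

End dirichlet_existence.

(** * Existence for the cell problem *)

Section cell_existence.
Context {R : realType} {n : nat}.
Local Notation T := 'rV[R]_n.
Local Notation leb := (@lebesgue_rV R n).
Local Notation Y := (@unit_cube R n).

Let mY := @measurable_unit_cube R n.
Let leY := @unit_cube_lty R n.

Definition smooth_periodic (phi : T -> R) := smooth phi /\ cell_periodic phi.

Lemma smooth_L2 phi : smooth phi -> L2 leb Y phi.
Proof. exact: smooth_L2_cube. Qed.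

Lemma smooth_gradL2 phi : smooth phi -> L2v Y (grad phi).
Proof.
by move=> sp k; under eq_fun do rewrite mxE; apply: smooth_L2_cube; exact: smooth_pderiv.
Qed.

Lemma gradsqE phi : smooth phi -> gradsq phi = nrm2 Y (grad phi).
Proof.
move=> sp; rewrite nrm2_sum //; last exact: smooth_gradL2.
by apply: eq_bigr => k _; apply: eq_Rintegral => x _; rewrite mxE.
Qed.

(** The test space of the cell problem requires mean zero, while only gradients enter the
    equation. *)
Lemma subr_mean phi : smooth_periodic phi -> exists psi, [/\ smooth_periodic psi, grad psi = grad phi &
  \int[leb]_(y in Y) psi y = 0].
Proof.
move=> [sp pp]; pose m := \int[leb]_(y in Y) phi y.
exists (fun x => 1 * phi x + - m); split.
- split; first by apply: smoothD; [exact: smoothZ|exact: smooth_cst].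
  by move=> y k; rewrite pp.
- rewrite (gradP 1 sp (smooth_cst (- m))); apply/funext => x; apply/rowP => k.
  by rewrite rVZDE !mxE pderiv_cst mul1r addr0.
- have im : leb.-integrable Y (EFin \o (fun=> - m)) by apply: (L2_integrable mY leY); exact: L2_cst.
  have ip : leb.-integrable Y (EFin \o (fun x => 1 * phi x)).
    by apply: (L2_integrable mY leY); apply: smooth_L2; exact: smoothZ.
  rewrite RintegralD // Rintegral_cst //= leb_unit_cube mulr1.
  by under eq_Rintegral do rewrite mul1r; rewrite subrr.
Qed.

Lemma W1_per_smooth phi : smooth_periodic phi -> \int[leb]_(y in Y) phi y = 0 -> W1_per phi (grad phi).
Proof.
move=> [sp pp] p0; have L1 := smooth_L2 sp; have Lg := smooth_gradL2 sp.
split => //; split.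
  split => // k; have := smooth_weak_pderiv (D := Y) k sp.
  by congr weak_pderiv; apply/funext => x; rewrite mxE.
exists (fun=> phi) => //; apply/(H1_cvgP mY) => // e e0; exists 0%N => m _.
split; first by under eq_Rintegral do rewrite subrr expr0n; rewrite Rintegral_cst // mul0r ltW.
by rewrite /nrm2 /ipv; under eq_Rintegral do rewrite subrr dotv0l; rewrite Rintegral_cst // mul0r ltW.
Qed.

(** The L^2-closure of the gradients of smooth periodic functions, the analogue of [Vcl] on the
    cell. *)
Definition Pcl (w : T -> 'rV[R]_n) := L2v Y w /\ forall e : R, 0 < e ->
  exists2 phi, smooth_periodic phi & nrm2 Y (fun x => grad phi x - w x) <= e.

Lemma W1_per_Pcl v Dv : W1_per v Dv -> Pcl Dv.
Proof.
move=> [[[Lu LDu _] [phi tphi cphi]] _]; split => // e e0.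
have Lp m := smooth_L2 (tphi m).1; have Lg m := smooth_gradL2 (tphi m).1.
have /(H1_cvgP mY Lp Lg Lu LDu) /(_ e e0) [K /(_ K (leqnn K)) [_ h]] := cphi.
by exists (phi K).
Qed.

Lemma Pcl_ipv0 F w : L2v Y F -> Pcl w -> (forall phi, smooth_periodic phi -> ipv Y F (grad phi) = 0) ->
  ipv Y F w = 0.
Proof.
move=> LF [Lw Hw] F0; apply: (ipv_lim0 mY LF Lw) => e e0.
have [psi tpsi He] := Hw e e0; exists (grad psi); split => //; last exact: F0.
exact: smooth_gradL2 tpsi.1.
Qed.

Lemma L2v_cst (c : 'rV[R]_n) : L2v Y (fun=> c).
Proof. by move=> k; exact: L2_cst. Qed.

Lemma cell_existence (al be : R) B j : 0 < al -> 0 <= be -> tfield Y al be B ->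
  exists chi, cell_solution B j chi.
Proof.
move=> al0 be0 tB.
pose S : set (T -> 'rV[R]_n) := [set F | exists2 phi, smooth_periodic phi & F = grad phi].
have SL : S `<=` L2v Y by move=> _ [phi tphi ->]; exact: smooth_gradL2 tphi.1.
have S0 : S 0.
  exists (fun=> 0); first by split => //; exact: smooth_cst.
  by apply/funext => x; apply/rowP => k; rewrite !mxE pderiv_cst.
have SP a u v : S u -> S v -> S (a *: u + v).
  move=> [p [sp pp] ->] [q [sq pq] ->]; exists (fun x => a * p x + q x).
    split; first by apply: smoothD => //; exact: smoothZ.
    by move=> y k; rewrite pp pq.
  by rewrite gradP.
(* With f = - e_j, orthogonality of B (w - e_j) to the periodic gradients is the cell equation for
   the j-th corrector. *)
have Le : L2v Y (fun=> - delta_mx ord0 j) by exact: L2v_cst.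
have [s [w [Ss Lw sw Hw]]] := lax_milgram mY al0 be0 leY tB SL S0 SP Le.
have /choice[psi psiP] : forall m, exists psi, [/\ smooth_periodic psi, s m = grad psi & \int[leb]_(y in Y) psi y = 0].
  move=> m; have [phi tphi ->] := Ss m; have [psi [? E ?]] := subr_mean tphi.
  by exists psi; split.
have spsi m : smooth (psi m) by case: (psiP m) => -[].
have ppsi m : cell_periodic (psi m) by case: (psiP m) => -[].
have gpsi m : s m = grad (psi m) by case: (psiP m).
have ipsi m : \int[leb]_(y in Y) psi m y = 0 by case: (psiP m).
have Lp m := smooth_L2 (spsi m); have Lg m := smooth_gradL2 (spsi m).
have [c c0 PW] := @poincare_wirtinger R n.
have c1 : 0 < c + 1 by rewrite ltr_wpDl.
have [|v Lv sv] := L2_complete mY leY Lp.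
  move=> e e0; have [K HK] := sw (e / (c + 1) / 4) ltac:(by rewrite !divr_gt0).
  exists K => m p Km Kp.
  have sd : smooth (fun x => -1 * psi p x + psi m x) by apply: smoothD => //; exact: smoothZ.
  have id0 : \int[leb]_(y in Y) (-1 * psi p y + psi m y) = 0.
    have ip : leb.-integrable Y (EFin \o (fun x => -1 * psi p x)).
      by apply: (L2_integrable mY leY); exact: L2Z.
    rewrite RintegralD //; last exact: L2_integrable.
    by rewrite RintegralZl // ?ipsi ?mulr0 ?addr0 //; exact: L2_integrable.
  have := PW _ sd id0; rewrite gradsqE //.
  under eq_Rintegral do rewrite mulN1r addrC; move=> /le_trans; apply.
  have -> : grad (fun x => -1 * psi p x + psi m x) = (fun x => (s m x - w x) + (w x - s p x)).
    by rewrite gradP // -!gpsi; apply/funext => x; rewrite scaleN1r addrA subrK addrC.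
  have Lmw : L2v Y (fun x => s m x - w x) by rewrite gpsi; exact: L2vB.
  have Lwp : L2v Y (fun x => w x - s p x) by rewrite gpsi; exact: L2vB.
  have h : nrm2 Y (fun x => (s m x - w x) + (w x - s p x)) <= e / (c + 1).
    apply: (le_trans (nrm2D_le mY Lmw Lwp)); rewrite [X in _ + 2 * X]nrm2C.
    have half (X Y d : R) : X <= d / 4 -> Y <= d / 4 -> 2 * X + 2 * Y <= d by lra.
    exact: half (HK m Km) (HK p Kp).
  apply: (le_trans (ler_wpM2l c0 h)).
  by rewrite mulrA ler_pdivrMr // mulrC ler_pM2l // lerDl.
have cv : forall e : R, 0 < e -> exists K : nat, forall m, (K <= m)%N ->
    \int[leb]_(x in Y) ((psi m x - v x) ^+ 2) <= e /\ nrm2 Y (fun x => grad (psi m) x - w x) <= e.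
  move=> e e0; have [K1 H1] := sv e e0; have [K2 H2] := sw e e0; exists (maxn K1 K2) => m.
  rewrite geq_max => /andP[h1 h2]; split; first exact: H1.
  by rewrite -gpsi; exact: H2.
have H1v : H1 Y v w.
  split; [exact: Lv|exact: Lw|move=> k]; apply: (weak_limit mY leY k spsi Lp Lg Lv Lw) => e e0.
  by have [K /(_ K (leqnn K)) H] := cv e e0; exists K.
(* The zero mean of the potentials passes to the limit: the unit cube has measure 1, so a mean is
   bounded by the L^2 norm. *)
have v0 : \int[leb]_(y in Y) v y = 0.
  apply/eqP; rewrite -sqrf_eq0 eq_le sqr_ge0 andbT; apply/ler_addgt0Pr => e e0; rewrite add0r.
  have [K /(_ K (leqnn K)) HK] := sv e e0; apply: le_trans HK.
  have L1 : L2 leb Y (fun=> 1) by exact: L2_cst.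
  have := L2_CS mY (L2B mY (Lp K) Lv) L1.
  rewrite [X in _ <= _ * X -> _](_ : _ = 1); last first.
    by under eq_Rintegral do rewrite expr1n; rewrite Rintegral_cst //= leb_unit_cube mul1r.
  rewrite mulr1 => /(le_trans _); apply.
  rewrite [X in _ <= X ^+ 2](_ : _ = - \int[leb]_(y in Y) v y) ?sqrrN //.
  under eq_Rintegral do rewrite mulr1.
  have iv : leb.-integrable Y (EFin \o (fun x => -1 * v x)).
    by apply: (L2_integrable mY leY); exact: L2Z.
  have -> : \int[leb]_(y in Y) (psi K y - v y) = \int[leb]_(y in Y) (psi K y + -1 * v y).
    by apply: eq_Rintegral => y _; rewrite mulN1r.
  rewrite RintegralD //; last exact: L2_integrable.
  by rewrite ipsi add0r RintegralZl ?mulN1r //; exact: L2_integrable.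
have Ww : W1_per v w.
  split => //; split => //; exists psi; first by move=> m; split.
  by apply/(H1_cvgP mY Lp Lg Lv Lw).
exists (v, w); split => //= u Du Hu.
have [LDu _] := W1_per_Pcl Hu.
have Lew : L2v Y (fun x => - delta_mx ord0 j + w x) by exact: L2vD.
have E : ipv Y (fun x => mxv (B x) (- delta_mx ord0 j + w x)) Du = 0.
  apply: Pcl_ipv0 (W1_per_Pcl Hu) _; first exact: (L2v_tfield mY be0 tB Lew).
  by move=> p tp; apply: Hw; exists p.
apply/eqP; rewrite -subr_eq0; apply/eqP; rewrite -[RHS]E.
rewrite -[LHS]/(ipv Y (fun x => mxv (B x) (w x)) Du - ipv Y (fun x => mxv (B x) (delta_mx ord0 j)) Du).
rewrite -ipvB //; [|exact: (L2v_tfield mY be0 tB)|exact: (L2v_tfield mY be0 tB (L2v_cst _))].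
by apply: eq_Rintegral => x _; rewrite -mxvB addrC.
Qed.

End cell_existence.

(** * The homogenized tensor *)

Section homogenized_theory.
Context {R : realType} {n : nat}.
Local Notation T := 'rV[R]_n.
Local Notation leb := (@lebesgue_rV R n).
Local Notation Y := (@unit_cube R n).
Variables (al be : R).
Hypothesis al0 : 0 < al.
Hypothesis be0 : 0 <= be.
Implicit Types (B : T -> 'M[R]_n) (c : 'rV[R]_n).

Let mY := @measurable_unit_cube R n.
Let leY := @unit_cube_lty R n.

(** Gradient of the corrector in direction [c], by linearity from the chosen correctors of the basis
    vectors. *)
Definition dchi B c (y : T) : 'rV[R]_n := \sum_j c ord0 j *: (corrector B j).2 y.
(* The gradient of y |-> c . y - chi_c y, where chi_c is the corrector. *)
Definition cellg B c (y : T) : 'rV[R]_n := c - dchi B c y.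

Lemma corrector_spec B j : tfield Y al be B -> cell_solution B j (corrector B j).
Proof. by move=> tB; have /getPex := cell_existence j al0 be0 tB. Qed.

Lemma PclP a (F G : T -> 'rV[R]_n) : Pcl F -> Pcl G -> Pcl (fun y => a *: F y + G y).
Proof.
move=> [LF HF] [LG HG]; split; first exact: L2vP.
move=> e e0; have c0 : 0 < 4 * (a ^+ 2 + 1) by rewrite mulr_gt0 // ltr_wpDl // sqr_ge0.
have [p [sp pp] Hp] := HF (e / (4 * (a ^+ 2 + 1))) ltac:(by rewrite divr_gt0).
have [q [sq pq] Hq] := HG (e / 4) ltac:(by rewrite divr_gt0).
exists (fun x => a * p x + q x).
  split; first by apply: smoothD => //; exact: smoothZ.
  by move=> y k; rewrite pp pq.
have Lp := L2vB mY (smooth_gradL2 sp) LF; have Lq := L2vB mY (smooth_gradL2 sq) LG.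
have -> : (fun x => grad (fun x => a * p x + q x) x - (a *: F x + G x)) =
    (fun x => a *: (grad p x - F x) + (grad q x - G x)).
  by apply/funext => x; rewrite gradP // scalerBr addrACA -opprD.
apply: (le_trans (nrm2D_le mY (L2vZ mY a Lp) Lq)); rewrite nrm2Z //.
have h := nrm2_ge0 Y (fun x => grad p x - F x).
move: Hp Hq h; move: (nrm2 _ _) (nrm2 _ _) => P Q; rewrite ler_pdivlMr // => Hp Hq h.
by have := sqr_ge0 a; nra.
Qed.

Lemma Pcl0 : Pcl (fun _ : T => 0 : 'rV[R]_n).
Proof.
split; first exact: L2v0.
move=> e e0; exists (fun=> 0); first by split => //; exact: smooth_cst.
rewrite (@nrm2_eq _ _ _ _ (fun=> 0)); last by move=> x _; apply/rowP => k; rewrite !mxE pderiv_cst subr0.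
by rewrite /nrm2 /ipv; under eq_Rintegral do rewrite dotv0l; rewrite Rintegral_cst // mul0r ltW.
Qed.

Lemma dchi_Pcl B c : tfield Y al be B -> Pcl (dchi B c).
Proof.
move=> tB; rewrite /dchi; elim: (index_enum _) => [|j r IH].
  by rewrite (_ : (fun y => _) = fun=> 0); [exact: Pcl0|apply/funext => y; rewrite big_nil].
have -> : (fun y => \sum_(i <- j :: r) c ord0 i *: (corrector B i).2 y) =
   (fun y => c ord0 j *: (corrector B j).2 y + \sum_(i <- r) c ord0 i *: (corrector B i).2 y).
  by apply/funext => y; rewrite big_cons.
by apply: PclP => //; have [/W1_per_Pcl] := corrector_spec j tB.
Qed.

Lemma cellg_L2v B c : tfield Y al be B -> L2v Y (cellg B c).
Proof. by move=> tB; apply: L2vB => //; [exact: L2v_cst|case: (dchi_Pcl c tB)]. Qed.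

Lemma Pcl_mean (F : T -> 'rV[R]_n) c : Pcl F -> ipv Y (fun=> c) F = 0.
Proof.
move=> PF; apply: Pcl_ipv0 => //; first exact: L2v_cst.
move=> phi [sp pp]; rewrite ipvE //; [|exact: L2v_cst|exact: smooth_gradL2].
rewrite big1 // => k _.
have i1 : leb.-integrable Y (EFin \o pderiv k phi).
  by apply: L2_integrable => //; apply: smooth_L2; exact: smooth_pderiv.
under eq_Rintegral do rewrite mxE.
by rewrite RintegralZl // periodic_pderiv0 // mulr0.
Qed.

Lemma cellg_delta B j y : cellg B (delta_mx ord0 j) y = delta_mx ord0 j - (corrector B j).2 y.
Proof.
rewrite /cellg /dchi (bigD1 j) //= big1 ?addr0; first by rewrite mxE !eqxx scale1r.
by move=> i ij; rewrite mxE (negbTE ij) andbF scale0r.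
Qed.

Lemma cellg_sum B c y : cellg B c y = \sum_j c ord0 j *: cellg B (delta_mx ord0 j) y.
Proof.
rewrite /cellg {1}(row_sum_delta c) /dchi -sumrB; apply: eq_bigr => j _.
by rewrite -scalerBr; congr (_ *: _); have := cellg_delta B j y; rewrite /cellg /dchi => ->.
Qed.

Lemma ipv_suml (I : Type) (r : seq I) (F : I -> T -> 'rV[R]_n) (G : T -> 'rV[R]_n) :
  (forall i, L2v Y (F i)) -> L2v Y G ->
  ipv Y (fun y => \sum_(i <- r) F i y) G = \sum_(i <- r) ipv Y (F i) G.
Proof.
move=> LF LG; elim: r => [|i r IH].
  rewrite /ipv; under eq_Rintegral do rewrite big_nil dotv0l.
  by rewrite Rintegral_cst // mul0r big_nil.
have Lr : L2v Y (fun y => \sum_(i <- r) F i y).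
  by move=> k; under eq_fun do rewrite summxE; apply: L2_sum => // j _; exact: LF.
rewrite big_cons -IH -ipvD //; apply: eq_Rintegral => y _; by rewrite big_cons.
Qed.

Lemma mxv_sum (C : 'M[R]_n) (I : Type) (r : seq I) (F : I -> 'rV[R]_n) :
  mxv C (\sum_(i <- r) F i) = \sum_(i <- r) mxv C (F i).
Proof. by rewrite /mxv mulmx_suml. Qed.

(** The equations for the basis vectors combine linearly, and the test function is first shifted to
    mean zero. *)
Lemma cell_equation B c phi : tfield Y al be B -> smooth_periodic phi ->
  ipv Y (fun y => mxv (B y) (cellg B c y)) (grad phi) = 0.
Proof.
move=> tB tphi; have Lg := smooth_gradL2 tphi.1.
have Lj j : L2v Y (fun y => mxv (B y) (cellg B (delta_mx ord0 j) y)).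
  by apply: (L2v_tfield mY be0 tB); exact: cellg_L2v.
have H j : ipv Y (fun y => mxv (B y) (cellg B (delta_mx ord0 j) y)) (grad phi) = 0.
  have [W /= Hj] := corrector_spec j tB.
  have [psi [tpsi <- psi0]] := subr_mean tphi.
  have Lg' := smooth_gradL2 tpsi.1.
  have := Hj _ _ (W1_per_smooth tpsi psi0) => /eqP; rewrite eq_sym -subr_eq0 => /eqP <-.
  have [LW _] := W1_per_Pcl W.
  rewrite -[RHS]/(ipv Y (fun x => mxv (B x) (delta_mx ord0 j)) (grad psi) - ipv Y (fun x => mxv (B x) ((corrector B j).2 x)) (grad psi)).
  rewrite -ipvB //; [|exact: (L2v_tfield mY be0 tB (L2v_cst _))|exact: (L2v_tfield mY be0 tB)].
  by apply: eq_Rintegral => x _; rewrite -mxvB cellg_delta.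
have -> : (fun y => mxv (B y) (cellg B c y)) = (fun y => \sum_j c ord0 j *: mxv (B y) (cellg B (delta_mx ord0 j) y)).
  by apply/funext => y; rewrite cellg_sum mxv_sum; apply: eq_bigr => j _; rewrite mxvZ.
rewrite ipv_suml //; last by move=> j; exact: L2vZ.
by rewrite big1 // => j _; rewrite ipvZ // H mulr0.
Qed.

Lemma homogenizedE B i j : tfield Y al be B ->
  homogenized B i j = ipv Y (fun y => mxv (B y) (cellg B (delta_mx ord0 j) y)) (fun=> delta_mx ord0 i).
Proof.
move=> tB; have [mB eB] := tB.
rewrite /homogenized mxE leb_unit_cube /= invr1 !mul1r.
have [W _] := corrector_spec j tB; have [LW _] := W1_per_Pcl W.
have LB i' j' : L2 leb Y (fun y => B y i' j').
  apply: (@L2_bounded _ _ _ _ _ mY leY _ be) => // y Yy; exact: elliptic_entry be0 (eB y Yy).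
have ik k : leb.-integrable Y (EFin \o (fun y => B y i k * (corrector B j).2 y ord0 k)).
  by apply: L2M_integrable.
have isum : leb.-integrable Y (EFin \o (fun y => - (\sum_k B y i k * (corrector B j).2 y ord0 k))).
  have h : leb.-integrable Y (EFin \o (fun y => \sum_k B y i k * (corrector B j).2 y ord0 k)).
    apply: eq_integrable (integrable_sum mY (index_enum 'I_n) (fun k _ => ik k)) => // x _ /=.
    by rewrite sumEFin.
  apply: eq_integrable (integrableZl mY (-1) h) => // y _ /=.
  by rewrite -EFinM mulN1r.
have -> : - (\sum_k \int[leb]_(y in Y) (B y i k * (corrector B j).2 y ord0 k)) =
    \int[leb]_(y in Y) (- (\sum_k B y i k * (corrector B j).2 y ord0 k)).
  have h : leb.-integrable Y (EFin \o (fun y => \sum_k B y i k * (corrector B j).2 y ord0 k)).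
    apply: eq_integrable (integrable_sum mY (index_enum 'I_n) (fun k _ => ik k)) => // x _ /=.
    by rewrite sumEFin.
  rewrite -Rintegral_sum // -mulN1r -(RintegralZl (-1) mY h).
  by apply: eq_Rintegral => y _; rewrite mulN1r.
rewrite -RintegralD //; last exact: L2_integrable.
by apply: eq_Rintegral => y _; rewrite dotv_delta cellg_delta mxvB [RHS]mxE [X in _ = _ + X]mxE mxv_delta mxvE.
Qed.

Lemma homogenized_form B c c' : tfield Y al be B ->
  dotv (mxv (homogenized B) c) c' = ipv Y (fun y => mxv (B y) (cellg B c y)) (fun=> c').
Proof.
move=> tB.
have Lj j : L2v Y (fun y => mxv (B y) (cellg B (delta_mx ord0 j) y)).
  by apply: (L2v_tfield mY be0 tB); exact: cellg_L2v.
have -> : (fun y => mxv (B y) (cellg B c y)) = (fun y => \sum_j c ord0 j *: mxv (B y) (cellg B (delta_mx ord0 j) y)).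
  by apply/funext => y; rewrite cellg_sum mxv_sum; apply: eq_bigr => j _; rewrite mxvZ.
rewrite ipv_suml //; [|by move=> j; exact: L2vZ|exact: L2v_cst].
have -> : dotv (mxv (homogenized B) c) c' = \sum_j c ord0 j * \sum_i c' ord0 i * homogenized B i j.
  rewrite /dotv; under eq_bigr do rewrite mxvE mulr_suml.
  rewrite exchange_big; apply: eq_bigr => j _; rewrite mulr_sumr; apply: eq_bigr => i _; ring.
apply: eq_bigr => j _; rewrite ipvZ //; last exact: L2v_cst.
congr (_ * _); rewrite ipvC.
have -> : (fun=> c') = (fun _ : T => \sum_i c' ord0 i *: (delta_mx ord0 i : 'rV[R]_n)).
  by apply/funext => y; rewrite -row_sum_delta.
rewrite ipv_suml //; last by move=> i; exact: L2v_cst.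
apply: eq_bigr => i _; rewrite homogenizedE // (ipvZ mY _ (L2v_cst _) (Lj j)).
by rewrite [in RHS]ipvC.
Qed.

Lemma cell_orth B c (F : T -> 'rV[R]_n) : tfield Y al be B -> Pcl F ->
  ipv Y (fun y => mxv (B y) (cellg B c y)) F = 0.
Proof.
move=> tB PF; apply: Pcl_ipv0 => //; first by apply: (L2v_tfield mY be0 tB); exact: cellg_L2v.
by move=> phi; exact: cell_equation.
Qed.

(** The cell equation lets any periodic gradient be subtracted from c', in particular the one
    belonging to another tensor B'. With B' = B this makes symmetry and coercivity visible; with B'
    different it allows two homogenized tensors to be compared. *)
Lemma homogenized_formg B B' c c' : tfield Y al be B -> tfield Y al be B' ->
  dotv (mxv (homogenized B) c) c' = ipv Y (fun y => mxv (B y) (cellg B c y)) (cellg B' c').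
Proof.
move=> tB tB'; rewrite homogenized_form //.
have L := L2v_tfield mY be0 tB (cellg_L2v c tB).
rewrite [RHS]ipvC /cellg ipvB //; [|exact: L2v_cst|by case: (dchi_Pcl c' tB')].
by rewrite [X in _ - X]ipvC (cell_orth _ tB (dchi_Pcl c' tB')) subr0 ipvC.
Qed.

Lemma homogenized_sym B c c' : tfield Y al be B ->
  dotv (mxv (homogenized B) c) c' = dotv (mxv (homogenized B) c') c.
Proof. by move=> tB; rewrite !(homogenized_formg _ _ tB tB) (ipv_tfieldC _ _ tB). Qed.

Lemma nrm2_cst c : nrm2 Y (fun=> c) = dotv c c.
Proof. by rewrite /nrm2 /ipv Rintegral_cst //= leb_unit_cube mulr1. Qed.

(** The cell field has mean c, and its norm dominates that of its mean by Cauchy-Schwarz. *)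
Lemma cellg_nrm2_ge B c : tfield Y al be B -> dotv c c <= nrm2 Y (cellg B c).
Proof.
move=> tB; have L := cellg_L2v c tB; have Lc := @L2v_cst R n c.
have E : ipv Y (fun=> c) (cellg B c) = dotv c c.
  rewrite ipvC /cellg ipvB //; last by case: (dchi_Pcl c tB).
  by rewrite [X in _ - X]ipvC (Pcl_mean _ (dchi_Pcl c tB)) subr0 -/(nrm2 _ _) nrm2_cst.
have H := ipv_CS mY Lc L; rewrite E nrm2_cst expr2 in H.
have [->|c0] := eqVneq (dotv c c) 0; first exact: nrm2_ge0.
by rewrite -(ler_pM2l (x := dotv c c)) // lt_neqAle eq_sym c0 dotvv_ge0.
Qed.

Lemma homogenized_ge B c : tfield Y al be B -> al * dotv c c <= dotv (mxv (homogenized B) c) c.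
Proof.
move=> tB; rewrite (homogenized_formg _ _ tB tB).
apply: le_trans (coercive mY be0 tB (cellg_L2v c tB)); rewrite ler_wpM2l ?(ltW al0) //.
exact: cellg_nrm2_ge.
Qed.

(** The constant field c is a competitor: with g the cell field, c - g is a periodic gradient, so
    the energy of c is that of g plus that of c - g. This is the arithmetic-mean bound. *)
Lemma homogenized_le B c : tfield Y al be B -> dotv (mxv (homogenized B) c) c <= be * dotv c c.
Proof.
move=> tB; have L := cellg_L2v c tB; have Lc := @L2v_cst R n c.
pose b (F G : T -> 'rV[R]_n) := ipv Y (fun y => mxv (B y) (F y)) G.
have LB F : L2v Y F -> L2v Y (fun y => mxv (B y) (F y)) by move=> LF; exact: (L2v_tfield mY be0 tB LF).
have e1 : b (cellg B c) (cellg B c) = b (cellg B c) (fun=> c).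
  by rewrite /b -homogenized_formg // homogenized_form.
have e2 : 0 <= b (fun y => c - cellg B c y) (fun y => c - cellg B c y).
  apply: le_trans (coercive mY be0 tB (L2vB mY Lc L)); rewrite mulr_ge0 ?nrm2_ge0 ?(ltW al0) //.
have e3 : b (fun y => c - cellg B c y) (fun y => c - cellg B c y) =
   b (fun=> c) (fun=> c) - b (cellg B c) (fun=> c).
  have d : Pcl (fun y => c - cellg B c y).
    by have := dchi_Pcl c tB; congr Pcl; apply/funext => y; rewrite /cellg opprB addrC subrK.
  transitivity (b (fun=> c) (fun y => c - cellg B c y)).
    rewrite /b; transitivity (ipv Y (fun y => mxv (B y) c - mxv (B y) (cellg B c y)) (fun y => c - cellg B c y)).
      by apply: eq_Rintegral => y _; rewrite mxvB.
    rewrite ipvB //; [|exact: LB|exact: LB|exact: L2vB].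
    by rewrite (cell_orth _ tB d) subr0.
  rewrite /b ipvC ipvB //; last exact: LB.
  by rewrite ipvC; congr (_ - _); rewrite ipvC (ipv_tfieldC _ _ tB).
have e4 : b (fun=> c) (fun=> c) <= be * dotv c c.
  rewrite -nrm2_cst /nrm2 /b /ipv -(RintegralZl _ mY (ipv_integrable mY Lc Lc)).
  apply: le_Rintegral => //.
  - by apply: ipv_integrable => //; exact: LB.
  - by apply: eq_integrable (integrableZl mY be (ipv_integrable mY Lc Lc)).
  - by move=> y Yy; apply: elliptic_form_le be0 (tB.2 y Yy).
rewrite (homogenized_formg _ _ tB tB) -/(b _ _) e1.
by apply: le_trans e4; rewrite -subr_ge0 -e3.
Qed.

Lemma homogenized_elliptic B : tfield Y al be B -> elliptic al be (homogenized B).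
Proof.
move=> tB; split.
- apply/matrixP => i j; rewrite mxE.
  have := homogenized_sym (delta_mx ord0 i) (delta_mx ord0 j) tB.
  by rewrite !dotv_delta !mxv_delta.
- by move=> xi; exact: homogenized_ge.
(* With w = A0 xi, Cauchy-Schwarz for the form of A0 gives |w| ^ 4 <= (A0 xi . xi) (A0 w . w) <= be
   ^ 2 |xi| ^ 2 |w| ^ 2. *)
- move=> xi; set w := mxv _ xi.
  have H : dotv (mxv (homogenized B) xi) w ^+ 2 <= dotv (mxv (homogenized B) xi) xi * dotv (mxv (homogenized B) w) w.
    apply: (@sip_CS R _ setT (fun x y => dotv (mxv (homogenized B) x) y)) => //.
    + by move=> u v _ _; exact: homogenized_sym.
    + by move=> a u v w' _ _ _; rewrite mxvP dotvP.
    + by move=> u _; apply: le_trans (homogenized_ge u tB); rewrite mulr_ge0 ?dotvv_ge0 ?(ltW al0).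
  have h1 := homogenized_le xi tB; have h2 := homogenized_le w tB.
  have h3 := homogenized_ge xi tB; have h4 := homogenized_ge w tB.
  have x0 := dotvv_ge0 xi; have w0 := dotvv_ge0 w; rewrite -/w in H.
  have p1 : 0 <= dotv w xi by apply: le_trans h3; rewrite mulr_ge0 // ltW.
  have p2 : 0 <= dotv (mxv (homogenized B) w) w by apply: le_trans h4; rewrite mulr_ge0 // ltW.
  have H2 : dotv w w ^+ 2 <= (be * dotv xi xi) * (be * dotv w w).
    by apply: (le_trans H); apply: ler_pM.
  have [->|wn0] := eqVneq (dotv w w) 0; first by rewrite mulr_ge0 // sqr_ge0.
  have wp : 0 < dotv w w by rewrite lt_neqAle eq_sym wn0.
  by rewrite -(ler_pM2r wp) -expr2; apply: (le_trans H2); rewrite le_eqVlt; apply/orP; left; apply/eqP; ring.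
Qed.

Lemma cellg_nrm2_le B c : tfield Y al be B -> al * nrm2 Y (cellg B c) <= be * dotv c c.
Proof.
move=> tB; apply: le_trans (homogenized_le c tB).
rewrite (homogenized_formg _ _ tB tB); exact: (coercive mY be0 tB (cellg_L2v c tB)).
Qed.

(** Both entries are written with the same pair of cell fields, g of B and g' of B', so their
    difference is the integral of (B - B') g . g'. Each field has squared norm at most be / al, and
    a matrix with entries at most dl has norm at most n dl. *)
Lemma homogenized_lipschitz B B' (dl : R) : tfield Y al be B -> tfield Y al be B' -> 0 <= dl ->
  (forall y i j, Y y -> `|B y i j - B' y i j| <= dl) ->
  forall i j, `|homogenized B i j - homogenized B' i j| <= n%:R * dl * (be / al).
Proof.
move=> tB tB' dl0 HB i j.
pose c : 'rV[R]_n := delta_mx ord0 j; pose c' : 'rV[R]_n := delta_mx ord0 i.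
have Lc := cellg_L2v c tB; have Lc' := cellg_L2v c' tB'.
have mD i' j' : measurable_fun Y (fun y => (B y - B' y) i' j').
  under eq_fun do rewrite !mxE; apply: measurable_funB; [exact: tB.1|exact: tB'.1].
have DB y i' j' : Y y -> `|(B y - B' y) i' j'| <= dl by move=> Yy; rewrite !mxE; exact: HB.
have LD : L2v Y (fun y => mxv (B y - B' y) (cellg B c y)) by exact: (L2v_mxv mY mD DB Lc).
have E : homogenized B i j - homogenized B' i j = ipv Y (fun y => mxv (B y - B' y) (cellg B c y)) (cellg B' c').
  have e (H : 'M[R]_n) : dotv (mxv H c) c' = H i j by rewrite /c /c' dotv_delta mxv_delta.
  have h1 : homogenized B i j = ipv Y (fun y => mxv (B y) (cellg B c y)) (cellg B' c').
    by rewrite -(homogenized_formg c c' tB tB') e.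
  have h2 : homogenized B' i j = ipv Y (fun y => mxv (B' y) (cellg B c y)) (cellg B' c').
    by rewrite -(ipv_tfieldC (cellg B' c') _ tB') -(homogenized_formg c' c tB' tB) (homogenized_sym c' c tB') e.
  have L1 := L2v_tfield mY be0 tB Lc; have L2 := L2v_tfield mY be0 tB' Lc.
  rewrite [X in X - _]h1 [X in _ - X]h2 -(ipvB mY L1 L2 Lc').
  by apply: eq_Rintegral => y _; rewrite mxvBmx.
have n1 : nrm2 Y (fun y => mxv (B y - B' y) (cellg B c y)) <= (n%:R * dl) ^+ 2 * nrm2 Y (cellg B c).
  have i1 := ipv_integrable mY Lc Lc.
  rewrite /nrm2 /ipv -(RintegralZl _ mY i1); apply: le_Rintegral => //; first exact: ipv_integrable.
    by apply: eq_integrable (integrableZl mY ((n%:R * dl) ^+ 2) i1).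
  by move=> y Yy; apply: mxv_entry_bound dl0 _ => i' j'; exact: DB.
have ng (C : T -> 'M[R]_n) k : tfield Y al be C -> nrm2 Y (cellg C (delta_mx ord0 k)) <= be / al.
  move=> tC; rewrite ler_pdivlMr // mulrC; apply: (le_trans (cellg_nrm2_le _ tC)).
  by rewrite dotv_delta mxE !eqxx mulr1.
have r0 : 0 <= n%:R * dl * (be / al) by rewrite mulr_ge0 ?divr_ge0 ?(ltW al0) // mulr_ge0.
rewrite -ler_sqr ?nnegrE // real_normK ?num_real // E.
apply: (le_trans (ipv_CS mY LD Lc')).
rewrite (_ : (n%:R * dl * (be / al)) ^+ 2 = ((n%:R * dl) ^+ 2 * (be / al)) * (be / al)); last by ring.
apply: ler_pM; [exact: nrm2_ge0|exact: nrm2_ge0| |exact: ng].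
by apply: (le_trans n1); rewrite ler_wpM2l ?sqr_ge0 //; exact: ng.
Qed.

End homogenized_theory.

(** * Periodic extension from the unit cell *)

Section periodic_extension.
Context {R : realType} {n : nat}.
Local Notation T := 'rV[R]_n.
Local Notation leb := (@lebesgue_rV R n).
Local Notation Y := (@unit_cube R n).

Definition fracv (y : T) : T := \row_k (y ord0 k - (Num.floor (y ord0 k))%:~R).

(** The faces of the cells, where the fractional part leaves the open cube, get the value 0. The
    cell problem constrains correctors on the cube only, so their gradients are extended in this way
    before being scaled. *)
Definition pext (f : T -> R) (y : T) : R := if fracv y \in Y then f (fracv y) else 0.

Lemma frac_cube y : Y y -> fracv y = y.
Proof.
move=> Yy; apply/rowP => k; rewrite mxE (@floor_def _ _ 0) ?subr0 //.
by have /andP[h1 h2] := Yy k; rewrite (ltW h1).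
Qed.

Lemma frac_periodic : cell_periodic fracv.
Proof.
move=> y k; apply/rowP => i; rewrite !mxE eqxx /=.
have [->|ik] := eqVneq i k; last by rewrite addr0.
rewrite (_ : (true)%:R = 1%:~R) // floorDrz ?intr_int // intrKfloor intrD; ring.
Qed.

Lemma pext_periodic f : cell_periodic (pext f).
Proof. by move=> y k; rewrite /pext frac_periodic. Qed.

Lemma pext_cube f y : Y y -> pext f y = f y.
Proof. by move=> Yy; rewrite /pext frac_cube // mem_set. Qed.

Lemma measurable_frac : measurable_fun setT fracv.
Proof.
apply: measurable_fun_rV => k; under eq_fun do rewrite mxE.
apply: measurable_funB; first exact: measurable_coord.
have mf : measurable_fun setT (fun x : measurableTypeR R => ((Num.floor (x : R))%:~R : R)).
  apply: nondecreasing_measurable => // x y xy; by rewrite ler_int le_floor.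
exact: (measurableT_comp mf (measurable_coord k)).
Qed.

Lemma measurable_pext f : measurable_fun Y f -> measurable_fun setT (pext f).
Proof.
move=> mf.
have mp : measurable_fun setT (fun y : T => if y \in Y then f y else 0).
  by have := (measurable_restrictT f (@measurable_unit_cube R n)).1 mf.
exact: (measurableT_comp mp measurable_frac).
Qed.

Lemma pext_Lper f : L2 leb Y f -> Lper (pext f).
Proof.
move=> [mf Lf]; split; [exact: measurable_pext|exact: pext_periodic|].
split; first by apply: measurable_funTS; exact: measurable_pext.
apply: eq_integrable Lf; first exact: measurable_unit_cube.
by move=> y; rewrite inE => Yy /=; rewrite pext_cube.
Qed.

End periodic_extension.

(** * Extended cell fields and the fluctuation of their flux *)

Section cell_package.
Context {R : realType} {n : nat}.
Local Notation T := 'rV[R]_n.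
Local Notation leb := (@lebesgue_rV R n).
Local Notation Y := (@unit_cube R n).

Let mY := @measurable_unit_cube R n.
Let leY := @unit_cube_lty R n.

Lemma periodic_bounded (f : T -> R) : continuous f -> cell_periodic f ->
  exists2 C : R, 0 <= C & forall y, `|f y| <= C.
Proof.
move=> cf pf; have [C C0 HC] := continuous_box_bounded 2 cf; exists C => // y.
pose z : 'rV[int]_n := \row_k Num.floor (y ord0 k).
have -> : y = fracv y + zv z by apply/rowP => k; rewrite !mxE subrK.
rewrite (periodic_zv _ _ pf); apply: HC => k; rewrite mxE /= in_itv /=.
have /andP[h1 h2] := floor_itv (y ord0 k); rewrite intrD in h2.
by apply/andP; split; lra.
Qed.

Lemma Lper_smooth (f : T -> R) : smooth_periodic f -> Lper f.
Proof.
by move=> [sf pf]; split => //; [apply: continuous_rV_measurable; exact: smooth_continuous|exact: smooth_L2].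
Qed.

Lemma pderiv_periodic (f : T -> R) k : smooth_periodic f -> smooth_periodic (pderiv k f).
Proof.
move=> [sf pf]; split; first exact: smooth_pderiv.
move=> y i; have := pderiv_shift (delta_mx ord0 i) k sf.
by rewrite (_ : (fun x => f (x + _)) = f) => [/(congr1 (fun h => h y)) <-|]; last by apply/funext => x; exact: pf.
Qed.

Lemma LperD (f g : T -> R) a : Lper f -> Lper g -> Lper (fun y => a * f y + g y).
Proof.
move=> [mf pf Lf] [mg pg Lg]; split.
- by apply: measurable_funD => //; exact: measurable_funM.
- by move=> y k; rewrite pf pg.
- exact: L2P.
Qed.

Lemma Lper_cst (c : R) : Lper (fun _ : T => c).
Proof. by split => //; exact: L2_cst. Qed.

Lemma Lper_sum (I : Type) (r : seq I) (F : I -> T -> R) : (forall i, Lper (F i)) ->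
  Lper (fun y => \sum_(i <- r) F i y).
Proof.
move=> LF; elim: r => [|i r IH].
  by under eq_fun do rewrite big_nil; exact: Lper_cst.
under eq_fun do rewrite big_cons.
have := LperD 1 (LF i) IH; by under eq_fun do rewrite mul1r.
Qed.

Lemma LperM_bounded (f g : T -> R) (C : R) : Lper f -> measurable_fun setT g -> cell_periodic g ->
  (forall y, `|g y| <= C) -> Lper (fun y => g y * f y).
Proof.
move=> [mf pf Lf] mg pg gC; split.
- exact: measurable_funM.
- by move=> y k; rewrite pf pg.
- by apply: (L2M_bounded mY Lf (M := C)) => //; exact: measurable_funTS.
Qed.

Variables (al be : R).
Hypothesis al0 : 0 < al.
Hypothesis be0 : 0 <= be.
Variable B : T -> 'M[R]_n.
Hypothesis Bell : forall y, elliptic al be (B y).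
Hypothesis Bmeas : forall i j, measurable_fun setT (fun y => B y i j).
Hypothesis Bper : cell_periodic B.

Lemma Bcell : tfield Y al be B.
Proof. by split => // i j; exact: measurable_funTS. Qed.

Lemma Lper_mxv (F : T -> 'rV[R]_n) i : (forall k, Lper (fun y => F y ord0 k)) ->
  Lper (fun y => mxv (B y) (F y) ord0 i).
Proof.
move=> LF; under eq_fun do rewrite mxvE; apply: Lper_sum => j.
apply: (LperM_bounded (C := be)) => //; first by move=> y k; rewrite Bper.
by move=> y; exact: elliptic_entry be0 (Bell y).
Qed.

Variable c : 'rV[R]_n.

Definition gext (y : T) : 'rV[R]_n := \row_k pext (fun y => cellg B c y ord0 k) y.

Lemma gext_Lper k : Lper (fun y => gext y ord0 k).
Proof. by under eq_fun do rewrite mxE; apply: pext_Lper; exact: (cellg_L2v al0 be0 c Bcell). Qed.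

Lemma gext_cube y : Y y -> gext y = cellg B c y.
Proof. by move=> Yy; apply/rowP => k; rewrite mxE pext_cube. Qed.

(** Fluctuation of the cell flux about its mean. It is periodic, of mean zero and divergence-free,
    the three properties on which [weak_estimate] rests. *)
Definition qcell k (y : T) : R := mxv (B y) (gext y) ord0 k - mxv (homogenized B) c ord0 k.

Lemma qcell_Lper k : Lper (qcell k).
Proof.
have := LperD 1 (Lper_mxv k gext_Lper) (Lper_cst (- mxv (homogenized B) c ord0 k)).
by under eq_fun do rewrite mul1r.
Qed.

Lemma qcell_mean k : \int[leb]_(y in Y) qcell k y = 0.
Proof.
have [_ _ L1] := Lper_mxv k gext_Lper.
have ic : leb.-integrable Y (EFin \o (fun=> - mxv (homogenized B) c ord0 k)).
  by apply: L2_integrable => //; exact: L2_cst.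
rewrite /qcell RintegralD //; last exact: L2_integrable.
rewrite Rintegral_cst //= leb_unit_cube mulr1.
rewrite -[X in _ - X](dotv_delta _ k) (homogenized_form al0 be0 _ _ Bcell).
apply/eqP; rewrite subr_eq0; apply/eqP; apply: eq_Rintegral => y; rewrite inE => Yy.
by rewrite gext_cube // dotv_delta.
Qed.

Lemma qcell_div phi : smooth phi -> cell_periodic phi ->
  \int[leb]_(y in Y) (\sum_k qcell k y * pderiv k phi y) = 0.
Proof.
move=> sp pp; have tphi : smooth_periodic phi by [].
have Lg := smooth_gradL2 sp.
have L1 := L2v_tfield mY be0 Bcell (cellg_L2v al0 be0 c Bcell).
have Lc := @L2v_cst R n (mxv (homogenized B) c).
have e1 := cell_equation al0 be0 c Bcell tphi.
have e2 : ipv Y (fun=> mxv (homogenized B) c) (grad phi) = 0.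
  apply: Pcl_mean; split => // e e0; exists phi => //.
  rewrite (@nrm2_eq _ _ _ _ (fun=> 0)); last by move=> x _; rewrite subrr.
  by rewrite /nrm2 /ipv; under eq_Rintegral do rewrite dotv0l; rewrite Rintegral_cst // mul0r ltW.
have := ipvB mY L1 Lc Lg; rewrite e1 e2 subrr => H; rewrite -[RHS]H.
apply: eq_Rintegral => y; rewrite inE => Yy; apply: eq_bigr => k _.
by rewrite /qcell gext_cube // !mxE.
Qed.

End cell_package.

Section weak_estimate.
Context {R : realType} {n : nat}.
Local Notation T := 'rV[R]_n.
Local Notation leb := (@lebesgue_rV R n).
Local Notation Y := (@unit_cube R n).
Variables (O : set T) (M : R) (k0 : 'I_n).
Hypothesis oO : open O.
Hypothesis OM : O `<=` box n M.
Hypothesis M0 : 0 < M.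
Hypothesis leO : (leb O < +oo)%E.

Let mO : measurable O := open_measurable_rV oO.

Lemma test_coord_bounded psi : test_function O psi -> coord_bounded M psi.
Proof.
move=> tpsi x [k Hk]; apply: (test_function_out tpsi) => /OM /(_ k) /=.
by rewrite in_itv /= -ltr_norml ltNge Hk.
Qed.

Lemma nrm2_grad_pderiv psi i : test_function O psi ->
  \int[leb]_(x in O) (pderiv i psi x ^+ 2) <= nrm2 O (grad psi).
Proof.
move=> tpsi; rewrite nrm2_sum //; last exact: test_function_gradL2.
rewrite (bigD1 i) //= [X in _ <= X + _](_ : _ = \int[leb]_(x in O) (pderiv i psi x ^+ 2)).
  by rewrite lerDl; apply: sumr_ge0 => j _; apply: Rintegral_ge0 => x _; exact: sqr_ge0.
by apply: eq_Rintegral => x _; rewrite mxE.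
Qed.

Lemma test_uniform_bound (I : finType) (F : I -> T -> R) : (forall i, test_function O (F i)) ->
  exists2 C : R, 0 <= C & forall i x, `|F i x| <= C.
Proof.
move=> tF; have /choice[C HC] : forall i, exists C : R, 0 <= C /\ forall x, `|F i x| <= C.
  by move=> i; have [C C0 HC] := test_function_bounded (tF i); exists C.
exists (\sum_i C i) => [|i x]; first by apply: sumr_ge0 => i _; case: (HC i).
apply: le_trans ((HC i).2 x) _; rewrite (bigD1 i) //= lerDl; apply: sumr_ge0 => j _; by case: (HC j).
Qed.

(* Write eta dpsi = d (eta psi) - psi deta: the first term vanishes as q is
   divergence-free, the second is small as q has mean zero. *)
Lemma weak_estimate (q : 'I_n -> T -> R) (eta : T -> R) :
  (forall k, Lper (q k)) -> (forall k, \int[leb]_(y in Y) q k y = 0) ->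
  (forall phi, smooth phi -> cell_periodic phi ->
     \int[leb]_(y in Y) (\sum_k q k y * pderiv k phi y) = 0) ->
  test_function O eta ->
  exists2 C : R, 0 <= C & forall (eps : R) psi, 0 < eps <= 1 -> test_function O psi ->
    (\int[leb]_(x in O) (\sum_k q k (eps^-1 *: x) * (eta x * pderiv k psi x))) ^+ 2 <=
    C * eps ^+ 2 * nrm2 O (grad psi).
Proof.
move=> Lq q0 qdiv teta; have seta := proj1 teta.
have [D1 D10 HD1] := test_uniform_bound (fun k => test_function_pderiv k teta).
have [D2 D20 HD2] := test_uniform_bound (fun ki : 'I_n * 'I_n => test_function_pderiv ki.1 (test_function_pderiv ki.2 teta)).
have [C C0 HC] := @mean_zero_scale R n M M0.
pose Q k := \int[leb]_(y in Y) (q k y ^+ 2).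
have Q0 k : 0 <= Q k by apply: Rintegral_ge0 => x _; exact: sqr_ge0.
(* For the derivatives of psi d_k eta: [D1] and [D2] bound the first and second derivatives of eta,
   and Friedrichs' inequality turns psi ^ 2 into 4 M ^ 2 times the squared gradient. *)
pose D := 2 * D1 ^+ 2 + 2 * D2 ^+ 2 * (4 * M ^+ 2).
have D0 : 0 <= D.
  by apply: addr_ge0; [|apply: mulr_ge0]; apply: mulr_ge0 => //; exact: sqr_ge0.
exists (n%:R * \sum_k (C * Q k * (n%:R * D))) => [|eps psi e01 tpsi].
  by rewrite mulr_ge0 // sumr_ge0 // => k _; rewrite mulr_ge0 ?mulr_ge0.
have spsi := proj1 tpsi; have /andP[e0 e1] := e01.
pose N := nrm2 O (grad psi); have N0 : 0 <= N := nrm2_ge0 _ _.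
pose f k x := pderiv k eta x * psi x.
have tf k : test_function O (f k) by apply: test_functionM => //; exact: smooth_pderiv.
have Lqe k : L2 leb O (fun x => q k (eps^-1 *: x)) := (Lper_sqr_int (Lq k) mO OM M0 e01).1.
have tep : test_function O (fun x => eta x * psi x) by exact: test_functionM.
have Ltep k := test_function_L2' mO leO (test_function_pderiv k tep).
have Lf k := test_function_L2' mO leO (tf k).
have ia k : leb.-integrable O (EFin \o (fun x => q k (eps^-1 *: x) * pderiv k (fun x => eta x * psi x) x)).
  exact: L2M_integrable.
have ib k : leb.-integrable O (EFin \o (fun x => q k (eps^-1 *: x) * f k x)) by exact: L2M_integrable.
have isum (g : 'I_n -> T -> R) : (forall k, leb.-integrable O (EFin \o g k)) ->
    leb.-integrable O (EFin \o (fun x => \sum_k g k x)).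
  move=> ig; apply: eq_integrable (integrable_sum mO (index_enum 'I_n) (fun k _ => ig k)) => // x _ /=.
  by rewrite sumEFin.
have E : \int[leb]_(x in O) (\sum_k q k (eps^-1 *: x) * (eta x * pderiv k psi x)) =
    - (\sum_k \int[leb]_(x in O) (q k (eps^-1 *: x) * f k x)).
  have z : \int[leb]_(x in O) (\sum_k q k (eps^-1 *: x) * pderiv k (fun x => eta x * psi x) x) = 0.
    rewrite -[RHS](div_free_scale Lq qdiv e0 (proj1 tep) (test_coord_bounded tep)).
    apply: Rintegral_restrict => x Ox; rewrite big1 // => k _.
    by rewrite (test_function_out (test_function_pderiv k tep) Ox) mulr0.
  have ib' := isum _ ib; have ia' := isum _ ia.
  have imb : leb.-integrable O (EFin \o (fun x => -1 * \sum_k q k (eps^-1 *: x) * f k x)).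
    by apply: eq_integrable (integrableZl mO (-1) ib').
  transitivity (\int[leb]_(x in O) (\sum_k q k (eps^-1 *: x) * pderiv k (fun x => eta x * psi x) x +
      -1 * \sum_k q k (eps^-1 *: x) * f k x)).
    apply: eq_Rintegral => x _; rewrite mulN1r -sumrB; apply: eq_bigr => k _.
    rewrite pderivM; [|by move=> y; exact: smooth_diff..].
    rewrite /f; ring.
  rewrite RintegralD // z add0r RintegralZl // mulN1r Rintegral_sum //.
rewrite E sqrrN; apply: (le_trans (sqr_sum_le _)); rewrite card_ord.
rewrite -!mulrA ler_wpM2l // mulr_suml; apply: ler_sum => k _.
have -> : \int[leb]_(x in O) (q k (eps^-1 *: x) * f k x) = \int[leb]_x (q k (eps^-1 *: x) * f k x).
  by apply: Rintegral_restrict => x Ox; rewrite (test_function_out (tf k) Ox) mulr0.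
apply: (le_trans (HC _ _ _ (Lq k) (q0 k) e01 (proj1 (tf k)) (test_coord_bounded (tf k)))).
have S : \sum_i \int[leb]_x (pderiv i (f k) x ^+ 2) <= n%:R * D * N.
  apply: (@le_trans _ _ (\sum_(i < n) D * N)); last first.
    by rewrite sumr_const card_ord -[leLHS]mulr_natl mulrA.
  apply: ler_sum => i _.
  have -> : \int[leb]_x (pderiv i (f k) x ^+ 2) = \int[leb]_(x in O) (pderiv i (f k) x ^+ 2).
    have r x : ~ O x -> pderiv i (f k) x ^+ 2 = 0.
      by move=> Ox; rewrite (test_function_out (test_function_pderiv i (tf k)) Ox) expr0n.
    by rewrite (Rintegral_restrict r).
  have L1 := test_function_L2' mO leO (test_function_pderiv i tpsi).
  have L2p := test_function_L2' mO leO tpsi.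
  have i1 := L2_integrable_sqr L1; have i2 := L2_integrable_sqr L2p.
  have j1 : leb.-integrable O (EFin \o (fun x => 2 * D1 ^+ 2 * pderiv i psi x ^+ 2)).
    by apply: eq_integrable (integrableZl mO (2 * D1 ^+ 2) i1).
  have j2 : leb.-integrable O (EFin \o (fun x => 2 * D2 ^+ 2 * psi x ^+ 2)).
    by apply: eq_integrable (integrableZl mO (2 * D2 ^+ 2) i2).
  have j3 : leb.-integrable O (EFin \o (fun x => pderiv i (f k) x ^+ 2)).
    by apply: L2_integrable_sqr; apply: test_function_L2' => //; exact: test_function_pderiv.
  have j4 : leb.-integrable O (EFin \o (fun x => 2 * D1 ^+ 2 * pderiv i psi x ^+ 2 + 2 * D2 ^+ 2 * psi x ^+ 2)).
    by apply: eq_integrable (integrableD mO j1 j2).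
  have p : \int[leb]_(x in O) (pderiv i (f k) x ^+ 2) <=
      \int[leb]_(x in O) (2 * D1 ^+ 2 * pderiv i psi x ^+ 2 + 2 * D2 ^+ 2 * psi x ^+ 2).
    apply: le_Rintegral => // x _; rewrite /f pderivM; last 2 first.
    - by move=> y; apply: smooth_diff; exact: smooth_pderiv.
    - by move=> y; exact: smooth_diff.
    have b1 := HD1 k x; have b2 := HD2 (i, k) x; rewrite /= in b2.
    apply: (le_trans (sqrD_le _ _)); rewrite addrC !exprMn.
    have s1 : pderiv k eta x ^+ 2 <= D1 ^+ 2 by rewrite -(real_normK (num_real (pderiv k eta x))) ler_sqr ?nnegrE.
    have s2 : pderiv i (pderiv k eta) x ^+ 2 <= D2 ^+ 2.
      by rewrite -(real_normK (num_real (pderiv i (pderiv k eta) x))) ler_sqr ?nnegrE.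
    have t1 := ler_wpM2r (sqr_ge0 (pderiv i psi x)) s1; have t2 := ler_wpM2r (sqr_ge0 (psi x)) s2.
    by rewrite -!mulrA; lra.
  apply: (le_trans p); rewrite RintegralD // (RintegralZl _ mO i1) (RintegralZl _ mO i2).
  have h1 := nrm2_grad_pderiv i tpsi; have h2 := nrm2_grad_pderiv k0 tpsi; rewrite -/N in h1 h2.
  have h3 := friedrichs k0 OM M0 tpsi.
  have M20 : 0 <= 4 * M ^+ 2 by rewrite mulr_ge0 // sqr_ge0.
  have h4 := le_trans h3 (ler_wpM2l M20 h2).
  have D1s : 0 <= 2 * D1 ^+ 2 by rewrite mulr_ge0 // sqr_ge0.
  have D2s : 0 <= 2 * D2 ^+ 2 by rewrite mulr_ge0 // sqr_ge0.
  have g1 := ler_wpM2l D1s h1; have g2 := ler_wpM2l D2s h4.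
  apply: (le_trans (lerD g1 g2)).
  by rewrite le_eqVlt; apply/orP; left; apply/eqP; rewrite /D; ring.
have CQ : 0 <= C * eps ^+ 2 * Q k by apply: mulr_ge0 => //; apply: mulr_ge0 => //; exact: sqr_ge0.
apply: (le_trans (ler_wpM2l CQ S)).
by rewrite le_eqVlt; apply/orP; left; apply/eqP; rewrite /N; ring.
Qed.

End weak_estimate.

(** * Oscillating test functions *)

Section oscillating_test_functions.
Context {R : realType} {n : nat}.
Local Notation T := 'rV[R]_n.
Local Notation leb := (@lebesgue_rV R n).
Local Notation Y := (@unit_cube R n).
Variables (O : set T) (M : R) (k0 : 'I_n).
Hypothesis oO : open O.
Hypothesis OM : O `<=` box n M.
Hypothesis M0 : 0 < M.
Hypothesis leO : (leb O < +oo)%E.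
Variables (al be : R).
Hypothesis al0 : 0 < al.
Hypothesis be0 : 0 <= be.
Variable B : R -> T -> 'M[R]_n.
Hypothesis Bell : forall t y, elliptic al be (B t y).
Hypothesis Bmeas : forall t i j, measurable_fun setT (fun y => B t y i j).
Hypothesis Bper : forall t, cell_periodic (B t).
Variable sigma : T -> R.
Variable h : T -> 'rV[R]_n.
Hypothesis Lh : L2v O h.

Local Notation Bs eps x := (B (sigma x) (eps^-1 *: x)).
Local Notation A0 t := (homogenized (B t)).

Hypothesis Bs_meas : forall eps i j, measurable_fun O (fun x => Bs eps x i j).
Hypothesis A0_meas : forall i j, measurable_fun O (fun x => A0 (sigma x) i j).

Let mO : measurable O := open_measurable_rV oO.
Let mY := @measurable_unit_cube R n.
Let leY := @unit_cube_lty R n.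

Lemma tfield_fine eps : tfield O al be (fun x => Bs eps x).
Proof. by split. Qed.

Lemma A0_elliptic t : elliptic al be (A0 t).
Proof. exact: (homogenized_elliptic al0 be0 (Bcell (Bell t) (Bmeas t))). Qed.

Lemma tfield_effective : tfield O al be (fun x => A0 (sigma x)).
Proof. by split => // x _; exact: A0_elliptic. Qed.

(* E and p are, up to kap, a field and its flux on the scale eps, and the flux
   is weakly close to the homogenized flux of F; v is the oscillating part. *)
Definition oscillating_at (kap : R) (F E p v : T -> 'rV[R]_n) (eps : R) :=
  [/\ L2v O E, L2v O p, exists2 psi, test_function O psi & v = grad psi,
    nrm2 O (fun x => E x - F x - v x) <= kap &
    [/\ nrm2 O (fun x => p x - mxv (Bs eps x) (E x)) <= kap,
      forall psi, test_function O psi ->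
        ipv O (fun x => p x - mxv (A0 (sigma x)) (F x)) (grad psi) ^+ 2 <= kap * nrm2 O (grad psi) &
      ipv O (fun x => p x - mxv (A0 (sigma x)) (F x)) h ^+ 2 <= kap]].

(** The accuracy [kap] is fixed before eps tends to 0, and the fields may depend on both: the
    cut-off and the smooth corrector are chosen from [kap]. *)
Definition oscillating F := forall kap : R, 0 < kap -> exists E p v : R -> T -> 'rV[R]_n,
  \forall eps \near (0 : R)^'+, oscillating_at kap F (E eps) (p eps) (v eps) eps.

Let combine_le (a X Y r kap : R) : 0 < kap -> 0 <= r -> X <= kap / (4 * (a ^+ 2 + 1)) * r ->
  Y <= kap / (4 * (a ^+ 2 + 1)) * r -> 2 * (a ^+ 2 * X) + 2 * Y <= kap * r.
Proof.
move=> kap0 r0 hX hY; have c0 : 0 < 4 * (a ^+ 2 + 1) by rewrite mulr_gt0 // ltr_wpDl // sqr_ge0.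
have e : kap * r = kap / (4 * (a ^+ 2 + 1)) * r * (4 * (a ^+ 2 + 1)) by rewrite mulrAC divfK ?gt_eqF.
rewrite e; have a2 := sqr_ge0 a; have X1 := ler_wpM2l a2 hX.
have q0 : 0 <= kap / (4 * (a ^+ 2 + 1)) * r by rewrite mulr_ge0 // divr_ge0 // ltW.
have aq := mulr_ge0 a2 q0.
by move: q0 hY X1 aq; move: (kap / _ * r) => q q0 hY X1 aq; lra.
Qed.

(** All errors are squares and combine with the factors 2 a ^ 2 and 2; asking accuracy kap / (4 (a ^
    2 + 1)) of both fields absorbs them. *)
Lemma oscillatingP a F F' : L2v O F -> L2v O F' -> oscillating F -> oscillating F' ->
  oscillating (fun x => a *: F x + F' x).
Proof.
move=> LF LF' gF gF' kap kap0.
have c0 : 0 < 4 * (a ^+ 2 + 1) by rewrite mulr_gt0 // ltr_wpDl // sqr_ge0.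
have k1 : 0 < kap / (4 * (a ^+ 2 + 1)) by rewrite divr_gt0.
have [E [p [v H]]] := gF _ k1; have [E' [p' [v' H']]] := gF' _ k1.
exists (fun eps x => a *: E eps x + E' eps x), (fun eps x => a *: p eps x + p' eps x),
  (fun eps x => a *: v eps x + v' eps x).
apply: filterS2 H H' => eps [LE Lp [psi tpsi ve] h1 [h2 h3 h4]]
  [LE' Lp' [psi' tpsi' ve'] h1' [h2' h3' h4']].
have Lv : L2v O (v eps) by rewrite ve; exact: test_function_gradL2.
have Lv' : L2v O (v' eps) by rewrite ve'; exact: test_function_gradL2.
have LBE := L2v_tfield mO be0 (tfield_fine eps) LE; have LBE' := L2v_tfield mO be0 (tfield_fine eps) LE'.
have LAF := L2v_tfield mO be0 tfield_effective LF; have LAF' := L2v_tfield mO be0 tfield_effective LF'.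
have comb (X Y r : R) : 0 <= r -> X <= kap / (4 * (a ^+ 2 + 1)) * r -> Y <= kap / (4 * (a ^+ 2 + 1)) * r ->
    2 * (a ^+ 2 * X) + 2 * Y <= kap * r by exact: combine_le.
have comb1 (X Y : R) : X <= kap / (4 * (a ^+ 2 + 1)) -> Y <= kap / (4 * (a ^+ 2 + 1)) -> 2 * (a ^+ 2 * X) + 2 * Y <= kap.
  by move=> hX hY; have := @comb X Y 1 ler01; rewrite !mulr1; exact.
have lin (G : T -> 'rV[R]_n) : L2v O G -> ipv O (fun x => a *: p eps x + p' eps x - mxv (A0 (sigma x)) (a *: F x + F' x)) G =
    a * ipv O (fun x => p eps x - mxv (A0 (sigma x)) (F x)) G + ipv O (fun x => p' eps x - mxv (A0 (sigma x)) (F' x)) G.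
  move=> LG; rewrite -ipvP //; [|exact: L2vB|exact: L2vB].
  by apply: eq_Rintegral => x _; rewrite mxvP scalerBr opprD addrACA.
split.
- exact: L2vP.
- exact: L2vP.
- exists (fun x => a * psi x + psi' x); first exact: test_functionP.
  by rewrite gradP ?ve ?ve' //; [exact: proj1 tpsi|exact: proj1 tpsi'].
- have -> : (fun x => a *: E eps x + E' eps x - (a *: F x + F' x) - (a *: v eps x + v' eps x)) =
      (fun x => a *: (E eps x - F x - v eps x) + (E' eps x - F' x - v' eps x)).
    have rr (X X' Y Y' Z Z' : 'rV[R]_n) : a *: X + X' - (a *: Y + Y') - (a *: Z + Z') = a *: (X - Y - Z) + (X' - Y' - Z').
      by apply/rowP => k; rewrite !mxE; ring.
    by apply/funext => x; exact: rr.
  have La : L2v O (fun x => E eps x - F x - v eps x) by apply: L2vB => //; exact: L2vB.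
  have Lb : L2v O (fun x => E' eps x - F' x - v' eps x) by apply: L2vB => //; exact: L2vB.
  apply: (le_trans (nrm2D_le mO (L2vZ mO a La) Lb)); rewrite nrm2Z //; exact: comb1.
- split.
  + have -> : (fun x => a *: p eps x + p' eps x - mxv (Bs eps x) (a *: E eps x + E' eps x)) =
      (fun x => a *: (p eps x - mxv (Bs eps x) (E eps x)) + (p' eps x - mxv (Bs eps x) (E' eps x))).
      by apply/funext => x; rewrite mxvP scalerBr opprD addrACA.
    have La : L2v O (fun x => p eps x - mxv (Bs eps x) (E eps x)) by exact: L2vB.
    have Lb : L2v O (fun x => p' eps x - mxv (Bs eps x) (E' eps x)) by exact: L2vB.
    apply: (le_trans (nrm2D_le mO (L2vZ mO a La) Lb)); rewrite nrm2Z //; exact: comb1.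
  + move=> phi tphi; rewrite lin; last exact: test_function_gradL2.
    apply: (le_trans (sqrD_le _ _)); rewrite exprMn; apply: comb; [exact: nrm2_ge0|exact: h3|exact: h3'].
  + rewrite lin //; apply: (le_trans (sqrD_le _ _)); rewrite exprMn; exact: comb1.
Qed.

(** The fields built for a close F' serve for F too: E, p and v are unchanged, and replacing F' by F
    in the homogenized flux costs at most be ^ 2 times the squared distance. *)
Lemma oscillating_lim F : L2v O F -> (forall e : R, 0 < e -> exists F', [/\ L2v O F', oscillating F' &
  nrm2 O (fun x => F' x - F x) <= e]) -> oscillating F.
Proof.
move=> LF HF kap kap0.
pose N := nrm2 O h; have N0 : 0 <= N := nrm2_ge0 _ _.
(* One summand for each place where F' is replaced by F: the field itself, the flux tested with
   gradients, and the flux tested with [h]. *)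
pose c := 4 + 4 * be ^+ 2 + 4 * be ^+ 2 * N.
have b2 := sqr_ge0 be.
have bN : 0 <= be ^+ 2 * N by rewrite mulr_ge0.
have c0 : 0 < c by rewrite /c -mulrA; lra.
have kc : 0 < kap / c by rewrite divr_gt0.
have [F' [LF' gF' eF']] := HF (kap / c) kc.
have k4 : 0 < kap / 4 by rewrite divr_gt0.
have [E [p [v H]]] := gF' (kap / 4) k4; exists E, p, v.
apply: filterS H => eps [LE Lp [psi tpsi ve] h1 [h2 h3 h4]].
have Lv : L2v O (v eps) by rewrite ve; exact: test_function_gradL2.
have Ld : L2v O (fun x => F' x - F x) by exact: L2vB.
have LAd := L2v_tfield mO be0 tfield_effective Ld.
have nAd := le_trans (nrm2_tfield mO be0 tfield_effective Ld) (ler_wpM2l b2 eF').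
have LpA : L2v O (fun x => p eps x - mxv (A0 (sigma x)) (F' x)).
  by apply: L2vB => //; exact: (L2v_tfield mO be0 tfield_effective LF').
have kce : kap / c * c = kap by rewrite divfK ?gt_eqF.
have lin (G : T -> 'rV[R]_n) : L2v O G -> ipv O (fun x => p eps x - mxv (A0 (sigma x)) (F x)) G ^+ 2 <=
    2 * ipv O (fun x => p eps x - mxv (A0 (sigma x)) (F' x)) G ^+ 2 + 2 * (be ^+ 2 * (kap / c) * nrm2 O G).
  move=> LG; have -> : ipv O (fun x => p eps x - mxv (A0 (sigma x)) (F x)) G =
     ipv O (fun x => p eps x - mxv (A0 (sigma x)) (F' x)) G + ipv O (fun x => mxv (A0 (sigma x)) (F' x - F x)) G.
    rewrite -ipvD //; apply: eq_Rintegral => x _; rewrite mxvB.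
    by congr (dotv _ _); rewrite addrA subrK.
  apply: (le_trans (sqrD_le _ _)); rewrite lerD2l ler_wpM2l //.
  by apply: (le_trans (ipv_CS mO LAd LG)); rewrite ler_wpM2r // nrm2_ge0.
split => //; first by exists psi.
- have -> : (fun x => E eps x - F x - v eps x) = (fun x => (E eps x - F' x - v eps x) + (F' x - F x)).
    have rr (X Y Y' Z : 'rV[R]_n) : X - Y - Z = X - Y' - Z + (Y' - Y) by apply/rowP => k; rewrite !mxE; ring.
    by apply/funext => x; exact: rr.
  have La : L2v O (fun x => E eps x - F' x - v eps x) by apply: L2vB => //; exact: L2vB.
  apply: (le_trans (nrm2D_le mO La Ld)).
  have : kap / c * 4 <= kap by rewrite -[leRHS]kce ler_wpM2l ?(ltW kc) // /c -mulrA; lra.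
  by move: h1 eF'; lra.
- split.
  + by apply: (le_trans h2); lra.
  + move=> phi tphi; apply: (le_trans (lin _ (test_function_gradL2 mO leO tphi))).
    have n0 := nrm2_ge0 O (grad phi); have := h3 _ tphi.
    have e : be ^+ 2 * (kap / c) * 4 <= kap.
      rewrite mulrAC mulrC -[leRHS]kce ler_wpM2l ?(ltW kc) // /c -mulrA; lra.
    have := ler_wpM2r n0 e; lra.
  + apply: (le_trans (lin _ Lh)); rewrite -/N.
    have e : be ^+ 2 * (kap / c) * N * 4 <= kap.
      rewrite (_ : _ * 4 = kap / c * (4 * be ^+ 2 * N)); last by ring.
      by rewrite -[leRHS]kce ler_wpM2l ?(ltW kc) // /c -!mulrA; lra.
    by move: h4 e; lra.
Qed.

Lemma oscillating_eq F F' : L2v O F -> L2v O F' -> (forall x, O x -> F x = F' x) -> oscillating F -> oscillating F'.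
Proof.
move=> LF LF' FF' gF; apply: oscillating_lim => // e e0; exists F; split => //.
rewrite (@nrm2_eq _ _ _ _ (fun=> 0)); last by move=> x Ox; rewrite FF' ?subrr.
by rewrite /nrm2 /ipv; under eq_Rintegral do rewrite dotv0l; rewrite Rintegral_cst // mul0r ltW.
Qed.

End oscillating_test_functions.

Section oscillating_indicator.
Context {R : realType} {n : nat}.
Local Notation T := 'rV[R]_n.
Local Notation leb := (@lebesgue_rV R n).
Local Notation Y := (@unit_cube R n).
Variables (O : set T) (M : R).
Hypothesis oO : open O.
Hypothesis OM : O `<=` box n M.
Hypothesis M0 : 0 < M.
Hypothesis leO : (leb O < +oo)%E.

Let mO : measurable O := open_measurable_rV oO.
Let mY := @measurable_unit_cube R n.
Let leY := @unit_cube_lty R n.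

Lemma L2v_bounded_scale (eta : T -> R) (C : R) (F : T -> 'rV[R]_n) : measurable_fun O eta ->
  (forall x, `|eta x| <= C) -> L2v O F ->
  L2v O (fun x => eta x *: F x) /\ nrm2 O (fun x => eta x *: F x) <= C ^+ 2 * nrm2 O F.
Proof.
move=> me eC LF; have L : L2v O (fun x => eta x *: F x).
  by move=> k; under eq_fun do rewrite mxE; exact: (L2M_bounded mO (LF k) me).
split => //; rewrite -nrm2Z //; apply: nrm2_le => //; first exact: L2vZ.
move=> x _; rewrite !dotvZl !dotvZr !mulrA ler_wpM2r ?dotvv_ge0 // -!expr2.
by rewrite -(real_normK (num_real (eta x))) ler_sqr ?nnegrE ?eC // (le_trans _ (eC x)).
Qed.

Lemma L2v_periodic_scale (G : T -> 'rV[R]_n) (eps : R) : (forall k, Lper (fun y => G y ord0 k)) -> 0 < eps <= 1 ->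
  L2v O (fun x => G (eps^-1 *: x)) /\ nrm2 O (fun x => G (eps^-1 *: x)) <= (2 * M + 2) ^+ n * nrm2 Y G.
Proof.
move=> LG e01; have H k := Lper_sqr_int (LG k) mO OM M0 e01.
have L : L2v O (fun x => G (eps^-1 *: x)) by move=> k; case: (H k).
split => //; rewrite !nrm2_sum //; last by move=> k; case: (LG k).
by rewrite mulr_sumr; apply: ler_sum => k _; case: (H k).
Qed.

Lemma mean_zero_ipv (q : 'I_n -> T -> R) (eta : T -> R) (h : T -> 'rV[R]_n) (kap : R) :
  (forall k, Lper (q k)) -> (forall k, \int[leb]_(y in Y) q k y = 0) -> test_function O eta -> L2v O h -> 0 < kap ->
  \forall eps \near (0 : R)^'+, (\int[leb]_(x in O) (\sum_k q k (eps^-1 *: x) * (eta x * h x ord0 k))) ^+ 2 <= kap.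
Proof.
move=> Lq q0 teta Lh kap0; have [C C0 HC] := test_function_bounded teta.
have meta : measurable_fun O eta by exact: test_function_measurable teta.
have Leh k : L2 leb O (fun x => eta x * h x ord0 k) by exact: (L2M_bounded mO (Lh k) meta).
(* With s = min 1 kap, a sum of absolute value at most s has square at most kap. *)
pose s := Num.min 1 kap; have s0 : 0 < s by rewrite lt_min ltr01.
have s1 : s <= 1 by rewrite ge_min lexx.
have sk : s <= kap by rewrite ge_min lexx orbT.
pose r := s / (n%:R + 1); have n1 : 0 < n%:R + 1 :> R by rewrite ltr_wpDl.
have r0 : 0 < r by rewrite divr_gt0.
have H : \forall eps \near (0 : R)^'+, forall k : 'I_n, `|\int[leb]_(x in O) (q k (eps^-1 *: x) * (eta x * h x ord0 k))| <= r.
  apply: filter_forall => k; have := mean_value oO OM M0 leO (Lq k) (Leh k) r0.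
  by apply: filterS => eps; rewrite q0 mul0r subr0.
near=> eps.
have e01 : 0 < eps <= 1 by apply/andP; split; near: eps; [exact: nbhs_right_gt|exact: nbhs_right_le].
have Hr : forall k : 'I_n, `|\int[leb]_(x in O) (q k (eps^-1 *: x) * (eta x * h x ord0 k))| <= r by near: eps; exact: H.
have ii k : leb.-integrable O (EFin \o (fun x => q k (eps^-1 *: x) * (eta x * h x ord0 k))).
  exact: (L2M_integrable mO (Lper_sqr_int (Lq k) mO OM M0 e01).1 (Leh k)).
rewrite (Rintegral_sum (index_enum _) mO ii).
have S : `|\sum_k \int[leb]_(x in O) (q k (eps^-1 *: x) * (eta x * h x ord0 k))| <= s.
  apply: (le_trans (ler_norm_sum _ _ _)); apply: (@le_trans _ _ (\sum_(k < n) r)); first exact: ler_sum.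
  rewrite sumr_const card_ord -[leLHS]mulr_natl /r mulrCA -[leRHS]mulr1 ler_wpM2l ?(ltW s0) //.
  by rewrite ler_pdivrMr // mul1r lerDl.
rewrite -(real_normK (num_real _)); move: S (normr_ge0 (\sum_k \int[leb]_(x in O) (q k (eps^-1 *: x) * (eta x * h x ord0 k)))).
by move: (`|_|) => X; nra.
Unshelve. all: by end_near. Qed.

(** The factor - eps compensates the 1 / eps of the chain rule: the first term is the oscillating
    part of the field, and what is left is of order eps. *)
Lemma grad_scale_product (phi eta : T -> R) (eps : R) (x : T) : eps != 0 -> smooth phi -> smooth eta ->
  grad (fun x => - eps * (phi (eps^-1 *: x) * eta x)) x =
  - (eta x *: grad phi (eps^-1 *: x)) - (eps * phi (eps^-1 *: x)) *: grad eta x.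
Proof.
move=> e0 sp se; have ss := smooth_scale eps^-1 sp; apply/rowP => k; rewrite !mxE.
rewrite pderivZ; last by move=> y; apply: smooth_diff; exact: smoothM.
rewrite pderivM; [|by move=> y; exact: smooth_diff|by move=> y; exact: smooth_diff].
by rewrite pderiv_scale //; field.
Qed.

End oscillating_indicator.

Section oscillating_base.
Context {R : realType} {n : nat}.
Local Notation T := 'rV[R]_n.
Local Notation leb := (@lebesgue_rV R n).
Local Notation Y := (@unit_cube R n).
Variables (O : set T) (M : R) (k0 : 'I_n).
Hypothesis oO : open O.
Hypothesis OM : O `<=` box n M.
Hypothesis M0 : 0 < M.
Hypothesis leO : (leb O < +oo)%E.
Variables (al be : R).
Hypothesis al0 : 0 < al.
Hypothesis be0 : 0 <= be.
Variable B : R -> T -> 'M[R]_n.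
Hypothesis Bell : forall t y, elliptic al be (B t y).
Hypothesis Bmeas : forall t i j, measurable_fun setT (fun y => B t y i j).
Hypothesis Bper : forall t, cell_periodic (B t).
Variable sigma : T -> R.
Variable h : T -> 'rV[R]_n.
Hypothesis Lh : L2v O h.

Local Notation Bs eps x := (B (sigma x) (eps^-1 *: x)).
Local Notation A0 t := (homogenized (B t)).

Hypothesis Bs_meas : forall eps i j, measurable_fun O (fun x => Bs eps x i j).
Hypothesis A0_meas : forall i j, measurable_fun O (fun x => A0 (sigma x) i j).

Let mO : measurable O := open_measurable_rV oO.
Let mY := @measurable_unit_cube R n.
Let leY := @unit_cube_lty R n.

Let le_split (a x : R) : 0 <= a -> 0 < x -> x / (a + 1) * a <= x.
Proof. by move=> a0 x0; rewrite -mulrA ler_piMr ?(ltW x0) // mulrC ler_pdivrMr ?mul1r ?lerDl // ltr_wpDl. Qed.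

Let sum2_le (X1 X2 a b k : R) : X1 <= a -> X2 <= b -> 4 * a <= k -> 4 * b <= k -> 2 * X1 + 2 * X2 <= k.
Proof. lra. Qed.

Let mean_le (i p e a : R) : `|i - p| <= e -> p <= a * e -> i <= (a + 1) * e.
Proof. rewrite ler_norml => /andP[_]; lra. Qed.

(** Here [e] is the cut-off eta and [i] the indicator of A at a point. On A the two tensors agree
    and the difference vanishes; off A, i = 0 and the weight (i - e) ^ 2 is e ^ 2. *)
Let flux_diff_le (B1 B2 : 'M[R]_n) (w : 'rV[R]_n) (e i : R) : elliptic al be B1 -> elliptic al be B2 ->
  B1 = B2 \/ i = 0 ->
  dotv (e *: mxv B1 w - mxv B2 (e *: w)) (e *: mxv B1 w - mxv B2 (e *: w)) <= 4 * be ^+ 2 * (dotv w w * (i - e) ^+ 2).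
Proof.
move=> [_ _ b1] [_ _ b2] [->|->].
  by rewrite mxvZ subrr dotv0l; apply: mulr_ge0; apply: mulr_ge0; rewrite ?sqr_ge0 ?dotvv_ge0.
rewrite sub0r sqrrN; apply: (le_trans (dotvD_le _ _)); rewrite -scaleN1r mxvZ !dotvZl !dotvZr.
have c1 := ler_wpM2l (sqr_ge0 e) (b1 w); have c2 := ler_wpM2l (sqr_ge0 e) (b2 w).
move: c1 c2; move: (dotv _ _) (dotv _ _) (dotv _ _) => X1 X2 X3; rewrite !expr2; lra.
Qed.

(* E = eta (c - grad phi) (x / eps) and p = eta (B g) (x / eps), where g is the cell
   field and phi smooth with c - grad phi close to g; v is the gradient of
   - eps eta phi (x / eps), so that E - v differs from eta c by eps phi grad eta. *)
Lemma oscillating_indicator (A : set T) (t : R) (c : 'rV[R]_n) : measurable A -> A `<=` O ->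
  (forall x, A x -> sigma x = t) -> oscillating O B sigma h (fun x => \1_A x *: c).
Proof.
move=> mA AO At kap kap0.
have ind0 x : ~ A x -> \1_A x = 0 :> R by move=> nAx; rewrite indicE memNset.
have AE x : mxv (A0 (sigma x)) (\1_A x *: c) = \1_A x *: mxv (A0 t) c.
  have key (H : R -> 'M[R]_n) : mxv (H (sigma x)) (\1_A x *: c) = \1_A x *: mxv (H t) c.
    rewrite mxvZ; case: (pselect (A x)) => [Ax|nAx]; first by rewrite (At x Ax).
    by rewrite (ind0 x nAx) !scale0r.
  exact: (key (fun t => A0 t)).
pose m := mxv (A0 t) c; pose C2 := dotv c c; pose Cm := dotv m m; pose Nh := nrm2 O h.
have tB := Bcell (Bell t) (Bmeas t).
have C20 : 0 <= C2 := dotvv_ge0 c; have Cm0 : 0 <= Cm := dotvv_ge0 m; have Nh0 : 0 <= Nh := nrm2_ge0 _ _.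
pose Cg := be / al * C2; have Cg0 : 0 <= Cg by rewrite mulr_ge0 // divr_ge0 // ltW.
have be2 : 0 <= be ^+ 2 by exact: sqr_ge0.
(* Collects the coefficients with which [e1], the L^2 error of the cut-off eta, enters the four
   smallness conditions [hK1] to [hK4]. *)
pose K := 4 * C2 + 16 * be ^+ 2 * (2 * Cg + 3) + 4 * Cm + 4 * (Cm * Nh).
have t1 : 0 <= 16 * be ^+ 2 * (2 * Cg + 3) by rewrite !mulr_ge0 //; lra.
have t2 : 0 <= Cm * Nh by rewrite mulr_ge0.
have K0 : 0 <= K by rewrite /K; lra.
pose e1 := kap / (K + 1); have e10 : 0 < e1 by rewrite divr_gt0 // ltr_wpDl.
have e1K : e1 * K <= kap by exact: le_split.
have e1le a : 0 <= a -> a <= K -> e1 * a <= kap.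
  by move=> a0 aK; apply: le_trans e1K; rewrite ler_wpM2l // ltW.
have hK1 : 4 * (e1 * C2) <= kap by rewrite mulrCA; apply: e1le; rewrite /K; lra.
have hK2 : 4 * (e1 * Cm) <= kap by rewrite mulrCA; apply: e1le; rewrite /K; lra.
have hK3 : 4 * (e1 * Cm * Nh) <= kap by rewrite -mulrA mulrCA; apply: e1le; rewrite /K; lra.
have hK4 : 4 * (4 * be ^+ 2 * ((2 * Cg + 2 + 1) * e1)) <= kap.
  rewrite (_ : 4 * _ = e1 * (16 * be ^+ 2 * (2 * Cg + 3))); first by apply: e1le; rewrite /K; lra.
  by ring.
have [eta teta He1] := test_dense oO leO (L2_indic oO leO mA) e10.
have [Me Me0 HMe] := test_function_bounded teta; have seta := proj1 teta.
have meta : measurable_fun O eta by exact: test_function_measurable teta.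
pose T0 := (2 * M + 2) ^+ n; have T00 : 0 <= T0 by apply: exprn_ge0; apply: addr_ge0 => //; apply: mulr_ge0 => //; exact: ltW.
pose K2 := 4 * (Me ^+ 2 * (T0 * be ^+ 2)).
have K20 : 0 <= K2 by rewrite !mulr_ge0 // sqr_ge0.
(* Accuracy of the smooth corrector. It depends on eta through the bound [Me], so eta has to be
   chosen before phi. *)
pose dl := Num.min 1 (kap / (K2 + 1)).
have dl0 : 0 < dl by rewrite lt_min ltr01 divr_gt0 // ltr_wpDl.
have dl1 : dl <= 1 by rewrite ge_min lexx.
have dlK : dl * K2 <= kap.
  apply: le_trans (le_split K20 kap0); rewrite ?ler_wpM2r // ge_min lexx orbT //.
have [Ldc /(_ dl dl0)[phi tphi Hphi]] := dchi_Pcl al0 be0 c tB.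
have [sphi pphi] := tphi.
pose g := gext (B t) c; pose gn y := c - grad phi y.
have Lg k : Lper (fun y => g y ord0 k) by exact: (gext_Lper al0 be0 (Bell t) (Bmeas t)).
have Lgn k : Lper (fun y => gn y ord0 k).
  have := LperD (-1) (Lper_smooth (pderiv_periodic k tphi)) (Lper_cst (c ord0 k)).
  by congr Lper; apply/funext => y; rewrite /gn !mxE addrC mulN1r.
have LgnY : L2v Y gn by move=> k; case: (Lgn k).
have LgY : L2v Y g by move=> k; case: (Lg k).
have Ngg : nrm2 Y (fun y => g y - gn y) <= dl.
  apply: le_trans Hphi; rewrite le_eqVlt; apply/orP; left; apply/eqP; apply: nrm2_eq => y Yy.
  by rewrite /g gext_cube // /gn /cellg opprB addrC subrKA addrC.
have Ncg : nrm2 Y (cellg (B t) c) <= Cg.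
  rewrite /Cg mulrAC ler_pdivlMr // mulrC; exact: cellg_nrm2_le.
have Ngn : nrm2 Y gn <= 2 * Cg + 2.
  have -> : nrm2 Y gn = nrm2 Y (fun y => cellg (B t) c y + (dchi (B t) c y - grad phi y)).
    by apply: nrm2_eq => y _; rewrite /gn /cellg subrKA.
  have Lcg := cellg_L2v al0 be0 c tB.
  apply: (le_trans (nrm2D_le mY Lcg (L2vB mY Ldc (smooth_gradL2 sphi)))).
  rewrite nrm2C; have := le_trans Hphi dl1; move: Ncg; move: (nrm2 _ _) (nrm2 _ _) => X1 X2; lra.
pose q := qcell (B t) c.
have Lq k : Lper (q k) by exact: (qcell_Lper al0 be0).
have q0 k : \int[leb]_(y in Y) q k y = 0 by exact: (qcell_mean al0 be0).
have qdiv := @qcell_div _ _ _ _ al0 be0 _ (Bell t) (Bmeas t) c.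
have [Cw Cw0 HCw] := weak_estimate k0 oO OM M0 leO Lq q0 qdiv teta.
have [Cp Cp0 HCp] := periodic_bounded (smooth_continuous sphi) pphi.
pose Ng := nrm2 O (grad eta); have Ng0 : 0 <= Ng := nrm2_ge0 _ _.
have Lge : L2v O (grad eta) := test_function_gradL2 mO leO teta.
pose K3 := 4 * (Cp ^+ 2 * Ng) + 4 * Cw.
have t3 : 0 <= Cp ^+ 2 * Ng by rewrite mulr_ge0 // sqr_ge0.
have K30 : 0 <= K3 by apply: addr_ge0; exact: mulr_ge0.
have K31 : 4 * (Cp ^+ 2 * Ng) <= K3 by rewrite lerDl mulr_ge0.
have K32 : 4 * Cw <= K3 by rewrite lerDr mulr_ge0.
have epsK : \forall eps \near (0 : R)^'+, eps <= kap / (K3 + 1) by apply: nbhs_right_le; rewrite divr_gt0 // ltr_wpDl.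
pose z x := (\1_A x - eta x) ^+ 2.
have z_bd x : `|z x| <= (1 + Me) ^+ 2.
  rewrite ger0_norm ?sqr_ge0 // /z -(real_normK (num_real (_ - _))) ler_sqr ?nnegrE ?addr_ge0 //.
  apply: (le_trans (ler_normB _ _)); apply: lerD; [exact: indic_norm_le1|exact: HMe].
have mz : measurable_fun O z.
  by apply: measurable_funX; apply: measurable_funB => //; exact: measurable_indic.
have Lz : L2 leb O z by apply: (@L2_bounded _ _ _ _ _ mO leO _ ((1 + Me) ^+ 2)).
(* The mean value property will be applied to |gn| ^ 2, which therefore has to be square-integrable
   on the cell. This is where the smoothness of phi counts, the corrector gradient being only in
   L^2. *)
have Lgn2 : Lper (fun y => dotv (gn y) (gn y)).
  apply: Lper_smooth; split; last first.
    have gper : cell_periodic (grad phi).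
      by move=> y k; apply/rowP => i; rewrite [LHS]mxE [RHS]mxE; exact: (pderiv_periodic i tphi).2.
    by move=> y k; rewrite /gn gper.
  rewrite /dotv; apply: smooth_sum => k.
  have s : smooth (fun y => gn y ord0 k).
    rewrite (_ : (fun y => _) = fun y => c ord0 k + (-1) * pderiv k phi y); last by apply/funext => y; rewrite /gn !mxE mulN1r.
    by apply: smoothD; [exact: smooth_cst|apply: smoothZ; exact: smooth_pderiv].
  by move=> _; exact: smoothM.
have near_z := mean_value oO OM M0 leO Lgn2 Lz e10.
have k4 : 0 < kap / 4 by rewrite divr_gt0.
have near_h := mean_zero_ipv oO OM M0 leO Lq q0 teta Lh k4.
exists (fun eps x => eta x *: gn (eps^-1 *: x)), (fun eps x => eta x *: mxv (B t (eps^-1 *: x)) (g (eps^-1 *: x))),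
  (fun eps => grad (fun x => - eps * (phi (eps^-1 *: x) * eta x))).
near=> eps.
have eps0 : 0 < eps by near: eps; exact: nbhs_right_gt.
have eps1 : eps <= 1 by near: eps; exact: nbhs_right_le.
have e01 : 0 < eps <= 1 by rewrite eps0.
have epsk : eps <= kap / (K3 + 1) by near: eps; exact: epsK.
have eK : eps ^+ 2 * K3 <= kap.
  apply: le_trans (le_split K30 kap0); rewrite // ler_wpM2r //.
  by apply: le_trans epsk; rewrite expr2 ler_piMr // ltW.
have eK' a : 0 <= a -> a <= K3 -> eps ^+ 2 * a <= kap.
  by move=> a0 aK; apply: le_trans eK; rewrite ler_wpM2l // sqr_ge0.
have hz : `|\int[leb]_(x in O) (dotv (gn (eps^-1 *: x)) (gn (eps^-1 *: x)) * z x) -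
    (\int[leb]_(y in Y) dotv (gn y) (gn y)) * \int[leb]_(x in O) z x| <= e1 by near: eps; exact: near_z.
have hh : (\int[leb]_(x in O) (\sum_k q k (eps^-1 *: x) * (eta x * h x ord0 k))) ^+ 2 <= kap / 4 by near: eps; exact: near_h.
have LBg k : Lper (fun y => mxv (B t y) (g y) ord0 k) by exact: (Lper_mxv be0 (Bell t) (Bmeas t)).
have [LGn _] := L2v_periodic_scale oO OM M0 Lgn e01.
have [LG _] := L2v_periodic_scale oO OM M0 Lg e01.
have [LP _] := L2v_periodic_scale (G := fun y => mxv (B t y) (g y)) oO OM M0 LBg e01.
have [LE _] := L2v_bounded_scale oO meta HMe LGn.
have [Lp _] := L2v_bounded_scale oO meta HMe LP.
have tpsi : test_function O (fun x => - eps * (phi (eps^-1 *: x) * eta x)).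
  split; first by apply: smoothZ; apply: smoothM => //; exact: smooth_scale.
  case: teta => _ [Kc cK [KO K0']]; exists Kc => //; split => // x /K0' ->; rewrite !mulr0 //.
have iz : leb.-integrable O (EFin \o z) by exact: L2_integrable.
have He1z : \int[leb]_(x in O) z x <= e1 by [].
have Ld w : L2v O (fun x => (eta x - \1_A x) *: w).
  move=> k; have := L2Z mO (w ord0 k) (L2B mO (test_function_L2 oO leO teta) (L2_indic oO leO mA)).
  by congr (L2 _ _ _); apply/funext => x; rewrite mxE mulrC.
have Hd w : nrm2 O (fun x => (eta x - \1_A x) *: w) <= e1 * dotv w w.
  rewrite mulrC; apply: le_trans (ler_wpM2l (dotvv_ge0 w) He1z).
  rewrite -(RintegralZl _ mO iz) le_eqVlt; apply/orP; left; apply/eqP; apply: eq_Rintegral => x _.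
  by rewrite dotvZl dotvZr /z; ring.
pose Qv y := mxv (B t y) (g y) - m.
have LQ k : Lper (fun y => Qv y ord0 k).
  by have := Lq k; congr Lper; apply/funext => y; rewrite /Qv [RHS]mxE; congr (_ + _); rewrite [RHS]mxE.
have [LQe _] := L2v_periodic_scale oO OM M0 LQ e01.
have [LQv _] := L2v_bounded_scale oO meta HMe LQe.
(* Splits the flux error into the fluctuation [q] weighted by eta, controlled by [weak_estimate] or
   [mean_zero_ipv], and (eta - 1_A) times the homogenized flux, small because eta is close to
   1_A. *)
have lin (G : T -> 'rV[R]_n) : L2v O G -> ipv O (fun x => eta x *: mxv (B t (eps^-1 *: x)) (g (eps^-1 *: x)) - mxv (A0 (sigma x)) (\1_A x *: c)) G =
    \int[leb]_(x in O) (\sum_k q k (eps^-1 *: x) * (eta x * G x ord0 k)) + ipv O (fun x => (eta x - \1_A x) *: m) G.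
  move=> LG'; have -> : \int[leb]_(x in O) (\sum_k q k (eps^-1 *: x) * (eta x * G x ord0 k)) = ipv O (fun x => eta x *: Qv (eps^-1 *: x)) G.
    apply: eq_Rintegral => x _; apply: eq_bigr => k _.
    rewrite [in RHS]mxE (_ : Qv _ ord0 k = q k (eps^-1 *: x)); first by ring.
    by rewrite /Qv [LHS]mxE; congr (_ + _); rewrite [LHS]mxE.
  rewrite -(ipvD mO LQv (Ld m) LG'); apply: eq_Rintegral => x _; congr dotv.
  by rewrite AE /Qv scalerBr scalerBl addrA subrK.
split; [exact: LE|exact: Lp|by exists (fun x => - eps * (phi (eps^-1 *: x) * eta x))| |].
- have -> : (fun x => eta x *: gn (eps^-1 *: x) - \1_A x *: c - grad (fun x => - eps * (phi (eps^-1 *: x) * eta x)) x) =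
     (fun x => (eta x - \1_A x) *: c + (eps * phi (eps^-1 *: x)) *: grad eta x).
    apply/funext => x; rewrite grad_scale_product ?gt_eqF //.
    have rr (X Y Z W : 'rV[R]_n) (a b : R) : a *: (X - Y) - b *: X - (- (a *: Y) - W) = (a - b) *: X + W.
      by apply/rowP => k; rewrite !mxE; ring.
    exact: (rr _ _ 0).
  have b x : `|eps * phi (eps^-1 *: x)| <= eps * Cp by rewrite normrM gtr0_norm // ler_wpM2l // ltW.
  have mb : measurable_fun O (fun x => eps * phi (eps^-1 *: x)).
    by apply: continuous_rV_measurable; apply: smooth_continuous; apply: smoothZ; exact: smooth_scale.
  have [L1 N1] := L2v_bounded_scale oO mb b Lge.
  apply: (le_trans (nrm2D_le mO (Ld c) L1)).
  apply: (sum2_le (Hd c) N1 hK1).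
  rewrite exprMn -[X in 4 * X]mulrA mulrCA; apply: eK' => //; exact: mulr_ge0.
- split.
  (* [D1] comes from replacing g by the smooth gn, and [D2] from the points outside A, where sigma
     may differ from t but eta is small in the mean. *)
  + pose D1 x := eta x *: mxv (B t (eps^-1 *: x)) (g (eps^-1 *: x) - gn (eps^-1 *: x)).
    pose D2 x := eta x *: mxv (B t (eps^-1 *: x)) (gn (eps^-1 *: x)) - mxv (Bs eps x) (eta x *: gn (eps^-1 *: x)).
    have Lggn k : Lper (fun y => (g y - gn y) ord0 k).
      by have := LperD (-1) (Lgn k) (Lg k); congr Lper; apply/funext => y; rewrite [RHS]mxE [X in _ = _ + X]mxE mulN1r addrC.
    have LggnY : L2v Y (fun y => g y - gn y) by exact: L2vB.
    have [LB1 NB1] := L2v_periodic_scale oO OM M0 (fun k => Lper_mxv be0 (Bell t) (Bmeas t) (Bper t) k Lggn) e01.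
    have [LD1 ND1] := L2v_bounded_scale oO meta HMe LB1.
    have [LB2 _] := L2v_periodic_scale oO OM M0 (fun k => Lper_mxv be0 (Bell t) (Bmeas t) (Bper t) k Lgn) e01.
    have [LD2' _] := L2v_bounded_scale oO meta HMe LB2.
    have tBs : tfield O al be (fun x => Bs eps x) by split.
    have LD2 : L2v O D2 := L2vB mO LD2' (L2v_tfield mO be0 tBs LE).
    have -> : (fun x => eta x *: mxv (B t (eps^-1 *: x)) (g (eps^-1 *: x)) - mxv (Bs eps x) (eta x *: gn (eps^-1 *: x))) =
       (fun x => D1 x + D2 x).
      have rr (a : R) (X Z W : 'rV[R]_n) : a *: X - Z = a *: (X - W) + (a *: W - Z).
        by rewrite scalerBr addrA subrK.
      by apply/funext => x; rewrite /D1 (mxvB _ (g _)); exact: rr.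
    apply: (le_trans (nrm2D_le mO LD1 LD2)).
    have H1 : nrm2 O D1 <= Me ^+ 2 * (T0 * (be ^+ 2 * dl)).
      apply: (le_trans ND1); rewrite ler_wpM2l ?sqr_ge0 //; apply: (le_trans NB1).
      rewrite ler_wpM2l //; apply: (le_trans (nrm2_tfield mY be0 tB LggnY)).
      by rewrite ler_wpM2l.
    have Lw : leb.-integrable O (EFin \o (fun x => dotv (gn (eps^-1 *: x)) (gn (eps^-1 *: x)) * z x)).
      exact: (L2M_integrable mO (Lper_sqr_int Lgn2 mO OM M0 e01).1 Lz).
    have H2 : nrm2 O D2 <= 4 * be ^+ 2 * \int[leb]_(x in O) (dotv (gn (eps^-1 *: x)) (gn (eps^-1 *: x)) * z x).
      rewrite -(RintegralZl _ mO Lw); apply: le_Rintegral => //; first exact: ipv_integrable.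
        by apply: eq_integrable (integrableZl mO (4 * be ^+ 2) Lw).
      move=> x Ox; apply: (flux_diff_le _ _ (Bell t _) (Bell (sigma x) _)).
      by case: (pselect (A x)) => [Ax|nAx]; [left; rewrite (At x Ax)|right; exact: ind0].
    have Yn : \int[leb]_(y in Y) dotv (gn y) (gn y) <= 2 * Cg + 2 by [].
    have H3 : \int[leb]_(x in O) (dotv (gn (eps^-1 *: x)) (gn (eps^-1 *: x)) * z x) <= (2 * Cg + 2 + 1) * e1.
      have iz0 : 0 <= \int[leb]_(x in O) z x by apply: Rintegral_ge0 => x _; exact: sqr_ge0.
      apply: (mean_le hz); apply: ler_pM => //; exact: nrm2_ge0.
    have H4 := le_trans H2 (ler_wpM2l (mulr_ge0 (ler0n R 4) be2) H3).
    apply: (sum2_le H1 H4 _ hK4); apply: le_trans dlK.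
    by rewrite /K2 le_eqVlt; apply/orP; left; apply/eqP; ring.
  + move=> psi tps; have Lps := test_function_gradL2 mO leO tps; rewrite (lin _ Lps).
    apply: (le_trans (sqrD_le _ _)).
    have N0 := nrm2_ge0 O (grad psi).
    have H2 := le_trans (ipv_CS mO (Ld m) Lps) (ler_wpM2r N0 (Hd m)).
    have -> : \int[leb]_(x in O) (\sum_k q k (eps^-1 *: x) * (eta x * grad psi x ord0 k)) =
        \int[leb]_(x in O) (\sum_k q k (eps^-1 *: x) * (eta x * pderiv k psi x)).
      by apply: eq_Rintegral => x _; apply: eq_bigr => k _; rewrite [grad psi x ord0 k]mxE.
    apply: (sum2_le (HCw _ _ e01 tps) H2); rewrite mulrA; apply: (ler_wpM2r N0) => //.
    by rewrite mulrA mulrC; apply: eK' => //; exact: mulr_ge0.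
  + rewrite (lin _ Lh); apply: (le_trans (sqrD_le _ _)).
    have H2 := le_trans (ipv_CS mO (Ld m) Lh) (ler_wpM2r Nh0 (Hd m)).
    by apply: (sum2_le hh H2 _ hK3); rewrite mulrC divfK.
Unshelve. all: by end_near. Qed.

End oscillating_base.

(** * Convergence of the fluxes *)

Section weak_solutions.
Context {R : realType} {n : nat}.
Local Notation T := 'rV[R]_n.
Local Notation leb := (@lebesgue_rV R n).
Variables (O : set T).
Hypothesis oO : open O.
Hypothesis leO : (leb O < +oo)%E.
Variables (al be : R).
Hypothesis al0 : 0 < al.
Hypothesis be0 : 0 <= be.
Implicit Types (B : T -> 'M[R]_n) (F G w : T -> 'rV[R]_n).

Let mO : measurable O := open_measurable_rV oO.

Let sqr_mono (a b : R) : 0 <= a -> a <= b -> a ^+ 2 <= b ^+ 2.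
Proof. by move=> a0 ab; apply: lerXn2r => //; rewrite nnegrE // (le_trans a0). Qed.

Lemma sqrD3_le (a b c : R) : (a + b + c) ^+ 2 <= 3 * (a ^+ 2 + b ^+ 2 + c ^+ 2).
Proof. have := sqr_ge0 (a - b); have := sqr_ge0 (b - c); have := sqr_ge0 (a - c); lra. Qed.

Lemma Vcl_grad psi : test_function O psi -> Vcl O (grad psi).
Proof.
move=> tpsi; split; first exact: test_function_gradL2.
move=> e e0; exists psi => //; rewrite (@nrm2_eq _ _ _ _ (fun=> 0)); last by move=> x _; rewrite subrr.
by rewrite /nrm2 /ipv; under eq_Rintegral do rewrite dotv0l; rewrite Rintegral_cst // mul0r ltW.
Qed.

Lemma VclP a F G : Vcl O F -> Vcl O G -> Vcl O (fun x => a *: F x + G x).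
Proof.
move=> [LF HF] [LG HG]; split; first exact: L2vP.
move=> e e0; have c0 : 0 < 4 * (a ^+ 2 + 1) by rewrite mulr_gt0 // ltr_wpDl // sqr_ge0.
have [p tp Hp] := HF (e / (4 * (a ^+ 2 + 1))) ltac:(by rewrite divr_gt0).
have [q tq Hq] := HG (e / 4) ltac:(by rewrite divr_gt0).
exists (fun x => a * p x + q x); first exact: test_functionP.
have Lp := L2vB mO (test_function_gradL2 mO leO tp) LF; have Lq := L2vB mO (test_function_gradL2 mO leO tq) LG.
have -> : (fun x => grad (fun x => a * p x + q x) x - (a *: F x + G x)) =
    (fun x => a *: (grad p x - F x) + (grad q x - G x)).
  by apply/funext => x; rewrite (gradP _ (proj1 tp) (proj1 tq)) scalerBr addrACA -opprD.
apply: (le_trans (nrm2D_le mO (L2vZ mO a Lp) Lq)); rewrite nrm2Z //.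
have h := nrm2_ge0 O (fun x => grad p x - F x).
move: Hp Hq h; move: (nrm2 _ _) (nrm2 _ _) => P Q; rewrite ler_pdivlMr // => Hp Hq h.
by have := sqr_ge0 a; nra.
Qed.

Lemma VclB F G : Vcl O F -> Vcl O G -> Vcl O (fun x => F x - G x).
Proof. by move=> VF VG; have := VclP (-1) VG VF; under eq_fun do rewrite scaleN1r addrC. Qed.

(** Density of gradients of test functions; splitting one square for the pairing and one for the
    norm gives the factor 4. *)
Lemma Vcl_ipv_le F (kap : R) w : L2v O F -> 0 <= kap ->
  (forall psi, test_function O psi -> ipv O F (grad psi) ^+ 2 <= kap * nrm2 O (grad psi)) ->
  Vcl O w -> ipv O F w ^+ 2 <= 4 * kap * nrm2 O w.
Proof.
move=> LF k0 HF [Lw Hw]; apply/ler_addgt0Pr => e e0.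
have F0 := nrm2_ge0 O F; have c0 : 0 < 4 * kap + 2 * nrm2 O F + 1 by lra.
have [psi tpsi Hpsi] := Hw (e / (4 * kap + 2 * nrm2 O F + 1)) ltac:(by rewrite divr_gt0).
have Lp := test_function_gradL2 mO leO tpsi; have Ld := L2vB mO Lw Lp.
have -> : ipv O F w = ipv O F (grad psi) + ipv O F (fun x => w x - grad psi x).
  rewrite ![ipv O F _]ipvC -ipvD //; apply: eq_Rintegral => x _; by rewrite addrC subrK.
apply: (le_trans (sqrD_le _ _)).
have H1 := HF _ tpsi.
have H2 := ipv_CS mO LF Ld; rewrite [X in _ <= _ * X]nrm2C in H2.
have H3 : nrm2 O (grad psi) <= 2 * nrm2 O w + 2 * nrm2 O (fun x => grad psi x - w x).
  apply: le_trans (nrm2D_le mO Lw (L2vB mO Lp Lw)).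
  rewrite le_eqVlt; apply/orP; left; apply/eqP; apply: nrm2_eq => x _; by rewrite addrC subrK.
rewrite ler_pdivlMr // in Hpsi.
have d0 := nrm2_ge0 O (fun x => grad psi x - w x).
have H4 := ler_wpM2l k0 H3.
move: H1 H2 H4 Hpsi d0 F0; move: (ipv _ _ _) (ipv _ _ _) => X1 X2.
by move: (nrm2 _ _) (nrm2 _ _) (nrm2 _ _) (nrm2 _ _) => N1 N2 N3 N4; nra.
Qed.

(** Only gradients are kept: [F] stands for the gradient of the solution and [G] for that of the
    lift carrying the boundary data. *)
Definition weak_sol B G F := [/\ L2v O F, Vcl O (fun x => F x - G x) &
  forall psi, test_function O psi -> ipv O (fun x => mxv (B x) (F x)) (grad psi) = 0].

Lemma weak_sol_orth B G F w : tfield O al be B -> weak_sol B G F -> Vcl O w ->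
  ipv O (fun x => mxv (B x) (F x)) w = 0.
Proof. by move=> tB [LF _ H] Vw; apply: (Vcl_ipv0 oO leO) => //; exact: (L2v_tfield mO be0 tB LF). Qed.

(** Testing with F - G replaces the second F of the energy by G; coercivity and Cauchy-Schwarz
    conclude. *)
Lemma weak_sol_energy B G F : tfield O al be B -> L2v O G -> weak_sol B G F ->
  al ^+ 2 * nrm2 O F <= be ^+ 2 * nrm2 O G.
Proof.
move=> tB LG sF; have [LF VF _] := sF; have LBF := L2v_tfield mO be0 tB LF.
have H1 := coercive mO be0 tB LF.
have E : ipv O (fun x => mxv (B x) (F x)) F = ipv O (fun x => mxv (B x) (F x)) G.
  have := weak_sol_orth tB sF VF; rewrite ipvC ipvB // => /eqP; rewrite subr_eq0 => /eqP.
  by rewrite ipvC => ->; rewrite ipvC.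
rewrite E in H1.
have H2 := ipv_CS mO LBF LG; have H3 := nrm2_tfield mO be0 tB LF.
have G0 := nrm2_ge0 O G; have F0 := nrm2_ge0 O F.
have H4 := le_trans H2 (ler_wpM2r G0 H3).
have [F00|F1] := eqVneq (nrm2 O F) 0; first by rewrite F00 mulr0 mulr_ge0 // sqr_ge0.
have Fp : 0 < nrm2 O F by rewrite lt_neqAle eq_sym F1.
rewrite -(ler_pM2r Fp).
have H5 : (al * nrm2 O F) ^+ 2 <= be ^+ 2 * nrm2 O F * nrm2 O G.
  by apply: le_trans H4; apply: sqr_mono => //; rewrite mulr_ge0 // ltW.
by rewrite -mulrA -expr2 -exprMn [leRHS]mulrAC; exact: H5.
Qed.

(** With w = F1 - F2, the equations give that B1 w and - (B1 - B2) F2 have the same pairing with w,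
    so the norm of w is O (dl). The constant is fixed before the tensors, hence uniform in eps. *)
Lemma weak_sol_stability G h : L2v O G -> L2v O h -> exists2 C : R, 0 <= C &
  forall B1 B2 F1 F2 (dl : R), tfield O al be B1 -> tfield O al be B2 ->
  weak_sol B1 G F1 -> weak_sol B2 G F2 -> 0 <= dl -> (forall x i j, O x -> `|B1 x i j - B2 x i j| <= dl) ->
  (ipv O (fun x => mxv (B1 x) (F1 x)) h - ipv O (fun x => mxv (B2 x) (F2 x)) h) ^+ 2 <= C * dl ^+ 2.
Proof.
move=> LG Lh; pose NG := nrm2 O G; pose Nh := nrm2 O h.
have NG0 : 0 <= NG := nrm2_ge0 _ _; have Nh0 : 0 <= Nh := nrm2_ge0 _ _.
pose E := be ^+ 2 * NG / al ^+ 2.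
have al20 : 0 < al ^+ 2 by rewrite exprn_gt0.
have b2 := sqr_ge0 be; have E0 : 0 <= E by rewrite divr_ge0 ?(ltW al20) // mulr_ge0.
pose Q := n%:R ^+ 2 * E; have Q0 : 0 <= Q by rewrite mulr_ge0 // sqr_ge0.
exists (2 * (be ^+ 2 / al ^+ 2 * Q * Nh) + 2 * (Q * Nh)).
  by apply: addr_ge0; rewrite mulr_ge0 // mulr_ge0 // mulr_ge0 // divr_ge0 // ltW.
move=> B1 B2 F1 F2 dl t1 t2 s1 s2 dl0 HB.
have [L1 V1 _] := s1; have [L2 V2 _] := s2.
have e2 := weak_sol_energy t2 LG s2.
have NF2 : nrm2 O F2 <= E by rewrite /E ler_pdivlMr // mulrC.
have mD i j : measurable_fun O (fun x => (B1 x - B2 x) i j).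
  under eq_fun do rewrite !mxE; apply: measurable_funB; [exact: t1.1|exact: t2.1].
have LD : L2v O (fun x => mxv (B1 x - B2 x) (F2 x)).
  by apply: (L2v_mxv mO mD (L := dl)) => // x i j Ox; rewrite !mxE; exact: HB.
have ND : nrm2 O (fun x => mxv (B1 x - B2 x) (F2 x)) <= Q * dl ^+ 2.
  apply: (@le_trans _ _ ((n%:R * dl) ^+ 2 * nrm2 O F2)).
    have i1 := ipv_integrable mO L2 L2.
    rewrite /nrm2 /ipv -(RintegralZl _ mO i1); apply: le_Rintegral => //; first exact: ipv_integrable.
      by apply: eq_integrable (integrableZl mO ((n%:R * dl) ^+ 2) i1).
    by move=> x Ox; apply: mxv_entry_bound => // i j; rewrite !mxE; exact: HB.
  rewrite exprMn mulrAC /Q; apply: ler_wpM2r; first exact: sqr_ge0.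
  by apply: ler_wpM2l => //; exact: sqr_ge0.
pose w x := F1 x - F2 x.
have Lw : L2v O w by exact: L2vB.
have Vw : Vcl O w.
  have := VclB V1 V2; congr Vcl; apply/funext => x; rewrite /w opprB addrA subrK //.
have LB1 := L2v_tfield mO be0 t1 L1; have LB2 := L2v_tfield mO be0 t2 L2.
have LB12 := L2v_tfield mO be0 t1 L2; have LBw := L2v_tfield mO be0 t1 Lw.
have split1 H : L2v O H -> ipv O (fun x => mxv (B1 x) (F1 x)) H - ipv O (fun x => mxv (B2 x) (F2 x)) H =
    ipv O (fun x => mxv (B1 x) (w x)) H + ipv O (fun x => mxv (B1 x - B2 x) (F2 x)) H.
  move=> LH; rewrite -ipvB // -ipvD //; apply: eq_Rintegral => x _.
  by rewrite mxvBmx /w mxvB addrA subrK.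
have Ew : ipv O (fun x => mxv (B1 x) (w x)) w = - ipv O (fun x => mxv (B1 x - B2 x) (F2 x)) w.
  have := split1 _ Lw; rewrite (weak_sol_orth t1 s1 Vw) (weak_sol_orth t2 s2 Vw) subrr => /eqP.
  by rewrite eq_sym addr_eq0 => /eqP.
have Nw0 := nrm2_ge0 O w.
have Nw : nrm2 O w <= Q * dl ^+ 2 / al ^+ 2.
  rewrite ler_pdivlMr //.
  have H1 := coercive mO be0 t1 Lw; rewrite Ew in H1.
  have H2 := le_trans (ipv_CS mO LD Lw) (ler_wpM2r Nw0 ND).
  have [F00|F1'] := eqVneq (nrm2 O w) 0; first by rewrite F00 mul0r mulr_ge0 // sqr_ge0.
  have Fp : 0 < nrm2 O w by rewrite lt_neqAle eq_sym F1'.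
  rewrite -(ler_pM2r Fp); apply: le_trans H2.
  rewrite -[leRHS]sqrrN [X in X * _]mulrC -mulrA -expr2 -exprMn.
  by apply: sqr_mono => //; rewrite mulr_ge0 // ltW.
rewrite (split1 _ Lh); apply: (le_trans (sqrD_le _ _)); rewrite [leRHS]mulrDl; apply: lerD; rewrite -[leRHS]mulrA ler_wpM2l //.
  apply: (le_trans (ipv_CS mO LBw Lh)); apply: (@le_trans _ _ (be ^+ 2 * (Q * dl ^+ 2 / al ^+ 2) * Nh)).
    rewrite ler_wpM2r //; apply: (le_trans (nrm2_tfield mO be0 t1 Lw)); by rewrite ler_wpM2l.
  by rewrite le_eqVlt; apply/orP; left; apply/eqP; rewrite /Nh; ring.
apply: (le_trans (ipv_CS mO LD Lh)); apply: (le_trans (ler_wpM2r Nh0 ND)).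
by rewrite mulrAC mulrA.
Qed.

End weak_solutions.

Section homogenization_simple.
Context {R : realType} {n : nat}.
Local Notation T := 'rV[R]_n.
Local Notation leb := (@lebesgue_rV R n).
Local Notation Y := (@unit_cube R n).
Variables (O : set T) (M : R) (k0 : 'I_n).
Hypothesis oO : open O.
Hypothesis OM : O `<=` box n M.
Hypothesis M0 : 0 < M.
Hypothesis leO : (leb O < +oo)%E.
Variables (al be : R).
Hypothesis al0 : 0 < al.
Hypothesis be0 : 0 <= be.
Variable B : R -> T -> 'M[R]_n.
Hypothesis Bell : forall t y, elliptic al be (B t y).
Hypothesis Bmeas : forall t i j, measurable_fun setT (fun y => B t y i j).
Hypothesis Bper : forall t, cell_periodic (B t).
Variable sigma : T -> R.
Variable h : T -> 'rV[R]_n.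
Hypothesis Lh : L2v O h.

Local Notation Bs eps x := (B (sigma x) (eps^-1 *: x)).
Local Notation A0 t := (homogenized (B t)).

Hypothesis Bs_meas : forall eps i j, measurable_fun O (fun x => Bs eps x i j).
Hypothesis A0_meas : forall i j, measurable_fun O (fun x => A0 (sigma x) i j).

Let mO : measurable O := open_measurable_rV oO.

Let tBs eps : tfield O al be (fun x => Bs eps x).
Proof. by split. Qed.

Let tA0 : tfield O al be (fun x => A0 (sigma x)).
Proof. exact: (tfield_effective al0 be0 Bell Bmeas A0_meas). Qed.

(** Absorption, by contradiction: if N > kap then W <= 4 N, the three squares add up to at most (20
    + be ^ 2) kap N, and dividing by N bounds it by a multiple of kap. The factor 3 is from the
    square of a sum of three terms. *)
Let energy_arith : exists2 C : R, 0 <= C & forall kap N W X1 X2 X3 : R, 0 < kap -> 0 <= N ->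
  al * N <= X1 + X2 + X3 -> X1 ^+ 2 <= 4 * kap * W -> X2 ^+ 2 <= kap * W -> X3 ^+ 2 <= be ^+ 2 * N * kap ->
  W <= 2 * N + 2 * kap -> N <= C * kap.
Proof.
have b2 := sqr_ge0 be; have a2 : 0 < al ^+ 2 by rewrite exprn_gt0.
pose D := 3 * (20 + be ^+ 2) / al ^+ 2.
have D0 : 0 <= D by rewrite divr_ge0 ?(ltW a2) // mulr_ge0 // addr_ge0.
exists (1 + D); first by lra.
move=> kap N W X1 X2 X3 k0' N0 H h1 h2 h3 h4; rewrite leNgt; apply/negP => Nk.
have kN : kap < N by apply: le_lt_trans Nk; rewrite mulrDl mul1r lerDl mulr_ge0 // ltW.
have DkN : D * kap < N by apply: le_lt_trans Nk; rewrite mulrDl mul1r lerDr ltW.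
have S := sqrD3_le X1 X2 X3.
have H2 : (al * N) ^+ 2 <= (X1 + X2 + X3) ^+ 2.
  by apply: lerXn2r => //; rewrite nnegrE ?mulr_ge0 ?(ltW al0) // (le_trans _ H) // mulr_ge0 ?(ltW al0).
have kW := ler_wpM2l (ltW k0') h4.
have Np : 0 < N by apply: lt_trans kN.
have e1 : (al * N) ^+ 2 <= 3 * (20 + be ^+ 2) * kap * N.
  have kk : kap * kap <= kap * N by rewrite ler_wpM2l ?ltW.
  apply: (le_trans H2); apply: (le_trans S); move: h1 h2 h3 kW kk; move: (X1 ^+ 2) (X2 ^+ 2) (X3 ^+ 2) (be ^+ 2) => Y1 Y2 Y3 Y4; nra.
have e2 : al ^+ 2 * N <= 3 * (20 + be ^+ 2) * kap.
  by rewrite -(ler_pM2r Np); move: e1; rewrite exprMn [N ^+ 2]expr2 mulrA.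
have : N <= D * kap by rewrite /D mulrAC ler_pdivlMr // mulrC.
by rewrite leNgt DkN.
Qed.

(* Coercivity bounds |F eps - E|^2 by the pairing of F eps - E with its flux.  This
   is small: F eps - E is a gradient up to a small error, and when tested against
   gradients, p and the flux of F eps are both close to the flux of F0. *)
Lemma homogenization_of_oscillating G F0 (F : R -> T -> 'rV[R]_n) :
  weak_sol O (fun x => A0 (sigma x)) G F0 -> (forall eps, 0 < eps -> weak_sol O (fun x => Bs eps x) G (F eps)) ->
  oscillating O B sigma h F0 -> forall e : R, 0 < e -> \forall eps \near (0 : R)^'+,
  (ipv O (fun x => mxv (Bs eps x) (F eps x)) h - ipv O (fun x => mxv (A0 (sigma x)) (F0 x)) h) ^+ 2 <= e.
Proof.
move=> s0 sF osc e e0; have [C C0 HC] := energy_arith.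
have [LF0 VF0 _] := s0.
pose Nh := nrm2 O h; have Nh0 : 0 <= Nh := nrm2_ge0 _ _.
pose K := 3 * (be ^+ 2 * C * Nh + Nh + 1).
have b2 := sqr_ge0 be; have t1 : 0 <= be ^+ 2 * C * Nh by rewrite !mulr_ge0.
have K0 : 0 < K by rewrite /K; lra.
have kap0 : 0 < e / K by rewrite divr_gt0.
have [E [p [v H]]] := osc _ kap0; near=> eps.
have eps0 : 0 < eps by near: eps; exact: nbhs_right_gt.
have [LE Lp [psi tpsi ve] hd [hp hw hh]] :
    oscillating_at O B sigma h (e / K) F0 (E eps) (p eps) (v eps) eps by near: eps; exact: H.
have [LF VF _] := sF _ eps0; have tB := tBs eps.
have Vv : Vcl O (v eps) by rewrite ve; exact: Vcl_grad.
have [Lv _] := Vv.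
pose r x := F eps x - E eps x; pose d x := E eps x - F0 x - v eps x; pose w x := F eps x - F0 x - v eps x.
have Lr : L2v O r by exact: L2vB.
have Ld : L2v O d by apply: L2vB => //; exact: L2vB.
have Vw : Vcl O w.
  have VFF : Vcl O (fun x => F eps x - F0 x).
    have := VclB oO leO VF VF0; congr Vcl; apply/funext => x; rewrite opprB addrA subrK //.
  exact: (VclB oO leO VFF Vv).
have [Lw _] := Vw.
have LBF := L2v_tfield mO be0 tB LF; have LBE := L2v_tfield mO be0 tB LE; have LBr := L2v_tfield mO be0 tB Lr.
have LA := L2v_tfield mO be0 tA0 LF0.
have LpE : L2v O (fun x => p eps x - mxv (Bs eps x) (E eps x)) by exact: L2vB.
have LpA : L2v O (fun x => p eps x - mxv (A0 (sigma x)) (F0 x)) by exact: L2vB.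
have split1 (H' : T -> 'rV[R]_n) : L2v O H' -> ipv O (fun x => mxv (Bs eps x) (r x)) H' =
   ipv O (fun x => mxv (Bs eps x) (F eps x)) H' - ipv O (fun x => mxv (A0 (sigma x)) (F0 x)) H' -
   ipv O (fun x => p eps x - mxv (A0 (sigma x)) (F0 x)) H' + ipv O (fun x => p eps x - mxv (Bs eps x) (E eps x)) H'.
  move=> LH; rewrite (ipvB mO Lp LA LH) (ipvB mO Lp LBE LH).
  have -> : ipv O (fun x => mxv (Bs eps x) (r x)) H' = ipv O (fun x => mxv (Bs eps x) (F eps x)) H' - ipv O (fun x => mxv (Bs eps x) (E eps x)) H'.
    by rewrite -(ipvB mO LBF LBE LH); apply: eq_Rintegral => x _; rewrite -mxvB.
  ring.
pose X1 := - ipv O (fun x => p eps x - mxv (A0 (sigma x)) (F0 x)) w.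
pose X2 := ipv O (fun x => p eps x - mxv (Bs eps x) (E eps x)) w.
pose X3 := - ipv O (fun x => mxv (Bs eps x) (r x)) d.
(* r = w - d. Since w lies in the closure of gradients, the fluxes of both solutions vanish when
   tested with it; the pairing with the small d is left to Cauchy-Schwarz. *)
have Er : ipv O (fun x => mxv (Bs eps x) (r x)) r = X1 + X2 + X3.
  have -> : ipv O (fun x => mxv (Bs eps x) (r x)) r = ipv O (fun x => mxv (Bs eps x) (r x)) w - ipv O (fun x => mxv (Bs eps x) (r x)) d.
    rewrite ![ipv O (fun x => mxv (Bs eps x) (r x)) _]ipvC -(ipvB mO Lw Ld LBr); apply: eq_Rintegral => x _; congr dotv.
    have rr (X Y Z W : 'rV[R]_n) : X - Y = X - Z - W - (Y - Z - W) by apply/rowP => k; rewrite !mxE; ring.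
    exact: rr.
  rewrite (split1 _ Lw) (weak_sol_orth oO leO be0 tB (sF _ eps0) Vw) (weak_sol_orth oO leO be0 tA0 s0 Vw).
  by rewrite /X1 /X2 /X3 subrr sub0r.
have Nr0 := nrm2_ge0 O r.
have Nr : nrm2 O r <= C * (e / K).
  apply: (HC _ _ (nrm2 O w) X1 X2 X3) => //.
  - by rewrite -Er; exact: (coercive mO be0 tB Lr).
  - by rewrite /X1 sqrrN; apply: (Vcl_ipv_le oO leO LpA (ltW kap0) hw Vw).
  - apply: (le_trans (ipv_CS mO LpE Lw)); apply: ler_wpM2r => //; exact: nrm2_ge0.
  - rewrite /X3 sqrrN; apply: (le_trans (ipv_CS mO LBr Ld)); apply: ler_pM => //; [exact: nrm2_ge0|exact: nrm2_ge0|].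
    exact: (nrm2_tfield mO be0 tB Lr).
  - have -> : nrm2 O w = nrm2 O (fun x => r x + d x).
      apply: nrm2_eq => x _; rewrite /r /d /w.
      have rr (X Y Z W : 'rV[R]_n) : X - Z - W = X - Y + (Y - Z - W) by apply/rowP => k; rewrite !mxE; ring.
      exact: rr.
    by apply: (le_trans (nrm2D_le mO Lr Ld)); apply: lerD => //; rewrite ler_wpM2l.
have -> : ipv O (fun x => mxv (Bs eps x) (F eps x)) h - ipv O (fun x => mxv (A0 (sigma x)) (F0 x)) h =
   ipv O (fun x => mxv (Bs eps x) (r x)) h + (- ipv O (fun x => p eps x - mxv (Bs eps x) (E eps x)) h) +
   ipv O (fun x => p eps x - mxv (A0 (sigma x)) (F0 x)) h.
  have rr (X Y Z W : R) : X - Y = X - Y - Z + W + - W + Z by ring.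
  by rewrite (split1 _ Lh); exact: rr.
apply: (le_trans (sqrD3_le _ _ _)); rewrite sqrrN.
have Y1 : ipv O (fun x => mxv (Bs eps x) (r x)) h ^+ 2 <= be ^+ 2 * (C * (e / K)) * Nh.
  apply: (le_trans (ipv_CS mO LBr Lh)); rewrite ler_wpM2r //.
  by apply: (le_trans (nrm2_tfield mO be0 tB Lr)); rewrite ler_wpM2l.
have Y2 : ipv O (fun x => p eps x - mxv (Bs eps x) (E eps x)) h ^+ 2 <= e / K * Nh.
  by apply: (le_trans (ipv_CS mO LpE Lh)); rewrite ler_wpM2r.
have -> : e = 3 * (be ^+ 2 * (C * (e / K)) * Nh + e / K * Nh + e / K).
  have key q : q * K = 3 * (be ^+ 2 * (C * q) * Nh + q * Nh + q) by rewrite /K; ring.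
  by rewrite -[LHS](divfK (negbT (gt_eqF K0)) e); exact: key.
by rewrite ler_wpM2l // lerD // lerD.
Unshelve. all: by end_near. Qed.

Local Notation osc := (oscillating O B sigma h).

Lemma oscillating_sum (I : Type) (s : seq I) (F : I -> T -> 'rV[R]_n) : (forall i, L2v O (F i)) ->
  (forall i, osc (F i)) -> osc (fun x => \sum_(i <- s) F i x).
Proof.
move=> LF HF; have Ls r : L2v O (fun x => \sum_(i <- r) F i x).
  elim: r => [|i r IH]; first by under eq_fun do rewrite big_nil; exact: L2v0.
  by under eq_fun do rewrite big_cons; exact: L2vD.
have Lz : L2v O (fun x => \1_(set0 : set T) x *: (0 : 'rV[R]_n)).
  by under eq_fun do rewrite scaler0; exact: L2v0.
elim: s => [|i s IH].
  (* The indicator of the empty set makes the zero field oscillating, which is the base case. *)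
  have oz := oscillating_indicator k0 oO OM M0 leO al0 be0 Bell Bmeas Bper Lh Bs_meas (A := set0) (t := 0) 0
    measurable0 (@sub0set _ _) (fun x (f : set0 x) => False_ind _ f).
  apply: (oscillating_eq oO leO al0 be0 Bell Bmeas Lh A0_meas Lz (Ls [::]) _ oz).
  by move=> x _; rewrite big_nil scaler0.
have L1 : L2v O (fun x => 1 *: F i x + \sum_(j <- s) F j x) by exact: L2vP.
have oP := oscillatingP oO leO al0 be0 Bell Bmeas Lh Bs_meas A0_meas 1 (LF i) (Ls s) (HF i) IH.
apply: (oscillating_eq oO leO al0 be0 Bell Bmeas Lh A0_meas L1 (Ls _) _ oP).
by move=> x _; rewrite big_cons scale1r.
Qed.

(** A measurable subset of A still satisfies sigma = t, so indicators are covered and [L2_ind]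
    reaches every L^2 weight. *)
Lemma oscillating_level (A : set T) (t : R) (c : 'rV[R]_n) (f : T -> R) : measurable A -> A `<=` O ->
  (forall x, A x -> sigma x = t) -> L2 leb O f -> osc (fun x => (\1_A x * f x) *: c).
Proof.
move=> mA AO At; have LA g : L2 leb O g -> L2v O (fun x => (\1_A x * g x) *: c).
  move=> Lg k; have := L2Z mO (c ord0 k) (L2M_bounded mO Lg (measurable_indic mA) (fun x _ => indic_norm_le1 A x)).
  by congr (L2 _ _ _); apply/funext => x; rewrite mxE mulrC.
move: f; apply: (L2_ind mO leO).
- move=> S mS SO.
  have o1 := oscillating_indicator k0 oO OM M0 leO al0 be0 Bell Bmeas Bper Lh Bs_meas (A := A `&` S) (t := t) c.
  have e x : \1_(A `&` S) x *: c = (\1_A x * \1_S x) *: c by rewrite indicI.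
  under eq_fun do rewrite -e; apply: o1; [exact: measurableI|by move=> x [/AO]|by move=> x [/At]].
- move=> a f g Lf Lg of_ og.
  have oP := oscillatingP oO leO al0 be0 Bell Bmeas Lh Bs_meas A0_meas a (LA _ Lf) (LA _ Lg) of_ og.
  have LP := L2vP mO a (LA _ Lf) (LA _ Lg).
  apply: (oscillating_eq oO leO al0 be0 Bell Bmeas Lh A0_meas LP (LA _ (L2P mO a Lf Lg)) _ oP).
  by move=> x _; rewrite scalerA -scalerDl; congr (_ *: _); ring.
- move=> f Lf H; apply: (oscillating_lim oO leO al0 be0 Bell Bmeas Lh A0_meas (LA _ Lf)) => e e0.
  have c0 : 0 < dotv c c + 1 by rewrite ltr_wpDl // dotvv_ge0.
  have [g [Lg og eg]] := H (e / (dotv c c + 1)) ltac:(by rewrite divr_gt0).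
  exists (fun x => (\1_A x * g x) *: c); split => //; first exact: LA.
  have ifg := L2_integrable_sqr (L2B mO Lf Lg).
  apply: (@le_trans _ _ (dotv c c * \int[leb]_(x in O) ((f x - g x) ^+ 2))).
    rewrite -(RintegralZl _ mO ifg); apply: le_Rintegral => //.
    + by apply: ipv_integrable => //; apply: L2vB => //; exact: LA.
    + by apply: eq_integrable (integrableZl mO (dotv c c) ifg).
    + move=> x _; rewrite -scalerBl dotvZl dotvZr -mulrBr mulrCA mulrA -expr2 mulrC ler_wpM2l ?dotvv_ge0 //.
      rewrite exprMn -[leRHS]sqrrN opprB -[leRHS]mul1r ler_wpM2r ?sqr_ge0 //.
  move: eg; rewrite ler_pdivlMr //; have := dotvv_ge0 c.
  have : 0 <= \int[leb]_(x in O) ((f x - g x) ^+ 2) by apply: Rintegral_ge0 => x _; exact: sqr_ge0.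
  by move: (dotv c c) (Rintegral _ _ _) => D I; nra.
Qed.

(** F is split over the values t of sigma and the coordinates k. Duplicates in [s] are removed so
    that each point of [O] is counted in exactly one level set. *)
Lemma oscillating_simple (s : seq R) F : measurable_fun O sigma -> (forall x, O x -> sigma x \in s) ->
  L2v O F -> osc F.
Proof.
move=> ms sv LF.
pose S t := O `&` sigma @^-1` [set t].
have mS t : measurable (S t) by exact: ms.
have L1 t k : L2v O (fun x => (\1_(S t) x * F x ord0 k) *: (delta_mx ord0 k : 'rV[R]_n)).
  move=> j; have := L2Z mO ((delta_mx ord0 k : 'rV[R]_n) ord0 j) (L2M_bounded mO (LF k) (measurable_indic (mS t)) (fun x _ => indic_norm_le1 _ x)).
  by congr (L2 _ _ _); apply/funext => x; rewrite [RHS]mxE mulrC.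
have o1 t k : osc (fun x => (\1_(S t) x * F x ord0 k) *: (delta_mx ord0 k : 'rV[R]_n)).
  by apply: (oscillating_level (t := t)) => // x [].
have o2 t : osc (fun x => \sum_k (\1_(S t) x * F x ord0 k) *: (delta_mx ord0 k : 'rV[R]_n)).
  exact: oscillating_sum.
have L2 t : L2v O (fun x => \sum_k (\1_(S t) x * F x ord0 k) *: (delta_mx ord0 k : 'rV[R]_n)).
  by move=> j; under eq_fun do rewrite summxE; apply: L2_sum => // k _; exact: L1.
have o3 := oscillating_sum (undup s) L2 o2.
have L3 : L2v O (fun x => \sum_(t <- undup s) \sum_k (\1_(S t) x * F x ord0 k) *: (delta_mx ord0 k : 'rV[R]_n)).
  by move=> j; under eq_fun do rewrite summxE; apply: L2_sum => // t _; exact: L2.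
suff E x : O x -> \sum_(t <- undup s) \sum_k (\1_(S t) x * F x ord0 k) *: (delta_mx ord0 k : 'rV[R]_n) = F x.
  exact: (oscillating_eq oO leO al0 be0 Bell Bmeas Lh A0_meas L3 LF E o3).
move=> Ox; rewrite exchange_big /= [RHS]row_sum_delta; apply: eq_bigr => k _.
rewrite -scaler_suml; congr (_ *: _); rewrite -mulr_suml.
rewrite (bigD1_seq (sigma x)) ?undup_uniq ?mem_undup ?sv //= big1; last first.
  by move=> t /eqP ts; rewrite indicE memNset // => -[_] /= /esym.
by rewrite indicE mem_set // addr0 mul1r.
Qed.

End homogenization_simple.

(** * Rounding a measurable function to finitely many values *)

Section simple_approximation.
Context {R : realType} d (T : measurableType d).
Implicit Types (D : set T) (f g sigma : T -> R).

Lemma measurable_approx D f :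
  (forall dl : R, 0 < dl -> exists2 g : T -> R, measurable_fun D g & forall x, D x -> `|f x - g x| <= dl) ->
  measurable_fun D f.
Proof.
move=> H; have /choice[g gP] : forall m : nat, exists g : T -> R, measurable_fun D g /\ forall x, D x -> `|f x - g x| <= m.+1%:R^-1.
  by move=> m; have [g mg hg] := H m.+1%:R^-1 ltac:(by rewrite invr_gt0); exists g.
apply: (measurable_fun_cvg (h := g)) => [m|x Dx]; first exact: (gP m).1.
apply/cvgrPdist_le => e e0; near=> m.
apply: le_trans ((gP m).2 x Dx) _; apply: ltW; near: m; exact: near_infty_natSinv_lt (PosNum e0).
Unshelve. all: by end_near. Qed.

Lemma measurable_comp_finite D sigma (s : seq R) (G : R -> T -> R) : measurable D -> measurable_fun D sigma ->
  (forall x, D x -> sigma x \in s) -> (forall t, measurable_fun D (G t)) -> measurable_fun D (fun x => G (sigma x) x).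
Proof.
move=> mD ms sv mG; pose S t := D `&` sigma @^-1` [set t].
have mS t : measurable (S t) by exact: ms.
apply: (eq_measurable_fun (fun x => \sum_(t <- undup s) \1_(S t) x * G t x)) => [x|].
  rewrite inE => Dx; rewrite (bigD1_seq (sigma x)) ?undup_uniq ?mem_undup ?sv //= big1.
    by rewrite indicE mem_set // addr0 mul1r.
  by move=> t /eqP ts; rewrite indicE memNset ?mul0r // => -[_] /= /esym.
apply: measurable_sum => t; apply: measurable_funM => //; exact: measurable_indic.
Qed.

Variables (a b : R) (D : set T) (sigma : T -> R).
Hypothesis ms : measurable_fun D sigma.
Hypothesis sab : forall x, D x -> a <= sigma x <= b.

Definition round_down (dl : R) x : R := a + dl * (Num.truncn ((sigma x - a) / dl))%:R.

Lemma round_down_close dl x : 0 < dl -> D x -> `|sigma x - round_down dl x| <= dl.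
Proof.
move=> d0 Dx; have /andP[h1 h2] := sab Dx.
have p : 0 <= (sigma x - a) / dl by rewrite divr_ge0 ?(ltW d0) // subr_ge0.
have /andP[t1 t2] := truncn_itv p; rewrite ler_pdivlMr // in t1; rewrite ltr_pdivrMr // -natr1 in t2.
by rewrite /round_down ger0_norm; lra.
Qed.

Lemma round_down_measurable dl : 0 < dl -> measurable_fun D (round_down dl).
Proof.
move=> d0; apply: measurable_funD => //; apply: measurable_funM => //.
have mf : measurable_fun setT (fun y : measurableTypeR R => ((Num.truncn ((y - a) / dl))%:R : R)).
  apply: nondecreasing_measurable => // x y xy; rewrite ler_nat; apply: le_truncn.
  by rewrite ler_wpM2r ?invr_ge0 ?(ltW d0) // lerD2r.
exact: (measurableT_comp mf ms).
Qed.

Lemma round_down_finite dl : 0 < dl -> exists s : seq R, forall x, D x -> round_down dl x \in s.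
Proof.
move=> d0; exists [seq a + dl * k%:R | k <- iota 0 (Num.truncn ((b - a) / dl)).+1] => x Dx.
have /andP[h1 h2] := sab Dx.
apply/mapP; exists (Num.truncn ((sigma x - a) / dl)) => //; rewrite mem_iota /= add0n ltnS.
by apply: le_truncn; rewrite ler_wpM2r ?invr_ge0 ?(ltW d0) // lerD2r.
Qed.

End simple_approximation.

Section homogenization.
Context {R : realType} {n : nat}.
Local Notation T := 'rV[R]_n.
Local Notation leb := (@lebesgue_rV R n).
Local Notation Y := (@unit_cube R n).
Variables (O : set T) (M : R) (k0 : 'I_n).
Hypothesis oO : open O.
Hypothesis OM : O `<=` box n M.
Hypothesis M0 : 0 < M.
Hypothesis leO : (leb O < +oo)%E.
Variables (al be : R).
Hypothesis al0 : 0 < al.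
Hypothesis be0 : 0 <= be.
Variable B : R -> T -> 'M[R]_n.
Hypothesis Bell : forall t y, elliptic al be (B t y).
Hypothesis Bmeas : forall t i j, measurable_fun setT (fun y => B t y i j).
Hypothesis Bper : forall t, cell_periodic (B t).
Variable Lp : R.
Hypothesis Lp0 : 0 <= Lp.
Hypothesis BLip : forall s t y i j, `|B s y i j - B t y i j| <= Lp * `|s - t|.

Local Notation A0 t := (homogenized (B t)).

Let mO : measurable O := open_measurable_rV oO.
(** A Lipschitz constant in t valid both for the tensor and for its homogenization, the factor n be
    / al being the loss in [homogenized_lipschitz]. *)
Let L0 := Lp * (1 + n%:R * (be / al)).

Let L00 : 0 <= L0.
Proof. by rewrite mulr_ge0 // addr_ge0 // mulr_ge0 // divr_ge0 // ltW. Qed.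

Let LpL0 : Lp <= L0.
Proof. by rewrite ler_peMr // lerDl mulr_ge0 // divr_ge0 // ltW. Qed.

Lemma homogenized_Lipschitz s t i j : `|A0 s i j - A0 t i j| <= L0 * `|s - t|.
Proof.
have c0 : 0 <= Lp * `|s - t| by rewrite mulr_ge0.
apply: le_trans (homogenized_lipschitz al0 be0 (Bcell (Bell s) (Bmeas s)) (Bcell (Bell t) (Bmeas t)) c0 (fun y i j _ => BLip s t y i j) i j) _.
rewrite (_ : _ * _ * _ = Lp * (n%:R * (be / al)) * `|s - t|); last by ring.
by rewrite ler_wpM2r // ler_wpM2l // lerDr.
Qed.

Variables (a b : R).

Section measurability.
Variable sigma : T -> R.
Hypothesis ms : measurable_fun O sigma.
Hypothesis sab : forall x, O x -> a <= sigma x <= b.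

(** Rounding sigma down to a finite grid gives measurable compositions, and the Lipschitz bound
    makes them converge uniformly as the grid is refined. *)
Lemma measurable_comp_lipschitz (G : R -> T -> R) (L : R) : 0 <= L -> (forall t, measurable_fun O (G t)) ->
  (forall s t x, `|G s x - G t x| <= L * `|s - t|) -> measurable_fun O (fun x => G (sigma x) x).
Proof.
move=> L00' mG GL; apply: measurable_approx => dl dl0.
have l1 : 0 < L + 1 by rewrite ltr_wpDl.
have d0 : 0 < dl / (L + 1) by rewrite divr_gt0.
have [s sv] := round_down_finite sab d0.
exists (fun x => G (round_down a sigma (dl / (L + 1)) x) x).
  exact: (measurable_comp_finite mO (round_down_measurable a ms d0) sv).
move=> x Ox; apply: (le_trans (GL _ _ _)).
apply: (@le_trans _ _ (L * (dl / (L + 1)))); first by rewrite ler_wpM2l // (round_down_close sab).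
by rewrite mulrCA ler_piMr ?(ltW dl0) // ler_pdivrMr // mul1r lerDl.
Qed.

Lemma measurable_fine eps i j : measurable_fun O (fun x => B (sigma x) (eps^-1 *: x) i j).
Proof.
apply: (measurable_comp_lipschitz (G := fun t x => B t (eps^-1 *: x) i j) Lp0) => [t|s t x]; last exact: BLip.
exact: (measurableT_comp (Bmeas t i j) (@measurable_scale _ _ eps^-1 O)).
Qed.

Lemma measurable_effective i j : measurable_fun O (fun x => A0 (sigma x) i j).
Proof.
apply: (measurable_comp_lipschitz (G := fun t x => A0 t i j) L00) => // s t x; exact: homogenized_Lipschitz.
Qed.

End measurability.

Variables (sigma : T -> R) (G h : T -> 'rV[R]_n).
Hypothesis ms : measurable_fun O sigma.
Hypothesis sab : forall x, O x -> a <= sigma x <= b.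
Hypothesis LG : L2v O G.
Hypothesis Lh : L2v O h.
Hypothesis weak_sol_exists : forall C, tfield O al be C -> exists F, weak_sol O C G F.

Let sqr_chain (x y z w k e : R) : (x - y) ^+ 2 <= k -> (y - z) ^+ 2 <= e / 6 -> (w - z) ^+ 2 <= k ->
  12 * k <= e -> (x - w) ^+ 2 <= e.
Proof.
move=> h1 h2 h3 h4; have := sqrD3_le (x - y) (y - z) (z - w).
rewrite (_ : x - y + (y - z) + (z - w) = x - w); last by ring.
rewrite (_ : (z - w) ^+ 2 = (w - z) ^+ 2); last by ring.
move: h1 h2 h3; move: ((x - y) ^+ 2) ((y - z) ^+ 2) ((w - z) ^+ 2) => a1 a2 a3; lra.
Qed.

Let small_square (k d e : R) : 0 <= k -> 0 < d -> d <= 1 -> d * (12 * k + 1) <= e -> 12 * (k * d ^+ 2) <= e.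
Proof.
move=> k0' d0 d1; have d2 : d ^+ 2 <= d by rewrite expr2 ler_piMr // ltW.
by have := ler_wpM2l k0' d2; lra.
Qed.

(** Replacing sigma by its rounding [tau] costs O (dl) at the fine scale, uniformly in eps, and in
    the limit, by [weak_sol_stability]. As [tau] takes finitely many values, every L^2 field is
    oscillating for it. *)
Lemma homogenization F0 (F : R -> T -> 'rV[R]_n) :
  weak_sol O (fun x => A0 (sigma x)) G F0 ->
  (forall eps, 0 < eps -> weak_sol O (fun x => B (sigma x) (eps^-1 *: x)) G (F eps)) ->
  forall e : R, 0 < e -> \forall eps \near (0 : R)^'+,
  (ipv O (fun x => mxv (B (sigma x) (eps^-1 *: x)) (F eps x)) h - ipv O (fun x => mxv (A0 (sigma x)) (F0 x)) h) ^+ 2 <= e.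
Proof.
move=> s0 sF e e0; have [C C0 HC] := weak_sol_stability oO leO al0 be0 LG Lh.
pose K := C * L0 ^+ 2; have K0 : 0 <= K by rewrite mulr_ge0 // sqr_ge0.
(* Ensures 12 C (L0 dl) ^ 2 <= e: of three differences, squared and weighted by 3, the two rounding
   errors use e / 2 and the error for [tau] the other half. *)
pose dl := Num.min 1 (e / (12 * K + 1)).
have c0 : 0 < 12 * K + 1 by rewrite ltr_wpDl // mulr_ge0.
have dl0 : 0 < dl by rewrite lt_min ltr01 divr_gt0.
have dl1 : dl <= 1 by rewrite ge_min lexx.
have dlK : 12 * (C * (L0 * dl) ^+ 2) <= e.
  have : dl * (12 * K + 1) <= e by rewrite -ler_pdivlMr // ge_min lexx orbT.
  by rewrite exprMn [C * _]mulrA; exact: (small_square K0 dl0 dl1).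
pose tau := round_down a sigma dl.
have mt : measurable_fun O tau by exact: round_down_measurable.
have [s sv] := round_down_finite sab dl0.
have tab x : O x -> a <= tau x <= b.
  move=> Ox; have /andP[h1 h2] := sab Ox.
  have p : 0 <= (sigma x - a) / dl by rewrite divr_ge0 ?(ltW dl0) // subr_ge0.
  have /andP[t1 _] := truncn_itv p; rewrite ler_pdivlMr // mulrC in t1.
  have t0 : 0 <= dl * (Num.truncn ((sigma x - a) / dl))%:R by rewrite mulr_ge0 // ltW.
  by rewrite /tau /round_down; apply/andP; split; lra.
have close x : O x -> `|sigma x - tau x| <= dl by move=> Ox; exact: (round_down_close sab dl0 Ox).
have mBt := measurable_fine mt tab; have mAt := measurable_effective mt tab.
have mBs := measurable_fine ms sab; have mAs := measurable_effective ms sab.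
have tA : tfield O al be (fun x => A0 (sigma x)) by exact: (tfield_effective al0 be0 Bell Bmeas mAs).
have tAt : tfield O al be (fun x => A0 (tau x)) by exact: (tfield_effective al0 be0 Bell Bmeas mAt).
have tB eps : tfield O al be (fun x => B (sigma x) (eps^-1 *: x)) by split => //; exact: mBs.
have tBt eps : tfield O al be (fun x => B (tau x) (eps^-1 *: x)) by split => //; exact: mBt.
have [H0 sH0] := weak_sol_exists tAt.
have /choice[H sH] : forall eps, exists H, weak_sol O (fun x => B (tau x) (eps^-1 *: x)) G H.
  by move=> eps; exact: (weak_sol_exists (tBt eps)).
have e6 : 0 < e / 6 by rewrite divr_gt0.
have osc := oscillating_simple k0 oO OM M0 leO al0 be0 Bell Bmeas Bper Lh mBt mAt mt sv (let: And3 L _ _ := sH0 in L).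
have near_t := homogenization_of_oscillating oO leO al0 be0 Bell Bmeas Lh mBt mAt sH0 (fun eps _ => sH eps) osc e6.
have Ld0 : 0 <= L0 * dl by rewrite mulr_ge0 // ltW.
have S0 : (ipv O (fun x => mxv (A0 (sigma x)) (F0 x)) h - ipv O (fun x => mxv (A0 (tau x)) (H0 x)) h) ^+ 2 <= C * (L0 * dl) ^+ 2.
  apply: (HC _ _ _ _ (L0 * dl) tA tAt s0 sH0 Ld0) => x i j Ox.
  apply: (le_trans (homogenized_Lipschitz _ _ i j)); rewrite ler_wpM2l //; exact: close.
near=> eps.
have eps0 : 0 < eps by near: eps; exact: nbhs_right_gt.
have ht : (ipv O (fun x => mxv (B (tau x) (eps^-1 *: x)) (H eps x)) h - ipv O (fun x => mxv (A0 (tau x)) (H0 x)) h) ^+ 2 <= e / 6.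
  by near: eps; exact: near_t.
have S1 : (ipv O (fun x => mxv (B (sigma x) (eps^-1 *: x)) (F eps x)) h - ipv O (fun x => mxv (B (tau x) (eps^-1 *: x)) (H eps x)) h) ^+ 2 <= C * (L0 * dl) ^+ 2.
  apply: (HC _ _ _ _ (L0 * dl) (tB eps) (tBt eps) (sF _ eps0) (sH eps) Ld0) => x i j Ox.
  by apply: (le_trans (BLip _ _ _ i j)); apply: ler_pM LpL0 _ => //; exact: close.
exact: (sqr_chain S1 ht S0 dlK).
Unshelve. all: by end_near. Qed.

End homogenization.

(** * Regularity of the tensor in t *)

Section positive_open.
Context {R : realType} {n : nat}.
Local Notation T := 'rV[R]_n.
Local Notation leb := (@lebesgue_rV R n).

Lemma leb_open_gt0 (U : set T) x : open U -> U x -> (0 < leb U)%E.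
Proof.
move=> oU Ux; have [p px pU] := qbox_nbhs oU Ux.
have mq := @measurable_qbox R n p.
have qU : qbox p `<=` U by move=> y yq; apply: pU => k; exact: ltW (yq k).
suff h : (0 < leb (qbox p))%E.
  exact: lt_le_trans h (le_measure leb (mem_set mq) (mem_set (open_measurable_rV oU)) qU).
pose r : R := p.2.+1%:R^-1; have r0 : 0 < r by rewrite invr_gt0.
pose v : T := \row_k ratr (p.1 ord0 k).
have H := ge0_integral_affine v ltr01 (f := fun x => (\1_(qbox p) x)%:E)
  ltac:(by apply/measurable_EFinP; exact: measurable_indic) (fun x => ltac:(by rewrite lee_fin)).
rewrite expr1n mul1e in H.
have -> : leb (qbox p) = (\int[leb]_x (\1_(qbox p) x)%:E)%E by rewrite integral_indic // setIT.
rewrite H.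
have -> : (\int[leb]_x (\1_(qbox p) (1 *: x + v))%:E = \int[leb]_x (\1_(pbox n `]- r, r[%classic) x)%:E)%E.
  apply: eq_integral => x' _; congr EFin; rewrite !indicE; congr (_%:R); congr nat_of_bool.
  apply/idP/idP => /set_mem H'; apply/mem_set => k.
    by rewrite /= in_itv /= -ltr_norml; have := H' k; rewrite !mxE mul1r addrK.
  by have := H' k; rewrite /= in_itv /= -ltr_norml !mxE mul1r addrK.
rewrite integral_indic //; last exact: measurable_pbox.
have E : leb (pbox n `]- r, r[%classic) = ((2 * r) ^+ n)%:E by apply: leb_pbox => //; exact: lebesgue_measure_ooN.
apply: (@lt_le_trans _ _ ((2 * r) ^+ n)%:E); first by rewrite lte_fin exprn_gt0 // mulr_gt0.
by rewrite setIT -E.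
Qed.

(** A continuous function negative at one point is so on a nonempty open set, which has positive
    measure. *)
Lemma continuous_ae_ge0 (D : set T) (f : T -> R) : open D -> (forall x, D x -> {for x, continuous f}) ->
  {ae leb, forall x, D x -> 0 <= f x} -> forall x, D x -> 0 <= f x.
Proof.
move=> oD cf [N [mN N0 HN]] x Dx; rewrite leNgt; apply/negP => fx.
have near_x : \forall y \near x, D y /\ f y < 0.
  apply: filterI; first exact: oD.
  by have /cvgr_lt := cf x Dx; apply.
have [U [oU Ux UD]] : exists U : set T, [/\ open U, U x & forall y, U y -> D y /\ f y < 0].
  exists (interior [set y | D y /\ f y < 0]); split; [exact: open_interior|exact: near_x|exact: interior_subset].
have UN : U `<=` N by move=> y /UD[Dy fy]; apply: HN => /= /(_ Dy); rewrite leNgt fy.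
have := leb_open_gt0 oU Ux.
have := le_measure leb (mem_set (open_measurable_rV oU)) (mem_set mN) UN.
by rewrite [X in (_ <= X)%E]N0 => H1 H2; have := lt_le_trans H2 H1; rewrite ltxx.
Qed.

Lemma bump_gt0 (a c : 'I_n -> R) m (x : T) : (forall k, a k < x ord0 k < c k) -> 0 < bump a c m x.
Proof.
move=> H; have f0 (s : R) : 0 < s -> 0 < flat 0 s by move=> s0; rewrite /flat s0 expr0 invr1 mul1r expR_gt0.
apply: prodr_gt0 => k _; have /andP[h1 h2] := H k; apply: mulr_gt0; apply: f0.
  by rewrite subr_gt0 ltr_pM2l.
by rewrite mulNr addrC subr_gt0 ltr_pM2l.
Qed.

Lemma Rintegral_gt0 (f : T -> R) (x : T) : continuous f -> leb.-integrable setT (EFin \o f) -> (forall y, 0 <= f y) ->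
  0 < f x -> 0 < \int[leb]_y f y.
Proof.
move=> cf fi f0 fx; pose U := [set y | f x / 2 < f y].
have oU : open U.
  rewrite (_ : U = f @^-1` [set s | f x / 2 < s]) //.
  by apply: open_comp; [move=> y _; exact: cf|exact: open_gt].
have Ux : U x by rewrite /U /=; lra.
have mU := open_measurable_rV oU.
rewrite -lte_fin -(integrable_EFin_Rintegral measurableT fi).
apply: (@lt_le_trans _ _ ((f x / 2)%:E * leb U)%E).
  by rewrite mule_gt0 ?lte_fin ?divr_gt0 //; exact: leb_open_gt0 Ux.
rewrite -[U in leb U]setIT -integral_indic // -ge0_integralZl_EFin //; last 2 first.
- by apply/measurable_EFinP; exact: measurable_indic.
- by rewrite divr_ge0 // ltW.
apply: ge0_integral_le => y _; first by rewrite lee_fin mulr_ge0 // divr_ge0 // ltW.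
rewrite -EFinM lee_fin indicE; case: (pselect (U y)) => Uy; last by rewrite memNset // mulr0.
by rewrite mem_set // mulr1; exact: ltW.
Qed.

End positive_open.

(** * Lipschitz bounds from bounded weak derivatives *)

Section weak_lipschitz.
Context {R : realType} {n : nat}.
Local Notation T := 'rV[R]_n.
Local Notation leb := (@lebesgue_rV R n).
Implicit Types (f g phi : T -> R) (x : T) (k : 'I_n).

Local Notation e_ k := (delta_mx ord0 k : T).

(** The mean value theorem twice along the line: the error is s c times a second derivative, with
    |c| <= |s|. *)
Lemma smooth_taylor phi (K : R) k : smooth phi -> coord_bounded K phi -> exists2 C : R, 0 <= C &
  forall x (s : R), `|phi (x + s *: e_ k) - phi x - s * pderiv k phi x| <= C * s ^+ 2.
Proof.
move=> sp pK; have sk := smooth_pderiv k sp.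
have [C HC] := coord_bounded_bounded (smooth_continuous (smooth_pderiv k sk)) (coord_bounded_pderiv k (coord_bounded_pderiv k pK)).
have C0 : 0 <= C by apply: le_trans (HC 0).
exists C => // x s.
have mvt g (s' : R) : smooth g -> exists2 c : R, `|c| <= `|s'| & g (x + s' *: e_ k) - g x = pderiv k g (x + c *: e_ k) * s'.
  move=> sg; pose F t := g (x + t *: e_ k).
  have dF (t : R) : is_derive t 1 F (pderiv k g (x + t *: e_ k)).
    have dg : derivable g (x + t *: e_ k) (e_ k) by apply: diff_pderivable; exact: smooth_diff.
    have E : (fun h : R => h^-1 *: ((F \o shift t) (h *: (1 : R)) - F t)) =
      (fun h => h^-1 *: ((g \o shift (x + t *: e_ k)) (h *: e_ k) - g (x + t *: e_ k))).
      apply/funext => h /=; rewrite [h *: (1 : R)]mulr1 /F scalerDl.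
      by rewrite addrCA.
    split; first by rewrite /derivable E; exact: dg.
    by rewrite /derive E.
  have cF (a b : R) : {within `[a, b], continuous F}.
    apply: continuous_subspaceT => t; have [d _] := dF t.
    by apply: differentiable_continuous; exact/derivable1_diffP.
  have F0 : F 0 = g x by rewrite /F scale0r addr0.
  case: (leP 0 s') => s0.
    have [c] := MVT_segment s0 (fun t _ => dF t) (cF 0 s').
    rewrite in_itv /= => /andP[c1 c2] E; exists c; first by rewrite !ger0_norm.
    by rewrite -F0 -[g _]/(F s') E subr0.
  have [c] := MVT_segment (ltW s0) (fun t _ => dF t) (cF s' 0).
  rewrite in_itv /= => /andP[c1 c2] E; exists c; first by rewrite !ler0_norm ?lerN2 // ltW.
  by rewrite -F0 -[g _]/(F s') -opprB E sub0r mulrN opprK.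
have [c cs ->] := mvt _ s sp; have [c2 _ E] := mvt _ c sk.
rewrite mulrC -mulrBr E normrM normrM mulrCA -(real_normK (num_real s)) expr2.
apply: ler_pM => //; exact: ler_wpM2l.
Qed.

(* Telescope over N equal steps; the second-order errors add up to O(1 / N). *)
Lemma le_of_second_order (G : R -> R) (h K D : R) : 0 <= h -> 0 <= D ->
  (forall s t, 0 <= s <= h -> 0 <= t <= h -> `|G t - G s| <= K * `|t - s| + D * (t - s) ^+ 2) ->
  `|G h - G 0| <= K * h.
Proof.
move=> h0 D0 H; apply/ler_addgt0Pr => e e0.
pose N := (Num.truncn (D * h ^+ 2 / e)).+1; pose d := h / N%:R.
have N0 : 0 < N%:R :> R by rewrite ltr0n.
have dN : d * N%:R = h by rewrite divfK // gt_eqF.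
have d0 : 0 <= d by rewrite divr_ge0 // ltW.
have t_in i : (i <= N)%N -> 0 <= d * i%:R <= h.
  by move=> iN; rewrite mulr_ge0 //= -dN ler_wpM2l // ler_nat.
have -> : G h - G 0 = \sum_(0 <= i < N) (G (d * i.+1%:R) - G (d * i%:R)).
  by rewrite (telescope_sumr (fun i => G (d * i%:R))) // dN mulr0.
apply: (le_trans (ler_norm_sum _ _ _)).
apply: (@le_trans _ _ (\sum_(0 <= i < N) (K * d + D * d ^+ 2))).
  rewrite big_nat [leRHS]big_nat; apply: ler_sum => i /andP[_ iN].
  apply: (le_trans (H _ _ (t_in _ (ltnW iN)) (t_in _ iN))).
  by rewrite -mulrBr -natr1 addrAC subrr add0r mulr1 ger0_norm.
rewrite sumr_const_nat subn0 -[leLHS]mulr_natl.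
have -> : N%:R * (K * d + D * d ^+ 2) = K * h + D * h ^+ 2 / N%:R by rewrite /d; field; rewrite gt_eqF.
rewrite lerD2l ler_pdivrMr // [leRHS]mulrC -ler_pdivrMr //.
by apply: ltW; exact: truncnS_gt.
Qed.

(** To be read with [m] the mass of a bump, [g0] and [gh] the averages near the two endpoints, and
    [b] and [a] the point values there. *)
Lemma mean_difference_le (a b g0 gh m e w : R) : 0 < m -> `|gh - g0| <= e * m ->
  `|g0 - b * m| <= w / 2 * m -> `|gh - a * m| <= w / 2 * m -> `|a - b| <= e + w.
Proof.
move=> m0; rewrite -(ler_pM2r m0 `|a - b|) -[X in _ * X <= (e + w) * m](gtr0_norm m0) -normrM.
rewrite !ler_norml => /andP[h1 h2] /andP[h3 h4] /andP[h5 h6].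
by apply/andP; split; lra.
Qed.

Lemma normr_Rintegral_le (D : set T) f g : measurable D -> leb.-integrable D (EFin \o f) ->
  leb.-integrable D (EFin \o g) -> (forall x, D x -> `|f x| <= g x) ->
  `|\int[leb]_(x in D) f x| <= \int[leb]_(x in D) g x.
Proof.
move=> mD fi gi fg; rewrite ler_norml; apply/andP; split; last first.
  by apply: le_Rintegral => // x /fg; apply: le_trans; exact: ler_norm.
have ni : leb.-integrable D (EFin \o (fun x => -1 * g x)) by apply: eq_integrable (integrableZl mD (-1) gi).
rewrite -mulN1r -(RintegralZl (-1) mD gi); apply: le_Rintegral => // x /fg.
by rewrite ler_norml mulN1r => /andP[].
Qed.

(* Average f against a bump concentrated near z0 and translate the bump along
   e_k: the weak derivative controls the increments up to second order. *)
Lemma weak_lipschitz (Q : set T) f g k (E r0 h : R) (z0 : T) : open Q -> (leb Q < +oo)%E ->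
  (forall x, Q x -> {for x, continuous f}) -> 0 <= E -> ess_le Q f E -> weak_pderiv Q k f g -> ess_le Q g E ->
  0 <= h -> 0 < r0 -> (forall x t, (forall i, `|x ord0 i - z0 ord0 i| <= r0) -> 0 <= t <= h -> Q (x + t *: e_ k)) ->
  `|f (z0 + h *: e_ k) - f z0| <= E * h.
Proof.
move=> oQ lQ cf E0 [mf fE] wf [mg gE] h0 r00 HQ.
have mQ := open_measurable_rV oQ.
have fb x : Q x -> `|f x| <= E.
  move=> Qx; rewrite -subr_ge0; apply: (continuous_ae_ge0 oQ (f := fun x => E - `|f x|) _ _ Qx) => [y Qy|].
    apply: continuousB; first exact: cst_continuous.
    by apply: continuous_comp; [exact: cf|exact: norm_continuous].
  by apply: filterS fE => y H /H; rewrite subr_ge0.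
have Lf : L2 leb Q f by exact: (L2_bounded mQ lQ mf fb).
(* [g] is bounded by E only almost everywhere; the truncation is bounded everywhere and gives the
   same integrals. *)
pose g' x := Num.max (- E) (Num.min E (g x)).
have g'b x : `|g' x| <= E by rewrite /g' ler_norml le_max lexx /= ge_max ge_min lexx /= andbT; lra.
have mg' : measurable_fun Q g' by apply: measurable_maxr => //; exact: measurable_minr.
have Lg' : L2 leb Q g' by apply: (L2_bounded mQ lQ mg') => x _; exact: g'b.
have gg' (phi : T -> R) : \int[leb]_(x in Q) (g x * phi x) = \int[leb]_(x in Q) (g' x * phi x).
  apply: Rintegral_eq_ae; apply: filterS gE => x H /H; rewrite ler_norml /g' => /andP[h1 h2].
  by rewrite (min_idPr h2) (max_idPr h1).
apply/ler_addgt0Pr => w w0.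
have z0Q t : 0 <= t <= h -> Q (z0 + t *: e_ k).
  by move=> th; apply: HQ => // i; rewrite subrr normr0 ltW.
have near_r (t : R) : 0 <= t <= h -> exists2 r : R, 0 < r <= r0 & forall x, (forall i, `|x ord0 i - z0 ord0 i| < r) ->
    `|f (x + t *: e_ k) - f (z0 + t *: e_ k)| <= w / 2.
  move=> th; have w2 : 0 < w / 2 by rewrite divr_gt0.
  have /cvgrPdist_le /(_ _ w2) /nbhs_ballP[rho /= rho0 Hr] := cf _ (z0Q t th).
  exists (Num.min rho r0); first by rewrite lt_min rho0 r00 ge_min lexx orbT.
  move=> x Hx; rewrite distrC; apply: Hr; split => // i j; rewrite (ord1 i) -ball_normE /= !mxE.
  rewrite opprD addrACA subrr addr0 distrC; apply: lt_le_trans (Hx j) _; by rewrite ge_min lexx.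
have h00 : 0 <= (0 : R) <= h by rewrite h0 andbT.
have hh : 0 <= h <= h by rewrite h0 /=.
have [r1 /andP[r10 r1r] H1] := near_r 0 h00; have [r2 /andP[r20 r2r] H2] := near_r h hh.
pose r := Num.min r1 r2.
have r_gt0 : 0 < r by rewrite lt_min r10.
have rr0 : r <= r0 by rewrite ge_min r1r.
pose phi := bump (fun i => z0 ord0 i - r) (fun i => z0 ord0 i + r) 0.
have sphi : smooth phi by exact: smooth_bump.
have phi0 x : 0 <= phi x by exact: bump_ge0.
have phi_out x : ~ (forall i, `|x ord0 i - z0 ord0 i| < r) -> phi x = 0.
  move=> /existsNP[i Hi]; apply: (@bump_out _ _ _ _ _ _ i) => H; apply: Hi.
  by rewrite ltr_norml ltrBrDl ltrBlDl; move: H => /andP[h1 h2]; apply/andP; split; lra.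
(* The bump translated by t along e_k. Its derivative in t is minus its k-th partial derivative,
   which the weak derivative transfers to f. *)
pose psi t x := phi (x + (- t) *: e_ k).
have tpsi t : 0 <= t <= h -> test_function Q (psi t).
  move=> th; split; first exact: smooth_shift.
  exists [set x : T | forall i, `[z0 ord0 i + t * (e_ k) ord0 i - r, z0 ord0 i + t * (e_ k) ord0 i + r]%classic (x ord0 i)].
    exact: (@rV_compact R n (fun i => `[z0 ord0 i + t * (e_ k) ord0 i - r, z0 ord0 i + t * (e_ k) ord0 i + r]%classic) (fun=> @segment_compact R _ _)).
  split => x Hx.
    have -> : x = (x + (- t) *: e_ k) + t *: e_ k by rewrite scaleNr subrK.
    apply: HQ => // i; apply: le_trans rr0; have := Hx i; rewrite /= in_itv /= => /andP[h1 h2].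
    rewrite !mxE ler_norml; rewrite !mxE in h1 h2; apply/andP; split; lra.
  apply: phi_out => H; apply: Hx => i; have := H i; rewrite /= in_itv /= ltr_norml !mxE => /andP[h1 h2].
  by apply/andP; split; lra.
have psi0 : psi 0 = phi by apply/funext => x; rewrite /psi oppr0 scale0r addr0.
have [K K0 pK] : exists2 K : R, 0 < K & coord_bounded K phi.
  by rewrite -psi0; exact: (test_function_coord_bounded (tpsi 0 h00)).
have [C C0 HC] := smooth_taylor k sphi pK.
pose m := \int[leb]_x phi x.
have iphi : leb.-integrable setT (EFin \o phi) := continuous_cb_integrable (smooth_continuous sphi) pK.
have m0 : 0 < m.
  apply: (@Rintegral_gt0 _ _ _ z0) => //; first exact: smooth_continuous.
  by apply: bump_gt0 => i; apply/andP; split; lra.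
have psim t : 0 <= t <= h -> \int[leb]_(x in Q) psi t x = m.
  move=> th; have out x : ~ Q x -> psi t x = 0 by exact: test_function_out (tpsi t th).
  rewrite (Rintegral_restrict out) /m (Rintegral_affine ((- t) *: e_ k) ltr01 iphi) expr1n mul1r.
  by apply: eq_Rintegral => x _; rewrite scale1r.
have Lpsi t : 0 <= t <= h -> L2 leb Q (psi t) by move=> th; exact: (test_function_L2' mQ lQ (tpsi t th)).
pose G t := \int[leb]_(x in Q) (f x * psi t x).
have HG : `|G h - G 0| <= E * m * h.
  pose D := E * C * fine (leb Q).
  apply: (le_of_second_order (D := D)) => // [|s t sh th].
    by rewrite !mulr_ge0 // fine_ge0.
  have LPs := Lpsi s sh; have LPt := Lpsi t th.
  have Lk := test_function_L2' mQ lQ (test_function_pderiv k (tpsi s sh)).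
  pose err x := psi t x - psi s x + (t - s) * pderiv k (psi s) x.
  have Lerr : L2 leb Q err by apply: L2D => //; [exact: L2B|exact: L2Z].
  have i0 := L2M_integrable mQ Lf Lerr; have i1 := L2M_integrable mQ Lf Lk; have i2 := L2M_integrable mQ Lg' LPs.
  have it := L2M_integrable mQ Lf LPt; have is_ := L2M_integrable mQ Lf LPs.
  have EG : G t - G s = \int[leb]_(x in Q) (f x * err x) + (t - s) * \int[leb]_(x in Q) (g' x * psi s x).
    have -> : \int[leb]_(x in Q) (g' x * psi s x) = - \int[leb]_(x in Q) (f x * pderiv k (psi s) x).
      by rewrite (wf _ (tpsi s sh)) opprK gg'.
    rewrite mulrN -(RintegralZl _ mQ i1).
    have j1 : leb.-integrable Q (EFin \o (fun x => (t - s) * (f x * pderiv k (psi s) x))).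
      by apply: eq_integrable (integrableZl mQ (t - s) i1).
    rewrite -RintegralB // /G -RintegralB //; apply: eq_Rintegral => x _; rewrite /err; ring.
  have errb x : `|err x| <= C * (t - s) ^+ 2.
    have e : x + (- s) *: e_ k + (- (t - s)) *: e_ k = x + (- t) *: e_ k.
      by rewrite -addrA -scalerDl; congr (_ + _ *: _); ring.
    by have := HC (x + (- s) *: e_ k) (- (t - s)); rewrite sqrrN mulNr opprK e /err /psi pderiv_shift.
  have cQ (c : R) : leb.-integrable Q (EFin \o (fun=> c)) by apply: L2_integrable => //; exact: L2_cst.
  rewrite EG; apply: (le_trans (ler_normD _ _)); rewrite addrC; apply: lerD; last first.
    have -> : D * (t - s) ^+ 2 = \int[leb]_(x in Q) (E * (C * (t - s) ^+ 2)) by rewrite Rintegral_cst // /D; ring.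
    apply: normr_Rintegral_le => // x Qx; rewrite normrM; apply: ler_pM => //; exact: fb.
  rewrite normrM mulrC ler_wpM2r // -(psim s sh) -(RintegralZl _ mQ (L2_integrable mQ lQ LPs)).
  apply: normr_Rintegral_le => // [|x Qx].
    by apply: eq_integrable (integrableZl mQ E (L2_integrable mQ lQ LPs)).
  by rewrite normrM (ger0_norm (phi0 _)) ler_wpM2r.
have GV t (v : R) : 0 <= t <= h -> (forall x, (forall i, `|x ord0 i - z0 ord0 i| < r) -> `|f (x + t *: e_ k) - v| <= w / 2) ->
    `|G t - v * m| <= w / 2 * m.
  move=> th Hv; have LPt := Lpsi t th; have ip := L2_integrable mQ lQ LPt; have it := L2M_integrable mQ Lf LPt.
  have jz (c : R) : leb.-integrable Q (EFin \o (fun x => c * psi t x)).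
    by apply: eq_integrable (integrableZl mQ c ip).
  have e c : c * m = \int[leb]_(x in Q) (c * psi t x) by rewrite -(psim t th) (RintegralZl _ mQ ip).
  rewrite !e /G -(RintegralB mQ it (jz v)).
  apply: (normr_Rintegral_le mQ _ (jz (w / 2))).
  - have := integrableB mQ it (jz v); exact: eq_integrable.
  - move=> x Qx; rewrite -mulrBl normrM (ger0_norm (phi0 _)).
    case: (pselect (forall i, `|(x + (- t) *: e_ k) ord0 i - z0 ord0 i| < r)) => H.
      rewrite ler_wpM2r //; have := Hv _ H; by rewrite scaleNr subrK.
    by rewrite /psi phi_out // !mulr0.
have rl : r <= r1 by rewrite ge_min lexx.
have rr : r <= r2 by rewrite ge_min lexx orbT.
have V0 := GV 0 (f (z0 + 0 *: e_ k)) h00 (fun x Hx => H1 x (fun i => lt_le_trans (Hx i) rl)).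
have Vh := GV h (f (z0 + h *: e_ k)) hh (fun x Hx => H2 x (fun i => lt_le_trans (Hx i) rr)).
rewrite scale0r addr0 in V0.
by rewrite mulrAC in HG; exact: (mean_difference_le m0 HG V0 Vh).
Qed.

End weak_lipschitz.

Section coordinatewise_continuity.
Context {R : realType} {n : nat}.
Local Notation T := 'rV[R]_n.
Local Notation leb := (@lebesgue_rV R n).
Implicit Types (f : T -> R) (x y z : T).

Lemma nbhs_coord x (P : set T) : nbhs x P <-> exists2 dl : R, 0 < dl & forall y, (forall i, `|y ord0 i - x ord0 i| < dl) -> P y.
Proof.
split => [/nbhs_ballP[e /= e0 H]|[dl dl0 H]].
  exists e => // y Hy; apply: H; split => // i j; rewrite (ord1 i) -ball_normE /= distrC; exact: Hy.
apply/nbhs_ballP; exists dl => //= y [_ Hy]; apply: H => i.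
by have := Hy ord0 i; rewrite -ball_normE /= distrC.
Qed.

Lemma continuous_coordP f x : (forall e : R, 0 < e -> exists2 dl : R, 0 < dl &
  forall y, (forall i, `|y ord0 i - x ord0 i| < dl) -> `|f y - f x| <= e) -> {for x, continuous f}.
Proof.
move=> H; have FF : Filter (nbhs x) by exact: nbhs_filter.
apply/(@cvgrPdist_le _ _ _ (nbhs x) FF) => e e0; have [dl dl0 Hd] := H e e0.
by apply/nbhs_coord; exists dl => // y Hy; rewrite distrC; exact: Hd.
Qed.

Lemma within_coord (C : set T) f z : {within C, continuous f} -> C z -> forall e : R, 0 < e -> exists2 dl : R, 0 < dl &
  forall z', C z' -> (forall i, `|z' ord0 i - z ord0 i| < dl) -> `|f z' - f z| <= e.
Proof.
move=> /subspace_continuousP cf Cz e e0.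
have /cvgrPdist_le /(_ e e0) /nbhs_coord[dl dl0 H] := cf z Cz.
by exists dl => // z' Cz' Hz; rewrite distrC; exact: H.
Qed.

Lemma unit_cube_open : open (@unit_cube R n).
Proof.
rewrite openE => y Yy.
have H : \forall z \near y, forall k : 'I_n, 0 < (z : T) ord0 k < 1.
  have FF : Filter (nbhs y) by exact: nbhs_filter.
  apply: (@filter_forall _ 'I_n (fun k z => 0 < (z : T) ord0 k < 1) (nbhs y) FF) => k; have ck := smooth_continuous (@smooth_coord R n k).
  have /andP[h1 h2] := Yy k; have c := ck y.
  have n1 : \forall z \near y, 0 < (z : T) ord0 k by have /cvgr_gt := c; apply.
  have n2 : \forall z \near y, (z : T) ord0 k < 1 by have /cvgr_lt := c; apply.
  by apply: filterS2 n1 n2 => z -> ->.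
exact: H.
Qed.

Lemma continuous_at_sum (I : Type) (r : seq I) (F : I -> T -> R) x : (forall i, {for x, continuous (F i)}) ->
  {for x, continuous (fun y => \sum_(i <- r) F i y)}.
Proof.
move=> H; elim: r => [|i r IH].
  have -> : (fun y => \sum_(i <- [::]) F i y) = (fun=> 0) by apply/funext => y; rewrite big_nil.
  exact: cst_continuous.
have -> : (fun y => \sum_(j <- i :: r) F j y) = (fun y => F i y + \sum_(j <- r) F j y).
  by apply/funext => y; rewrite big_cons.
exact: continuousD.
Qed.

End coordinatewise_continuity.

(** * A tensor elliptic at every point and Lipschitz in t *)

Section regularized_tensor.
Context {R : realType} {n : nat}.
Local Notation T := 'rV[R]_n.
Local Notation leb := (@lebesgue_rV R n).
Local Notation Y := (@unit_cube R n).
Variables (smin smax : R) (A : R -> T -> 'M[R]_n) (E al be : R).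
Hypothesis smm : smin < smax.
Hypothesis A_sym : forall t y, t \in `[smin, smax] -> (A t y)^T = A t y.
Hypothesis A_periodic : forall t, t \in `[smin, smax] -> cell_periodic (A t).
Hypothesis A_continuous : forall i j,
  {within cylinder `[smin, smax] Y, continuous (joint (fun t y => A t y i j))}.
Hypothesis E0 : 0 <= E.
Hypothesis al0 : 0 < al.
Hypothesis be0 : 0 < be.
Hypothesis A_W1infty : forall i j, W1infty_W1infty_le smin smax Y (fun t y => A t y i j) E.
Hypothesis A_elliptic : {ae leb, forall y, Y y ->
     forall t, t \in `[smin, smax] -> forall xi : T,
       al * enorm xi ^+ 2 <= dotv (mxv (A t y) xi) xi /\
       enorm (mxv (A t y) xi) <= be * enorm xi}.

Let cons (t : R) (y : T) : 'rV[R]_n.+1 := rV_cons (t : measurableTypeR R, y).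

Let cons0 t y : cons t y ord0 ord0 = t.
Proof. exact: rV_cons0. Qed.

Let consS t y k : cons t y ord0 (lift ord0 k) = y ord0 k.
Proof. exact: rV_consS. Qed.

Let joint_cons (f : R -> T -> R) t y : joint f (cons t y) = f t y.
Proof.
rewrite /joint cons0; congr f; apply/rowP => k; by rewrite rsubmxE consS.
Qed.

Let cylinder_cons (I : set R) t y : I t -> Y y -> cylinder I Y (cons t y).
Proof.
move=> It Yy; split; first by rewrite cons0.
by move=> k; rewrite rsubmxE consS; exact: Yy.
Qed.

Lemma tensor_continuous i j t y (e : R) : t \in `[smin, smax] -> Y y -> 0 < e -> exists2 dl : R, 0 < dl &
  forall t' y', t' \in `[smin, smax] -> Y y' -> `|t' - t| < dl -> (forall k, `|y' ord0 k - y ord0 k| < dl) ->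
  `|A t' y' i j - A t y i j| <= e.
Proof.
move=> tI Yy e0; have [dl dl0 H] := within_coord (@A_continuous i j) (cylinder_cons tI Yy) e0.
exists dl => // t' y' tI' Yy' ht hy.
have := H (cons t' y') (cylinder_cons tI' Yy'); rewrite !joint_cons; apply => k.
case: (unliftP ord0 k) => [l|] ->; first by rewrite !consS.
by rewrite !cons0.
Qed.

Lemma tensor_continuous_y i j t y : t \in `[smin, smax] -> Y y -> {for y, continuous (fun y => A t y i j)}.
Proof.
move=> tI Yy; apply: continuous_coordP => e e0.
have [dl dl0 H] := tensor_continuous i j tI Yy e0.
have /nbhs_coord[d2 d20 H2] := unit_cube_open Yy.
exists (Num.min dl d2) => [|y' Hy]; first by rewrite lt_min dl0.
apply: H => //; rewrite ?subrr ?normr0 //.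
- by apply: H2 => k; apply: lt_le_trans (Hy k) _; rewrite ge_min lexx orbT.
- by move=> k; apply: lt_le_trans (Hy k) _; rewrite ge_min lexx.
Qed.

Lemma tensor_measurable i j t : t \in `[smin, smax] -> measurable_fun Y (fun y => A t y i j).
Proof. by move=> tI; apply: continuous_at_measurable => [|y]; [exact: unit_cube_open|exact: tensor_continuous_y]. Qed.

Lemma tensor_apply_continuous t y xi k : t \in `[smin, smax] -> Y y -> {for y, continuous (fun y => mxv (A t y) xi ord0 k)}.
Proof.
move=> tI Yy; have -> : (fun y => mxv (A t y) xi ord0 k) = (fun y => \sum_j A t y k j * xi ord0 j).
  by apply/funext => z; rewrite mxvE.
apply: continuous_at_sum => j; apply: continuousM; [exact: tensor_continuous_y|exact: cst_continuous].
Qed.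

(** The bounds hold almost everywhere in y and both sides are continuous on the open cell, hence
    they hold everywhere there. The upper constant is al + be so that the constant tensor al I, used
    on the faces, satisfies it as well. *)
Lemma tensor_elliptic t y : t \in `[smin, smax] -> Y y -> elliptic al (al + be) (A t y).
Proof.
move=> tI Yy; split; first exact: A_sym.
- move=> xi; rewrite -subr_ge0.
  apply: (continuous_ae_ge0 unit_cube_open (f := fun y => dotv (mxv (A t y) xi) xi - al * dotv xi xi) _ _ Yy) => [z Yz|].
    apply: continuousB; last exact: cst_continuous.
    apply: continuous_at_sum => k; apply: continuousM; [exact: tensor_apply_continuous|exact: cst_continuous].
  apply: filterS A_elliptic => z H Yz; have [h _] := H Yz t tI xi; by rewrite subr_ge0 -enorm_sqr.
- move=> xi; apply: (@le_trans _ _ (be ^+ 2 * dotv xi xi)); last first.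
    by rewrite ler_wpM2r ?dotvv_ge0 // lerXn2r ?nnegrE ?addr_ge0 ?ltW // ltrDr.
  rewrite -subr_ge0.
  apply: (continuous_ae_ge0 unit_cube_open (f := fun y => be ^+ 2 * dotv xi xi - dotv (mxv (A t y) xi) (mxv (A t y) xi)) _ _ Yy) => [z Yz|].
    apply: continuousB; first exact: cst_continuous.
    by apply: continuous_at_sum => k; apply: continuousM; exact: tensor_apply_continuous.
  apply: filterS A_elliptic => z H Yz; have [_ h] := H Yz t tI xi.
  by rewrite subr_ge0 -!enorm_sqr -exprMn lerXn2r // nnegrE ?mulr_ge0 ?sqrtr_ge0 // ltW.
Qed.

Lemma cylinder_open : open (cylinder `]smin, smax[ Y).
Proof.
rewrite openE => z [zI Yz]; have /nbhs_coord[dl dl0 H] := unit_cube_open Yz.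
move: zI; rewrite /= in_itv /= => /andP[z1 z2].
apply/nbhs_coord; exists (Num.min dl (Num.min (z ord0 ord0 - smin) (smax - z ord0 ord0))).
  by rewrite !lt_min dl0 !subr_gt0 z1.
move=> w Hw; split.
  have := Hw ord0; rewrite !lt_min => /and3P[_ h1 h2]; rewrite /= in_itv /=.
  by move: h1 h2; rewrite !ltr_norml => /andP[? ?] /andP[? ?]; apply/andP; split; lra.
apply: H => k; rewrite !rsubmxE; have := Hw (lift ord0 k); rewrite !lt_min => /and3P[] //.
Qed.

Lemma cylinder_lty : (lebesgue_rV n.+1 (cylinder `]smin, smax[ Y) < +oo)%E.
Proof.
pose K : R := `|smin| + `|smax| + 1.
have K0 : 0 < K by rewrite /K ltr_wpDl // addr_ge0.
apply: le_lt_trans (leb_box_lty n.+1 K0).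
apply: le_measure; rewrite ?inE; [exact: open_measurable_rV cylinder_open|exact: measurable_box|].
move=> z [zI Yz] k; rewrite /= in_itv /= /K.
have a1 := normr_ge0 smin; have a2 := normr_ge0 smax.
case: (unliftP ord0 k) => [l|] ->.
  by have := Yz l; rewrite rsubmxE => /andP[h1 h2]; apply/andP; split; lra.
move: zI; rewrite /= in_itv /= => /andP[h1 h2].
have b1 := ler_norm (- smin); have b2 := ler_norm smax; rewrite normrN in b1.
by apply/andP; split; lra.
Qed.

Lemma tensor_lipschitz_interior i j s t y : smin < s -> s <= t -> t < smax -> Y y ->
  `|A t y i j - A s y i j| <= E * (t - s).
Proof.
move=> s1 st t1 Yy; have [fE [ft wf ftE] _] := @A_W1infty i j.
have /nbhs_coord[dl dl0 Hd] := unit_cube_open Yy.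
(* Small enough for the box of radius r around (s, y), carried up to height t, to stay in the open
   cylinder. *)
pose r := Num.min (dl / 2) (Num.min ((s - smin) / 2) ((smax - t) / 2)).
have r0 : 0 < r by rewrite !lt_min !divr_gt0 // subr_gt0.
have rd : r < dl by apply: (@le_lt_trans _ _ (dl / 2)); [rewrite ge_min lexx|lra].
have rs : r < s - smin by apply: (@le_lt_trans _ _ ((s - smin) / 2)); [rewrite !ge_min lexx orbT|lra].
have rt : r < smax - t by apply: (@le_lt_trans _ _ ((smax - t) / 2)); [rewrite !ge_min lexx !orbT|lra].
have st0 : 0 <= t - s by rewrite subr_ge0.
have cf z : cylinder `]smin, smax[ Y z -> {for z, continuous (joint (fun t y => A t y i j))}.
  move=> Cz; apply: continuous_coordP => e e0.
  have Cz' : cylinder `[smin, smax] Y z by case: Cz => zI Yz; split => //; exact: subset_itv_oo_cc.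
  have [d1 d10 H1] := within_coord (@A_continuous i j) Cz' e0.
  have /nbhs_coord[d2 d20 H2] := cylinder_open Cz.
  exists (Num.min d1 d2) => [|w Hw]; first by rewrite lt_min d10.
  apply: H1 => [|k]; last by apply: lt_le_trans (Hw k) _; rewrite ge_min lexx.
  have [wI Yw] : cylinder `]smin, smax[ Y w by apply: H2 => k; apply: lt_le_trans (Hw k) _; rewrite ge_min lexx orbT.
  by split => //; exact: subset_itv_oo_cc.
have := weak_lipschitz (z0 := cons s y) cylinder_open cylinder_lty cf E0 fE wf ftE st0 r0.
have -> : cons s y + (t - s) *: delta_mx ord0 ord0 = cons t y.
  apply: rV_consP; first by rewrite [LHS]mxE [X in _ + X]mxE !cons0 [X in _ * X]mxE !eqxx mulr1 addrC subrK.
  by move=> k; rewrite mxE [X in _ + X]mxE !consS [X in _ * X]mxE /= mulr0 addr0.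
rewrite !joint_cons; apply => z u Hz /andP[u0 u1]; split.
  have := Hz ord0; rewrite cons0 !mxE !eqxx mulr1 ler_norml => /andP[h1 h2] /=.
  by rewrite in_itv /=; apply/andP; split; lra.
apply: Hd => k; have := Hz (lift ord0 k); rewrite consS rsubmxE !mxE /= mulr0 addr0 => h.
exact: le_lt_trans rd.
Qed.

(** The weak derivative lives on the open interval; its ends are reached by continuity. Both s and t
    are pulled towards the midpoint by a small factor [la], which only shrinks their distance. *)
Lemma tensor_lipschitz i j s t y : s \in `[smin, smax] -> t \in `[smin, smax] -> Y y ->
  `|A s y i j - A t y i j| <= E * `|s - t|.
Proof.
wlog st : s t / t <= s => [H sI tI Yy|sI tI Yy].
  case: (leP t s) => h; first exact: H.
  by rewrite distrC [`|s - t|]distrC; apply: H => //; exact: ltW.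
rewrite [`|s - t|]ger0_norm ?subr_ge0 //; apply/ler_addgt0Pr => e e0.
have e2 : 0 < e / 2 by rewrite divr_gt0.
have [d1 d10 H1] := tensor_continuous i j sI Yy e2; have [d2 d20 H2] := tensor_continuous i j tI Yy e2.
pose mid := (smin + smax) / 2; pose W := smax - smin.
have W0 : 0 < W by rewrite subr_gt0.
pose la := Num.min (1 / 2) (Num.min (d1 / (2 * W)) (d2 / (2 * W))).
have la0 : 0 < la by rewrite !lt_min !divr_gt0 ?mulr_gt0.
have la1 : la <= 1 / 2 by rewrite ge_min lexx.
have laW d : 0 < d -> la <= d / (2 * W) -> la * W < d.
  by move=> d0; rewrite ler_pdivlMr ?mulr_gt0 // => h; lra.
have l1 : la * W < d1 by apply: laW => //; rewrite !ge_min lexx orbT.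
have l2 : la * W < d2 by apply: laW => //; rewrite !ge_min lexx !orbT.
pose move_in u := u + la * (mid - u).
have in_oo u : u \in `[smin, smax] -> smin < move_in u < smax.
  rewrite in_itv /= => /andP[h1 h2]; rewrite /move_in /mid; rewrite /W in W0; apply/andP; split; nra.
have close u : u \in `[smin, smax] -> `|move_in u - u| <= la * W.
  rewrite in_itv /= => /andP[h1 h2]; rewrite /move_in addrAC subrr add0r normrM gtr0_norm //; apply: ler_wpM2l; first exact: ltW.
  by rewrite ler_norml /mid /W; rewrite /W in W0; apply/andP; split; lra.
have in_cc u : u \in `[smin, smax] -> move_in u \in `[smin, smax].
  by move=> /in_oo /andP[h1 h2]; rewrite in_itv /= !ltW.
have /andP[s1 s2] := in_oo s sI; have /andP[t1 t2] := in_oo t tI.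
have ts : move_in t <= move_in s by rewrite /move_in; nra.
have L := tensor_lipschitz_interior i j t1 ts s2 Yy.
have B1 := H1 (move_in s) y (in_cc s sI) Yy (le_lt_trans (close s sI) l1) ltac:(by move=> k; rewrite subrr normr0).
have B2 := H2 (move_in t) y (in_cc t tI) Yy (le_lt_trans (close t tI) l2) ltac:(by move=> k; rewrite subrr normr0).
have L' : E * (move_in s - move_in t) <= E * (s - t) by rewrite ler_wpM2l // /move_in; nra.
move: (le_trans L L') B1 B2; rewrite !ler_norml => /andP[? ?] /andP[? ?] /andP[? ?].
by apply/andP; split; lra.
Qed.

(** Projection onto [smin, smax]: composing with it defines the tensor for every real t without
    increasing its Lipschitz constant in t. *)
Definition clamp (t : R) : R := Num.max smin (Num.min smax t).

Lemma clamp_in t : clamp t \in `[smin, smax].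
Proof. by rewrite /clamp in_itv /= le_max lexx /= ge_max ge_min lexx /= andbT ltW. Qed.

Lemma clamp_id t : t \in `[smin, smax] -> clamp t = t.
Proof. by rewrite in_itv /clamp /= => /andP[h1 h2]; rewrite (min_idPr h2) (max_idPr h1). Qed.

Lemma clamp_lipschitz s t : `|clamp s - clamp t| <= `|s - t|.
Proof.
have n1 (x y : R) : x - y <= `|x - y| by exact: ler_norm.
have n2 (x y : R) : y - x <= `|x - y| by rewrite distrC; exact: ler_norm.
have hmax (a x y : R) : `|Num.max a x - Num.max a y| <= `|x - y|.
  by have := n1 x y; have := n2 x y; rewrite ler_norml; case: (leP a x); case: (leP a y) => *; apply/andP; split; lra.
have hmin (a x y : R) : `|Num.min a x - Num.min a y| <= `|x - y|.
  by have := n1 x y; have := n2 x y; rewrite ler_norml; case: (leP a x); case: (leP a y) => *; apply/andP; split; lra.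
exact: le_trans (hmax _ _ _) (hmin _ _ _).
Qed.

(* On the faces of the cells, which form a null set, the values of A are not
   constrained; they are replaced by those of a constant tensor. *)
Definition regular (t : R) (y : T) : 'M[R]_n :=
  if fracv y \in Y then A (clamp t) (fracv y) else al%:M.

Lemma regular_elliptic t y : elliptic al (al + be) (regular t y).
Proof.
rewrite /regular; case: (pselect (Y (fracv y))) => Yy; [rewrite mem_set //|rewrite memNset //].
  by apply: tensor_elliptic => //; exact: clamp_in.
have e (x : T) : mxv al%:M x = al *: x by rewrite /mxv tr_scalar_mx mul_mx_scalar.
split; first exact: tr_scalar_mx.
  by move=> xi; rewrite e dotvZl.
move=> xi; rewrite e dotvZl dotvZr mulrA -expr2 ler_wpM2r ?dotvv_ge0 //.
by rewrite lerXn2r ?nnegrE ?addr_ge0 ?ltW // ltrDl.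
Qed.

Lemma regular_measurable t i j : measurable_fun setT (fun y => regular t y i j).
Proof.
have mA : measurable_fun Y (fun y => A (clamp t) y i j - (al%:M : 'M[R]_n) i j).
  by apply: measurable_funB => //; apply: tensor_measurable; exact: clamp_in.
have := measurable_pext mA; move=> /(measurable_funD) /(_ (measurable_cst ((al%:M : 'M[R]_n) i j))).
apply: eq_measurable_fun => y _ /=; rewrite /regular /pext; case: ifPn => _; last by rewrite add0r.
by rewrite subrK.
Qed.

Lemma regular_periodic t : cell_periodic (regular t).
Proof. by move=> y k; rewrite /regular frac_periodic. Qed.

Lemma regular_lipschitz s t y i j : `|regular s y i j - regular t y i j| <= E * `|s - t|.
Proof.
rewrite /regular; case: (pselect (Y (fracv y))) => Yy; [rewrite mem_set //|rewrite memNset //].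
  apply: (le_trans (tensor_lipschitz i j (clamp_in s) (clamp_in t) Yy)).
  by rewrite ler_wpM2l // clamp_lipschitz.
by rewrite subrr normr0 mulr_ge0.
Qed.

Lemma regular_eq t y : t \in `[smin, smax] -> Y (fracv y) -> regular t y = A t y.
Proof.
move=> tI Yy; rewrite /regular mem_set // clamp_id //.
pose z : 'rV[int]_n := \row_k Num.floor (y ord0 k).
have -> : A t y = A t (fracv y + zv z) by congr A; apply/rowP => k; rewrite !mxE subrK.
by rewrite (periodic_zv _ _ (A_periodic tI)).
Qed.

(** Where sigma obeys its bounds, the tensors can differ only if x / eps lies on a face of a cell.
    The indicator of the faces is periodic with integral zero over the cell, so [tile_bound] shows
    that the set of such x in [O] is null. *)
Lemma regular_eq_ae (O : set T) (M eps : R) (sigma : T -> R) : measurable O -> O `<=` box n M -> 0 < M -> 0 < eps <= 1 ->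
  {ae leb, forall x, O x -> smin <= sigma x <= smax} ->
  {ae leb, forall x, O x -> regular (sigma x) (eps^-1 *: x) = A (sigma x) (eps^-1 *: x)}.
Proof.
move=> mO OM M0 e01 sO.
pose q (y : T) : R := (fracv y \notin Y)%:R.
have mN : measurable (fracv @^-1` (~` Y)).
  by rewrite -[X in measurable X]setTI; apply: measurable_frac => //; apply: measurableC; exact: measurable_unit_cube.
have qE : q = \1_(fracv @^-1` (~` Y)).
  by apply/funext => y; rewrite /q indicE; congr (_%:R); congr nat_of_bool; apply/idP/idP; rewrite notin_setE inE.
have mq : measurable_fun setT q by rewrite qE; exact: measurable_indic.
have qp : cell_periodic q by move=> y k; rewrite /q frac_periodic.
have q0 y : 0 <= q y by rewrite /q.
have tb := tile_bound mq q0 qp mO OM M0 e01.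
have z : (\int[leb]_(y in Y) (q y)%:E = 0)%E.
  rewrite (eq_integral (cst 0%E)) ?integral0 // => y /set_mem Yy; rewrite /q frac_cube // mem_set //.
rewrite z mule0 in tb.
pose N := O `&` ((fun x => eps^-1 *: x) @^-1` (fracv @^-1` (~` Y))).
have mN' : measurable N.
  exact: (@measurable_scale _ _ eps^-1 O mO _ mN).
have N0 : leb N = 0%E.
  apply/eqP; rewrite eq_le measure_ge0 andbT; apply: le_trans tb.
  have -> : leb N = (\int[leb]_(x in O) (\1_N x)%:E)%E by rewrite integral_indic // (setIidl (@subIsetl _ _ _)).
  apply: ge0_integral_le => x Ox; rewrite ?lee_fin // qE !indicE ler_nat.
  by case: (pselect (N x)) => Nx; rewrite ?(memNset Nx) // mem_set //; case: Nx => _ Nx; rewrite mem_set.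
have aeN : {ae leb, forall x, O x -> Y (fracv (eps^-1 *: x))}.
  by exists N; split => // x /= /not_implyP[Ox H]; split.
apply: filterS2 sO aeN => x h1 h2 Ox; apply: regular_eq; last exact: h2.
by rewrite in_itv /= h1.
Qed.

End regularized_tensor.

(** * Convergence of the Dirichlet-to-Neumann pairing *)

Section dirichlet_to_neumann_congruence.
Context {R : realType} {n : nat}.
Local Notation T := 'rV[R]_n.
Local Notation leb := (@lebesgue_rV R n).

(** Correctors are chosen by [get], so it is the equality of the predicates [cell_solution] that
    makes the choices for B and B' coincide. *)
Lemma homogenized_eq (B B' : T -> 'M[R]_n) : (forall y, unit_cube y -> B y = B' y) -> homogenized B = homogenized B'.
Proof.
move=> BB'; have E (F : 'M[R]_n -> T -> R) : \int[leb]_(y in unit_cube) F (B y) y = \int[leb]_(y in unit_cube) F (B' y) y.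
  by apply: eq_Rintegral => y; rewrite inE => Yy; rewrite BB'.
have C j : corrector B j = corrector B' j.
  rewrite /corrector; congr get; apply/funext => chi; apply/propext; rewrite /cell_solution.
  split=> -[W H]; split => // v Dv Hv; have := H v Dv Hv.
    by rewrite (E (fun b y => dotv (mxv b (chi.2 y)) (Dv y))) (E (fun b y => dotv (mxv b (delta_mx ord0 j)) (Dv y))).
  by rewrite -(E (fun b y => dotv (mxv b (chi.2 y)) (Dv y))) -(E (fun b y => dotv (mxv b (delta_mx ord0 j)) (Dv y))).
have e1 i j : \int[leb]_(y in unit_cube) B y i j = \int[leb]_(y in unit_cube) B' y i j := E (fun b _ => b i j).
have e2 i j k : \int[leb]_(y in unit_cube) (B y i k * (corrector B j).2 y ord0 k) =
    \int[leb]_(y in unit_cube) (B' y i k * (corrector B' j).2 y ord0 k).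
  by rewrite C; exact: (E (fun b y => b i k * (corrector B' j).2 y ord0 k)).
have key (v X X' Z Z' : R) : X = X' -> Z = Z' -> v^-1 * X - v^-1 * Z = v^-1 * X' - v^-1 * Z' by move=> -> ->.
rewrite /homogenized; apply/matrixP => i j; rewrite [LHS]mxE [RHS]mxE.
by apply: key; [exact: e1|apply: eq_bigr => k _; exact: e2].
Qed.

(** As for the correctors, the predicates defining the solutions coincide, hence so do the solutions
    chosen by [get]. *)
Lemma DtN_ae (O : set T) (B B' : T -> 'M[R]_n) g phi : {ae leb, forall x, O x -> B x = B' x} ->
  DtN O B g phi = DtN O B' g phi.
Proof.
move=> BB'; have E (F G : T -> 'rV[R]_n) :
    \int[leb]_(x in O) dotv (mxv (B x) (F x)) (G x) = \int[leb]_(x in O) dotv (mxv (B' x) (F x)) (G x).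
  by apply: Rintegral_eq_ae; apply: filterS BB' => x H /H ->.
have D : dirichlet O B g = dirichlet O B' g.
  rewrite /dirichlet; congr get; apply/funext => w; apply/propext; rewrite /dirichlet_solution.
  by split=> -[h1 h2 h3]; split => // v Dv Hv; have := h3 v Dv Hv; rewrite E.
by rewrite /DtN D; exact: E.
Qed.

End dirichlet_to_neumann_congruence.

Section dirichlet_to_neumann_limit.
Context {R : realType} {n : nat}.
Local Notation T := 'rV[R]_n.
Local Notation leb := (@lebesgue_rV R n).
Local Notation Y := (@unit_cube R n).
Variables (smin smax : R) (A : R -> T -> 'M[R]_n) (E al be : R).
Hypothesis smm : smin < smax.
Hypothesis A_sym : forall t y, t \in `[smin, smax] -> (A t y)^T = A t y.
Hypothesis A_periodic : forall t, t \in `[smin, smax] -> cell_periodic (A t).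
Hypothesis A_continuous : forall i j,
  {within cylinder `[smin, smax] Y, continuous (joint (fun t y => A t y i j))}.
Hypothesis E0 : 0 <= E.
Hypothesis al0 : 0 < al.
Hypothesis be0 : 0 < be.
Hypothesis A_W1infty : forall i j, W1infty_W1infty_le smin smax Y (fun t y => A t y i j) E.
Hypothesis A_elliptic : {ae leb, forall y, Y y ->
     forall t, t \in `[smin, smax] -> forall xi : T,
       al * enorm xi ^+ 2 <= dotv (mxv (A t y) xi) xi /\
       enorm (mxv (A t y) xi) <= be * enorm xi}.
Variables (O : set T) (k0 : 'I_n).
Hypothesis oO : open O.
Hypothesis bO : bounded_set O.

Local Notation B := (regular smin smax A al).
Local Notation clp := (clamp smin smax).

Let clampK t : clp (clp t) = clp t.
Proof. by rewrite clamp_id // clamp_in. Qed.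

Let regular_clamp t y : B (clp t) y = B t y.
Proof. by rewrite /regular clampK. Qed.

Lemma DtN_cvg (sigma g phi : T -> R) : H12 O g -> H12 O phi -> admissible O smin smax sigma ->
  DtN O (fine_tensor A eps sigma) g phi @[eps --> 0^'+] --> DtN O (effective_tensor A sigma) g phi.
Proof.
move=> Hg Hphi [ms sO].
have [M M0 OM] := bounded_leb_fin bO.
have mO := open_measurable_rV oO; have leO := leb_bounded_lty mO bO.
have [Hg1 _] := getPex Hg; have [[_ Lh _] _] := getPex Hphi; have [_ LG _] := Hg1.
rewrite -/(lift_bdry O g) in Hg1 LG; rewrite -/(lift_bdry O phi) in Lh.
have abe0 : 0 <= al + be by rewrite addr_ge0 // ltW.
have Bell := regular_elliptic smm A_sym A_continuous al0 be0 A_elliptic.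
have Bmeas := regular_measurable al smm A_continuous.
have Bper := regular_periodic smin smax A al.
have BLip := regular_lipschitz al smm A_continuous E0 A_W1infty.
(* sigma obeys its bounds almost everywhere only; its clamped version obeys them everywhere and
   agrees with it almost everywhere in [O]. *)
pose tau x := clp (sigma x).
have mt : measurable_fun O tau by apply: measurable_maxr => //; exact: measurable_minr.
have tab x : O x -> smin <= tau x <= smax by move=> _; have := clamp_in smm (sigma x); rewrite in_itv.
have mB := measurable_fine oO Bmeas E0 BLip mt tab.
have mA := measurable_effective oO al0 abe0 Bell Bmeas E0 BLip mt tab.
have tB eps : tfield O al (al + be) (fun x => B (tau x) (eps^-1 *: x)) by split => //; exact: mB.
have tA : tfield O al (al + be) (fun x => homogenized (B (tau x))).
  by split => // x _; exact: (homogenized_elliptic al0 abe0 (Bcell (Bell _) (Bmeas _))).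
have exD C : tfield O al (al + be) C -> dirichlet_solution O C g (dirichlet O C g).
  by move=> tC; apply: getPex; exact: (dirichlet_existence k0 oO OM M0 leO al0 abe0 tC).
have ws C : tfield O al (al + be) C -> weak_sol O C (lift_bdry O g).2 (dirichlet O C g).2.
  by move=> tC; have [? ? ?] := dirichlet_solution_facts oO leO (exD C tC); split.
have H := homogenization k0 oO OM M0 leO al0 abe0 Bell Bmeas Bper E0 BLip mt tab LG Lh
  (fun C tC => ex_intro _ _ (ws C tC)) (ws _ tA) (fun eps _ => ws _ (tB eps)).
have -> : DtN O (effective_tensor A sigma) g phi = DtN O (fun x => homogenized (B (tau x))) g phi.
  apply: DtN_ae; apply: filterS sO => x Hs /Hs sx; apply: homogenized_eq => y Yy.
  by rewrite regular_clamp regular_eq // ?in_itv // frac_cube.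
apply/cvgrPdist_le => e e0; have e2 : 0 < e ^+ 2 by rewrite exprn_gt0.
have He := H _ e2.
near=> eps.
have e01 : 0 < eps <= 1 by apply/andP; split; near: eps; [exact: nbhs_right_gt|exact: nbhs_right_le].
have -> : DtN O (fine_tensor A eps sigma) g phi = DtN O (fun x => B (tau x) (eps^-1 *: x)) g phi.
  apply: DtN_ae; apply: filterS (regular_eq_ae al A_periodic mO OM M0 e01 sO) => x Hx Ox.
  by rewrite regular_clamp Hx.
rewrite distrC -ler_sqr ?nnegrE ?(ltW e0) // real_normK ?num_real //.
by near: eps; exact: He.
Unshelve. all: by end_near. Qed.

End dirichlet_to_neumann_limit.

(** * Convergence of the posteriors *)

Section hellinger_limit.
Context d (X : measurableType d) (R : realType).
Variable prior : probability X R.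

(* The normalization is nonzero: otherwise, as 0^-1 = 0, the density would vanish
   almost everywhere instead of having integral 1. *)
Lemma posterior_density (Phi : X -> R) (nu : probability X R) : posterior prior Phi nu ->
  let C := \int[prior]_th expR (- Phi th) in
  [/\ 0 < C, exists2 m : X -> R, measurable_fun setT m & {ae prior, forall th, expR (- Phi th) = m th} &
    {ae prior, forall th, fine (RN_density nu prior th) = C^-1 * expR (- Phi th)}].
Proof.
move=> [dom aeq] C; have fin th : RN_density nu prior th \is a fin_num by exact: Radon_Nikodym_fin_num.
have irn : prior.-integrable setT (RN_density nu prior) by exact: Radon_Nikodym_integrable.
have aef : {ae prior, forall th, fine (RN_density nu prior th) = C^-1 * expR (- Phi th)}.
  by apply: filterS aeq => th /(_ Logic.I) ->.
have C0 : C != 0.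
  apply/eqP => C0; have H : {ae prior, forall th, RN_density nu prior th = 0%E}.
    by apply: filterS aeq => th /(_ Logic.I) ->; rewrite -/C C0 invr0 mul0r.
  have [N [mN N0 HN]] := H.
  have E : nu setT = (\int[prior]_th RN_density nu prior th)%E.
    by have := @Radon_Nikodym_integral _ _ _ (charge_of_finite_measure nu) prior setT dom measurableT.
  have I0 : (\int[prior]_th RN_density nu prior th = 0)%E.
    transitivity (\int[prior]_(th in [set: X]) (cst 0%E th : \bar R))%E; last exact: integral0.
    by apply: (integral_eq_off mN N0) => th _ Nth; apply: contrapT => h; apply: Nth; exact: HN.
  by move: E; rewrite I0 probability_setT => /eqP; rewrite onee_eq0.
have Cge : 0 <= C by apply: Rintegral_ge0 => th _; exact: expR_ge0.
split => //; first by rewrite lt_neqAle eq_sym C0.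
(* The Radon-Nikodym density supplies a measurable version of exp (- Phi), a function not known to
   be measurable itself. *)
exists (fun th => C * fine (RN_density nu prior th)).
  apply: measurable_funM => //; apply: measurableT_comp => //; exact: (measurable_int prior irn).
by apply: filterS aef => th ->; rewrite mulVKf.
Qed.

(** Dominated convergence twice: for the normalizations, and then for the squared differences, which
    are at most 8 / C0 once the normalizations stay above C0 / 2. *)
Lemma normalized_sqrt_diff_cvg (h : nat -> X -> R) (h0 : X -> R) :
  (forall k, measurable_fun setT (h k)) -> measurable_fun setT h0 ->
  (forall k th, 0 <= h k th <= 1) -> (forall th, 0 <= h0 th <= 1) ->
  (forall th, h k th @[k --> \oo] --> h0 th) ->
  0 < \int[prior]_th h0 th ->
  \int[prior]_th (Num.sqrt ((\int[prior]_th h0 th)^-1 * h0 th) - Num.sqrt ((\int[prior]_th h k th)^-1 * h k th)) ^+ 2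
    @[k --> \oo] --> (0 : R).
Proof.
move=> mh mh0 h01 h001 hcv C00.
have i1 : prior.-integrable setT (EFin \o (cst (1 : R))) by exact: finite_measure_integrable_cst.
have Ccv : \int[prior]_th h k th @[k --> \oo] --> \int[prior]_th h0 th.
  apply: (Rintegral_dct measurableT mh i1) => [k th _|th _]; last exact: hcv.
  by have /andP[? ?] := h01 k th; rewrite ger0_norm.
set C0 := \int[prior]_th h0 th in C00 Ccv *; pose C k := \int[prior]_th h k th.
(* The maximum keeps the denominator above C0 / 2 for every k, as domination requires, and equals
   [C k] for large k. *)
rewrite -/C in Ccv *; pose D k := Num.max (C0 / 2) (C k).
have C02 : 0 < C0 / 2 by rewrite divr_gt0.
have D0 k : 0 < D k by rewrite /D lt_max C02.
have Cbig : \forall k \near \oo, C0 / 2 < C k.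
  by have /cvgr_gt := Ccv; apply; lra.
have DC : \forall k \near \oo, D k = C k.
  by apply: filterS Cbig => k h'; rewrite /D; apply/max_idPr; exact: ltW.
have Dcv : D k @[k --> \oo] --> C0.
  by apply: cvg_trans Ccv; apply: near_eq_cvg; apply: filterS DC => k ->.
pose F k th := (Num.sqrt (C0^-1 * h0 th) - Num.sqrt ((D k)^-1 * h k th)) ^+ 2.
have msqrt (c : R) (u : X -> R) : measurable_fun setT u -> measurable_fun setT (fun th => Num.sqrt (c * u th)).
  move=> mu; apply: (measurableT_comp (f := fun x : R => Num.sqrt x)); last exact: measurable_funM.
  by apply: continuous_measurable_fun; exact: sqrt_continuous.
have mF k : measurable_fun setT (F k).
  by apply: measurable_funX; apply: measurable_funB; exact: msqrt.
have iK (c : R) : prior.-integrable setT (EFin \o (cst c)) by exact: finite_measure_integrable_cst.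
have FB k th : [set: X] th -> `|F k th| <= 8 / C0.
  move=> _; have /andP[a0 a1] := h001 th; have /andP[b0 b1] := h01 k th.
  have Di : (D k)^-1 <= 2 / C0.
    by rewrite -[2 / C0]invrK invfM invrK mulrC lef_pV2 ?posrE // /D le_max lexx.
  have p1 : 0 <= C0^-1 * h0 th by rewrite mulr_ge0 // invr_ge0 ltW.
  have p2 : 0 <= (D k)^-1 * h k th by rewrite mulr_ge0 // invr_ge0 ltW.
  have q1 : C0^-1 * h0 th <= 2 / C0.
    have i0 : 0 <= C0^-1 by rewrite invr_ge0 ltW.
    by have := ler_wpM2l i0 a1; lra.
  have q2 : (D k)^-1 * h k th <= 2 / C0.
    by apply: le_trans Di; rewrite ler_piMr // invr_ge0 ltW.
  rewrite ger0_norm ?sqr_ge0 // /F; have := sqrD_le (Num.sqrt (C0^-1 * h0 th)) (- Num.sqrt ((D k)^-1 * h k th)).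
  rewrite sqrrN !sqr_sqrtr // => /le_trans; apply; lra.
have Fcv th : F k th @[k --> \oo] --> (cst 0 th : R).
  rewrite (_ : cst 0 th = (Num.sqrt (C0^-1 * h0 th) - Num.sqrt (C0^-1 * h0 th)) ^+ 2); last by rewrite subrr expr0n.
  apply: cvgn_sqr; apply: cvgB; first exact: cvg_cst.
  apply: continuous_cvg; first exact: sqrt_continuous.
  apply: cvgM; last exact: hcv.
  by apply: cvgV Dcv; rewrite gt_eqF.
have := Rintegral_dct measurableT mF (iK (8 / C0)) FB (fun th _ => Fcv th).
rewrite Rintegral_cst // mul0r; apply: cvg_trans; apply: near_eq_cvg.
by apply: filterS DC => k e; rewrite /F e.
Qed.

(** The limit is tested along sequences [u], so that the exceptional null sets, one for each k, can
    be joined into a single [N]. Off [N] everything is expressed by the measurable versions of exp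
    (- Phi), which are set to 0 on [N]. *)
Lemma hellinger_cvg (Phi : R -> X -> R) (Phi0 : X -> R) (post : R -> probability X R) (post0 : probability X R) :
  (forall eps, 0 < eps -> posterior prior (Phi eps) (post eps)) -> posterior prior Phi0 post0 ->
  (forall eps th, 0 <= Phi eps th) -> (forall th, 0 <= Phi0 th) ->
  {ae prior, forall th, Phi eps th @[eps --> 0^'+] --> Phi0 th} ->
  hellinger prior post0 (post eps) @[eps --> 0^'+] --> 0.
Proof.
move=> Hp Hp0 P0 P00 cv; apply/cvg_at_rightP => u [u0 ucv].
have [C0 [m0 mm0 em0] RN0] := posterior_density Hp0.
have Hk k := posterior_density (Hp _ (u0 k)).
have /choice[m mP] : forall k, exists m : X -> R, measurable_fun setT m /\ {ae prior, forall th, expR (- Phi (u k) th) = m th}.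
  by move=> k; have [_ [m ? ?] _] := Hk k; exists m.
have em : {ae prior, forall th, forall k, expR (- Phi (u k) th) = m k th} by apply: ae_foralln => k; exact: (mP k).2.
have RNk : {ae prior, forall th, forall k, fine (RN_density (post (u k)) prior th) =
    (\int[prior]_th expR (- Phi (u k) th))^-1 * expR (- Phi (u k) th)}.
  by apply: ae_foralln => k; have [_ _] := Hk k.
have : {ae prior, forall th, [/\ forall k, expR (- Phi (u k) th) = m k th, expR (- Phi0 th) = m0 th,
   Phi eps th @[eps --> 0^'+] --> Phi0 th,
   forall k, fine (RN_density (post (u k)) prior th) = (\int[prior]_th expR (- Phi (u k) th))^-1 * expR (- Phi (u k) th) &
   fine (RN_density post0 prior th) = (\int[prior]_th expR (- Phi0 th))^-1 * expR (- Phi0 th)]}.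
  apply: filterS2 (filterI (filterI em em0) (filterI RNk RN0)) cv.
  by move=> th [[? ?] [? ?]] ?; split.
move=> [N [mN N0 HN]].
have good th : ~ N th -> [/\ forall k, expR (- Phi (u k) th) = m k th, expR (- Phi0 th) = m0 th,
   Phi eps th @[eps --> 0^'+] --> Phi0 th,
   forall k, fine (RN_density (post (u k)) prior th) = (\int[prior]_th expR (- Phi (u k) th))^-1 * expR (- Phi (u k) th) &
   fine (RN_density post0 prior th) = (\int[prior]_th expR (- Phi0 th))^-1 * expR (- Phi0 th)].
  by move=> Nth; apply: contrapT => h; apply: Nth; exact: HN.
pose h k th := m k th * \1_(~` N) th; pose h0 th := m0 th * \1_(~` N) th.
have ind1 th : ~ N th -> \1_(~` N) th = 1 :> R by move=> Nth; rewrite indicE mem_set.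
have ind0 th : N th -> \1_(~` N) th = 0 :> R by move=> Nth; rewrite indicE memNset.
have hE k th : ~ N th -> h k th = expR (- Phi (u k) th) by move=> Nth; rewrite /h ind1 // mulr1; have [->] := good th Nth.
have h0E th : ~ N th -> h0 th = expR (- Phi0 th) by move=> Nth; rewrite /h0 ind1 // mulr1; have [_ ->] := good th Nth.
have mI : measurable_fun setT (\1_(~` N) : X -> R) by apply: measurable_indic; exact: measurableC.
have exp1 (p : R) : 0 <= p -> 0 <= expR (- p) <= 1 by move=> p0; rewrite expR_ge0 -expR0 ler_expR oppr_le0.
have Ck k : \int[prior]_th expR (- Phi (u k) th) = \int[prior]_th h k th.
  by apply: (Rintegral_eq_off mN N0) => th _ Nth; rewrite hE.
have C0E : \int[prior]_th expR (- Phi0 th) = \int[prior]_th h0 th.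
  by apply: (Rintegral_eq_off mN N0) => th _ Nth; rewrite h0E.
have key := @normalized_sqrt_diff_cvg h h0 _ _ _ _ _ _.
have {key} : \int[prior]_th (Num.sqrt ((\int[prior]_th h0 th)^-1 * h0 th) - Num.sqrt ((\int[prior]_th h k th)^-1 * h k th)) ^+ 2
    @[k --> \oo] --> (0 : R).
  apply: key.
  - by move=> k; apply: measurable_funM => //; exact: (mP k).1.
  - exact: measurable_funM.
  - move=> k th; case: (pselect (N th)) => Nth; first by rewrite /h ind0 // mulr0 lexx ler01.
    by rewrite hE //; exact: exp1.
  - move=> th; case: (pselect (N th)) => Nth; first by rewrite /h0 ind0 // mulr0 lexx ler01.
    by rewrite h0E //; exact: exp1.
  - move=> th; case: (pselect (N th)) => Nth.
      by rewrite /h0 /h ind0 // mulr0; under eq_fun do rewrite mulr0; exact: cvg_cst.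
    rewrite h0E //; under eq_fun do rewrite hE //.
    apply: continuous_cvg; first exact: continuous_expR.
    apply: cvgN; have [_ _ c _ _] := good th Nth.
    by move/cvg_at_rightP : c; apply; split.
  - by rewrite -C0E.
move=> key; rewrite /hellinger -[0 : R]sqrtr0; apply: continuous_cvg; first exact: sqrt_continuous.
rewrite -[X in _ --> X](mulr0 2^-1); apply: cvgM; first exact: cvg_cst.
apply: cvg_trans key; apply: near_eq_cvg; apply: nearW => k.
apply: (Rintegral_eq_off mN N0) => th _ Nth; have [_ _ _ e1 e2] := good th Nth.
by rewrite e1 e2 -Ck -C0E hE // h0E.
Qed.

End hellinger_limit.

Section observations.
Context {R : realType}.

(** With C symmetric and invertible, v^T C^-1 v is the form of C at the vector C^-1 v. *)
Lemma misfit_ge0 n (C : 'M[R]_n) (z w : 'cV[R]_n) : covariance_matrix C -> C \in unitmx -> 0 <= misfit C z w.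
Proof.
move=> [sC C0] uC; rewrite /misfit mulr_ge0 ?invr_ge0 //; set v := z - w.
have := C0 (invmx C *m v); rewrite trmx_mul trmx_inv sC.
by rewrite -mulmxA -mulmxA mulKVmx // mulmxA.
Qed.

Lemma cvg_fin_sum (T I : Type) (F : set_system T) (r : seq I) (f : I -> T -> R) (l : I -> R) : Filter F ->
  (forall i, f i x @[x --> F] --> l i) -> \sum_(i <- r) f i x @[x --> F] --> \sum_(i <- r) l i.
Proof.
move=> FF H; elim: r => [|i r IH].
  by rewrite big_nil; under eq_fun do rewrite big_nil; exact: cvg_cst.
by rewrite big_cons; under eq_fun do rewrite big_cons; exact: cvgD.
Qed.

Lemma misfit_cvg (T : Type) (F : set_system T) n (C : 'M[R]_n) (z : 'cV[R]_n) (w : T -> 'cV[R]_n) (w0 : 'cV[R]_n) :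
  Filter F -> (forall i, w x i ord0 @[x --> F] --> w0 i ord0) -> misfit C z (w x) @[x --> F] --> misfit C z w0.
Proof.
move=> FF H.
have E (v : 'cV[R]_n) : misfit C z v = 2^-1 * \sum_j (\sum_i (z i ord0 - v i ord0) * invmx C i j) * (z j ord0 - v j ord0).
  rewrite /misfit mxE; congr (_ * _); apply: eq_bigr => j _; rewrite !mxE; congr (_ * _).
  by apply: eq_bigr => i _; rewrite !mxE.
rewrite E; under eq_fun do rewrite E.
have c i : z i ord0 - w x i ord0 @[x --> F] --> z i ord0 - w0 i ord0 by apply: cvgB => //; exact: cvg_cst.
apply: cvgM; first exact: cvg_cst.
apply: cvg_fin_sum => j; apply: cvgM => //; apply: cvg_fin_sum => i.
by apply: cvgM => //; exact: cvg_cst.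
Qed.

Lemma eq_cvg_lim (T : Type) (F : set_system T) (f f' : T -> R) (l l' : R) : (forall x, f x = f' x) -> l = l' ->
  f' x @[x --> F] --> l' -> f x @[x --> F] --> l.
Proof. by move=> /funext -> ->. Qed.

Lemma observation_cvg (n : nat) (T : Type) (F : set_system T) (Omega : set 'rV[R]_n) (J L : nat) (phi : 'I_J -> 'rV[R]_n -> R)
    (g : 'I_L -> 'rV[R]_n -> R) (B : T -> 'rV[R]_n -> 'M[R]_n) (B0 : 'rV[R]_n -> 'M[R]_n) : Filter F ->
  (forall j l, DtN Omega (B x) (g l) (phi j) @[x --> F] --> DtN Omega B0 (g l) (phi j)) ->
  forall i, observation Omega phi g (B x) i ord0 @[x --> F] --> observation Omega phi g B0 i ord0.
Proof.
move=> FF H i; case/mxvec_indexP: i => j l.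
have E C : observation Omega phi g C (mxvec_index j l) ord0 = DtN Omega C (g l) (phi j).
  by rewrite /observation mxE mxvecE mxE.
exact: (eq_cvg_lim (fun x => E (B x)) (E B0) (H j l)).
Qed.

End observations.

Theorem corollary3
  (R : realType) (d : nat) (d_ge2 : (2 <= d)%N)
  (Omega : set 'rV[R]_d)
  (Omega_neq0 : Omega !=set0)
  (Omega_open : open Omega)
  (Omega_bounded : bounded_set Omega)
  (Omega_connected : connected Omega)
  (Omega_regular : lipschitz_boundary Omega)
  (smin smax : R) (smin_gt0 : 0 < smin) (smin_lt_smax : smin < smax)
  (* the tensor A and its derivative dtA in t, both given by their continuous
     representatives on [smin, smax] x Y *)
  (A dtA : R -> 'rV[R]_d -> 'M[R]_d)
  (A_sym : forall t y, t \in `[smin, smax] -> (A t y)^T = A t y)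
  (A_periodic : forall t, t \in `[smin, smax] -> cell_periodic (A t))
  (A_continuous : forall i j,
     {within cylinder `[smin, smax] unit_cube,
        continuous (joint (fun t y => A t y i j))})
  (dtA_continuous : forall i j,
     {within cylinder `[smin, smax] unit_cube,
        continuous (joint (fun t y => dtA t y i j))})
  (dtA_derivative : forall i j,
     weak_pderiv (cylinder `]smin, smax[ unit_cube) ord0
       (joint (fun t y => A t y i j)) (joint (fun t y => dtA t y i j)))
  (E1 alpha beta : R)
  (E1_gt0 : 0 < E1) (alpha_gt0 : 0 < alpha) (beta_gt0 : 0 < beta)
  (A_W1infty : forall i j,
     W1infty (cylinder `]smin, smax[ unit_cube)
       (joint (fun t y => A t y i j)) /\
     W1infty_W1infty_le smin smax unit_cube (fun t y => A t y i j) E1)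
  (dtA_W1infty : forall i j,
     W1infty (cylinder `]smin, smax[ unit_cube)
       (joint (fun t y => dtA t y i j)) /\
     W1infty_W1infty_le smin smax unit_cube (fun t y => dtA t y i j) E1)
  (A_elliptic : {ae @lebesgue_rV R d, forall y, unit_cube y ->
     forall t, t \in `[smin, smax] -> forall xi : 'rV[R]_d,
       alpha * enorm xi ^+ 2 <= dotv (mxv (A t y) xi) xi /\
       enorm (mxv (A t y) xi) <= beta * enorm xi})
  (dtA_elliptic : {ae @lebesgue_rV R d, forall y, unit_cube y ->
     forall t, t \in `[smin, smax] -> forall xi : 'rV[R]_d,
       E1^-1 * enorm xi ^+ 2 <= dotv (mxv (dtA t y) xi) xi})
  (J L : nat)
  (Gamma : 'I_J -> set 'rV[R]_d)
  (Gamma_bdry : forall j, Gamma j `<=` bdry Omega)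
  (Gamma_disjoint : trivIset setT Gamma)
  (phi : 'I_J -> 'rV[R]_d -> R)
  (phi_H12 : forall j, H12 Omega (phi j))
  (phi_support : forall j, bdry_support Omega (phi j) `<=` Gamma j)
  (g : 'I_L -> 'rV[R]_d -> R)
  (g_H12 : forall l, H12 Omega (g l))
  (prior : probability (C0 Omega) R)
  (prior_gaussian : gaussian prior)
  (P : C0 Omega -> 'rV[R]_d -> R)
  (P_def : P = @P1 R d Omega \/ level_set_map P)
  (P_admissible : {ae prior, forall th, admissible Omega smin smax (P th)})
  (z : 'cV[R]_(J * L))
  (Ce : 'M[R]_(J * L))
  (Ce_covariance : covariance_matrix Ce) (Ce_invertible : Ce \in unitmx)
  (post : R -> probability (C0 Omega) R)
  (post_eps : forall eps, 0 < eps ->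
     posterior prior
       (fun th => misfit Ce z
          (observation Omega phi g (fine_tensor A eps (P th))))
       (post eps))
  (post0 : probability (C0 Omega) R)
  (post0_eff :
     posterior prior
       (fun th => misfit Ce z
          (observation Omega phi g (effective_tensor A (P th))))
       post0) :
  hellinger prior post0 (post eps) @[eps --> 0^'+] --> 0.
Proof.
(* Friedrichs' inequality is applied along one coordinate; one exists as d is positive. *)
have k0 : 'I_d := Ordinal (ltnW d_ge2).
apply: (hellinger_cvg post_eps post0_eff) => [eps th|th|]; [exact: misfit_ge0|exact: misfit_ge0|].
apply: filterS P_admissible => th adm.
(* The misfit is a fixed polynomial in the observations, so the convergence of each pairing (j, l)
   is enough. *)
apply: misfit_cvg; apply: observation_cvg => j l.
exact: (DtN_cvg smin_lt_smax A_sym A_periodic A_continuous (ltW E1_gt0) alpha_gt0 beta_gt0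
  (fun i j => (A_W1infty i j).2) A_elliptic k0 Omega_open Omega_bounded (g_H12 l) (phi_H12 j) adm).
Qed.
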